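(* Let $(\mathrm{PA}_t)_{t\ge1}$ be the preferential attachment model with parameters $m\ge2$ and $\delta\in(-m,0)$, and let $\tau=3+\delta/m\in(2,3)$. Then $$\frac{\mathrm{diam}(\mathrm{PA}_t)}{\log\log t}\longrightarrow\frac{2}{\log m}+\frac{4}{|\log(\tau-2)|}$$ in probability as $t\to\infty$.
   Context: Preferential attachment model with parameters $m\in\mathbb{N}$, $\delta\in(-m,\infty)$: for $s\in\mathbb{N}$ and $j\in[m]$, $\xi_{s,j}\in[s]$ denotes the vertex to which the $j$-th edge of vertex $s$ is attached. Order pairs by $(s,i)\le(t,j)$ iff $s<t$, or $s=t$ and $i\le j$; set $(t,0):=(t-1,m)$. Degrees: $D_{t,k}(v)=\sum_{(s,i)\le(t,k)}(\mathbf 1_{\{\xi_{s,i}=v\}}+\mathbf 1_{\{s=v\}})$ and $D_t(v)=D_{t,m}(v)$. Set $\xi_{1,j}=1$ for all $j\in[m]$ (vertex 1 has $m$ self-loops), and for $t\ge2$, conditionally on $(\xi_{s,i})_{(s,i)\le(t,j-1)}$, $\xi_{t,j}=v$ with probability $(D_{t,j-1}(v)+1+j\delta/m)/c_{t,j}$ if $v=t$ and $(D_{t,j-1}(v)+\delta)/c_{t,j}$ if $v<t$, where $c_{t,j}=[m(t-1)+(j-1)](2+\delta/m)+1+\delta/m$. $\mathrm{PA}_t$ is the multigraph on $[t]$ with an edge between $s$ and $\xi_{s,i}$ for every $(s,i)\le(t,m)$. $\mathrm{diam}$ denotes the graph diameter. *)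

(* Defs.v *)
From Stdlib Require Import Reals List Arith Bool Lia Lra.
Import ListNotations.
Open Scope R_scope.
Open Scope bool_scope.

(* A history is the list of attachment decisions made so far, in the order
   of the pairs (s,i): entry (s, x) records that the current edge of vertex s
   is attached to vertex x, i.e. xi_{s,i} = x.  Vertices are 1,...,t. *)
Definition history := list (nat * nat).

Definition degree (h : history) (v : nat) : nat :=
  fold_right Nat.add 0%nat
    (map (fun e => ((if Nat.eqb (snd e) v then 1 else 0)
                   + (if Nat.eqb (fst e) v then 1 else 0))%nat) h).

(* The k-th decision (k = 0,1,...) concerns the pair (s,j) with
   s = k / m + 1 and j = k mod m + 1. *)
Definition cur_vertex (m k : nat) : nat := (k / m + 1)%nat.
Definition cur_edge (m k : nat) : nat := (k mod m + 1)%nat.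

(* Conditional probability that xi_{s,j} = v given the history h
   (h contains exactly the decisions (s',i) < (s,j)). *)
Definition step_prob (m : nat) (delta : R) (h : history) (v : nat) : R :=
  let k := length h in
  let s := cur_vertex m k in
  let j := cur_edge m k in
  if Nat.eqb s 1 then (if Nat.eqb v 1 then 1 else 0)
  else
    let c := (INR (m * (s - 1) + (j - 1))) * (2 + delta / INR m)
             + 1 + delta / INR m in
    if Nat.eqb v s then (INR (degree h v) + 1 + INR j * delta / INR m) / c
    else if Nat.ltb v s then (INR (degree h v) + delta) / c
    else 0.

Fixpoint pa_expect (m : nat) (delta : R) (n : nat) (h : history)
         (f : history -> R) : R :=
  match n with
  | O => f h
  | S n' =>
      let s := cur_vertex m (length h) in
      fold_right Rplus 0
        (map (fun v => step_prob m delta h v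
                       * pa_expect m delta n' (h ++ [(s, v)]) f)
             (seq 1 s))
  end.

Definition PA_prob (m : nat) (delta : R) (t : nat) (A : history -> bool) : R :=
  pa_expect m delta (m * t) [] (fun h => if A h then 1 else 0).

Definition adj (h : history) (u v : nat) : bool :=
  existsb (fun e => (Nat.eqb (fst e) u && Nat.eqb (snd e) v)
                    || (Nat.eqb (fst e) v && Nat.eqb (snd e) u)) h.

Fixpoint reach (h : history) (t k u v : nat) : bool :=
  match k with
  | O => Nat.eqb u v
  | S k' => reach h t k' u v
            || existsb (fun w => reach h t k' u w && adj h w v) (seq 1 t)
  end.

(* Graph distance between u and v (any finite distance is < t);
   pairs in different components contribute 0. *)
Definition dist (h : history) (t u v : nat) : nat :=
  match find (fun k => reach h t k u v) (seq 0 t) with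
  | Some k => k
  | None => 0%nat
  end.

Definition diam (h : history) (t : nat) : nat :=
  fold_right Nat.max 0%nat
    (flat_map (fun u => map (fun v => dist h t u v) (seq 1 t)) (seq 1 t)).

(* Main.v *)
(** All probabilistic estimates are one-step (super)martingale inequalities, integrated by
    induction along the sequence of attachment decisions.  Write [gam = 1/(2 + delta/m)]
    and [kappa = tau - 2 = (1 - gam)/gam].

    Upper bound.  For every dyadic scale [r], the vertices of degree at least
    [exp (a^j ln r / 2)], with [a] slightly larger than [kappa], are mostly joined through a
    common younger neighbour to those of the previous level; after [lnln t / |ln kappa|]
    levels all vertices of polylogarithmic degree are at distance at most
    [2 lnln t / |ln kappa|] from vertex 1.  If [k] generations of older neighbours of [v]
    avoid these good vertices, then [m^k] choices do so, whence the fraction of such [v] is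
    doubly exponentially small in [k], and none is left for [k] slightly above
    [lnln t / ln m].

    Lower bound.  In the last [t / polylog t] vertices there are with high probability two
    disjoint clusters of depth [k] just below [lnln t / ln m] in which every edge goes one
    level down and every exit leads from level 0 to an old vertex.  Erasing the old targets
    leaves a process with an autonomous law, and given it the erased edges are dominated by
    independent ones with kernel [C (u /\ v)^(-gam) (u \/ v)^(gam-1)].  A first moment bound
    on paths leaving the clusters, truncated so that the [n]-th vertex is at least
    [t exp (- B A^n)] with [A] slightly above [kappa^(-1/2)], shows that the clusters are
    not joined by [4 lnln t / |ln kappa|] steps. *)
Require Import Defs.
From Stdlib Require Import Reals List Arith Bool Lia Lra Permutation Psatz ZArith ListDec.
Import ListNotations.
Open Scope R_scope.
Local Coercion INR : nat >-> R.

(* Origin of [kappa]: at time [r] the vertices of degree at least [d] carry a total weight of about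
   [r * d^(-kappa)]. A fresh vertex joins them to a given vertex of degree [d'] with probability
   about [d' * d^(-kappa) / r], so the next [r] vertices suffice once [d'] exceeds [d^kappa]. A
   level thus costs two edges and multiplies the logarithm of the degree by about [kappa]. In the
   lower bound one edge multiplies the truncation exponent by about [kappa^(-1/2)], which matches.
   Obstacle above: good vertices carry only a polylogarithmically small fraction of the weight, so
   the power [m] gains little at first. A short phase A follows weight fractions until bad vertices
   are polylogarithmically rare; phase B counts bad vertices, because the degrees of vertices that
   are not good are polylogarithmic and counts can be turned back into weights. Obstacle below: the
   existence of clusters is a condition on the whole history and would distort edge probabilities.
   Clusters, their leaves and young degrees are functions of the erased history, so a path bound
   that holds given that history survives the conditioning. *)
Create HintDb pos.
Ltac pos :=
 solve [ trivial | lra | lia |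
 lazymatch goal with
 | |- _ /\ _ => split; pos
 | |- forall _, _ => intros; pos
 | |- (0 <= _ * _)%R => apply Rmult_le_pos; pos
 | |- (0 < _ * _)%R => apply Rmult_lt_0_compat; pos
 | |- (0 <= / _)%R => apply Rlt_le, Rinv_0_lt_compat; pos
 | |- (0 < / _)%R => apply Rinv_0_lt_compat; pos
 | |- (0 <= _ / _)%R => apply Rmult_le_pos; [pos|apply Rlt_le, Rinv_0_lt_compat; pos]
 | |- (0 < _ / _)%R => apply Rdiv_lt_0_compat; pos
 | |- (0 <= _ ^ _)%R => apply pow_le; pos
 | |- (0 < _ ^ _)%R => apply pow_lt; pos
 | |- (1 <= _ ^ _)%R => apply pow_R1_Rle; pos
 | |- (0 <= _ + _)%R => apply Rplus_le_le_0_compat; pos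
 | |- (0 <= exp _)%R => apply Rlt_le, exp_pos
 | |- (0 < exp _)%R => apply exp_pos
 | |- (0 <= INR _)%R => apply pos_INR
 | |- (0 < INR _)%R => apply lt_0_INR; pos
 | |- (INR _ <= INR _)%R => apply le_INR; pos
 | |- (1 <= INR _)%R => apply (le_INR 1); pos
 | |- (2 <= INR _)%R => apply (le_INR 2); pos
 | |- (0 <= Rabs _)%R => apply Rabs_pos
 | |- (?a * _ <= ?a * _)%R => apply Rmult_le_compat_l; pos
 | |- (_ * ?a <= _ * ?a)%R => apply Rmult_le_compat_r; pos
 | |- (_ / ?a <= _ / ?a)%R => apply Rmult_le_compat_r; pos
 | |- (_ * _ <= _ * _)%R => apply Rmult_le_compat; pos
 | |- (_ + _ <= _ + _)%R => apply Rplus_le_compat; pos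
 | |- (_ ^ _ <= _ ^ _)%R => apply pow_incr; pos
 | |- (/ _ <= / _)%R => apply Rinv_le_contravar; pos
 | |- In _ (seq _ _) => apply in_seq; pos
 | |- NoDup (seq _ _) => apply seq_NoDup
 | |- NoDup (filter _ _) => apply NoDup_filter; pos
 | |- (_ * _ <= _ * _)%nat => apply Nat.mul_le_mono_l; pos
 | |- _ <> 0 => apply Rgt_not_eq; pos
 | |- (0 <= _)%R => first [solve [auto with pos] | apply Rlt_le; solve [auto with pos]]
 | |- @eq R _ _ => first [reflexivity | ring | field; pos]
 | |- _ => solve [auto with pos | constructor; auto | eauto | congruence]
 end ].

(** * Finite sums *)

Fixpoint sumL {A : Type} (f : A -> R) (l : list A) : R :=
 match l with [] => 0 | a :: l' => f a + sumL f l' end.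

Definition b2R (b : bool) : R := if b then 1 else 0.

Lemma b2R_range b : 0 <= b2R b <= 1.
Proof. destruct b; simpl; lra. Qed.

Lemma sumL_fold {A} (f : A -> R) l : fold_right Rplus 0 (map f l) = sumL f l.
Proof. induction l; simpl; congruence. Qed.

Lemma sumL_app {A} (f : A -> R) l1 l2 : sumL f (l1 ++ l2) = sumL f l1 + sumL f l2.
Proof. induction l1; simpl; lra. Qed.

Lemma sumL_ext {A} (f g : A -> R) l :
 (forall x, In x l -> f x = g x) -> sumL f l = sumL g l.
Proof.
 induction l; simpl; intros H; [pos|].
 rewrite H, IHl; auto.
Qed.

Lemma sumL_le {A} (f g : A -> R) l :
 (forall x, In x l -> f x <= g x) -> sumL f l <= sumL g l.
Proof.
 induction l; simpl; intros H; [lra|].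
 pos.
Qed.

Lemma sumL_plus {A} (f g : A -> R) l : sumL (fun x => f x + g x) l = sumL f l + sumL g l.
Proof. induction l; simpl; lra. Qed.

Lemma sumL_scal {A} c (f : A -> R) l : sumL (fun x => c * f x) l = c * sumL f l.
Proof. induction l; simpl; lra. Qed.

Lemma sumL_scal_r {A} c (f : A -> R) l : sumL (fun x => f x * c) l = sumL f l * c.
Proof. induction l; simpl; lra. Qed.

Lemma sumL_const {A} c (l : list A) : sumL (fun _ => c) l = c * INR (length l).
Proof.
 induction l; [simpl; lra|]. cbn [sumL length]. rewrite S_INR. lra.
Qed.

Lemma sumL_nonneg {A} (f : A -> R) l : (forall x, In x l -> 0 <= f x) -> 0 <= sumL f l.
Proof.
 induction l; simpl; intros H; [lra|].
 pos.
Qed.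

Lemma sumL_map {A B} (f : B -> R) (g : A -> B) l : sumL f (map g l) = sumL (fun x => f (g x)) l.
Proof. induction l; simpl; congruence. Qed.

Lemma sumL_flat_map {A B} (f : B -> R) (g : A -> list B) l :
 sumL f (flat_map g l) = sumL (fun x => sumL f (g x)) l.
Proof. induction l; simpl; [pos|]. rewrite sumL_app. pos. Qed.

Lemma sumL_exchange {A B} (f : A -> B -> R) l1 l2 :
 sumL (fun x => sumL (f x) l2) l1 = sumL (fun y => sumL (fun x => f x y) l1) l2.
Proof.
 induction l1; simpl.
 - rewrite (sumL_const 0 l2). lra.
 - rewrite sumL_plus. pos.
Qed.

Lemma sumL_filter {A} (f : A -> R) p l :
 sumL f (filter p l) = sumL (fun x => if p x then f x else 0) l.
Proof. induction l; simpl; [pos|]. destruct (p a); simpl; lra. Qed.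

Lemma sumL_perm {A} (f : A -> R) l1 l2 : Permutation l1 l2 -> sumL f l1 = sumL f l2.
Proof. induction 1; simpl; lra. Qed.

Lemma sumL_eqb_notin (f : nat -> R) u l :
 ~ In u l -> sumL (fun v => if Nat.eqb v u then f v else 0) l = 0.
Proof.
 induction l; simpl; intros H; [pos|].
 destruct (Nat.eqb_spec a u); [pos|].
 rewrite IHl; pos.
Qed.

Lemma sumL_eqb (f : nat -> R) u l :
 NoDup l -> In u l -> sumL (fun v => if Nat.eqb v u then f v else 0) l = f u.
Proof.
 induction 1; simpl; intros Hin; [tauto|].
 destruct (Nat.eqb_spec x u).
 - subst. rewrite sumL_eqb_notin by assumption. lra.
 - rewrite IHNoDup; [lra|]. destruct Hin; pos.
Qed.

Lemma sumL_In_le {A} (f : A -> R) l x :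
 (forall y, In y l -> 0 <= f y) -> In x l -> f x <= sumL f l.
Proof.
 induction l; simpl; intros H Hin; [tauto|]. destruct Hin as [->|Hin].
 - pose proof (sumL_nonneg f l (fun y Hy => H y (or_intror Hy))). lra.
 - specialize (IHl (fun y Hy => H y (or_intror Hy)) Hin). pose proof (H a (or_introl eq_refl)). lra.
Qed.

Lemma sumL_incl (f : nat -> R) l1 l2 :
 NoDup l1 -> incl l1 l2 -> (forall y, In y l2 -> 0 <= f y) -> sumL f l1 <= sumL f l2.
Proof.
 revert l2. induction l1 as [|a l1 IH]; simpl; intros l2 Hnd Hin Hpos.
 - apply sumL_nonneg; auto.
 - inversion Hnd; subst.
  assert (Ha : In a l2) by (apply Hin; left; reflexivity).
  destruct (in_split _ _ Ha) as (p & q & ->).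
  rewrite (sumL_perm f (p ++ a :: q) (a :: p ++ q)) by (apply Permutation_sym, Permutation_middle).
  apply Rplus_le_compat_l. apply IH; auto.
  + intros x Hx. assert (Hx' : In x (p ++ a :: q)) by (apply Hin; right; exact Hx).
   apply in_app_or in Hx'. apply in_or_app. destruct Hx' as [|[->|]]; tauto.
  + intros y Hy. apply Hpos. apply in_app_or in Hy. apply in_or_app. simpl. tauto.
Qed.

Lemma INR_sum_filter {A} (p : A -> bool) l : INR (length (filter p l)) = sumL (fun x => b2R (p x)) l.
Proof.
 induction l; [pos|]. cbn [filter sumL]. destruct (p a); cbn [length b2R]; rewrite ?S_INR; lra.
Qed.

Lemma b2R_existsb_le {A} (p : A -> bool) l : b2R (existsb p l) <= sumL (fun x => b2R (p x)) l.
Proof.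
 induction l; simpl; [lra|].
 destruct (p a), (existsb p l); simpl in *; lra.
Qed.

(** * The attachment process *)

Class PAmodel := {
 m : nat;
 delta : R;
 Hm : (2 <= m)%nat;
 Hd1 : - INR m < delta;
 Hd2 : delta < 0 }.

Section Process.
Context {P : PAmodel}.

Definition chi : R := delta / INR m.
(** The normaliser [c_{t,j}] as a function of the number [k = m * (t - 1) + (j - 1)] of decisions
    already made. *)
Definition cc (k : nat) : R := INR k * (2 + chi) + 1 + chi.
Definition cur (k : nat) : nat := cur_vertex m k.

Lemma INRm_ge2 : 2 <= m.
Proof. apply (le_INR 2). exact Hm. Qed.

Lemma chi_range : -1 < chi < 0.
Proof.
 pose proof Hd1. pose proof Hd2. unfold chi.
 split.
 - apply Rmult_lt_reg_r with m; [lra|]. unfold Rdiv. rewrite Rmult_assoc, Rinv_l by lra. lra.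
 - apply Rmult_lt_reg_r with m; [lra|]. unfold Rdiv. rewrite Rmult_assoc, Rinv_l by lra. lra.
Qed.

Lemma delta_chi : delta = m * chi.
Proof. pose proof INRm_ge2. unfold chi. pos. Qed.

Lemma md_pos : 0 < m + delta.
Proof. pose proof Hd1. lra. Qed.

Lemma cc_pos k : 0 < cc k.
Proof. unfold cc. pose proof chi_range. pose proof (pos_INR k). nra. Qed.

Lemma cc_mono k1 k2 : (k1 <= k2)%nat -> cc k1 <= cc k2.
Proof.
 unfold cc. pose proof chi_range. pos.
Qed.

Lemma cur_bounds k : (1 <= cur k /\ m * (cur k - 1) <= k < m * cur k)%nat.
Proof.
 unfold cur, cur_vertex. pose proof Hm.
 pose proof (Nat.div_mod k m ltac:(lia)). pose proof (Nat.mod_upper_bound k m ltac:(lia)).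
 nia.
Qed.

Lemma cur_unique k u : (1 <= u)%nat -> (m * (u - 1) <= k < m * u)%nat -> cur k = u.
Proof.
 intros H1 H2. pose proof (cur_bounds k) as (H3 & H4).
 destruct (Nat.lt_trichotomy (cur k) u) as [Hl|[Hl|Hl]]; [|assumption|]; nia.
Qed.

Lemma cur_mul s j : (j < m)%nat -> cur (m * s + j) = S s.
Proof. intros. apply cur_unique; [lia|]. lia. Qed.

Lemma cur_mono k1 k2 : (k1 <= k2)%nat -> (cur k1 <= cur k2)%nat.
Proof.
 pose proof (cur_bounds k1). pose proof (cur_bounds k2).
 nia.
Qed.

Lemma cur_edge_val k : cur_edge m k = (k - m * (cur k - 1) + 1)%nat.
Proof.
 unfold cur_edge, cur, cur_vertex. pose proof Hm.
 pose proof (Nat.div_mod k m ltac:(lia)).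
 lia.
Qed.

Definition ext (h : history) (v : nat) : history := h ++ [(cur (length h), v)].

Inductive valid : history -> Prop :=
| valid_nil : valid []
| valid_ext h v : valid h -> (1 <= v <= cur (length h))%nat -> valid (ext h v).

Lemma ext_length h v : length (ext h v) = S (length h).
Proof. unfold ext. rewrite length_app. simpl. lia. Qed.

Lemma degree_app h h' u : degree (h ++ h') u = (degree h u + degree h' u)%nat.
Proof.
 unfold degree. induction h; simpl; [pos|]. lia.
Qed.

Lemma degree_ext h v u :
 degree (ext h v) u =
 (degree h u + (if Nat.eqb v u then 1 else 0) + (if Nat.eqb (cur (length h)) u then 1 else 0))%nat.
Proof.
 unfold ext. rewrite degree_app. unfold degree at 2. simpl. lia.
Qed.

Lemma degree_ge h u : valid h -> (1 <= u)%nat ->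
 (Nat.min m (length h - m * (u - 1)) <= degree h u)%nat.
Proof.
 intros Hv Hu. induction Hv; [apply Nat.le_0_l || (simpl; lia)|].
 rewrite degree_ext, ext_length.
 destruct (Nat.eqb_spec (cur (length h)) u); [lia|].
 assert ((m * u = m * (u - 1) + m)%nat) by nia.
 assert (~ (m * (u - 1) <= length h < m * u)%nat)
  by (intro; apply n; apply cur_unique; assumption).
 pos.
Qed.

Lemma degree_completed h u : valid h -> (1 <= u)%nat -> (m * u <= length h)%nat -> (m <= degree h u)%nat.
Proof.
 intros. pose proof (degree_ge h u H H0).
 assert ((m * u = m * (u - 1) + m)%nat) by nia. lia.
Qed.

Lemma degree_le h u : valid h -> (1 <= u)%nat ->
 (degree h u <= 2 * (length h - m * (u - 1)))%nat.
Proof.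
 intros Hv Hu. induction Hv; [pos|].
 rewrite degree_ext, ext_length.
 pose proof (cur_bounds (length h)) as (Hc1 & Hc2).
 assert ((v = u -> m * (u - 1) <= length h)%nat).
 { nia. }
 destruct (Nat.eqb_spec v u), (Nat.eqb_spec (cur (length h)) u); subst; lia.
Qed.

Lemma degree_sum h S : valid h -> (cur (length h) <= S)%nat ->
 sumL (fun v => INR (degree h v)) (seq 1 S) = 2 * INR (length h).
Proof.
 intros Hv. induction Hv; intros HS.
 - simpl. rewrite sumL_const. lra.
 - rewrite ext_length in *.
  assert (Hc : (cur (length h) <= S)%nat) by (pose proof (cur_mono (length h) (Datatypes.S (length h)) ltac:(lia)); lia).
  specialize (IHHv Hc).
  rewrite (sumL_ext _ (fun u => INR (degree h u) + ((if Nat.eqb u v then 1 else 0) +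
    (if Nat.eqb u (cur (length h)) then 1 else 0)))).
  + rewrite sumL_plus, sumL_plus.
   rewrite (sumL_eqb (fun _ => 1)), (sumL_eqb (fun _ => 1)).
   * rewrite S_INR. lra.
   * pos.
   * pos.
   * pos.
   * pos.
  + intros x _. rewrite degree_ext, !plus_INR.
   rewrite (Nat.eqb_sym v x), (Nat.eqb_sym (cur (length h)) x).
   destruct (Nat.eqb x v), (Nat.eqb x (cur (length h))); simpl; lra.
Qed.

Definition wt (h : history) (v : nat) : R :=
 if Nat.eqb v (cur (length h)) then INR (degree h v) + 1 + INR (cur_edge m (length h)) * chi
 else INR (degree h v) + delta.

(** With [j] edges placed, the current vertex has weight at least [(j + 1) * (1 + chi)], positive as
    [chi > -1]; a completed vertex has degree at least [m], which exceeds [- delta]. *)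
Lemma wt_pos h v : valid h -> (1 <= v <= cur (length h))%nat -> 0 < wt h v.
Proof.
 intros Hv Hb. unfold wt. pose proof (cur_bounds (length h)) as (Hc1 & Hc2). pose proof chi_range.
 destruct (Nat.eqb_spec v (cur (length h))).
 - subst. rewrite cur_edge_val. pose proof (degree_ge h _ Hv Hc1) as Hd.
  set (j := (length h - m * (cur (length h) - 1))%nat) in *.
  assert ((j < m)%nat) by (unfold j; nia).
  rewrite Nat.min_r in Hd by lia. apply le_INR in Hd.
  rewrite plus_INR. simpl (INR 1). pose proof (pos_INR j). nra.
 - assert (Hd : (m <= degree h v)%nat) by (apply degree_completed; [assumption|lia|nia]).
  apply le_INR in Hd. pose proof Hd1. lra.
Qed.

Lemma wt_sum h : valid h -> sumL (wt h) (seq 1 (cur (length h))) = cc (length h).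
Proof.
 intros Hv. set (s := cur (length h)).
 pose proof (cur_bounds (length h)) as (Hc1 & Hc2).
 rewrite (sumL_ext _ (fun v => INR (degree h v) + (delta +
   (if Nat.eqb v s then 1 + INR (cur_edge m (length h)) * chi - delta else 0)))).
 - rewrite sumL_plus, sumL_plus, degree_sum by pos.
  rewrite (sumL_eqb (fun _ => 1 + INR (cur_edge m (length h)) * chi - delta)).
  + rewrite sumL_const, length_seq, cur_edge_val. fold s. unfold cc.
   rewrite delta_chi.
   assert (HL : INR (length h) = m * (s - 1) + INR (length h - m * (s - 1))).
   { rewrite <- (INR_1), <- minus_INR, <- mult_INR, <- plus_INR by lia. f_equal. lia. }
   rewrite plus_INR. simpl (INR 1).
   rewrite HL. ring.
  + pos.
  + pos.
 - intros v _. unfold wt. fold s. destruct (Nat.eqb_spec v s); lra.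
Qed.

Lemma step_prob_eq h v : valid h -> (1 <= v <= cur (length h))%nat ->
 step_prob m delta h v = wt h v / cc (length h).
Proof.
 intros Hv Hb. pose proof (cur_bounds (length h)) as (Hc1 & Hc2).
 pose proof (cc_pos (length h)).
 assert (HC : INR (m * (cur (length h) - 1) + (cur_edge m (length h) - 1)) * (2 + delta / m)
       + 1 + delta / m = cc (length h)).
 { rewrite cur_edge_val.
  replace (m * (cur (length h) - 1) + (length h - m * (cur (length h) - 1) + 1 - 1))%nat with (length h) by lia.
  pos. }
 unfold step_prob. change (cur_vertex m (length h)) with (cur (length h)).
 destruct (Nat.eqb_spec (cur (length h)) 1).
 (* The forced self-loops of vertex 1 obey the general rule: it is the only vertex, so its weight is
    the whole sum. *)
 - assert (v = 1%nat) by lia. subst v. simpl.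
  pose proof (wt_sum h Hv) as Hs. rewrite e in Hs. simpl in Hs. rewrite <- Hs. pos.
 - rewrite HC. unfold wt. destruct (Nat.eqb_spec v (cur (length h))).
  + unfold chi. pos.
  + destruct (Nat.ltb_spec v (cur (length h))); pos.
Qed.

Lemma step_prob_old h v : valid h -> (1 <= v)%nat -> (m * v <= length h)%nat ->
 step_prob m delta h v = (INR (degree h v) + delta) / cc (length h).
Proof.
 intros Hv H1 H2. pose proof (cur_bounds (length h)) as (Hc1 & Hc2).
 rewrite step_prob_eq by (assumption || nia). unfold wt.
 destruct (Nat.eqb_spec v (cur (length h))); pos.
Qed.

Lemma step_prob_nonneg h v : valid h -> (1 <= v <= cur (length h))%nat -> 0 <= step_prob m delta h v.
Proof.
 intros. rewrite step_prob_eq by assumption. pose proof (wt_pos h v H H0). pose proof (cc_pos (length h)).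
 pos.
Qed.

Lemma step_prob_self h : valid h -> step_prob m delta h (cur (length h)) <= 2 * m / cc (length h).
Proof.
 intros Hv. pose proof (cur_bounds (length h)) as (Hc1 & Hc2).
 rewrite step_prob_eq by pos. unfold wt. rewrite Nat.eqb_refl.
 pose proof (cc_pos (length h)). pose proof chi_range.
 apply Rmult_le_compat_r; [pos|].
 pose proof (degree_le h _ Hv Hc1).
 assert (Hd' : (degree h (cur (length h)) + 1 <= 2 * m)%nat) by nia.
 apply le_INR in Hd'. rewrite plus_INR, mult_INR in Hd'. simpl in Hd'.
 pose proof (pos_INR (cur_edge m (length h))). nra.
Qed.

Definition E1 (h : history) (f : nat -> R) : R :=
 sumL (fun v => step_prob m delta h v * f v) (seq 1 (cur (length h))).

Definition E (n : nat) (h : history) (f : history -> R) : R := pa_expect m delta n h f.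

Lemma E_O h f : E 0 h f = f h.
Proof. pos. Qed.

Lemma E_S n h f : E (S n) h f = E1 h (fun v => E n (ext h v) f).
Proof. unfold E at 1. simpl. rewrite sumL_fold. pos. Qed.

Lemma E1_const h c : valid h -> E1 h (fun _ => c) = c.
Proof.
 intros Hv. unfold E1. rewrite sumL_scal_r.
 rewrite (sumL_ext _ (fun v => wt h v * / cc (length h))).
 - rewrite sumL_scal_r, wt_sum by assumption. pose proof (cc_pos (length h)). pos.
 - intros x Hx. apply in_seq in Hx. rewrite step_prob_eq by pos. pos.
Qed.

Lemma E1_le h f g : valid h -> (forall v, (1 <= v <= cur (length h))%nat -> f v <= g v) -> E1 h f <= E1 h g.
Proof.
 intros Hv H. apply sumL_le. intros v Hx. apply in_seq in Hx.
 apply Rmult_le_compat_l; [apply step_prob_nonneg; pos|apply H; lia].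
Qed.

Lemma E1_ext h f g : (forall v, (1 <= v <= cur (length h))%nat -> f v = g v) -> E1 h f = E1 h g.
Proof.
 intros H. apply sumL_ext. intros v Hx. apply in_seq in Hx. rewrite H by lia. pos.
Qed.

Lemma E1_plus h f g : E1 h (fun v => f v + g v) = E1 h f + E1 h g.
Proof.
 unfold E1. rewrite <- sumL_plus. apply sumL_ext. pos.
Qed.

Lemma E1_scal h c f : E1 h (fun v => c * f v) = c * E1 h f.
Proof.
 unfold E1. rewrite <- sumL_scal. apply sumL_ext. pos.
Qed.

Lemma E1_sumL {A} h (f : A -> nat -> R) l :
 E1 h (fun v => sumL (fun a => f a v) l) = sumL (fun a => E1 h (f a)) l.
Proof.
 unfold E1. rewrite (sumL_ext _ (fun v => sumL (fun a => step_prob m delta h v * f a v) l)).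
 - rewrite sumL_exchange. pos.
 - intros. rewrite sumL_scal. pos.
Qed.

Lemma E1_eqb h u c : (1 <= u <= cur (length h))%nat ->
 E1 h (fun v => if Nat.eqb v u then c v else 0) = step_prob m delta h u * c u.
Proof.
 intros Hu. unfold E1.
 rewrite (sumL_ext _ (fun v => if Nat.eqb v u then step_prob m delta h v * c v else 0)).
 - rewrite (sumL_eqb (fun v => step_prob m delta h v * c v)); pos.
 - intros v _. destruct (Nat.eqb v u); ring.
Qed.

Lemma E_le n : forall h f g, valid h ->
 (forall l, valid (h ++ l) -> length l = n -> f (h ++ l) <= g (h ++ l)) -> E n h f <= E n h g.
Proof.
 induction n; intros h f g Hv H.
 - specialize (H []). rewrite app_nil_r in H. auto.
 - rewrite !E_S. apply E1_le; [assumption|]. intros v Hb. apply IHn.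
  + pos.
  + intros l Hl Hn. unfold ext in *. rewrite <- app_assoc in *. apply H; [assumption|simpl; lia].
Qed.

Lemma E_ext n : forall h f g, valid h ->
 (forall l, valid (h ++ l) -> length l = n -> f (h ++ l) = g (h ++ l)) -> E n h f = E n h g.
Proof.
 intros. apply Rle_antisym; apply E_le; intros; try assumption; rewrite H0; auto; lra.
Qed.

Lemma E_const n : forall h c, valid h -> E n h (fun _ => c) = c.
Proof.
 induction n; intros h c Hv; [pos|]. rewrite E_S.
 rewrite (E1_ext _ _ (fun _ => c)).
 - apply E1_const; assumption.
 - intros. apply IHn. pos.
Qed.

Lemma E_plus n : forall h f g, E n h (fun x => f x + g x) = E n h f + E n h g.
Proof.
 induction n; intros h f g; [pos|]. rewrite !E_S, <- E1_plus.
 apply E1_ext. pos.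
Qed.

Lemma E_scal n : forall h c f, E n h (fun x => c * f x) = c * E n h f.
Proof.
 induction n; intros h c f; [pos|]. rewrite !E_S, <- E1_scal.
 apply E1_ext. pos.
Qed.

Lemma E_sumL {A} n : forall h (f : A -> history -> R) l,
 E n h (fun x => sumL (fun a => f a x) l) = sumL (fun a => E n h (f a)) l.
Proof.
 induction n; intros h f l; [pos|]. rewrite E_S.
 rewrite (sumL_ext (fun a => E (S n) h (f a)) (fun a => E1 h (fun v => E n (ext h v) (f a)))).
 - rewrite <- E1_sumL. apply E1_ext. pos.
 - intros. apply E_S.
Qed.

Lemma E_add n1 : forall n2 h f, E (n1 + n2) h f = E n1 h (fun h' => E n2 h' f).
Proof.
 induction n1; intros n2 h f; [pos|]. simpl Nat.add. rewrite !E_S.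
 apply E1_ext. pos.
Qed.

Lemma E_nonneg n h f : valid h -> (forall l, valid (h ++ l) -> length l = n -> 0 <= f (h ++ l)) -> 0 <= E n h f.
Proof.
 intros Hv H. rewrite <- (E_const n h 0 Hv). apply E_le; assumption.
Qed.

Lemma E_le_const n h f c : valid h ->
 (forall l, valid (h ++ l) -> length l = n -> f (h ++ l) <= c) -> E n h f <= c.
Proof.
 intros Hv H. rewrite <- (E_const n h c Hv). apply E_le; assumption.
Qed.

Lemma E_prefix n1 n2 h f : valid h ->
 E (n1 + n2) h (fun h' => f (firstn (length h + n1) h')) = E n1 h f.
Proof.
 intros Hv. rewrite E_add. apply E_ext; [assumption|]. intros l Hl Hn.
 rewrite (E_ext n2 _ _ (fun _ => f (h ++ l))).
 - apply E_const; assumption.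
 - pos.
 - intros l' _ _. f_equal. rewrite <- Hn, <- length_app. rewrite firstn_app, Nat.sub_diag.
  rewrite app_nil_r. apply firstn_all.
Qed.

Lemma valid_prefix h l : valid (h ++ l) -> valid h.
Proof.
 induction l as [|e l IH] using rev_ind; intros H.
 - rewrite app_nil_r in H. assumption.
 - apply IH. rewrite app_assoc in H. inversion H.
  + exfalso. eapply app_cons_not_nil. pos.
  + apply app_inj_tail in H0. destruct H0 as [<- _]. assumption.
Qed.

Lemma valid_firstn n h : valid h -> valid (firstn n h).
Proof. intros H. apply valid_prefix with (skipn n h). rewrite firstn_skipn. assumption. Qed.

Lemma E_super n : forall h F, valid h ->
 (forall l, valid (h ++ l) -> (length l < n)%nat ->
   E1 (h ++ l) (fun v => F (ext (h ++ l) v)) <= F (h ++ l)) ->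
 E n h F <= F h.
Proof.
 induction n; intros h F Hv H.
 - pos.
 - rewrite E_S. apply Rle_trans with (E1 h (fun v => F (ext h v))).
  + apply E1_le; [assumption|]. intros v Hb. apply IHn; [pos|].
   intros l Hl Hn. unfold ext at 1 3. rewrite <- app_assoc.
   replace (F (ext h v ++ l)) with (F (h ++ ([(cur (length h), v)] ++ l)))
    by (unfold ext; rewrite <- app_assoc; reflexivity).
   apply H; [|simpl; lia]. unfold ext in Hl. rewrite <- app_assoc in Hl. assumption.
  + specialize (H []). rewrite app_nil_r in H. apply H; [assumption|simpl; lia].
Qed.

(** Some potentials below are supermartingales only from one vertex to the next, not from one edge
    to the next. *)
Lemma E_super_block w : forall h F s, valid h -> length h = (m * s)%nat ->
 (forall l s', valid (h ++ l) -> length (h ++ l) = (m * s')%nat -> (s <= s' < s + w)%nat ->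
   E m (h ++ l) F <= F (h ++ l)) ->
 E (m * w) h F <= F h.
Proof.
 induction w; intros h F s Hv Hs H.
 - rewrite Nat.mul_0_r, E_O. lra.
 - replace (m * S w)%nat with (m + m * w)%nat by lia. rewrite E_add.
  apply Rle_trans with (E m h F).
  + apply E_le; [assumption|]. intros l Hl Hn. apply (IHw _ _ (S s)); [assumption| |].
   * rewrite length_app. lia.
   * intros l' s' Hl' Hs' Hb. rewrite <- app_assoc in *. apply (H _ s'); pos.
  + specialize (H [] s). rewrite app_nil_r in H. apply H; pos.
Qed.

(** * Weights of vertex sets *)

(** For completed vertices [w h U / cc] is the probability that the next edge hits [U], so weights
    are linear martingales up to a deterministic factor. *)
Definition w (h : history) (U : list nat) : R := sumL (fun u => INR (degree h u) + delta) U.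

Lemma w_ext h v U : NoDup U ->  (forall u, In u U -> (m * u <= length h)%nat) ->
 w (ext h v) U = w h U + sumL (fun u => if Nat.eqb v u then 1 else 0) U.
Proof.
 intros Hn HU. unfold w. rewrite <- sumL_plus. apply sumL_ext. intros u Hu.
 rewrite degree_ext, !plus_INR. pose proof (cur_bounds (length h)).
 specialize (HU u Hu). destruct (Nat.eqb_spec (cur (length h)) u); [nia|].
 destruct (Nat.eqb v u); simpl; lra.
Qed.

Lemma E1_hits h U : valid h -> (forall u, In u U -> (1 <= u)%nat /\ (m * u <= length h)%nat) ->
 E1 h (fun v => sumL (fun u => if Nat.eqb v u then 1 else 0) U) = w h U / cc (length h).
Proof.
 intros Hv HU. rewrite E1_sumL. unfold w, Rdiv. rewrite <- sumL_scal_r. apply sumL_ext.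
 intros u Hu. destruct (HU u Hu). pose proof (cur_bounds (length h)) as (Hc1 & Hc2).
 rewrite (E1_eqb h u (fun _ => 1)) by nia. rewrite step_prob_old by assumption.
 pos.
Qed.

Lemma E1_w h U : valid h -> NoDup U -> (forall u, In u U -> (1 <= u)%nat /\ (m * u <= length h)%nat) ->
 E1 h (fun v => w (ext h v) U) = w h U * (1 + / cc (length h)).
Proof.
 intros Hv Hn HU.
 rewrite (E1_ext _ _ (fun v => w h U + sumL (fun u => if Nat.eqb v u then 1 else 0) U)).
 - rewrite E1_plus, E1_const, E1_hits by assumption. pos.
 - intros. apply w_ext; [assumption|]. apply HU; assumption.
Qed.

Lemma w_nonneg h U : valid h -> (forall u, In u U -> (1 <= u)%nat /\ (m * u <= length h)%nat) -> 0 <= w h U.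
Proof.
 intros Hv HU. apply sumL_nonneg. intros u Hu. destruct (HU u Hu).
 pose proof (degree_completed h u Hv H H0). apply le_INR in H1. pose proof md_pos. lra.
Qed.

Lemma degree_app_le h l u : (degree h u <= degree (h ++ l) u)%nat.
Proof. rewrite degree_app. lia. Qed.

Lemma w_app_le h l U : w h U <= w (h ++ l) U.
Proof.
 apply sumL_le. intros u _. apply Rplus_le_compat_r, le_INR, degree_app_le.
Qed.

Lemma cc_vertices s : cc (m * s) = s * (2 * m + delta) + 1 + chi.
Proof. unfold cc. rewrite mult_INR, delta_chi. ring. Qed.

Lemma w_total h s : valid h -> length h = (m * s)%nat -> w h (seq 1 s) = s * (2 * m + delta).
Proof.
 intros Hv Hs. pose proof (wt_sum h Hv) as Hw.
 assert (Hc : cur (length h) = S s) by (rewrite Hs, <- (Nat.add_0_r (m*s)); apply cur_mul; pose proof Hm; lia).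
 rewrite Hc, seq_S, sumL_app in Hw. simpl in Hw.
 assert (wt h (S s) = 1 + chi).
 { unfold wt. rewrite Hc, Nat.eqb_refl, cur_edge_val, Hc.
  assert (degree h (S s) = 0%nat).
  { pose proof (degree_le h (S s) Hv ltac:(lia)). lia. }
  rewrite H. replace (length h - m * (S s - 1) + 1)%nat with 1%nat; [simpl; ring|].
  lia. }
 rewrite Hs, cc_vertices in Hw.
 assert (w h (seq 1 s) = sumL (wt h) (seq 1 s)).
 { apply sumL_ext. intros u Hu. apply in_seq in Hu. unfold wt. rewrite Hc.
  destruct (Nat.eqb_spec u (S s)); pos. }
 lra.
Qed.

End Process.

#[export] Hint Resolve cc_pos valid_nil valid_ext valid_firstn b2R_range w_nonneg E_nonneg cc_mono : pos.
#[export] Hint Extern 4 (0 <= b2R _) => apply b2R_range : pos.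
#[export] Hint Extern 4 (b2R _ <= 1) => apply b2R_range : pos.

(** * Elementary inequalities *)

Lemma exp_ge1 x : 1 + x <= exp x.
Proof.
 destruct (Req_dec x 0) as [->|Hx]; [rewrite exp_0; lra|].
 left. apply exp_ineq1. pos.
Qed.

Lemma ln_le_sub1 y : 0 < y -> ln y <= y - 1.
Proof.
 intros Hy. pose proof (exp_ge1 (ln y)). rewrite exp_ln in H by assumption. lra.
Qed.

(** From [exp (- x) >= 1 - x] one gets [exp x <= 1 / (1 - x)], and [1 - x >= 1/2] bounds the
    remainder by [2 * x^2]. No lower bound on [x] is required. *)
Lemma exp_le_quadratic x : x <= 1/2 -> exp x <= 1 + x + 2 * x * x.
Proof.
 pose proof (exp_ge1 (- x)).
 assert (0 < exp x) by apply exp_pos.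
 assert (exp x * exp (- x) = 1) by (rewrite <- exp_plus, Rplus_opp_r, exp_0; reflexivity).
 nra.
Qed.

Lemma exp_mono x y : x <= y -> exp x <= exp y.
Proof. intros [H| ->]; [left; apply exp_increasing; assumption|lra]. Qed.

Lemma ln_mono x y : 0 < x -> x <= y -> ln x <= ln y.
Proof. intros H [H1| ->]; [left; apply ln_increasing; assumption|lra]. Qed.

(** Weighted arithmetic and geometric means of [y] and [1], proved by [ln u <= u - 1] at [y / z] and
    at [/ z] for the arithmetic mean [z]. *)
Lemma Rpower_bernoulli y a : 0 < y -> 0 <= a <= 1 -> Rpower y a <= a * y + (1 - a).
Proof.
 intros Hy Ha. set (z := a * y + (1 - a)).
 assert (Hz : 0 < z) by (unfold z; destruct (Req_dec a 0) as [->|]; [lra|]; nra).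
 rewrite <- (exp_ln z Hz). apply exp_mono.
 pose proof (ln_le_sub1 (y / z) ltac:(apply Rdiv_lt_0_compat; assumption)) as H1.
 pose proof (ln_le_sub1 (/ z) ltac:(apply Rinv_0_lt_compat; assumption)) as H2.
 unfold Rdiv in H1. rewrite ln_mult in H1 by pos.
 rewrite ln_Rinv in H1, H2 by assumption.
 assert (a * (y * / z - 1) + (1 - a) * (/ z - 1) = 0).
 { transitivity (z * / z - 1); [unfold z; ring|]. pos. }
 nra.
Qed.

Lemma Rpower_pos x a : 0 < Rpower x a.
Proof. apply exp_pos. Qed.

Lemma Rpower_le_base x y a : 0 < x -> x <= y -> 0 <= a -> Rpower x a <= Rpower y a.
Proof. intros. apply Rle_Rpower_l; lra. Qed.

Lemma Rpower_div x y a : 0 < x -> 0 < y -> Rpower (x / y) a = Rpower x a / Rpower y a.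
Proof.
 intros. unfold Rpower, Rdiv. rewrite ln_mult, ln_Rinv by pos.
 rewrite <- exp_Ropp, <- exp_plus. f_equal. ring.
Qed.

Lemma Rpower_2_le a : 0 <= a <= 1 -> Rpower 2 a <= 2.
Proof. pose proof (Rpower_bernoulli 2 a). lra. Qed.

Lemma b2R_le_div (b : bool) x y : 0 < y -> 0 <= x -> (b = true -> y <= x) -> b2R b <= x / y.
Proof.
 intros Hy Hx H. destruct b; simpl.
 - apply Rmult_le_reg_r with y; [assumption|]. unfold Rdiv. rewrite Rmult_assoc, Rinv_l by lra.
  lra.
 - pos.
Qed.

Lemma Rdiv_le_swap x y z : 0 < z -> x <= y * z -> x / z <= y.
Proof.
 intros Hz H. apply Rmult_le_reg_r with z; [assumption|].
 unfold Rdiv. rewrite Rmult_assoc, Rinv_l by lra. lra.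
Qed.

Lemma Rle_div_swap x y z : 0 < z -> x * z <= y -> x <= y / z.
Proof.
 intros Hz H. apply Rmult_le_reg_r with z; [assumption|].
 unfold Rdiv. rewrite Rmult_assoc, Rinv_l by lra. lra.
Qed.

(** * Growth factors of weights and the exponent [gam] *)

Section Tools.
Context {P : PAmodel}.

(** Equal to [1 / (tau - 1)]: the degree of vertex [v] at time [t] grows like [(t / v)^gam]. *)
Definition gam : R := / (2 + chi).

Lemma gam_range : 1/2 < gam < 1.
Proof.
 pose proof chi_range. split.
 - replace (1/2) with (/ 2) by lra. apply Rinv_lt_contravar; lra.
 - rewrite <- Rinv_1. apply Rinv_lt_contravar; lra.
Qed.

Lemma gam_inv : gam * (2 + chi) = 1.
Proof. pose proof chi_range. unfold gam. pos. Qed.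

Lemma cc_lower k : INR k <= gam * cc k.
Proof.
 unfold cc. pose proof chi_range. pose proof gam_range. pose proof gam_inv.
 replace (gam * (k * (2 + chi) + 1 + chi)) with (k * (gam * (2 + chi)) + gam * (1 + chi)) by ring.
 rewrite H1. nra.
Qed.

Lemma cc_upper k : gam * cc k <= k + 1.
Proof.
 unfold cc. pose proof chi_range. pose proof gam_range. pose proof gam_inv.
 replace (gam * (k * (2 + chi) + 1 + chi)) with (k * (gam * (2 + chi)) + gam * (1 + chi)) by ring.
 rewrite H1. nra.
Qed.

Fixpoint Pi (a n : nat) : R :=
 match n with O => 1 | S n' => Pi a n' * (1 + / cc (a + n')) end.

Lemma Pi_front a n : Pi a (S n) = (1 + / cc a) * Pi (S a) n.
Proof.
 induction n.
 - simpl. rewrite Nat.add_0_r. ring.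
 - change (Pi a (S (S n))) with (Pi a (S n) * (1 + / cc (a + S n))). rewrite IHn.
  simpl. replace (a + S n)%nat with (S (a + n)) by lia. ring.
Qed.

Lemma Pi_plus a n1 n2 : Pi a (n1 + n2) = Pi a n1 * Pi (a + n1) n2.
Proof.
 induction n2; simpl.
 - rewrite Nat.add_0_r. ring.
 - rewrite Nat.add_succ_r. simpl. rewrite IHn2, Nat.add_assoc. ring.
Qed.

Lemma inv_cc_pos k : 0 < / cc k.
Proof. pos. Qed.

Lemma Pi_ge1 a n : 1 <= Pi a n.
Proof.
 induction n; simpl; [lra|]. pose proof (inv_cc_pos (a + n)). nra.
Qed.

Lemma Pi_pos a n : 0 < Pi a n.
Proof. pose proof (Pi_ge1 a n). lra. Qed.

Lemma Pi_lower a n : Rpower ((INR (a + n) + 1) / (a + 1)) gam <= Pi a n.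
Proof.
 pose proof gam_range. pose proof (pos_INR a).
 induction n.
 - rewrite Nat.add_0_r. unfold Rdiv. rewrite Rinv_r by lra. unfold Rpower.
  rewrite ln_1, Rmult_0_r, exp_0. pos.
 - pose proof (pos_INR (a + n)).
  replace ((INR (a + S n) + 1) / (a + 1)) with
   ((INR (a + n) + 1) / (a + 1) * ((INR (a + n) + 2) / (INR (a + n) + 1))).
  2: { rewrite Nat.add_succ_r, S_INR. pos. }
  rewrite <- Rpower_mult_distr by pos.
  apply Rmult_le_compat; [left; apply Rpower_pos|left; apply Rpower_pos|assumption|].
  eapply Rle_trans; [apply Rpower_bernoulli; pos|].
  replace (gam * ((INR (a + n) + 2) / (INR (a + n) + 1)) + (1 - gam)) with (1 + gam / (INR (a + n) + 1))
   by pos.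
  apply Rplus_le_compat_l. pose proof (cc_upper (a + n)). pose proof (cc_pos (a + n)).
  apply Rdiv_le_swap; [lra|].
  apply Rmult_le_reg_l with (cc (a + n)); [assumption|].
  rewrite <- Rmult_assoc, Rinv_r by lra. lra.
Qed.

(** Dominates [Pi] since [k <= gam * cc k]. It is the growth product for the normaliser
    [k * (2 + chi)], which reappears in [kern_bound]. *)
Fixpoint PG (a n : nat) : R :=
 match n with O => 1 | S n' => PG a n' * (1 + gam / INR (a + n')) end.

Lemma PG_pos a n : 0 < PG a n.
Proof.
 pose proof gam_range. induction n; simpl; [lra|].
 apply Rmult_lt_0_compat; [assumption|]. destruct (a + n)%nat eqn:Ea.
 - simpl. unfold Rdiv. rewrite Rinv_0. lra.
 - assert (0 < gam / INR (S n0)) by pos. lra.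
Qed.

(* (1 - 1/k)^gam <= 1 - gam/k, so (k/(k-1))^gam >= 1/(1-gam/k) >= 1 + gam/k *)
Lemma PG_upper a n : (2 <= a)%nat -> PG a n <= Rpower ((INR (a + n) - 1) / (a - 1)) gam.
Proof.
 intros Ha. pose proof gam_range. assert (2 <= a) by pos.
 induction n.
 - rewrite Nat.add_0_r. unfold Rdiv. rewrite Rinv_r by lra. unfold Rpower.
  rewrite ln_1, Rmult_0_r, exp_0. pos.
 - cbn [PG]. assert (2 <= INR (a + n)) by pos.
  set (k := INR (a + n)) in *.
  replace ((INR (a + S n) - 1) / (a - 1)) with ((k - 1) / (a - 1) * (k / (k - 1))).
  2: { rewrite Nat.add_succ_r, S_INR. fold k. pos. }
  rewrite <- Rpower_mult_distr by pos.
  assert (0 < gam / k < 1).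
  { split; [pos|]. apply Rmult_lt_reg_r with k; [lra|].
   unfold Rdiv. rewrite Rmult_assoc, Rinv_l by lra. lra. }
  apply Rmult_le_compat; [left; apply PG_pos|lra|assumption|].
  pose proof (Rpower_bernoulli ((k - 1) / k) gam ltac:(apply Rdiv_lt_0_compat; lra) ltac:(lra)) as HB.
  replace (gam * ((k - 1) / k) + (1 - gam)) with (1 - gam / k) in HB by pos.
  assert (Rpower (k / (k - 1)) gam * Rpower ((k - 1) / k) gam = 1).
  { rewrite Rpower_mult_distr by pos.
   replace (k / (k - 1) * ((k - 1) / k)) with 1 by pos.
   unfold Rpower. rewrite ln_1, Rmult_0_r, exp_0. pos. }
  pose proof (Rpower_pos (k / (k - 1)) gam).
  nra.
Qed.

Lemma Pi_upper a n : (2 <= a)%nat -> Pi a n <= Rpower ((INR (a + n) - 1) / (a - 1)) gam.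
Proof.
 intros Ha. eapply Rle_trans; [|apply PG_upper; assumption].
 induction n; simpl; [lra|]. apply Rmult_le_compat; [left; apply Pi_pos| |assumption|].
 - pos.
 - apply Rplus_le_compat_l. assert (0 < INR (a + n)) by pos.
  pose proof (cc_lower (a + n)). pose proof (cc_pos (a + n)).
  apply Rle_div_swap; [assumption|]. rewrite Rmult_comm. apply Rdiv_le_swap; pos.
Qed.

(* [PiV s s'] is the growth factor of weights between vertex-times [s] and [s']. *)
Definition PiV (s s' : nat) : R := Pi (m * s) (m * s' - m * s).

Lemma PiV_upper s s' : (1 <= s <= s')%nat -> PiV s s' <= 2 * Rpower (s' / s) gam.
Proof.
 intros Hs. pose proof Hm. pose proof gam_range.
 assert (1 <= s) by pos.
 assert (s <= s') by pos.
 pose proof INRm_ge2.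
 eapply Rle_trans; [apply Pi_upper; nia|].
 replace (m * s + (m * s' - m * s))%nat with (m * s')%nat by nia. rewrite !mult_INR.
 (* The shifts by one cost at most a factor 2 in the base, because [m * s >= 2]. *)
 apply Rle_trans with (Rpower (2 * (s' / s)) gam).
 - apply Rpower_le_base; [apply Rdiv_lt_0_compat; nra| |lra].
  apply Rdiv_le_swap; [nra|].
  replace (2 * (s' / s) * (m * s - 1)) with
   (m * s' + (s' / s) * (m * s - 2)) by pos.
  assert (2 <= m * s) by nra.
  assert (0 <= s' / s * (m * s - 2)) by pos. lra.
 - rewrite <- Rpower_mult_distr by pos.
  apply Rmult_le_compat_r; [left; apply Rpower_pos|]. apply Rpower_2_le. lra.
Qed.

Lemma PiV_lower s s' : (1 <= s <= s')%nat -> Rpower (s' / s) gam / 2 <= PiV s s'.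
Proof.
 intros Hs. pose proof gam_range.
 assert (1 <= s) by pos.
 assert (s <= s') by pos.
 pose proof INRm_ge2.
 eapply Rle_trans; [|apply Pi_lower].
 replace (m * s + (m * s' - m * s))%nat with (m * s')%nat by nia. rewrite !mult_INR.
 apply Rdiv_le_swap; [lra|].
 apply Rle_trans with (Rpower (2 * ((m * s' + 1) / (m * s + 1))) gam).
 - apply Rpower_le_base; [pos| |lra].
  apply Rdiv_le_swap; [lra|].
  replace (2 * ((m * s' + 1) / (m * s + 1)) * s) with
   ((2 * s * (m * s' + 1)) / (m * s + 1)) by pos.
  assert (2 <= m * s) by nra.
  apply Rle_div_swap; nra.
 - rewrite <- Rpower_mult_distr by (lra || (apply Rdiv_lt_0_compat; nra)).
  rewrite Rmult_comm. apply Rmult_le_compat_l; [left; apply Rpower_pos|]. apply Rpower_2_le. lra.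
Qed.

Lemma PiV_S s s' : (s <= s')%nat -> PiV s (S s') = PiV s s' * PiV s' (S s').
Proof.
 intros. unfold PiV.
 replace (m * S s' - m * s)%nat with ((m * s' - m * s) + (m * S s' - m * s'))%nat by nia.
 rewrite Pi_plus. f_equal. f_equal. nia.
Qed.

Lemma PiV_ge1 s s' : 1 <= PiV s s'.
Proof. apply Pi_ge1. Qed.

Lemma PiV_refl s : PiV s s = 1.
Proof. unfold PiV. rewrite Nat.sub_diag. pos. Qed.

Lemma E_w n : forall h U, valid h -> NoDup U ->
 (forall u, In u U -> (1 <= u)%nat /\ (m * u <= length h)%nat) ->
 E n h (fun h' => w h' U) = w h U * Pi (length h) n.
Proof.
 induction n; intros h U Hv Hn HU; [rewrite E_O; simpl; ring|].
 rewrite E_S, Pi_front.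
 rewrite (E1_ext _ _ (fun v => Pi (S (length h)) n * w (ext h v) U)).
 - rewrite E1_scal, E1_w by assumption. ring.
 - intros v Hb. rewrite IHn.
  + rewrite ext_length. ring.
  + pos.
  + pos.
  + intros u Hu. rewrite ext_length. destruct (HU u Hu). pos.
Qed.

Lemma PiV_step_upper s : (2 <= s)%nat -> PiV s (S s) <= 1 + 2 * m / cc (m * s).
Proof.
 intros Hs. unfold PiV. replace (m * S s - m * s)%nat with m by lia.
 pose proof (cc_pos (m * s)).
 assert (forall n, (n <= m)%nat -> Pi (m * s) n <= 1 + 2 * n / cc (m * s)).
 { induction n; intros Hn.
  - simpl. lra.
  - cbn [Pi]. specialize (IHn ltac:(lia)).
   assert (/ cc (m * s + n) <= / cc (m * s)) by (apply Rinv_le_contravar; [assumption|apply cc_mono; lia]).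
   pose proof (inv_cc_pos (m * s + n)).
   assert (2 * n <= cc (m * s)).
   { rewrite cc_vertices. pose proof md_pos. pose proof chi_range.
    assert (n + 1 <= m) by (rewrite <- S_INR; apply le_INR; lia).
    pose proof INRm_ge2.
    assert (2 * (2 * m + delta) <= s * (2 * m + delta)) by pos. lra. }
   rewrite S_INR. unfold Rdiv in *. set (c := / cc (m * s)) in *.
   assert (2 * n * c <= 1).
   { unfold c. apply Rmult_le_reg_r with (cc (m * s)); [assumption|].
    rewrite Rmult_assoc, Rinv_l by lra. lra. }
   nra. }
 pos.
Qed.

(** * Concentration *)

(* [Z] is sampled at the block times and stopped when [ok] fails. *)
Lemma azuma (Z : history -> R) (ok : history -> bool) (b : nat -> R) (lam : R) wd h s :
 valid h -> length h = (m * s)%nat ->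
 (forall g s', valid g -> length g = (m * s')%nat -> (s <= s' < s + wd)%nat -> ok g = true -> E m g Z <= Z g) ->
 (forall g l s', valid (g ++ l) -> length g = (m * s')%nat -> (s <= s' < s + wd)%nat -> length l = m ->
   ok g = true -> Rabs (Z (g ++ l) - Z g) <= b s') ->
 (forall g l, ok (g ++ l) = true -> ok g = true) ->
 0 < lam -> (forall s', (s <= s' < s + wd)%nat -> lam * b s' <= 1/2) ->
 E (m * wd) h (fun h' => b2R (ok h') * exp (lam * (Z h' - Z h)))
  <= exp (2 * lam ^ 2 * sumL (fun s' => b s' ^ 2) (seq s wd)).
Proof.
 intros Hv Hs Hdrift Hb Hok Hlam Hlb.
 (* [V] compensates the quadratic term of the exponential, and the indicator of [ok] sends [F] to 0
    for good when [ok] fails, so that [F] is a supermartingale over blocks. *)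
 set (V := fun s' => 2 * lam ^ 2 * sumL (fun i => b i ^ 2) (seq s (s' - s))).
 set (F := fun g => b2R (ok g) * exp (lam * (Z g - Z h) - V (length g / m)%nat)).
 assert (HmP := Hm).
 assert (E (m * wd) h F <= F h).
 { apply (E_super_block wd h F s Hv Hs). intros l s' Hl Hs' Hbd.
  set (g := h ++ l) in *. unfold F at 2.
  destruct (ok g) eqn:Hokg.
  - rewrite Rmult_1_l.
   assert (Hdiv : (length g / m = s')%nat) by (rewrite Hs', Nat.mul_comm, Nat.div_mul; lia).
   rewrite Hdiv.
   set (K := exp (lam * (Z g - Z h) - V (S s'))).
   assert (0 < K) by apply exp_pos.
   (* The exponential is replaced by its quadratic bound; the linear term has mean at most 0 by
      [Hdrift]. *)
   apply Rle_trans with (E m g (fun g' => K * (1 + 2 * (lam * b s') ^ 2) + K * lam * (Z g' + - Z g))).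
   + apply E_le; [assumption|]. intros l' Hl' Hn.
    assert (Hdiv' : (length (g ++ l') / m = S s')%nat).
    { rewrite length_app, Hs', Hn. replace (m * s' + m)%nat with (S s' * m)%nat by lia. apply Nat.div_mul. lia. }
    unfold F. rewrite Hdiv'.
    specialize (Hb g l' s' Hl' Hs' Hbd Hn Hokg). specialize (Hlb s' Hbd).
    set (d := Z (g ++ l') - Z g) in *.
    replace (lam * (Z (g ++ l') - Z h) - V (S s')) with ((lam * (Z g - Z h) - V (S s')) + lam * d)
     by (unfold d; ring).
    rewrite exp_plus. fold K.
    assert (Hd : lam * d <= 1/2).
    { apply Rle_trans with (lam * b s'); [|assumption]. apply Rmult_le_compat_l; [lra|].
     pose proof (Rle_abs d). lra. }
    pose proof (exp_le_quadratic (lam * d) Hd).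
    assert ((lam * d) * (lam * d) <= (lam * b s') ^ 2).
    { replace (lam * d * (lam * d)) with (lam ^ 2 * (d * d)) by ring. rewrite Rpow_mult_distr.
     apply Rmult_le_compat_l; [pos|].
     replace (d * d) with (Rabs d * Rabs d) by (rewrite <- Rabs_mult; apply Rabs_right; nra).
     pose proof (Rabs_pos d). nra. }
    replace (Z (g ++ l') + - Z g) with d by pos.
    apply Rle_trans with (K * exp (lam * d)).
    * rewrite <- (Rmult_1_l (K * exp (lam * d))) at 2.
     pos.
    * apply Rle_trans with (K * (1 + lam * d + 2 * (lam * b s') ^ 2)).
     -- pos.
     -- pos.
   + rewrite E_plus, E_const, E_scal, E_plus, E_const by assumption.
    specialize (Hdrift g s' Hl Hs' Hbd Hokg).
    apply Rle_trans with (K * (1 + 2 * (lam * b s') ^ 2)).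
    * assert (K * lam * (E m g Z + - Z g) <= 0).
     { assert (0 < K * lam) by pos. nra. }
     lra.
    * apply Rle_trans with (K * exp (2 * (lam * b s') ^ 2)).
     -- apply Rmult_le_compat_l; [lra|]. apply exp_ge1.
     -- unfold K. rewrite <- exp_plus. apply exp_mono. unfold V.
       replace (S s' - s)%nat with (S (s' - s)) by lia. rewrite seq_S, sumL_app. simpl sumL at 2.
       replace (s + (s' - s))%nat with s' by lia. nra.
  - apply E_le_const; [assumption|]. intros l' Hl' Hn.
   unfold F. destruct (ok (g ++ l')) eqn:Hx; [|simpl; lra].
   apply Hok in Hx. pos. }
 assert (F h <= 1).
 { unfold F. rewrite Rminus_diag, Rmult_0_r. rewrite Hs, Nat.mul_comm, Nat.div_mul by lia.
  unfold V. rewrite Nat.sub_diag. rewrite Rmult_0_r, Rminus_diag, exp_0.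
  pose proof (b2R_range (ok h)). lra. }
 set (K := exp (2 * lam ^ 2 * sumL (fun s' => b s' ^ 2) (seq s wd))).
 rewrite (E_ext _ _ _ (fun h' => K * F h')).
 - rewrite E_scal. assert (0 < K) by apply exp_pos. nra.
 - pos.
 - intros l Hl Hn. unfold F, K.
  assert (Hdiv' : (length (h ++ l) / m = s + wd)%nat).
  { rewrite length_app, Hs, Hn. replace (m * s + m * wd)%nat with ((s + wd) * m)%nat by lia. apply Nat.div_mul. lia. }
  rewrite Hdiv'. unfold V. replace (s + wd - s)%nat with wd by lia.
  rewrite (Rmult_comm (exp _)), Rmult_assoc, <- exp_plus. f_equal. f_equal. ring.
Qed.

Lemma azuma_tail (Z : history -> R) (ok : history -> bool) (b : nat -> R) (lam x : R) wd h s :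
 valid h -> length h = (m * s)%nat ->
 (forall g s', valid g -> length g = (m * s')%nat -> (s <= s' < s + wd)%nat -> ok g = true -> E m g Z <= Z g) ->
 (forall g l s', valid (g ++ l) -> length g = (m * s')%nat -> (s <= s' < s + wd)%nat -> length l = m ->
   ok g = true -> Rabs (Z (g ++ l) - Z g) <= b s') ->
 (forall g l, ok (g ++ l) = true -> ok g = true) ->
 0 < lam -> (forall s', (s <= s' < s + wd)%nat -> lam * b s' <= 1/2) ->
 E (m * wd) h (fun h' => b2R (ok h' && (if Rle_dec x (Z h' - Z h) then true else false)))
  <= exp (2 * lam ^ 2 * sumL (fun s' => b s' ^ 2) (seq s wd) - lam * x).
Proof.
 intros Hv Hs Hdrift Hb Hok Hlam Hlb.
 pose proof (azuma Z ok b lam wd h s Hv Hs Hdrift Hb Hok Hlam Hlb).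
 apply Rle_trans with (E (m * wd) h (fun h' => exp (- (lam * x)) * (b2R (ok h') * exp (lam * (Z h' - Z h))))).
 - apply E_le; [assumption|]. intros l Hl Hn.
  destruct (ok (h ++ l)); simpl; [|lra].
  destruct (Rle_dec x (Z (h ++ l) - Z h)); simpl.
  + rewrite Rmult_1_l, <- exp_plus. rewrite <- exp_0. apply exp_mono. nra.
  + pos.
 - rewrite E_scal. unfold Rminus. rewrite exp_plus, Rmult_comm.
  pos.
Qed.

(* Exponential moments of a degree: [exp (th X)] with [th] shrinking at the rate at which degrees grow. *)
Lemma degree_exp_moment n : forall h u th, valid h -> (1 <= u)%nat -> (m * u <= length h)%nat ->
 0 <= th -> th * (Pi (length h) n) ^ 2 <= 1/2 ->
 E n h (fun h' => exp (th * INR (degree h' u))) <= exp (th * (Pi (length h) n) ^ 2 * INR (degree h u)).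
Proof.
 induction n; intros h u th Hv Hu Hmu Hth Hbd.
 - rewrite E_O. simpl Pi. right. f_equal. ring.
 - rewrite E_S. set (a := length h). pose proof (inv_cc_pos a).
  assert (HPf : Pi a (S n) = (1 + / cc a) * Pi (S a) n) by apply Pi_front.
  (* Why [Pi] is squared: for [T <= 1/2] only [exp T - 1 <= 2 * T] is available, so a step costs the
     factor [1 + 2 / cc a], which is at most [(1 + / cc a)^2]. *)
  set (T := th * Pi (S a) n ^ 2).
  assert (0 <= T) by (unfold T; apply Rmult_le_pos; [assumption|apply pow2_ge_0]).
  assert (T * (1 + / cc a) ^ 2 = th * Pi a (S n) ^ 2) by (unfold T; rewrite HPf; ring).
  assert (HT1 : T <= 1/2).
  { fold a in Hbd. nra. }
  apply Rle_trans with (E1 h (fun v => exp (T * INR (degree (ext h v) u)))).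
  + apply E1_le; [assumption|]. intros v Hb. unfold T.
   replace (S a) with (length (ext h v)) by (rewrite ext_length; reflexivity).
   apply IHn; try assumption.
   * pos.
   * rewrite ext_length. lia.
   * rewrite ext_length. assumption.
  + pose proof (cur_bounds (length h)) as (Hc1 & Hc2).
   set (D := INR (degree h u)).
   rewrite (E1_ext _ _ (fun v => exp (T * D) + (if Nat.eqb v u then exp (T * D) * (exp T - 1) else 0))).
   * rewrite E1_plus, E1_const by assumption.
    rewrite (E1_eqb h u (fun _ => exp (T * D) * (exp T - 1))) by nia.
    rewrite step_prob_old by assumption.
    pose proof (exp_le_quadratic T HT1). pose proof (exp_pos (T * D)).
    pose proof (exp_ge1 T).
    assert (0 <= D) by apply pos_INR.
    apply Rle_trans with (exp (T * D) * (1 + D * / cc a * (2 * T))).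
    -- rewrite Rmult_plus_distr_l, Rmult_1_r. apply Rplus_le_compat_l.
      replace ((D + delta) / cc a * (exp (T * D) * (exp T - 1)))
       with (exp (T * D) * ((D + delta) * / cc a * (exp T - 1))) by pos.
      apply Rmult_le_compat_l; [lra|]. pose proof Hd2.
      assert (exp T - 1 <= 2 * T) by nra.
      assert ((D + delta) * / cc a <= D * / cc a) by pos.
      assert (0 <= D * / cc a) by pos.
      nra.
    -- apply Rle_trans with (exp (T * D) * exp (D * / cc a * (2 * T))).
      ++ apply Rmult_le_compat_l; [lra|apply exp_ge1].
      ++ rewrite <- exp_plus. apply exp_mono.
       assert (0 <= T * D * (/ cc a) ^ 2) by pos. nra.
   * intros v _. rewrite degree_ext.
    destruct (Nat.eqb_spec (cur (length h)) u); [pos|].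
    destruct (Nat.eqb_spec v u).
    -- rewrite !plus_INR. fold D. rewrite Rplus_0_r, Rmult_plus_distr_l, exp_plus, Rmult_1_r. ring.
    -- rewrite !Nat.add_0_r. fold D. ring.
Qed.

Lemma degree_growth_tail n h u L : valid h -> (1 <= u)%nat -> (m * u <= length h)%nat ->
 Pi (length h) n <= 16 -> INR (degree h u) <= L ->
 E n h (fun h' => b2R (if Rle_dec (1024 * L) (INR (degree h' u)) then true else false)) <= exp (- L).
Proof.
 intros Hv Hu Hmu HPi HL. pose proof (Pi_ge1 (length h) n).
 assert (Pi (length h) n ^ 2 <= 256) by nra.
 (* The parameter [/ 512] satisfies the bound 1/2 of [degree_exp_moment] since [Pi^2 <= 256]; the
    moment is then at most [exp (L / 2)], while the threshold [1024 * L] contributes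
    [exp (- 2 * L)]. *)
 apply Rle_trans with (E n h (fun h' => exp (- (2 * L)) * exp (/ 512 * INR (degree h' u)))).
 - apply E_le; [assumption|]. intros l _ _.
  rewrite <- exp_plus. destruct (Rle_dec (1024 * L) (INR (degree (h ++ l) u))); simpl.
  + rewrite <- exp_0. apply exp_mono. lra.
  + pos.
 - rewrite E_scal.
  apply Rle_trans with (exp (- (2 * L)) * exp (/ 512 * Pi (length h) n ^ 2 * INR (degree h u))).
  + apply Rmult_le_compat_l; [pos|]. apply degree_exp_moment; try assumption; lra.
  + rewrite <- exp_plus. apply exp_mono. pose proof (pos_INR (degree h u)).
   nra.
Qed.

(** A negative moment, for lower tails. The shift by one makes the step exact:
    [W * (/ (W - 1) - / W) = / (W - 1)], so one decision multiplies the mean of [/ (W - 1)] by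
    [1 - / cc], which is at most [/ (1 + / cc)]. *)
Lemma E_inv_weight n : forall h U, valid h -> NoDup U ->
 (forall u, In u U -> (1 <= u)%nat /\ (m * u <= length h)%nat) -> 1 < w h U ->
 E n h (fun h' => / (w h' U - 1)) <= / ((w h U - 1) * Pi (length h) n).
Proof.
 induction n; intros h U Hv Hn HU Hw.
 - rewrite E_O. rewrite Rmult_1_r. lra.
 - rewrite E_S, Pi_front. set (W := w h U) in *. set (Q := Pi (S (length h)) n).
  assert (0 < Q) by apply Pi_pos. pose proof (cc_pos (length h)).
  assert (Hwe : forall v, w (ext h v) U = W + sumL (fun u => if Nat.eqb v u then 1 else 0) U).
  { intros. apply w_ext; [assumption|]. apply HU; assumption. }
  assert (Hs01 : forall v, sumL (fun u => if Nat.eqb v u then 1 else 0) U = 0 \/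
               sumL (fun u => if Nat.eqb v u then 1 else 0) U = 1).
  { intros v. rewrite (sumL_ext _ (fun u => if Nat.eqb u v then 1 else 0))
    by (intros; rewrite Nat.eqb_sym; reflexivity).
   destruct (in_dec Nat.eq_dec v U).
   - right. apply (sumL_eqb (fun _ => 1)); assumption.
   - left. apply (sumL_eqb_notin (fun _ => 1)); assumption. }
  apply Rle_trans with (E1 h (fun v => / Q * / (W - 1) +
    (- (/ Q * (/ (W - 1) - / W))) * sumL (fun u => if Nat.eqb v u then 1 else 0) U)).
  + apply E1_le; [assumption|]. intros v Hb.
   eapply Rle_trans; [apply IHn|].
   * pos.
   * pos.
   * intros u Hu. rewrite ext_length. destruct (HU u Hu). pos.
   * rewrite Hwe. destruct (Hs01 v) as [-> | ->]; lra.
   * rewrite ext_length. fold Q. rewrite Hwe.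
    destruct (Hs01 v) as [-> | ->]; right; field; lra.
  + rewrite E1_plus, E1_const, E1_scal, E1_hits by assumption. fold W.
   set (x := / cc (length h)). assert (0 < x) by (apply Rinv_0_lt_compat; assumption).
   apply Rle_trans with (/ Q * / (W - 1) * (1 - x)); [right; unfold Rdiv; fold x; field; lra|].
   replace (/ ((W - 1) * ((1 + x) * Q))) with (/ Q * / (W - 1) * / (1 + x)) by pos.
   apply Rmult_le_compat_l.
   * pos.
   * apply Rmult_le_reg_r with (1 + x); [lra|]. rewrite Rinv_l by lra. nra.
Qed.

End Tools.

#[export] Hint Resolve Rpower_pos Pi_pos PG_pos inv_cc_pos : pos.
#[export] Hint Extern 3 (exp _ <= exp _) => apply exp_mono; pos : pos.
#[export] Hint Extern 3 (ln _ <= ln _) => apply ln_mono; pos : pos.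
#[export] Hint Extern 3 (sumL _ _ <= sumL _ _) => apply sumL_le; pos : pos.
#[export] Hint Extern 3 (0 <= sumL _ _) => apply sumL_nonneg; pos : pos.
#[export] Hint Extern 3 (_ / _ <= _) => apply Rdiv_le_swap; pos : pos.
#[export] Hint Extern 3 (_ <= _ / _) => apply Rle_div_swap; pos : pos.

Definition Rltb (a b : R) : bool := if Rlt_dec a b then true else false.
Definition Rleb (a b : R) : bool := if Rle_dec a b then true else false.

Lemma Rltb_true a b : Rltb a b = true <-> a < b.
Proof. unfold Rltb. destruct (Rlt_dec a b); split; intros; (congruence || lra). Qed.
Lemma Rltb_false a b : Rltb a b = false <-> b <= a.
Proof. unfold Rltb. destruct (Rlt_dec a b); split; intros; (congruence || lra). Qed.
Lemma Rleb_true a b : Rleb a b = true <-> a <= b.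
Proof. unfold Rleb. destruct (Rle_dec a b); split; intros; (congruence || lra). Qed.
Lemma Rleb_false a b : Rleb a b = false <-> b < a.
Proof. unfold Rleb. destruct (Rle_dec a b); split; intros; (congruence || lra). Qed.

(** * Walks *)

Inductive near (h : history) : nat -> nat -> nat -> Prop :=
| near_refl k u : near h k u u
| near_step k u x v : near h k u x -> adj h x v = true -> near h (S k) u v.

Lemma adj_sym h u v : adj h u v = adj h v u.
Proof.
 induction h; simpl; [pos|]. rewrite IHh. f_equal.
 apply orb_comm.
Qed.

Lemma adj_In h u v : In (u, v) h -> adj h u v = true.
Proof.
 intros H. apply existsb_exists. exists (u, v).
 rewrite !Nat.eqb_refl. pos.
Qed.

Lemma adj_cases h u v : adj h u v = true -> In (u, v) h \/ In (v, u) h.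
Proof.
 unfold adj. rewrite existsb_exists. intros ((a, b) & Hin & Hb).
 apply orb_true_iff in Hb. destruct Hb as [Hb|Hb]; apply andb_true_iff in Hb as [H1 H2];
  apply Nat.eqb_eq in H1, H2; subst; tauto.
Qed.

Lemma adj_app h l u v : adj h u v = true -> adj (h ++ l) u v = true.
Proof. unfold adj. rewrite existsb_app. intros ->. pos. Qed.

Lemma near_le h k k' u v : near h k u v -> (k <= k')%nat -> near h k' u v.
Proof.
 intros H. revert k'. induction H; intros k' Hk; [pos|].
 destruct k'; [lia|]. apply near_step with x; [apply IHnear; lia|assumption].
Qed.

Lemma near_app h l k u v : near h k u v -> near (h ++ l) k u v.
Proof. induction 1; [pos|]. eapply near_step; [eassumption|]. apply adj_app; assumption. Qed.

Lemma near_trans h k1 k2 u x v : near h k1 u x -> near h k2 x v -> near h (k1 + k2) u v.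
Proof.
 intros H1 H2. induction H2; [apply near_le with k1; pos|].
 rewrite Nat.add_succ_r. eapply near_step; pos.
Qed.

Lemma near_adj h u v : adj h u v = true -> near h 1 u v.
Proof. intros. apply near_step with u; pos. Qed.

Lemma near_sym h k u v : near h k u v -> near h k v u.
Proof.
 induction 1; [pos|]. replace (S k) with (1 + k)%nat by lia.
 apply near_trans with x; [apply near_adj; rewrite adj_sym|]; assumption.
Qed.

Lemma reach_refl h t k u : reach h t k u u = true.
Proof. induction k; simpl; [apply Nat.eqb_refl|]. rewrite IHk. pos. Qed.

Lemma reach_near h t k u v : reach h t k u v = true -> near h k u v.
Proof.
 revert v. induction k; simpl; intros v H.
 - apply Nat.eqb_eq in H. subst. pos.
 - apply orb_true_iff in H as [H|H].
  + apply near_le with k; pos.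
  + apply existsb_exists in H as (x & _ & Hx). apply andb_true_iff in Hx as [Hx1 Hx2].
   eapply near_step; eauto.
Qed.

Lemma firstn_app_le {A} n (h l : list A) : (n <= length h)%nat -> firstn n (h ++ l) = firstn n h.
Proof.
 intros. rewrite firstn_app. replace (n - length h)%nat with 0%nat by lia. apply app_nil_r.
Qed.

Section Graph.
Context {P : PAmodel}.

Lemma valid_In h e : valid h -> In e h -> (1 <= snd e <= fst e)%nat /\ (m * (fst e - 1) < length h)%nat.
Proof.
 induction 1; simpl; intros Hin; [tauto|].
 rewrite ext_length. pose proof (cur_bounds (length h)) as (Hc1 & Hc2).
 apply in_app_or in Hin as [Hin|[<-|[]]].
 - specialize (IHvalid Hin). lia.
 - simpl. lia.
Qed.

Lemma valid_In_vertex h t e : valid h -> (length h <= m * t)%nat -> In e h ->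
 (1 <= snd e <= fst e)%nat /\ (fst e <= t)%nat.
Proof.
 intros Hv Hl Hin. destruct (valid_In h e Hv Hin) as [H1 H2].
 nia.
Qed.

Lemma valid_app_In h l e : valid (h ++ l) -> In e l -> (length h < m * fst e)%nat.
Proof.
 induction l as [|e' l IH] using rev_ind; intros Hv Hin; [destruct Hin|].
 rewrite app_assoc in Hv. inversion Hv as [Hnil|h0 v Hv0 Hb Heq].
 - destruct h, l; discriminate.
 - apply app_inj_tail in Heq as [-> He'].
  apply in_app_or in Hin as [Hin|[<-|[]]].
  + pos.
  + rewrite <- He'. simpl. pose proof (cur_bounds (length (h ++ l))) as (_ & H2).
   rewrite length_app in *. lia.
Qed.

(** [reach] scans only intermediate vertices in [1..t]; validity places all endpoints of edges
    there. *)
Lemma near_reach h t k u v : valid h -> (length h <= m * t)%nat -> near h k u v -> reach h t k u v = true.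
Proof.
 intros Hv Hl. induction 1; [apply reach_refl|].
 simpl. apply orb_true_iff. right. apply existsb_exists. exists x.
 rewrite IHnear. split; [|pos].
 apply in_seq. apply adj_cases in H0 as [H0|H0]; pose proof (valid_In_vertex h t _ Hv Hl H0); simpl in *; lia.
Qed.

(** * Joining a vertex to a set by two edges of a fresh vertex *)

Definition mem_edge (h : history) (z u : nat) : bool :=
 existsb (fun e => Nat.eqb (fst e) z && Nat.eqb (snd e) u) h.

Lemma mem_edge_In h z u : mem_edge h z u = true <-> In (z, u) h.
Proof.
 unfold mem_edge. rewrite existsb_exists. split.
 - intros ((a, b) & Hin & Hb). apply andb_true_iff in Hb as [H1 H2].
  apply Nat.eqb_eq in H1, H2. subst. assumption.
 - exists (z, u). rewrite !Nat.eqb_refl. auto.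
Qed.

Lemma mem_edge_app h l z u : mem_edge (h ++ l) z u = mem_edge h z u || mem_edge l z u.
Proof. apply existsb_app. Qed.

Lemma mem_edge_stable h l z u : valid (h ++ l) -> (m * z <= length h)%nat -> mem_edge (h ++ l) z u = mem_edge h z u.
Proof.
 intros Hv Hz. rewrite mem_edge_app. destruct (mem_edge l z u) eqn:E'; [|apply orb_false_r].
 apply mem_edge_In in E'. pose proof (valid_app_In h l _ Hv E'). simpl in H. lia.
Qed.

Definition joined (h : history) (z0 wd u : nat) (G : list nat) : bool :=
 existsb (fun z => mem_edge h z u && existsb (mem_edge h z) G) (seq (z0 + 1) wd).

Lemma existsb_mono {A} (p q : A -> bool) l : (forall x, p x = true -> q x = true) ->
 existsb p l = true -> existsb q l = true.
Proof.
 intros H. rewrite !existsb_exists. intros (x & H1 & H2). pos.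
Qed.

Lemma existsb_ext_In {A} (p q : A -> bool) l : (forall x, In x l -> p x = q x) -> existsb p l = existsb q l.
Proof. induction l; simpl; intros H; [pos|]. rewrite H, IHl; auto. Qed.

Lemma joined_app h l z0 wd u G : joined h z0 wd u G = true -> joined (h ++ l) z0 wd u G = true.
Proof.
 apply existsb_mono. intros z Hz. apply andb_true_iff in Hz as [H1 H2].
 rewrite mem_edge_app, H1. revert H2. apply existsb_mono. intros x Hx.
 rewrite mem_edge_app, Hx. pos.
Qed.

Lemma joined_stable h l z0 wd u G : valid (h ++ l) -> (m * (z0 + wd) <= length h)%nat ->
 joined (h ++ l) z0 wd u G = joined h z0 wd u G.
Proof.
 intros Hv Hz. apply existsb_ext_In. intros z Hin. apply in_seq in Hin.
 assert (m * z <= length h)%nat by nia.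
 rewrite mem_edge_stable by assumption. f_equal. apply existsb_ext_In. intros x _.
 apply mem_edge_stable; assumption.
Qed.

Lemma joined_near h z0 wd u G : joined h z0 wd u G = true -> exists x, In x G /\ near h 2 u x.
Proof.
 unfold joined. rewrite existsb_exists. intros (z & _ & Hz). apply andb_true_iff in Hz as [H1 H2].
 apply existsb_exists in H2 as (x & Hx & H2). exists x. split; [assumption|].
 apply mem_edge_In in H1, H2. change 2%nat with (1 + 1)%nat. apply near_trans with z.
 - apply near_sym, near_adj, adj_In. assumption.
 - apply near_adj, adj_In. assumption.
Qed.

Lemma sumL_indic_range v G : NoDup G -> sumL (fun u => if Nat.eqb v u then 1 else 0) G = b2R (existsb (Nat.eqb v) G).
Proof.
 intros Hn. rewrite (sumL_ext _ (fun u => if Nat.eqb u v then 1 else 0))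
  by (intros; rewrite Nat.eqb_sym; reflexivity).
 destruct (existsb (Nat.eqb v) G) eqn:Ex.
 - apply existsb_exists in Ex as (x & Hx & Hv). apply Nat.eqb_eq in Hv. subst.
  apply (sumL_eqb (fun _ => 1)); assumption.
 - apply (sumL_eqb_notin (fun _ => 1)). intro Hin.
  assert (existsb (Nat.eqb v) G = true) by (apply existsb_exists; exists v; rewrite Nat.eqb_refl; auto).
  pos.
Qed.

(** Each fresh vertex, whatever the past, sends its first edge to [u] with probability at least
    [d / C] and its second one into [G] with probability at least [g / C]. Weights only grow, so
    these bounds persist through the window. *)
Lemma not_joined_prob h z0 wd u G d g C :
 valid h -> length h = (m * z0)%nat -> (1 <= u <= z0)%nat -> NoDup G ->
 (forall x, In x G -> (1 <= x <= z0)%nat) ->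
 0 <= d -> 0 <= g -> d <= INR (degree h u) + delta -> g <= w h G -> cc (m * (z0 + wd)) <= C ->
 E (m * wd) h (fun h' => b2R (negb (joined h' z0 wd u G))) <= exp (- (wd * d * g / C ^ 2)).
Proof.
 intros Hv Hl Hu HG HGb Hd Hg Hdu HgG HC.
 assert (HmP := Hm). assert (0 < C) by (pose proof (cc_pos (m * (z0 + wd))); lra).
 set (q := d * g / C ^ 2).
 set (F := fun g' : history => b2R (negb (joined g' z0 wd u G)) * exp (q * (INR (length g' / m) - INR z0))).
 assert (E (m * wd) h F <= F h).
 { apply (E_super_block wd h F z0 Hv Hl). intros l s' Hvl Hs' Hb.
  set (h1 := h ++ l) in *.
  assert (Hdiv : (length h1 / m = s')%nat) by (rewrite Hs', Nat.mul_comm, Nat.div_mul; lia).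
  unfold F at 2. destruct (joined h1 z0 wd u G) eqn:Hj.
  - apply E_le_const; [assumption|]. intros l' Hl' Hn. unfold F.
   rewrite joined_app by assumption. simpl. lra.
  - rewrite Rmult_1_l, Hdiv.
   set (K := exp (q * (INR (S s') - INR z0))).
   assert (0 < K) by apply exp_pos.
   assert (cur (length h1) = S s') by (rewrite Hs', <- (Nat.add_0_r (m * s')); apply cur_mul; lia).
   assert (forall v, cur (length (ext h1 v)) = S s').
   { intros. rewrite ext_length, Hs'. replace (S (m * s')) with (m * s' + 1)%nat by lia. apply cur_mul. lia. }
   apply Rle_trans with (E m h1 (fun h' => K * b2R (negb (joined h' z0 wd u G)))).
   { apply E_le; [assumption|]. intros l' Hl' Hn. unfold F.
    assert (Hdiv' : (length (h1 ++ l') / m = S s')%nat).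
    { rewrite length_app, Hs', Hn. replace (m * s' + m)%nat with (S s' * m)%nat by lia. apply Nat.div_mul. lia. }
    rewrite Hdiv'. fold K. lra. }
   rewrite E_scal.
   assert (E m h1 (fun h' => b2R (negb (joined h' z0 wd u G))) <= 1 - q).
   (* Here [m >= 2] is used: the first two edges of the fresh vertex are exposed and the others are
      ignored. *)
   { replace m with (S (S (m - 2))) at 1 by lia. rewrite E_S.
    apply Rle_trans with (E1 h1 (fun v1 => E1 (ext h1 v1) (fun v2 =>
      1 + (- (if Nat.eqb v1 u then 1 else 0)) * sumL (fun x => if Nat.eqb v2 x then 1 else 0) G))).
    - apply E1_le; [assumption|]. intros v1 Hb1. rewrite E_S.
     assert (Hv1 : valid (ext h1 v1)) by pos.
     apply E1_le; [assumption|]. intros v2 Hb2.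
     assert (valid (ext (ext h1 v1) v2)) by pos.
     apply E_le_const; [assumption|]. intros l' Hl' Hn.
     rewrite sumL_indic_range by assumption.
     destruct (Nat.eqb_spec v1 u); [|pose proof (b2R_range (negb (joined (ext (ext h1 v1) v2 ++ l') z0 wd u G))); lra].
     destruct (existsb (Nat.eqb v2) G) eqn:Ex;
      [|pose proof (b2R_range (negb (joined (ext (ext h1 v1) v2 ++ l') z0 wd u G))); simpl; lra].
     assert (Hjj : joined (ext (ext h1 v1) v2 ++ l') z0 wd u G = true).
     { apply joined_app. apply existsb_exists. exists (S s'). split; [pos|].
      apply andb_true_iff. split.
      - apply mem_edge_In. apply in_or_app. left.
       apply in_or_app. right. pos.
      - apply existsb_exists in Ex as (x & Hx & Hxv). apply Nat.eqb_eq in Hxv. subst x.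
       apply existsb_exists. exists v2. split; [assumption|]. apply mem_edge_In.
       apply in_or_app. right. pos. }
     rewrite Hjj. simpl. lra.
    - assert (d / C <= step_prob m delta h1 u).
     { rewrite step_prob_old by (assumption || nia).
      pose proof (degree_app_le h l u) as Hda. apply le_INR in Hda. fold h1 in Hda.
      assert (Hcc : cc (length h1) <= C) by (eapply Rle_trans; [apply cc_mono|pos]; rewrite Hs'; nia).
      apply Rle_trans with ((INR (degree h1 u) + delta) / C).
      - pos.
      - apply Rmult_le_compat_l; [lra|]. pos. }
     apply Rle_trans with (E1 h1 (fun v1 => 1 + (if Nat.eqb v1 u then - (g / C) else 0))).
     + apply E1_le; [assumption|]. intros v1 Hb1.
      assert (Hv1 : valid (ext h1 v1)) by pos.
      rewrite E1_plus, E1_const, E1_scal by assumption.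
      destruct (Nat.eqb v1 u); [|lra].
      rewrite E1_hits.
      * assert (Hcc : cc (length (ext h1 v1)) <= C) by (eapply Rle_trans; [apply cc_mono|pos]; rewrite ext_length, Hs'; nia).
       assert (g <= w (ext h1 v1) G).
       { eapply Rle_trans; [exact HgG|]. unfold ext, h1. rewrite <- app_assoc. apply w_app_le. }
       assert (g / C <= w (ext h1 v1) G / cc (length (ext h1 v1))).
       { apply Rle_trans with (w (ext h1 v1) G / C).
        - pos.
        - apply Rmult_le_compat_l; [lra|]. pos. }
       lra.
      * pos.
      * intros x Hx. rewrite ext_length. specialize (HGb x Hx). nia.
     + rewrite E1_plus, E1_const by assumption.
      rewrite (E1_eqb h1 u (fun _ => - (g / C))) by pos.
      assert (q = d / C * (g / C)) by (unfold q; field; lra).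
      assert (0 <= g / C) by pos.
      nra. }
   apply Rle_trans with (K * exp (- q)).
   + apply Rmult_le_compat_l; [lra|]. pose proof (exp_ge1 (- q)). lra.
   + unfold K. rewrite <- exp_plus. apply exp_mono. rewrite S_INR. lra. }
 assert (F h <= 1).
 { unfold F. rewrite Hl, Nat.mul_comm, Nat.div_mul, Rminus_diag, Rmult_0_r, exp_0 by lia.
  pose proof (b2R_range (negb (joined h z0 wd u G))). lra. }
 rewrite (E_ext _ _ _ (fun h' => exp (- (q * wd)) * F h')).
 - rewrite E_scal. replace (- (wd * d * g / C ^ 2)) with (- (q * wd)) by (unfold q, Rdiv; ring).
  pose proof (exp_pos (- (q * wd))). nra.
 - pos.
 - intros l Hvl Hn. unfold F.
  assert (Hdiv' : (length (h ++ l) / m = z0 + wd)%nat).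
  { rewrite length_app, Hl, Hn. replace (m * z0 + m * wd)%nat with ((z0 + wd) * m)%nat by lia. apply Nat.div_mul. lia. }
  rewrite Hdiv', plus_INR. rewrite (Rmult_comm (b2R _)), <- Rmult_assoc, <- exp_plus.
  replace (- (q * wd) + q * (z0 + wd - z0)) with 0 by ring. rewrite exp_0. ring.
Qed.

(** Markov's inequality for the weight that fails to be joined, instead of a union bound: the
    probability does not depend on the size of [Cr], at the price of giving up half of its
    weight. *)
Lemma not_joined_weight h z0 wd (Cr : list nat) (om : nat -> R) G d g C :
 valid h -> length h = (m * z0)%nat -> NoDup G ->
 (forall u, In u Cr -> (1 <= u <= z0)%nat /\ d <= INR (degree h u) + delta /\ 0 <= om u) ->
 (forall x, In x G -> (1 <= x <= z0)%nat) ->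
 0 <= d -> 0 <= g -> g <= w h G -> cc (m * (z0 + wd)) <= C ->
 E (m * wd) h (fun h' => b2R (Rltb (sumL om Cr / 2)
   (sumL (fun u => om u * b2R (negb (joined h' z0 wd u G))) Cr)))
  <= 2 * exp (- (wd * d * g / C ^ 2)).
Proof.
 intros Hv Hl HG HC1 HGb Hd Hg HgG HC.
 assert (0 <= sumL om Cr) by (apply sumL_nonneg; intros; apply HC1; assumption).
 set (f := exp (- (INR wd * d * g / C ^ 2))).
 destruct (Req_dec (sumL om Cr) 0) as [H0|H0].
 - apply Rle_trans with 0; [|unfold f; pose proof (exp_pos (- (wd * d * g / C ^ 2))); lra].
  apply E_le_const; [assumption|]. intros l _ _. rewrite H0.
  replace (Rltb (0 / 2) _) with false; [pos|]. symmetry. apply Rltb_false.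
  unfold Rdiv. rewrite Rmult_0_l, <- H0. apply sumL_le. intros u Hu.
  pose proof (b2R_range (negb (joined (h ++ l) z0 wd u G))). destruct (HC1 u Hu) as (_ & _ & Hom). nra.
 - apply Rle_trans with (E (m * wd) h (fun h' => (2 / sumL om Cr) *
    sumL (fun u => om u * b2R (negb (joined h' z0 wd u G))) Cr)).
  + apply E_le; [assumption|]. intros l _ _.
   set (X := sumL (fun u => om u * b2R (negb (joined (h ++ l) z0 wd u G))) Cr).
   assert (0 <= X).
   { apply sumL_nonneg. intros u Hu. apply Rmult_le_pos; [apply HC1; assumption|pos]. }
   replace (2 / sumL om Cr * X) with (2 * X / sumL om Cr) by pos.
   apply b2R_le_div; [lra|lra|]. intros Hb. apply Rltb_true in Hb. lra.
  + rewrite E_scal, E_sumL.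
   apply Rle_trans with (2 / sumL om Cr * sumL (fun u => om u * f) Cr).
   * apply Rmult_le_compat_l; [pos|].
    apply sumL_le. intros u Hu. destruct (HC1 u Hu) as (Hu1 & Hu2 & Hu3). rewrite E_scal.
    apply Rmult_le_compat_l; [assumption|]. apply not_joined_prob; assumption.
   * rewrite sumL_scal_r. right. pos.
Qed.

(** * The chain of joined cores between times [r] and [r + n wd] *)

Section Chain.
Variables (r wd : nat) (D : nat -> R).

Definition core (h : history) (d : R) : list nat :=
 filter (fun u => Rleb d (INR (degree (firstn (m * r) h) u) + delta)) (seq 1 r).

(** Every level has its own window of [wd] fresh vertices, so its joins may be estimated given the
    outcome of the earlier levels. Degrees are read at time [r] throughout. *)
Fixpoint chain (h : history) (j : nat) : list nat :=
 match j with
 | O => [1%nat]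
 | S j' => filter (fun u => joined h (r + j' * wd) wd u (chain h j')) (core h (D j'))
 end.

Lemma chain_stable h l j : valid (h ++ l) -> (m * (r + j * wd) <= length h)%nat ->
 chain (h ++ l) j = chain h j.
Proof.
 intros Hv. induction j; intros Hl; [pos|]. simpl.
 assert (Hl' : (m * (r + j * wd) <= length h)%nat) by pos.
 rewrite (IHj Hl'). unfold core. rewrite firstn_app_le by nia.
 apply filter_ext. intros u. apply joined_stable; [assumption|]. nia.
Qed.

Lemma chain_NoDup h j : NoDup (chain h j).
Proof.
 destruct j; simpl.
 - constructor; pos.
 - apply NoDup_filter, NoDup_filter, seq_NoDup.
Qed.

Lemma chain_near h j u : In u (chain h j) -> near h (2 * j) u 1.
Proof.
 revert u. induction j; simpl chain; intros u Hu.
 - destruct Hu as [<-|[]]. pos.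
 - apply filter_In in Hu as [_ Hu]. apply joined_near in Hu as (x & Hx & Hn).
  replace (2 * S j)%nat with (2 + 2 * j)%nat by lia. apply near_trans with x; auto.
Qed.

Hypothesis Hr : (1 <= r)%nat.

Lemma chain_In h j u : In u (chain h j) -> (1 <= u <= r)%nat.
Proof.
 destruct j; simpl.
 - lia.
 - intros H. apply filter_In in H as [H _]. apply filter_In in H as [H _]. apply in_seq in H. lia.
Qed.

Variable g : nat -> R.

Definition chain_fail (h : history) (j : nat) : bool :=
 existsb (fun i => Rltb (w (firstn (m * r) h) (chain h i)) (g i)) (seq 0 (S j)).

(** A core has weight at least [2 * g (S j)]. Outside an event of probability [2 * f] at most half
    of that weight fails to join the previous level, so [g (S j)] remains for the next one. *)
Lemma chain_prob (n : nat) (f C : R) hr :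
 valid hr -> length hr = (m * r)%nat -> cc (m * (r + n * wd)) <= C ->
 (forall j, (j <= n)%nat -> 0 <= g j) -> (forall j, (j < n)%nat -> 0 <= D j) ->
 g 0%nat <= INR (degree hr 1) + delta ->
 (forall j, (j < n)%nat -> 2 * g (S j) <= w hr (core hr (D j))) ->
 (forall j, (j < n)%nat -> exp (- (wd * D j * g j / C ^ 2)) <= f) ->
 forall j, (j <= n)%nat -> E (m * (j * wd)) hr (fun h => b2R (chain_fail h j)) <= j * (2 * f).
Proof.
 intros Hv Hl HC Hg HD Hg0 Hcore Hf.
 assert (Hfn : forall l, firstn (m * r) (hr ++ l) = hr).
 { intros. rewrite firstn_app_le by lia. rewrite <- Hl. apply firstn_all. }
 assert (Hf0 : forall j, (j < n)%nat -> 0 <= f).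
 { intros j Hj. specialize (Hf j Hj). pose proof (exp_pos (- (wd * D j * g j / C ^ 2))). lra. }
 induction j; intros Hj.
 - rewrite Nat.mul_0_r, E_O. unfold chain_fail. simpl.
  replace (firstn (m * r) hr) with hr by (rewrite <- Hl, firstn_all; reflexivity).
  replace (Rltb (w hr [1%nat]) (g 0%nat)) with false.
  + simpl. lra.
  + symmetry. apply Rltb_false. unfold w. simpl. lra.
 - replace (m * (S j * wd))%nat with (m * (j * wd) + m * wd)%nat by pos. rewrite E_add.
  specialize (IHj ltac:(lia)).
  apply Rle_trans with (E (m * (j * wd)) hr (fun h => b2R (chain_fail h j) + 2 * f)).
  2: { rewrite E_plus, E_const by assumption. rewrite S_INR. lra. }
  apply E_le; [assumption|]. intros l Hvl Hn. set (h := hr ++ l) in *.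
  assert (length h = (m * (r + j * wd))%nat) by (unfold h; rewrite length_app; lia).
  destruct (chain_fail h j) eqn:Hcf.
  + simpl. apply Rle_trans with 1; [|pose proof (Hf0 j ltac:(lia)); lra].
   apply E_le_const; [assumption|]. pos.
  + simpl b2R.
   assert (Hgj : g j <= w hr (chain h j)).
   { destruct (Rle_dec (g j) (w hr (chain h j))); [assumption|].
    assert (chain_fail h j = true); [|pos].
    apply existsb_exists. exists j. split; [pos|]. unfold h. rewrite Hfn. fold h.
    apply Rltb_true. lra. }
   set (om := fun u => INR (degree hr u) + delta).
   apply Rle_trans with (2 * exp (- (wd * D j * g j / C ^ 2))); [|pose proof (Hf j ltac:(lia)); lra].
   eapply Rle_trans; [|apply (not_joined_weight h (r + j * wd) wd (core hr (D j)) om (chain h j) (D j) (g j) C)].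
   * apply E_le; [assumption|]. intros l' Hvl' Hn'.
    destruct (chain_fail (h ++ l') (S j)) eqn:Hcf'; [|apply b2R_range].
    replace (Rltb _ _) with true; [pos|]. symmetry. apply Rltb_true.
    assert (Hfn' : firstn (m * r) (h ++ l') = hr) by (unfold h; rewrite <- app_assoc; apply Hfn).
    apply existsb_exists in Hcf' as (i & Hi & Hlt). apply in_seq in Hi. rewrite Hfn' in Hlt.
    apply Rltb_true in Hlt.
    assert (i = S j).
    { destruct (Nat.eq_dec i (S j)); [assumption|].
     assert (chain_fail h j = true); [|pos].
     apply existsb_exists. exists i. split; [pos|]. unfold h at 1. rewrite Hfn.
     apply Rltb_true. rewrite chain_stable in Hlt; [assumption|assumption|]. nia. }
    subst i. simpl chain in Hlt. unfold core in Hlt at 1. rewrite Hfn' in Hlt.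
    assert (Hcr : core hr (D j) = filter (fun u => Rleb (D j) (INR (degree hr u) + delta)) (seq 1 r)).
    { unfold core. replace (firstn (m * r) hr) with hr by (rewrite <- Hl, firstn_all; reflexivity). pos. }
    rewrite <- Hcr in Hlt. unfold w in Hlt. rewrite sumL_filter in Hlt.
    rewrite chain_stable in Hlt by pos.
    specialize (Hcore j ltac:(lia)). unfold w in Hcore. fold om in Hcore, Hlt.
    assert (sumL om (core hr (D j)) =
      sumL (fun x => if joined (h ++ l') (r + j * wd) wd x (chain h j) then om x else 0) (core hr (D j)) +
      sumL (fun u => om u * b2R (negb (joined (h ++ l') (r + j * wd) wd u (chain h j)))) (core hr (D j))).
    { rewrite <- sumL_plus. apply sumL_ext. intros x _.
     destruct (joined (h ++ l') (r + j * wd) wd x (chain h j)); simpl; ring. }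
    assert (sumL (fun x => if joined (h ++ l') (r + j * wd) wd x (chain h j) then om x else 0) (core hr (D j)) < g (S j)) by exact Hlt.
    lra.
   * pos.
   * pos.
   * apply chain_NoDup.
   * intros u Hu. unfold core in Hu. replace (firstn (m * r) hr) with hr in Hu by (rewrite <- Hl, firstn_all; reflexivity).
    apply filter_In in Hu as [Hu1 Hu2]. apply in_seq in Hu1. apply Rleb_true in Hu2.
    pose proof (degree_app_le hr l u) as Hda. apply le_INR in Hda. fold h in Hda.
    split; [nia|]. unfold om. specialize (HD j ltac:(lia)). lra.
   * intros x Hx. apply chain_In in Hx. nia.
   * pos.
   * apply Hg. lia.
   * eapply Rle_trans; [exact Hgj|]. apply w_app_le.
   * eapply Rle_trans; [|exact HC]. apply cc_mono. nia.
Qed.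

End Chain.
End Graph.

(** * Power sums *)

Lemma Rpower_1_l a : Rpower 1 a = 1.
Proof. unfold Rpower. rewrite ln_1, Rmult_0_r, exp_0. pos. Qed.

Lemma Rpower_pred i a : 1 < i -> 0 <= a <= 1 -> Rpower (i - 1) a <= Rpower i a * (1 - a / i).
Proof.
 intros Hi Ha.
 replace (i - 1) with (i * ((i - 1) / i)) at 1 by pos.
 assert (0 < (i - 1) / i) by pos.
 rewrite <- Rpower_mult_distr by lra.
 apply Rmult_le_compat_l; [pos|].
 eapply Rle_trans; [apply Rpower_bernoulli; lra|]. right. pos.
Qed.

(** Telescoping form of the comparison with an integral: by [Rpower_pred], [a * i^(-(1+a))] is at
    most [(i-1)^(-a) - i^(-a)]. *)
Lemma sum_pow_tail a n0 k : 0 < a <= 1 -> (1 <= n0)%nat ->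
 sumL (fun i => Rpower (INR i) (- (1 + a))) (seq (S n0) k)
  <= / a * (Rpower (INR n0) (- a) - Rpower (INR (n0 + k)) (- a)).
Proof.
 intros Ha Hn. induction k.
 - simpl. rewrite Nat.add_0_r. lra.
 - rewrite seq_S, sumL_app. cbn [sumL].
  replace (S n0 + k)%nat with (n0 + S k)%nat by lia.
  set (i := INR (n0 + S k)). assert (Hi : INR (n0 + k) = i - 1) by (unfold i; rewrite Nat.add_succ_r, S_INR; lra).
  rewrite Hi in IHk.
  assert (1 <= i - 1) by (rewrite <- Hi; apply (le_INR 1); lia).
  assert (a * Rpower i (- (1 + a)) <= Rpower (i - 1) (- a) - Rpower i (- a)).
  { pose proof (Rpower_pred i a ltac:(lra) ltac:(lra)).
   replace (- (1 + a)) with (Ropp 1 + Ropp a) by ring. rewrite Rpower_plus, !Rpower_Ropp, Rpower_1 by lra.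
   set (X := Rpower (i - 1) a) in *. set (Y := Rpower i a) in *.
   assert (0 < X) by apply Rpower_pos. assert (0 < Y) by apply Rpower_pos.
   assert (0 < a / i <= 1) by pos.
   apply Rmult_le_reg_r with (X * Y); [nra|].
   replace ((/ X - / Y) * (X * Y)) with (Y - X) by pos.
   replace (a * (/ i * / Y) * (X * Y)) with (a / i * X) by pos.
   assert (X <= Y) by nra. nra. }
  assert (Rpower i (- (1 + a)) <= / a * (Rpower (i - 1) (- a) - Rpower i (- a))).
  { apply Rmult_le_reg_l with a; [lra|]. rewrite <- Rmult_assoc, Rinv_r by lra. lra. }
  lra.
Qed.

Lemma sum_pow_tail' a n0 k : 0 < a <= 1 -> (1 <= n0)%nat ->
 sumL (fun i => Rpower (INR i) (- (1 + a))) (seq n0 k) <= (1 + / a) * Rpower (INR n0) (- a).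
Proof.
 intros Ha Hn. assert (0 < / a) by pos.
 assert (1 <= n0) by pos.
 pose proof (Rpower_pos n0 (- a)).
 destruct k; [simpl; nra|]. simpl.
 pose proof (sum_pow_tail a n0 k Ha Hn). pose proof (Rpower_pos (INR (n0 + k)) (- a)).
 assert (Rpower n0 (- (1 + a)) <= Rpower n0 (- a)).
 { apply Rle_Rpower; lra. }
 nra.
Qed.

Lemma sum_pow_head a k : 0 < a <= 1 ->
 sumL (fun i => Rpower (INR i) (a - 1)) (seq 1 k) <= / a * Rpower (INR k) a.
Proof.
 intros Ha. assert (0 < / a) by pos.
 destruct k; [simpl; pose proof (Rpower_pos 0 a); nra|].
 induction k.
 - simpl. rewrite !Rpower_1_l. assert (1 <= / a) by (rewrite <- Rinv_1; apply Rinv_le_contravar; lra). lra.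
 - rewrite seq_S, sumL_app. cbn [sumL].
  replace (1 + S k)%nat with (S (S k)) by lia. set (i := INR (S (S k))).
  assert (Hi : INR (S k) = i - 1) by (unfold i; rewrite (S_INR (S k)); lra). rewrite Hi in IHk.
  assert (1 <= i - 1) by (rewrite <- Hi; apply (le_INR 1); lia).
  pose proof (Rpower_pred i a ltac:(lra) ltac:(lra)).
  assert (Rpower i (a - 1) = Rpower i a / i).
  { replace (a - 1) with (a + Ropp 1) by ring. rewrite Rpower_plus, Rpower_Ropp, Rpower_1 by lra. pos. }
  assert (/ a * (Rpower i a * (1 - a / i)) = / a * Rpower i a - Rpower i a / i) by pos.
  assert (/ a * Rpower (i - 1) a <= / a * (Rpower i a * (1 - a / i))) by pos.
  lra.
Qed.

Lemma ln_succ_ge i : 1 < i -> / i <= ln i - ln (i - 1).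
Proof.
 intros Hi. pose proof (ln_le_sub1 ((i - 1) / i) ltac:(apply Rdiv_lt_0_compat; lra)) as H.
 unfold Rdiv in H. rewrite ln_mult, ln_Rinv in H by pos.
 replace ((i - 1) * / i - 1) with (- / i) in H by pos. lra.
Qed.

Lemma sum_harmonic n0 k : (1 <= n0)%nat ->
 sumL (fun i => / INR i) (seq n0 (S k)) <= 1 + ln (INR (n0 + k)).
Proof.
 intros Hn. assert (1 <= n0) by pos.
 assert (0 <= ln n0) by (rewrite <- ln_1; apply ln_mono; lra).
 induction k.
 - simpl. rewrite Nat.add_0_r. assert (/ n0 <= 1) by (rewrite <- Rinv_1; apply Rinv_le_contravar; lra). lra.
 - rewrite seq_S, sumL_app. cbn [sumL].
  set (i := INR (n0 + S k)). assert (Hi : 1 < i) by (apply (lt_INR 1); lia).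
  assert (H1 : INR (n0 + k) = i - 1) by (unfold i; rewrite (Nat.add_succ_r n0 k), S_INR; lra).
  rewrite H1 in IHk. pose proof (ln_succ_ge i Hi). lra.
Qed.

(** * Weights of the oldest vertices *)

Section Groups.
Context {P : PAmodel}.

(** Vertex 1 is the root of every chain, so its weight needs a lower tail. After its own [m]
    self-loops the weight is [2 * m + delta >= 2], and Markov's inequality applies to the negative
    moment from then on. *)
Lemma vertex1_degree r y : (1 <= r)%nat -> 0 < y ->
 E (m * r) [] (fun h => b2R (Rltb (w h [1%nat]) y)) <= 2 * y * Rpower r (- gam).
Proof.
 intros Hr Hy. replace (m * r)%nat with (m * 1 + (m * r - m * 1))%nat by nia.
 rewrite E_add. apply E_le_const; [pos|]. intros l Hv Hl.
 assert (Hw1 : w l [1%nat] = 2 * m + delta).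
 { change [1%nat] with (seq 1 1). rewrite (w_total l 1 Hv Hl). simpl. ring. }
 assert (2 <= w l [1%nat]) by (rewrite Hw1; pose proof md_pos; pose proof INRm_ge2; lra).
 apply Rle_trans with (E (m * r - m * 1) l (fun h => y * / (w h [1%nat] - 1))).
 - apply E_le; [assumption|]. intros l' Hl' _. pose proof (w_app_le l l' [1%nat]).
  apply b2R_le_div; [lra|lra|]. intros Hb. apply Rltb_true in Hb. lra.
 - rewrite E_scal.
  pose proof (E_inv_weight (m * r - m * 1) l [1%nat] Hv) as HI.
  assert (HPV : Rpower (r / INR 1) gam / 2 <= PiV 1 r) by (apply PiV_lower; lia).
  unfold PiV in HPV. rewrite <- Hl in HPV at 1.
  set (Q := Pi (length l) (m * r - m * 1)) in *.
  replace (r / INR 1) with (INR r) in HPV by (simpl; field).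
  rewrite Rpower_Ropp. pose proof (Rpower_pos r gam).
  assert (E (m * r - m * 1) l (fun h' => / (w h' [1%nat] - 1)) <= / Q).
  { eapply Rle_trans; [apply HI|].
   - constructor; pos.
   - intros u [<-|[]]. lia.
   - lra.
   - apply Rinv_le_contravar; [lra|]. nra. }
  assert (/ Q <= 2 * / Rpower r gam).
  { replace (2 * / Rpower r gam) with (/ (Rpower r gam / 2)) by pos.
   pos. }
  nra.
Qed.

Lemma in_seq1_completed n0 (g : history) s u : length g = (m * s)%nat -> (n0 <= s)%nat -> In u (seq 1 n0) ->
 (1 <= u)%nat /\ (m * u <= length g)%nat.
Proof. intros Hg Hs Hu. apply in_seq in Hu. nia. Qed.

Lemma w_mono_len g n0 s : valid g -> length g = (m * s)%nat -> (n0 <= s)%nat -> w g (seq 1 n0) <= w g (seq 1 s).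
Proof.
 intros Hv Hg Hs. apply sumL_incl.
 - pos.
 - intros u Hu. apply in_seq in Hu. pos.
 - intros u Hu. destruct (in_seq1_completed s g s u Hg ltac:(lia) Hu).
  pose proof (degree_completed g u Hv H H0) as Hd. apply le_INR in Hd. pose proof md_pos. lra.
Qed.

Lemma w_app_bounds g l U n : NoDup U -> length l = n -> valid (g ++ l) ->
 (forall u, In u U -> (1 <= u)%nat /\ (m * u <= length g)%nat) ->
 w g U <= w (g ++ l) U <= w g U + n.
Proof.
 intros HU. revert l. induction n; intros l Hl Hv HUb.
 - destruct l; [|discriminate]. rewrite app_nil_r. simpl. lra.
 - destruct (exists_last (l := l)) as (l0 & e & ->); [destruct l; discriminate|].
  rewrite length_app in Hl. simpl in Hl.
  assert (Hv0 : valid (g ++ l0)) by (apply valid_prefix with [e]; rewrite <- app_assoc; assumption).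
  specialize (IHn l0 ltac:(lia) Hv0 HUb).
  rewrite app_assoc in Hv |- *. inversion Hv as [Hn|h v Hh Hb Heq].
  { destruct (g ++ l0); discriminate. }
  apply app_inj_tail in Heq as [Hhg <-]. rewrite Hhg in *.
  rewrite w_ext; [|assumption|intros u Hu; destruct (HUb u Hu); rewrite length_app; lia].
  rewrite sumL_indic_range by assumption. pose proof (b2R_range (existsb (Nat.eqb v) U)).
  rewrite S_INR. lra.
Qed.

(* The normalised weight of the first [n0] vertices is a martingale with increments
  [O((n0/s)^gam)], hence total variance [O(n0)]. *)
Lemma group_weight_conc : exists kap, 0 < kap /\ forall n0 r, (2 <= n0 <= r)%nat ->
 E (m * r) [] (fun h => b2R (Rltb (w h (seq 1 n0))
   (n0 * (2 * m + delta) / 4 * Rpower (r / n0) gam))) <= exp (- (kap * n0)).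
Proof.
 pose proof gam_range. pose proof INRm_ge2. pose proof md_pos. pose proof Hm.
 set (a := 2 * gam - 1). assert (0 < a <= 1) by (unfold a; lra).
 set (B := 16 * INR m ^ 2 * (1 + / a)).
 assert (0 < B).
 { assert (0 < / a) by pos.
  assert (0 < m ^ 2) by pos. apply Rmult_lt_0_compat; lra. }
 set (M := 2 * INR m + delta). assert (0 < M) by (unfold M; lra).
 (* The first bound keeps [lam * b <= 1/2]; the second makes the variance term at most
    [lam * n0 * M / 4], half of the gain [lam * n0 * M / 2]. *)
 set (lam := Rmin (/ (8 * INR m)) (M / (8 * B))).
 assert (0 < lam).
 { apply Rmin_glb_lt; pos. }
 exists (lam * M / 4). split; [pos|].
 intros n0 r Hn0. set (U := seq 1 n0).
 assert (2 <= n0) by pos.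
 replace (m * r)%nat with (m * n0 + m * (r - n0))%nat by nia.
 rewrite E_add. apply E_le_const; [pos|]. intros h Hv Hl.
 assert (Hw0 : w h U = n0 * M) by (apply w_total; assumption).
 (* The sign turns the upper tail of [azuma_tail] into a lower tail for the weight. *)
 set (Z := fun g : history => - (w g U / PiV n0 (length g / m))).
 set (b := fun s => 4 * INR m * Rpower (INR n0 / INR s) gam).
 assert (HZ : forall g s, length g = (m * s)%nat -> Z g = - (w g U / PiV n0 s)).
 { intros g s Hg. unfold Z. rewrite Hg, Nat.mul_comm, Nat.div_mul by lia. pos. }
 assert (Htail := azuma_tail Z (fun _ => true) b lam (n0 * M / 2) (r - n0) h n0 Hv Hl).
 assert (HU : NoDup U) by apply seq_NoDup.
 eapply Rle_trans; [|eapply Rle_trans; [apply Htail|]].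
 - apply E_le; [assumption|]. intros l Hvl Hn.
  assert (Hlen : length (h ++ l) = (m * r)%nat) by (rewrite length_app; nia).
  destruct (Rltb _ _) eqn:Hb; [|apply b2R_range]. apply Rltb_true in Hb.
  destruct (Rle_dec _ _) as [|Hc]; [pos|]. exfalso. apply Hc.
  rewrite (HZ _ r Hlen), (HZ _ n0 Hl), PiV_refl, Hw0.
  pose proof (PiV_lower n0 r ltac:(lia)) as HP. pose proof (PiV_ge1 n0 r).
  assert (w (h ++ l) U / PiV n0 r <= n0 * M / 2).
  { apply Rdiv_le_swap; [lra|]. assert (0 < n0 * M) by pos. nra. }
  lra.
 - intros g s' Hg Hgl Hs' _. rewrite (HZ g s' Hgl).
  rewrite (E_ext m g Z (fun g' => - / PiV n0 (S s') * w g' U)).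
  + rewrite E_scal, E_w; [|assumption|assumption|intros; eapply in_seq1_completed; [pos| |eassumption]; lia].
   rewrite PiV_S by lia. unfold PiV at 2. rewrite Hgl. replace (m * S s' - m * s')%nat with m by lia.
   pose proof (PiV_ge1 n0 s'). pose proof (Pi_pos (m * s') m). right. pos.
  + pos.
  + intros l Hvl Hn. rewrite (HZ _ (S s')); [pos|]. rewrite length_app. lia.
 - intros g l s' Hvl Hgl Hs' Hn _.
  assert (Hg : valid g) by (eapply valid_prefix; eassumption).
  rewrite (HZ g s' Hgl), (HZ (g ++ l) (S s')) by (rewrite length_app; lia).
  assert (HUc : forall u, In u U -> (1 <= u)%nat /\ (m * u <= length g)%nat)
   by (intros; eapply in_seq1_completed; [pos| |eassumption]; lia).
  pose proof (w_app_bounds g l U m HU Hn Hvl HUc).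
  rewrite PiV_S by lia. set (rho := PiV s' (S s')). set (Q := PiV n0 s').
  assert (1 <= Q) by apply PiV_ge1. assert (1 <= rho) by apply PiV_ge1.
  assert (rho <= 1 + 2 * m / cc (m * s')) by (apply PiV_step_upper; lia).
  assert (w g U <= cc (m * s')).
  { eapply Rle_trans; [apply (w_mono_len g n0 s'); try assumption; lia|].
   rewrite (w_total g s') by assumption. rewrite cc_vertices. pose proof chi_range. lra. }
  assert (w g U * (rho - 1) <= 2 * m).
  { apply Rle_trans with (w g U * (2 * m / cc (m * s'))).
   - pos.
   - pose proof (cc_pos (m * s')). unfold Rdiv. rewrite (Rmult_comm (2 * m)), <- Rmult_assoc.
    rewrite <- (Rmult_1_l (2 * m)) at 2. apply Rmult_le_compat_r; [lra|].
    apply Rdiv_le_swap; lra. }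
  replace (- (w (g ++ l) U / (Q * rho)) - - (w g U / Q)) with ((w g U * rho - w (g ++ l) U) / (Q * rho)) by pos.
  assert (1 <= Q * rho) by nra.
  unfold Rdiv. rewrite Rabs_mult, (Rabs_right (/ (Q * rho))) by (left; apply Rinv_0_lt_compat; lra).
  assert (0 <= w g U * (rho - 1)) by pos.
  assert (Rabs (w g U * rho - w (g ++ l) U) <= 2 * m) by (apply Rabs_le; lra).
  assert (/ (Q * rho) <= 2 * Rpower (n0 / s') gam).
  { pose proof (PiV_lower n0 s' ltac:(lia)) as HP. fold Q in HP.
   assert (0 < s') by pos.
   assert (Rpower (n0 / s') gam * Rpower (s' / n0) gam = 1).
   { rewrite Rpower_mult_distr by pos.
    replace (n0 / s' * (s' / n0)) with 1 by pos. apply Rpower_1_l. }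
   pose proof (Rpower_pos (n0 / s') gam).
   apply Rmult_le_reg_r with (Q * rho); [lra|]. rewrite Rinv_l by lra.
   assert (Rpower (s' / n0) gam / 2 <= Q * rho) by nra.
   set (A := Rpower (INR n0 / INR s') gam) in *. set (A' := Rpower (INR s' / INR n0) gam) in *.
   assert (2 * A * (A' / 2) <= 2 * A * (Q * rho)) by pos. lra. }
  unfold b.
  apply Rle_trans with (2 * m * (2 * Rpower (n0 / s') gam)); [|pos].
  pos.
 - pos.
 - pos.
 - intros s' Hs'. unfold b. assert (0 < s') by pos.
  assert (Rpower (n0 / s') gam <= 1).
  { rewrite <- (Rpower_1_l gam). apply Rpower_le_base; [pos| |lra].
   apply Rdiv_le_swap; [lra|]. rewrite Rmult_1_l. pos. }
  assert (lam <= / (8 * m)) by apply Rmin_l.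
  pose proof (Rpower_pos (n0 / s') gam).
  apply Rle_trans with (/ (8 * m) * (4 * m)); [|right; field; lra].
  apply Rmult_le_compat; try lra; nra.
 - apply exp_mono.
  assert (sumL (fun s' => b s' ^ 2) (seq n0 (r - n0)) <= B * n0).
  { rewrite (sumL_ext _ (fun s' => 16 * m ^ 2 * Rpower n0 (1 + a) * Rpower (INR s') (- (1 + a)))).
   - rewrite sumL_scal.
    apply Rle_trans with (16 * m ^ 2 * Rpower n0 (1 + a) * ((1 + / a) * Rpower n0 (- a))).
    + apply Rmult_le_compat_l.
     * pos.
     * apply sum_pow_tail'; pos.
    + right. transitivity (16 * m ^ 2 * (1 + / a) * (Rpower n0 (1 + a) * Rpower n0 (- a))); [ring|].
     rewrite <- Rpower_plus. replace (1 + a + - a) with 1 by ring. rewrite Rpower_1 by lra. pos.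
   - intros s' Hs'. apply in_seq in Hs'. assert (0 < s') by pos.
    unfold b. rewrite Rpower_div by lra. rewrite Rpower_Ropp.
    replace (1 + a) with (gam + gam) by (unfold a; ring). rewrite !Rpower_plus.
    pose proof (Rpower_pos s' gam). pos. }
  assert (lam <= M / (8 * B)) by apply Rmin_r.
  assert (lam * B <= M / 8).
  { apply Rle_trans with (M / (8 * B) * B); [pos|right; field; lra]. }
  assert (2 * lam ^ 2 * sumL (fun s' => b s' ^ 2) (seq n0 (r - n0)) <= 2 * lam ^ 2 * (B * n0)) by pos.
  assert (2 * lam * n0 * (lam * B) <= 2 * lam * n0 * (M / 8)) by pos.
  lra.
Qed.

(** Among the [n0] oldest vertices, those below the threshold [d] hold at most [n0 * d] together;
    the rest belongs to the core. *)
Lemma core_weight r hr n0 d : valid hr -> length hr = (m * r)%nat -> (n0 <= r)%nat -> 0 <= d ->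
 w hr (seq 1 n0) - n0 * d <= w hr (core r hr d).
Proof.
 intros Hv Hl Hn Hd. unfold core. replace (firstn (m * r) hr) with hr by (rewrite <- Hl, firstn_all; reflexivity).
 unfold w. rewrite sumL_filter.
 replace r with (n0 + (r - n0))%nat by lia. rewrite seq_app, sumL_app.
 assert (Hpos : forall u, In u (seq (1 + n0) (r - n0)) ->
   0 <= (if Rleb d (INR (degree hr u) + delta) then INR (degree hr u) + delta else 0)).
 { intros u _. destruct (Rleb d (INR (degree hr u) + delta)) eqn:Hb; [apply Rleb_true in Hb|]; lra. }
 pose proof (sumL_nonneg _ _ Hpos).
 assert (sumL (fun u => INR (degree hr u) + delta) (seq 1 n0) <=
   sumL (fun u => (if Rleb d (INR (degree hr u) + delta) then INR (degree hr u) + delta else 0) + d) (seq 1 n0)).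
 { apply sumL_le. intros u _. destruct (Rleb d (INR (degree hr u) + delta)) eqn:Hb; [|apply Rleb_false in Hb]; lra. }
 rewrite (sumL_plus (fun u => if Rleb d (INR (degree hr u) + delta) then INR (degree hr u) + delta else 0)
   (fun _ => d)), sumL_const, length_seq in H0. lra.
Qed.

End Groups.

(** * One scale [r]: the chain up to time [2r], the final join up to time [4r] *)

Section Scale.
Context {P : PAmodel}.

Definition scale_bad (r n wd : nat) (D g : nat -> R) (L : R) (h : history) : bool :=
 chain_fail r wd D g h n ||
 existsb (fun u => Rleb L (INR (degree (firstn (m * (2 * r)) h) u) + delta)
          && negb (joined h (2 * r) (2 * r) u (chain r wd D h n))) (seq 1 (2 * r)).

Lemma chain_fail_stable r wd D g h l n : valid (h ++ l) -> (m * (r + n * wd) <= length h)%nat ->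
 chain_fail r wd D g (h ++ l) n = chain_fail r wd D g h n.
Proof.
 intros Hv Hl. apply existsb_ext_In. intros i Hi. apply in_seq in Hi.
 rewrite firstn_app_le by nia.
 assert (i * wd <= n * wd)%nat by (apply Nat.mul_le_mono_r; lia).
 rewrite chain_stable; [pos|assumption|nia].
Qed.

Lemma b2R_orb_le a b : b2R (a || b) <= b2R a + b2R b.
Proof. destruct a, b; simpl; lra. Qed.

Lemma b2R_orb_le' a b : b2R (a || b) <= b2R a + b2R (negb a && b).
Proof. destruct a, b; simpl; lra. Qed.

(** The four error terms are: a light vertex 1, a light group of oldest vertices, a failing level of
    the chain, and a union bound over the at most [2 * r] vertices that have to be joined to the
    last level. *)
Lemma scale_prob kap r n wd D g f L fL n0 :
 (forall n0 r, (2 <= n0 <= r)%nat ->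
   E (m * r) [] (fun h => b2R (Rltb (w h (seq 1 n0))
   (n0 * (2 * m + delta) / 4 * Rpower (r / n0) gam))) <= exp (- (kap * n0))) ->
 (1 <= r)%nat -> (n * wd <= r)%nat ->
 (forall j, (j <= n)%nat -> 0 < g j) -> (forall j, (j < n)%nat -> 0 <= D j) ->
 (forall j, (j < n)%nat -> (2 <= n0 j <= r)%nat /\
   2 * g (S j) <= INR (n0 j) * (2 * m + delta) / 4 * Rpower (r / INR (n0 j)) gam - INR (n0 j) * D j) ->
 (forall j, (j < n)%nat -> exp (- (wd * D j * g j / cc (m * (2 * r)) ^ 2)) <= f) ->
 0 <= f -> 0 <= L -> exp (- (INR (2 * r) * L * g n / cc (m * (4 * r)) ^ 2)) <= fL ->
 E (m * (4 * r)) [] (fun h => b2R (scale_bad r n wd D g L h)) <=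
  2 * g 0%nat * Rpower r (- gam) + sumL (fun j => exp (- (kap * INR (n0 j)))) (seq 0 n)
  + n * (2 * f) + INR (2 * r) * fL.
Proof.
 intros Hkap Hr Hnw Hg HD Hn0 Hf Hf0 HL HfL.
 assert (0 <= fL) by (pose proof (exp_pos (- (INR (2 * r) * L * g n / cc (m * (4 * r)) ^ 2))); lra).
 set (b1 := fun h => Rltb (w h [1%nat]) (g 0%nat)).
 set (b2 := fun j h => Rltb (w h (seq 1 (n0 j)))
   (INR (n0 j) * (2 * INR m + delta) / 4 * Rpower (INR r / INR (n0 j)) gam)).
 set (tail := INR n * (2 * f) + INR (2 * r) * fL).
 assert (0 <= tail).
 { unfold tail. pos. }
 replace (m * (4 * r))%nat with (m * r + m * (3 * r))%nat by lia. rewrite E_add.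
 apply Rle_trans with (E (m * r) [] (fun h => b2R (b1 h) + (sumL (fun j => b2R (b2 j h)) (seq 0 n) + tail))).
 2: { rewrite E_plus, E_plus, E_const, E_sumL by constructor.
    pose proof (vertex1_degree r (g 0%nat) Hr (Hg 0%nat ltac:(lia))).
    assert (sumL (fun j => E (m * r) [] (fun h => b2R (b2 j h))) (seq 0 n) <=
          sumL (fun j => exp (- (kap * INR (n0 j)))) (seq 0 n)).
    { apply sumL_le. intros j Hj. apply in_seq in Hj. apply Hkap. apply Hn0. lia. }
    unfold b1 in *. unfold tail. lra. }
 apply E_le; [pos|]. intros hr Hv Hl. simpl app.
 assert (0 <= sumL (fun j => b2R (b2 j hr)) (seq 0 n)) by pos.
 destruct (b1 hr) eqn:Hb1.
 { simpl b2R. apply Rle_trans with 1; [|lra]. apply E_le_const; [assumption|]. pos. }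
 destruct (existsb (fun j => b2 j hr) (seq 0 n)) eqn:Hb2.
 { pose proof (b2R_existsb_le (fun j => b2 j hr) (seq 0 n)) as Hx. rewrite Hb2 in Hx. simpl in Hx.
  apply Rle_trans with 1; [|simpl; lra]. apply E_le_const; [assumption|]. pos. }
 simpl b2R. apply Rle_trans with tail; [|lra].
 assert (Hg0 : g 0%nat <= w hr [1%nat]) by (apply Rltb_false; exact Hb1).
 assert (forall j, (j < n)%nat -> 2 * g (S j) <= w hr (core r hr (D j))).
 { intros j Hj. destruct (Hn0 j Hj) as [Hn0a Hn0b].
  eapply Rle_trans; [|apply (core_weight r hr (n0 j)); auto; lia].
  assert (Hnb : b2 j hr = false).
  { destruct (b2 j hr) eqn:Hx; [|pos].
   assert (existsb (fun j => b2 j hr) (seq 0 n) = true); [|pos].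
   apply existsb_exists. exists j. pos. }
  apply Rltb_false in Hnb. pos. }
 assert (Hchain : E (m * (n * wd)) hr (fun h => b2R (chain_fail r wd D g h n)) <= n * (2 * f)).
 { apply (chain_prob r wd D Hr g n f (cc (m * (2 * r)))); auto.
  - apply cc_mono. nia.
  - pos.
  - unfold w in Hg0. simpl in Hg0. lra. }
 apply Rle_trans with (E (m * (3 * r)) hr (fun h => b2R (chain_fail r wd D g h n) +
  b2R (negb (chain_fail r wd D g h n) && existsb (fun u => Rleb L (INR (degree (firstn (m * (2 * r)) h) u) + delta)
          && negb (joined h (2 * r) (2 * r) u (chain r wd D h n))) (seq 1 (2 * r))))).
 { apply E_le; [assumption|]. intros. apply b2R_orb_le'. }
 rewrite E_plus. apply Rplus_le_compat.
 - replace (m * (3 * r))%nat with (m * (n * wd) + (m * (3 * r) - m * (n * wd)))%nat by nia.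
  rewrite E_add. eapply Rle_trans; [|exact Hchain]. apply E_le; [assumption|]. intros l Hvl Hnl.
  apply E_le_const; [assumption|]. intros l' Hvl' _. rewrite chain_fail_stable; [lra|assumption|].
  rewrite length_app. nia.
 - replace (m * (3 * r))%nat with (m * r + m * (2 * r))%nat by lia. rewrite E_add.
  apply E_le_const; [assumption|]. intros l Hvl Hnl. set (h2 := hr ++ l) in *.
  assert (Hlh2 : length h2 = (m * (2 * r))%nat) by (unfold h2; rewrite length_app; lia).
  destruct (chain_fail r wd D g h2 n) eqn:Hcf.
  { apply Rle_trans with 0; [|pos].
   apply E_le_const; [assumption|]. intros l' Hvl' _. rewrite chain_fail_stable, Hcf; [pos|assumption|nia]. }
  set (Us := filter (fun u => Rleb L (INR (degree h2 u) + delta)) (seq 1 (2 * r))).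
  apply Rle_trans with (E (m * (2 * r)) h2 (fun h => sumL (fun u =>
    b2R (negb (joined h (2 * r) (2 * r) u (chain r wd D h2 n)))) Us)).
  + apply E_le; [assumption|]. intros l' Hvl' _. rewrite chain_fail_stable, Hcf by (assumption || nia).
   unfold Us. rewrite sumL_filter.
   eapply Rle_trans; [apply b2R_existsb_le|]. apply sumL_le. intros u _.
   rewrite firstn_app_le by lia. rewrite <- Hlh2, firstn_all.
   rewrite chain_stable by (assumption || nia).
   destruct (Rleb L (INR (degree h2 u) + delta)); simpl; lra.
  + rewrite E_sumL. apply Rle_trans with (sumL (fun _ => fL) Us).
   * apply sumL_le. intros u Hu. apply filter_In in Hu as [Hu1 Hu2].
    apply in_seq in Hu1. apply Rleb_true in Hu2.
    eapply Rle_trans; [|exact HfL].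
    apply (not_joined_prob h2 (2 * r) (2 * r) u (chain r wd D h2 n) L (g n) (cc (m * (4 * r)))); auto.
    -- lia.
    -- apply chain_NoDup.
    -- intros x Hx. apply chain_In in Hx; pos.
    -- pos.
    -- assert (Hw : g n <= w hr (chain r wd D h2 n)).
      { destruct (Rle_dec (g n) (w hr (chain r wd D h2 n))); [assumption|].
       assert (chain_fail r wd D g h2 n = true); [|pos].
       apply existsb_exists. exists n. split; [pos|].
       unfold h2 at 1. rewrite firstn_app_le, <- Hl, firstn_all by lia.
       apply Rltb_true. lra. }
      eapply Rle_trans; [exact Hw|]. apply w_app_le.
    -- apply cc_mono. lia.
   * rewrite sumL_const, Rmult_comm. apply Rmult_le_compat_r; [assumption|].
    apply le_INR. unfold Us. rewrite filter_length_le, length_seq. lia.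
Qed.

Lemma scale_good_weight r n wd D g L h : (1 <= r)%nat -> valid h -> (m * r <= length h)%nat ->
 scale_bad r n wd D g L h = false -> g n <= w (firstn (m * r) h) (chain r wd D h n).
Proof.
 intros Hr Hv Hl Hb. apply orb_false_iff in Hb as [Hb _].
 destruct (Rle_dec (g n) (w (firstn (m * r) h) (chain r wd D h n))); [assumption|].
 assert (chain_fail r wd D g h n = true); [|pos].
 apply existsb_exists. exists n. split; [pos|]. apply Rltb_true. lra.
Qed.

Lemma scale_good_joined r n wd D g L h u : (1 <= u <= 2 * r)%nat ->
 scale_bad r n wd D g L h = false -> L <= INR (degree (firstn (m * (2 * r)) h) u) + delta ->
 near h (2 * n + 2) u 1.
Proof.
 intros Hu Hb HL. apply orb_false_iff in Hb as [_ Hb].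
 assert (Hj : joined h (2 * r) (2 * r) u (chain r wd D h n) = true).
 { destruct (joined h (2 * r) (2 * r) u (chain r wd D h n)) eqn:Hj; [pos|].
  match type of Hb with existsb ?p ?l = false => assert (existsb p l = true); [|pos] end.
  apply existsb_exists. exists u. split; [pos|]. rewrite Hj.
  apply andb_true_iff. split; [apply Rleb_true; assumption|pos]. }
 apply joined_near in Hj as (x & Hx & Hn). replace (2 * n + 2)%nat with (2 + 2 * n)%nat by lia.
 apply near_trans with x; [assumption|]. eapply chain_near; eassumption.
Qed.

End Scale.

(** * Asymptotics *)

(** In the applications the variable is [x = ln t], so [ln x] is the iterated logarithm of the
    theorem. *)
Definition ev (Q : R -> Prop) : Prop := exists x0, forall x, x0 <= x -> Q x.

Lemma ev_and Q1 Q2 : ev Q1 -> ev Q2 -> ev (fun x => Q1 x /\ Q2 x).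
Proof.
 intros (a & Ha) (b & Hb). exists (Rmax a b).
 pose proof (Rmax_l a b). pose proof (Rmax_r a b). split; [apply Ha|apply Hb]; lra.
Qed.

Lemma ev_mono (Q1 Q2 : R -> Prop) : (forall x, Q1 x -> Q2 x) -> ev Q1 -> ev Q2.
Proof. intros H (a & Ha). exists a. auto. Qed.

Lemma ev_ge c : ev (fun x => c <= x).
Proof. exists c. auto. Qed.

Lemma ev_comp_ln Q : ev Q -> ev (fun x => Q (ln x)).
Proof.
 intros (a & Ha). exists (exp a). intros x Hx. apply Ha.
 rewrite <- (ln_exp a). pos.
Qed.

Lemma ln_div x y : 0 < x -> 0 < y -> ln (x / y) = ln x - ln y.
Proof. intros. unfold Rdiv. rewrite ln_mult, ln_Rinv by pos. ring. Qed.

Lemma exp_pow_nat x n : exp x ^ n = exp (n * x).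
Proof.
 induction n; [simpl; rewrite Rmult_0_l, exp_0; reflexivity|].
 rewrite S_INR. simpl pow. rewrite IHn, <- exp_plus. f_equal. ring.
Qed.

Lemma ev_pow_exp (p : nat) a C : 0 < a -> ev (fun y => C * y ^ p <= exp (a * y)).
Proof.
 intros Ha.
 set (q := INR (S p)). assert (Hq : 0 < q) by (apply lt_0_INR; lia).
 set (K := (a / q) ^ (S p)).
 assert (HK : 0 < K) by (apply pow_lt, Rdiv_lt_0_compat; assumption).
 exists (Rmax 0 (C / K)). intros y Hy.
 pose proof (Rmax_l 0 (C / K)). pose proof (Rmax_r 0 (C / K)).
 apply Rle_trans with (K * y ^ S p).
 - simpl pow at 2. rewrite <- Rmult_assoc. apply Rmult_le_compat_r; [pos|].
  assert (C / K * K <= y * K) by pos.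
  unfold Rdiv in H1. rewrite Rmult_assoc, Rinv_l in H1 by lra. lra.
 - unfold K. rewrite <- Rpow_mult_distr.
  replace (exp (a * y)) with (exp (a / q * y) ^ S p).
  + apply pow_incr. split.
   * pos.
   * pose proof (exp_ge1 (a / q * y)). lra.
  + rewrite exp_pow_nat. f_equal. fold q. pos.
Qed.

Lemma ev_ge_exp a C : 0 < a -> ev (fun y => C <= exp (a * y)).
Proof.
 intros. generalize (ev_pow_exp 0 a C H). apply ev_mono. pos.
Qed.

Lemma ev_lin_exp a C : 0 < a -> ev (fun y => C * y <= exp (a * y)).
Proof.
 intros. generalize (ev_pow_exp 1 a C H). apply ev_mono. pos.
Qed.

Lemma ev_ln_lin C : ev (fun x => C * ln x <= x).
Proof.
 generalize (ev_and _ _ (ev_comp_ln _ (ev_lin_exp 1 C ltac:(lra))) (ev_ge 1)). apply ev_mono.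
 intros x [H1 H2]. rewrite Rmult_1_l, exp_ln in H1 by lra. pos.
Qed.

Lemma ev_ln_ge c : ev (fun x => c <= ln x).
Proof. apply ev_comp_ln, ev_ge. Qed.

Definition nfloor (y : R) : nat := Z.to_nat (Int_part y).

Lemma nfloor_spec y : 0 <= y -> INR (nfloor y) <= y < INR (nfloor y) + 1.
Proof.
 intros Hy. unfold nfloor. destruct (base_Int_part y) as [H1 H2].
 assert ((0 <= Int_part y)%Z).
 { assert (-1 < Int_part y)%Z; [|lia]. apply lt_IZR. lra. }
 rewrite INR_IZR_INZ, Z2Nat.id by assumption. lra.
Qed.

Definition nceil (y : R) : nat := S (nfloor y).

Lemma nceil_spec y : 0 <= y -> y <= INR (nceil y) <= y + 1.
Proof. intros Hy. unfold nceil. rewrite S_INR. pose proof (nfloor_spec y Hy). lra. Qed.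

(** * Degree thresholds and weights at one scale *)

Section ScaleAsymptotics.
Context {P : PAmodel}.

Definition kappa : R := 1 + chi.

Lemma kappa_range : 0 < kappa < 1.
Proof. unfold kappa. pose proof chi_range. lra. Qed.

Lemma kappa_gam : kappa * gam = 1 - gam.
Proof. unfold kappa. pose proof gam_inv. nra. Qed.

Definition thr (a' : R) (r : nat) (j : nat) : R := exp (a' ^ j * ln (INR r) / 2).

(** Level [S j'] is held to [r * d^(-kappa)] for the threshold [d = thr a' r j'], with [e1] and
    [/ 16] as slack. Level 0 is vertex 1 alone, of degree about [r^gam]; the exponent
    [(gam + 1/2) / 2] lies between [1/2] and [gam], so its lower tail is small while [thr 0 * gw 0]
    still exceeds [r] by a power. *)
Definition gw (e1 a' : R) (r : nat) (j : nat) : R :=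
 match j with
 | O => exp ((gam + 1/2) / 2 * ln (INR r))
 | S j' => / 16 * exp (ln (INR r) - (1 + e1) * kappa * (a' ^ j' * ln (INR r) / 2))
 end.

Lemma pow_a_le1 a' j : 0 < a' < 1 -> 0 < a' ^ j <= 1.
Proof.
 split; [pos|]. rewrite <- (pow1 j). pos.
Qed.

Lemma pow_a_mono a' i j : 0 < a' < 1 -> (i <= j)%nat -> a' ^ j <= a' ^ i.
Proof.
 intros Ha Hij. replace j with (i + (j - i))%nat by lia. rewrite pow_add.
 pose proof (pow_a_le1 a' i Ha). pose proof (pow_a_le1 a' (j - i) Ha). nra.
Qed.

(** The last level [k] is the one whose threshold is about [x^s0]. The weight found there is [r] up
    to a power [2 * s0] of [x], hence a vertex of degree [x^2] misses it with probability at most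
    [exp (- 3 * x)], small enough for a union bound over all vertices. *)
Lemma scale_event kap e1 a' s0 rho :
 0 < kap ->
 (forall n0 r, (2 <= n0 <= r)%nat ->
   E (m * r) [] (fun h => b2R (Rltb (w h (seq 1 n0))
   (n0 * (2 * m + delta) / 4 * Rpower (r / n0) gam))) <= exp (- (kap * n0))) ->
 0 < e1 < 1/2 -> e1 < 2 * gam - 1 -> a' = (1 + e1) * kappa / (1 - e1) -> a' < 1 ->
 0 < s0 <= 1/8 -> 0 < rho < 1 ->
 ev (fun x => forall r k, (1 <= r)%nat -> rho * x <= ln r <= x ->
   a' * s0 * ln x <= a' ^ k * x / 2 <= s0 * ln x ->
   k <= ln x / (- ln a') + 1 ->
   E (m * (4 * r)) [] (fun h => b2R (scale_bad r (S k) (r / S k) (thr a' r) (gw e1 a' r) (x ^ 2) h))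
    <= exp (- (3 * ln x))
   /\ r * exp (- (2 * s0 * ln x)) / 16 <= gw e1 a' r (S k)).
Proof.
 intros Hkap Hgrp He1 He1g Ha' Ha1 Hs0 Hrho.
 pose proof gam_range as Hgam. pose proof kappa_range as Hkp. pose proof INRm_ge2 as Hm2.
 pose proof md_pos as Hmd. pose proof Hd2 as Hd2'. pose proof kappa_gam as Hkg.
 assert (Ha0 : 0 < a') by (rewrite Ha'; apply Rdiv_lt_0_compat; nra).
 assert (Hak : (1 + e1) * kappa = a' * (1 - e1)) by (rewrite Ha'; field; lra).
 assert (Hlna : 0 < - ln a') by (assert (ln a' < ln 1) by (apply ln_increasing; lra); rewrite ln_1 in H; lra).
 (* Thresholds are at most [r^(1/2)], so all the indices [y j] below are at least [r^c]; [c > 0]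
    amounts to [e1 < 2 * gam - 1]. *)
 set (c := 1 - (1 + e1) / (2 * gam)).
 assert (Hc : 0 < c).
 { unfold c. assert ((1 + e1) / (2 * gam) < 1); [|lra].
  apply Rmult_lt_reg_r with (2 * gam); [lra|]. unfold Rdiv. rewrite Rmult_assoc, Rinv_l by lra. lra. }
 set (K := 4 * INR m + 1).
 set (C1 := / (- ln a') + 3).
 assert (HC1 : 0 < C1) by (unfold C1; pose proof (Rinv_0_lt_compat _ Hlna); lra).
 set (s1 := e1 * rho * a' * s0).
 assert (Hs1 : 0 < s1) by (unfold s1; repeat apply Rmult_lt_0_compat; lra).
 set (c2 := rho * ((gam - 1/2) / 2)). assert (Hc2 : 0 < c2) by (unfold c2; apply Rmult_lt_0_compat; lra).
 assert (Hev : ev (fun x =>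
   (8 <= x /\ 2 <= ln x) /\
   ln 4 <= s1 * ln x /\
   4 <= exp (c * rho * x) /\
   4 * C1 * ln x <= exp (rho * x) /\
   (6 * 64 * C1 * K ^ 2) * (ln x) ^ 2 <= exp (s1 * ln x) /\
   (6 * 64 * C1 * K ^ 2) * (ln x) ^ 2 <= exp (c2 * x) /\
   (96 * 16 * K ^ 2) <= exp ((1 - 2 * s0) * ln x) /\
   (5 * ln x + ln 8 <= c2 * x) /\
   10 * ln x <= kap / 2 * exp (c * rho * x) /\
   C1 * ln x <= exp (1 * ln x) / 8)).
 { repeat apply ev_and.
  - apply ev_ge.
  - apply ev_ln_ge.
  - apply (ev_comp_ln (fun y => ln 4 <= s1 * y)). exists (ln 4 / s1). intros y Hy.
   assert (ln 4 / s1 * s1 <= y * s1) by pos.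
   unfold Rdiv in H. rewrite Rmult_assoc, Rinv_l in H by lra. lra.
  - apply ev_ge_exp. pos.
  - generalize (ev_and _ _ (ev_ln_lin 1) (ev_and _ _ (ev_lin_exp rho (4 * C1) ltac:(lra)) (ev_ge 0))).
   apply ev_mono. intros x (H1 & H2 & H3). assert (4 * C1 * ln x <= 4 * C1 * x) by pos. lra.
  - apply (ev_comp_ln (fun y => 6 * 64 * C1 * K ^ 2 * y ^ 2 <= exp (s1 * y))). apply ev_pow_exp. assumption.
  - generalize (ev_and _ _ (ev_ln_lin 1) (ev_and _ _ (ev_pow_exp 2 c2 (6 * 64 * C1 * K ^ 2) Hc2) (ev_ln_ge 0))).
   apply ev_mono. intros x (H1 & H2 & H3). eapply Rle_trans; [|exact H2].
   apply Rmult_le_compat_l; [|pos]. apply Rmult_le_pos; [lra|]. apply pow2_ge_0.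
  - apply (ev_comp_ln (fun y => 96 * 16 * K ^ 2 <= exp ((1 - 2 * s0) * y))). apply ev_ge_exp. lra.
  - generalize (ev_and _ _ (ev_ln_lin (10 / c2)) (ev_ge (2 * ln 8 / c2))). apply ev_mono. intros x (H1 & H2).
   assert (c2 * (10 / c2 * ln x) <= c2 * x) by pos.
   assert (c2 * (2 * ln 8 / c2) <= c2 * x) by pos.
   replace (c2 * (10 / c2 * ln x)) with (10 * ln x) in H by pos.
   replace (c2 * (2 * ln 8 / c2)) with (2 * ln 8) in H0 by pos. lra.
  - generalize (ev_and _ _ (ev_ln_lin 1) (ev_lin_exp (c * rho) (20 / kap) ltac:(apply Rmult_lt_0_compat; lra))).
   apply ev_mono. intros x (H1 & H2).
   assert (kap / 2 * (20 / kap * x) <= kap / 2 * exp (c * rho * x)) by pos.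
   replace (kap / 2 * (20 / kap * x)) with (10 * x) in H by pos. lra.
  - apply (ev_comp_ln (fun y => C1 * y <= exp (1 * y) / 8)).
   generalize (ev_lin_exp 1 (8 * C1) ltac:(lra)). apply ev_mono. pos. }
 revert Hev. apply ev_mono.
 intros x ((Hx8 & Hl2) & Hq1 & Hq2 & Hq3 & Hq4 & Hq5 & Hq6 & Hq7 & Hq8 & Hq9) r k Hr HR Hk1 Hk2.
 set (Rr := ln (INR r)) in *. set (l := ln x) in *.
 assert (Hx0 : 0 < x) by lra.
 assert (Hxl : x = exp l) by (unfold l; rewrite exp_ln; lra).
 assert (HrR : INR r = exp Rr) by (unfold Rr; rewrite exp_ln; pos).
 assert (HRpos : 0 < Rr) by nra.
 set (n := S k).
 assert (HnC : n <= C1 * l).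
 { unfold n. rewrite S_INR. unfold C1.
  lra. }
 assert (Hn1 : 1 <= n) by pos.
 set (d := fun j => a' ^ j * Rr / 2).
 assert (Hd_low : forall j, (j <= k)%nat -> rho * a' * s0 * l <= d j).
 { intros j Hj. pose proof (pow_a_mono a' j k ltac:(lra) Hj). pose proof (pow_a_le1 a' k ltac:(lra)).
  apply Rle_trans with (a' ^ k * Rr / 2); [nra|]. apply Rmult_le_compat_r; [lra|]. pos. }
 assert (Hd_half : forall j, 0 <= d j <= Rr / 2).
 { intros j. unfold d. pose proof (pow_a_le1 a' j ltac:(lra)). split; nra. }
 assert (Hd_top : d k <= s0 * l).
 { apply Rle_trans with (a' ^ k * x / 2); [|lra].
  apply Rmult_le_compat_r; [lra|]. pos. }
 (* Solution of [(r / y)^gam = d^(1 + e1)] for the threshold [d]: the [y j] oldest vertices have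
    mean weight of that order at time [r], and the surplus [d^e1] makes those below the threshold
    negligible. *)
 set (y := fun j => exp (Rr - (1 + e1) / gam * d j)).
 set (n0 := fun j => nfloor (y j)).
 assert (Hy : forall j, exp (c * rho * x) <= y j <= r).
 { intros j. destruct (Hd_half j) as [Hd0 Hdh]. split.
  - apply exp_mono.
   assert ((1 + e1) / gam * d j <= (1 + e1) / gam * (Rr / 2)) by pos.
   replace (Rr - (1 + e1) / gam * d j) with (c * Rr + ((1 + e1) / gam * (Rr / 2) - (1 + e1) / gam * d j))
    by (unfold c; field; lra).
   assert (c * (rho * x) <= c * Rr) by pos. lra.
  - rewrite HrR. apply exp_mono.
   assert (0 <= (1 + e1) / gam * d j) by pos. lra. }
 assert (Hn0 : forall j, y j / 2 <= INR (n0 j) <= y j /\ 2 <= INR (n0 j)).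
 { intros j. destruct (Hy j) as [Hy1 Hy2]. pose proof (nfloor_spec (y j) ltac:(lra)) as Hf. fold (n0 j) in Hf.
  pos. }
 assert (HKpos : 0 < K) by (unfold K; lra).
 assert (Hcc2 : cc (m * (2 * r)) <= K * r).
 { rewrite cc_vertices, mult_INR. simpl (INR 2). unfold K. pose proof chi_range.
  assert (1 <= r) by pos. nra. }
 assert (Hcc4 : cc (m * (4 * r)) <= 2 * K * r).
 { rewrite cc_vertices, mult_INR. simpl (INR 4). unfold K. pose proof chi_range.
  assert (1 <= r) by pos. nra. }
 assert (Hrn : 4 * n <= r).
 { rewrite HrR. apply Rle_trans with (exp (rho * x)); [|pos]. lra. }
 set (wd := (r / n)%nat).
 assert (Hwd : r / (2 * n) <= wd).
 {
  pose proof (Nat.div_mod r n ltac:(unfold n; lia)). pose proof (Nat.mod_upper_bound r n ltac:(unfold n; lia)).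
  assert (r <= n * wd + n).
  { rewrite <- mult_INR, <- plus_INR. pos. }
  pos. }
 assert (HKn : forall X j, 0 <= X -> 0 <= thr a' r j * gw e1 a' r j -> X * (2 * n * K ^ 2 * r) <= thr a' r j * gw e1 a' r j ->
   X <= wd * thr a' r j * gw e1 a' r j / cc (m * (2 * r)) ^ 2).
 { intros X j HX HTG H.
  set (TG := thr a' r j * gw e1 a' r j) in *. rewrite Rmult_assoc.
  apply Rle_div_swap; [pos|].
  apply Rle_trans with (X * (K * r) ^ 2).
  - pos.
  - apply Rle_trans with (r / (2 * n) * TG); [|pos].
   replace (X * (K * r) ^ 2) with (X * (2 * n * K ^ 2 * r) * (r / (2 * n))) by pos.
   rewrite (Rmult_comm (r / (2 * n)) TG).
   pos. }
 assert (Hgpos : forall j, 0 < gw e1 a' r j).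
 { intros [|j]; simpl; [pos|]. pos. }
 assert (HTpos : forall j, 0 < thr a' r j) by (intros; apply exp_pos).
 assert (HnK : forall Y, 6 * 64 * C1 * K ^ 2 * l ^ 2 <= Y -> 6 * l * (64 * n * K ^ 2) <= Y).
 { intros Y HY. eapply Rle_trans; [|exact HY].
  replace (6 * 64 * C1 * K ^ 2 * l ^ 2) with (6 * l * 64 * K ^ 2 * (C1 * l)) by ring.
  replace (6 * l * (64 * n * K ^ 2)) with (6 * l * 64 * K ^ 2 * n) by ring.
  pos. }
 assert (HK2 : 0 < K ^ 2) by pos.
 assert (Hexpo : forall j, (j < n)%nat -> 6 * l <= wd * thr a' r j * gw e1 a' r j / cc (m * (2 * r)) ^ 2).
 { intros j Hj. apply HKn; [lra|pos|].
  destruct j as [|j].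
  - unfold thr, gw. fold Rr. rewrite <- exp_plus.
   apply Rle_trans with (exp (c2 * x) * r).
   + specialize (HnK _ Hq5).
    replace (6 * l * (2 * n * K ^ 2 * r)) with (6 * l * (64 * n * K ^ 2) / 32 * r) by field.
    apply Rmult_le_compat_r; [lra|]. assert (0 <= 6 * l * (64 * n * K ^ 2)) by pos. lra.
   + rewrite HrR, <- exp_plus. apply exp_mono. unfold c2.
    assert (rho * x * ((gam - 1/2) / 2) <= Rr * ((gam - 1/2) / 2)) by pos.
    lra.
  (* The definition of [a'] serves this product: since [(1 + e1) * kappa = a' * (1 - e1)], threshold
     times weight is [r / 16] times the surplus [exp (e1 * d (S j))]. *)
  - assert (Hdj : d (S j) = a' * d j) by (unfold d; simpl; field).
   assert (Heq : thr a' r (S j) * gw e1 a' r (S j) = / 16 * (r * exp (e1 * d (S j)))).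
   { unfold thr, gw. fold Rr. fold (d j).
    rewrite HrR, <- exp_plus. rewrite (Rmult_comm (exp (d (S j)))), Rmult_assoc, <- exp_plus. f_equal. f_equal.
    rewrite Hak, Hdj. ring. }
   rewrite Heq.
   assert (exp (s1 * l) <= exp (e1 * d (S j))).
   { unfold s1. specialize (Hd_low (S j) ltac:(unfold n in Hj; lia)).
    replace (e1 * rho * a' * s0 * l) with (e1 * (rho * a' * s0 * l)) by ring. pos. }
   apply Rle_trans with (/ 16 * (r * exp (s1 * l))).
   + assert (6 * l * (64 * n * K ^ 2) * r <= exp (s1 * l) * r) by pos.
    assert (0 <= 6 * l * (2 * n * K ^ 2 * r)) by pos.
    lra.
   + pos. }
 assert (Hgn : r * exp (- (2 * s0 * l)) / 16 <= gw e1 a' r n).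
 { unfold n, gw. fold Rr. fold (d k). rewrite HrR, <- exp_plus.
  assert (exp (Rr + - (2 * s0 * l)) <= exp (Rr - (1 + e1) * kappa * d k)); [|lra].
  apply exp_mono. destruct (Hd_half k) as [Hdk0 _].
  assert ((1 + e1) * kappa * d k <= 2 * (s0 * l)); [|lra].
  apply Rle_trans with (2 * d k); [|lra]. apply Rmult_le_compat_r; [assumption|].
  apply Rle_trans with (2 * 1); [|lra]. pos. }
 split; [|pos].
 set (fL := exp (- (3 * x))).
 eapply Rle_trans; [apply (scale_prob kap r n wd (thr a' r) (gw e1 a' r) (exp (- (6 * l))) (x ^ 2) fL n0)|].
 - pos.
 - pos.
 - apply Nat.Div0.mul_div_le.
 - pos.
 - pos.
 - intros j Hj. destruct (Hn0 j) as ((Hn0a & Hn0b) & Hn0c). destruct (Hy j) as [_ Hyr].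
  split.
  { split; apply INR_le; pos. }
  unfold gw. unfold thr. fold Rr. fold (d j).
  set (N := INR (n0 j)) in *. assert (HN : 0 < N) by lra.
  assert (HyN : ln N <= Rr - (1 + e1) / gam * d j).
  { rewrite <- (ln_exp (Rr - (1 + e1) / gam * d j)). pos. }
  assert (Rr - (1 + e1) / gam * d j - ln 2 <= ln N).
  { rewrite <- (ln_exp (Rr - (1 + e1) / gam * d j)). rewrite <- ln_div by pos.
   pos. }
  assert (Hpw : Rpower (r / N) gam = exp (gam * (Rr - ln N))).
  { unfold Rpower. rewrite ln_div by lra. pos. }
  rewrite Hpw. set (A := exp (gam * (Rr - ln N))).
  assert (4 * exp (d j) <= A).
  { replace 4 with (exp (ln 4)) by (apply exp_ln; lra). rewrite <- exp_plus. apply exp_mono.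
   assert (Hg1 : gam * ((1 + e1) / gam * d j) <= gam * (Rr - ln N)) by pos.
   replace (gam * ((1 + e1) / gam * d j)) with (d j + e1 * d j) in Hg1 by pos.
   specialize (Hd_low j ltac:(unfold n in Hj; lia)).
   assert (s1 * l <= e1 * d j).
   { unfold s1. replace (e1 * rho * a' * s0 * l) with (e1 * (rho * a' * s0 * l)) by ring. pos. }
   lra. }
  assert (/ 2 * exp (Rr - (1 + e1) * kappa * d j) <= N * A).
  { unfold A. rewrite <- (exp_ln N) at 1 by assumption. rewrite <- exp_plus.
   replace (/ 2) with (exp (- ln 2)) by (rewrite exp_Ropp, exp_ln; lra). rewrite <- exp_plus. apply exp_mono.
   assert (H1 : (1 - gam) * (Rr - (1 + e1) / gam * d j - ln 2) <= (1 - gam) * ln N) by pos.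
   replace ((1 - gam) * (Rr - (1 + e1) / gam * d j - ln 2)) with
    ((1 - gam) * Rr - (1 + e1) * kappa * d j - (1 - gam) * ln 2) in H1.
   - assert (0 <= gam * ln 2) by pos. lra.
   - rewrite <- Hkg. pos. }
  assert (0 < A) by apply exp_pos.
  assert (N * (4 * exp (d j)) <= N * A) by pos.
  assert (N * 2 / 4 * A <= N * (2 * m + delta) / 4 * A) by pos.
  lra.
 - intros j Hj. apply exp_mono. specialize (Hexpo j Hj). lra.
 - pos.
 - pos.
 - apply exp_mono. apply Ropp_le_contravar.
  apply Rle_div_swap; [pos|].
  apply Rle_trans with (3 * x * (2 * K * r) ^ 2).
  + pos.
  + rewrite mult_INR.
   apply Rle_trans with ((1 + 1) * r * x ^ 2 * (r * exp (- (2 * s0 * l)) / 16)).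
   * assert (Hx1 : x * exp (- (2 * s0 * l)) = exp ((1 - 2 * s0) * l)).
    { rewrite Hxl at 1. rewrite <- exp_plus. f_equal. ring. }
    replace ((1 + 1) * r * x ^ 2 * (r * exp (- (2 * s0 * l)) / 16)) with
     (x * r ^ 2 * (x * exp (- (2 * s0 * l))) / 8) by field.
    rewrite Hx1.
    replace (3 * x * (2 * K * r) ^ 2) with (x * r ^ 2 * (12 * K ^ 2)) by ring.
    replace (x * r ^ 2 * exp ((1 - 2 * s0) * l) / 8) with (x * r ^ 2 * (exp ((1 - 2 * s0) * l) / 8)) by field.
    pos.
   * pos.
 -
  assert (exp (- (3 * l)) = exp (- (4 * l)) * x).
  { rewrite Hxl, <- exp_plus. f_equal. ring. }
  assert (2 * gw e1 a' r 0 * Rpower r (- gam) <= exp (- (3 * l)) / 4).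
  { unfold gw, Rpower. fold Rr. rewrite Rmult_assoc, <- exp_plus.
   apply Rle_trans with (2 * exp (- (3 * l) - ln 8)).
   - apply Rmult_le_compat_l; [lra|]. apply exp_mono.
    assert (rho * x * ((gam - 1/2) / 2) <= Rr * ((gam - 1/2) / 2)) by pos.
    unfold c2 in Hq7. lra.
   - unfold Rminus. rewrite exp_plus, exp_Ropp, exp_Ropp, exp_ln by lra. lra. }
  assert (sumL (fun j => exp (- (kap * INR (n0 j)))) (seq 0 n) <= exp (- (3 * l)) / 4).
  { apply Rle_trans with (sumL (fun _ : nat => exp (- (10 * l))) (seq 0 n)).
   - apply sumL_le. intros j _. apply exp_mono. apply Ropp_le_contravar.
    destruct (Hn0 j) as ((Hn0a & _) & _). destruct (Hy j) as [Hyj _].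
    apply Rle_trans with (kap * (y j / 2)); [|pos].
    apply Rle_trans with (kap / 2 * exp (c * rho * x)); [lra|].
    replace (kap * (y j / 2)) with (kap / 2 * y j) by field. pos.
   - rewrite sumL_const, length_seq.
    apply Rle_trans with (exp (- (4 * l)) * (x / 8)).
    + apply Rmult_le_compat; try (left; apply exp_pos); [lra|pos|].
     rewrite Rmult_1_l in Hq9. lra.
    + pose proof (Rmult_lt_0_compat _ _ (exp_pos (- (4 * l))) Hx0). lra. }
  assert (n * (2 * exp (- (6 * l))) <= exp (- (3 * l)) / 4).
  { apply Rle_trans with (x / 8 * (2 * exp (- (4 * l)))).
   - rewrite Rmult_1_l in Hq9.
    pos.
   - lra. }
  assert (INR (2 * r) * fL <= exp (- (3 * l)) / 4).
  { rewrite mult_INR. unfold fL. rewrite HrR.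
   apply Rle_trans with (2 * exp (- (3 * l) - ln 8)).
   - rewrite Rmult_assoc, <- exp_plus.
    apply Rmult_le_compat_l; [lra|]. apply exp_mono.
    assert (c2 * x <= x). { rewrite <- (Rmult_1_l x) at 2. apply Rmult_le_compat_r; [lra|].
     apply Rle_trans with (1 * 1); [|lra]. apply Rmult_le_compat; lra. }
    lra.
   - unfold Rminus. rewrite exp_plus, exp_Ropp, exp_Ropp, exp_ln by lra. lra. }
  lra.
Qed.

End ScaleAsymptotics.

(** * Good vertices at all times *)

Section AllScales.
Context {P : PAmodel}.

Definition good (t Q : nat) (h : history) (u : nat) : bool := reach h t Q u 1.

(** The two inputs of the recursion on bad vertices: a lower bound on the good weight to start it,
    and a degree bound that later converts numbers of vertices into weights. *)
Definition good_time (t Q : nat) (eta L : R) (h : history) (s : nat) : bool :=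
 let hs := firstn (m * s) h in
 Rleb (eta * INR s) (w hs (filter (good t Q hs) (seq 1 s))) &&
 forallb (fun u => good t Q hs u || Rleb (INR (degree hs u)) L) (seq 1 s).

(** The maximum with [u] lets a vertex born after [s0] be observed from its completion on. *)
Definition degree_jump (s0 s u : nat) (L : R) (h : history) : bool :=
 Rleb (INR (degree (firstn (m * Nat.max s0 u) h) u)) L
 && Rleb (1024 * L) (INR (degree (firstn (m * s) h) u)).

Lemma E_firstn t s f : (s <= t)%nat -> E (m * t) [] (fun h => f (firstn (m * s) h)) = E (m * s) [] f.
Proof.
 intros Hs. replace (m * t)%nat with (m * s + (m * t - m * s))%nat by nia.
 rewrite <- (E_prefix (m * s) (m * t - m * s) [] f) by constructor. pos.
Qed.

(** Time grows by a factor of at most 4 between the two observations, so the mean growth is at most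
    8, within the range of [degree_growth_tail]. *)
Lemma degree_jump_prob t s0 s u L : (1 <= s0)%nat -> (1 <= u <= s)%nat -> (s0 <= s <= t)%nat -> (s <= 4 * s0)%nat ->
 E (m * t) [] (fun h => b2R (degree_jump s0 s u L h)) <= exp (- L).
Proof.
 intros Hs0 Hu Hs Hs4. set (s1 := Nat.max s0 u).
 rewrite (E_ext _ _ _ (fun h => b2R (degree_jump s0 s u L (firstn (m * s) h)))).
 2: constructor.
 2: { intros l _ _. unfold degree_jump. rewrite !firstn_firstn.
    replace (Nat.min (m * s1) (m * s)) with (m * s1)%nat by nia.
    rewrite Nat.min_id. pos. }
 eapply Rle_trans; [right; apply (E_firstn t s (fun h => b2R (degree_jump s0 s u L h))); lia|].
 replace (m * s)%nat with (m * s1 + (m * s - m * s1))%nat by nia.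
 rewrite E_add. apply E_le_const; [pos|]. intros h Hv Hl. simpl app in *.
 destruct (Rle_dec (INR (degree h u)) L) as [HL|HL].
 - eapply Rle_trans; [|apply (degree_growth_tail (m * s - m * s1) h u L Hv)].
  + apply E_le; [assumption|]. intros l Hvl Hn. unfold degree_jump.
   rewrite (firstn_all2 (n := (m * s)%nat)) by (rewrite length_app; nia).
   destruct (Rle_dec (1024 * L) (INR (degree (h ++ l) u))) as [H1|H1].
   * apply b2R_range.
   * replace (Rleb (1024 * L) (INR (degree (h ++ l) u))) with false by (symmetry; apply Rleb_false; lra).
    rewrite andb_false_r. lra.
  + lia.
  + nia.
  + assert (HP : PiV s1 s <= 2 * Rpower (s / s1) gam) by (apply PiV_upper; unfold s1; lia).
   unfold PiV in HP. rewrite <- Hl in HP at 1.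
   assert (s <= 4 * s1).
   { replace 4 with (INR 4) by (simpl; ring). rewrite <- mult_INR. pos. }
   pose proof gam_range.
   assert (Rpower (s / s1) gam <= 4); [|lra].
   eapply Rle_trans; [apply Rpower_bernoulli; pos|].
   assert (s / s1 <= 4) by pos. nra.
  + pos.
 - apply Rle_trans with 0; [|pos]. apply E_le_const; [assumption|]. intros l Hvl Hn.
  unfold degree_jump. fold s1. rewrite firstn_app_le by lia. rewrite <- Hl, firstn_all.
  replace (Rleb (INR (degree h u)) L) with false by (symmetry; apply Rleb_false; lra). pos.
Qed.

(** One scale serves all times in [[4r, 8r)]. A vertex that is not good at [s] had small degree at
    time [2r], or was born later and had degree at most [2 * m] on completion; in the absence of
    jumps its degree at [s] is small as well. *)
Lemma good_time_of_scale t h s r n wd D g L :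
 valid h -> length h = (m * t)%nat -> (1 <= r)%nat -> (4 * r <= s < 8 * r)%nat -> (s <= t)%nat ->
 scale_bad r n wd D g L (firstn (m * (4 * r)) h) = false ->
 2 * m <= L + m ->
 (forall u, (1 <= u <= s)%nat -> degree_jump (2 * r) s u (L + m) h = false) ->
 forall eta, eta * s <= g n ->
 good_time t (2 * n + 2) eta (1024 * (L + m)) h s = true.
Proof.
 intros Hv Hl Hr Hs Hst Hsb HL Hj eta Heta.
 set (h4 := firstn (m * (4 * r)) h) in *. set (hs := firstn (m * s) h).
 assert (Hpre : exists l, hs = h4 ++ l).
 { exists (skipn (m * (4 * r)) hs). unfold h4, hs.
  rewrite <- (firstn_skipn (m * (4 * r)) (firstn (m * s) h)) at 1. f_equal.
  rewrite firstn_firstn. f_equal. nia. }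
 destruct Hpre as [l Hpre].
 assert (Hvs : valid hs) by (apply valid_firstn; assumption).
 assert (Hv4 : valid h4) by (apply valid_firstn; assumption).
 assert (Hls : length hs = (m * s)%nat) by (unfold hs; rewrite length_firstn; nia).
 assert (length h4 = (m * (4 * r))%nat) by (unfold h4; rewrite length_firstn; nia).
 assert (Hgood : forall u, near h4 (2 * n + 2) u 1 -> good t (2 * n + 2) hs u = true).
 { intros u Hu. apply near_reach; [assumption|nia|]. rewrite Hpre. apply near_app. assumption. }
 apply andb_true_iff. split.
 - apply Rleb_true. fold hs. eapply Rle_trans; [exact Heta|].
  pose proof (scale_good_weight r n wd D g L h4 Hr Hv4 ltac:(nia) Hsb) as Hw.
  set (hr := firstn (m * r) h4) in *.
  assert (Hhr : hs = hr ++ skipn (m * r) hs).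
  { rewrite <- (firstn_skipn (m * r) hs) at 1. f_equal. unfold hr, h4, hs. rewrite !firstn_firstn. f_equal. nia. }
  eapply Rle_trans; [exact Hw|]. eapply Rle_trans; [apply (w_app_le hr (skipn (m * r) hs))|]. rewrite <- Hhr.
  apply sumL_incl.
  + apply chain_NoDup.
  + intros u Hu. pose proof (chain_In r wd D Hr h4 n u Hu). apply filter_In. split; [pos|].
   apply Hgood. apply near_le with (2 * n)%nat; [|lia]. eapply chain_near; eassumption.
  + intros u Hu. apply filter_In in Hu as [Hu _].
   destruct (in_seq1_completed s hs s u Hls ltac:(lia) Hu) as [H1 H2].
   pose proof (degree_completed hs u Hvs H1 H2) as Hd. apply le_INR in Hd. pose proof md_pos. lra.
 - apply forallb_forall. intros u Hu. apply in_seq in Hu. fold hs.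
  destruct (good t (2 * n + 2) hs u) eqn:Hg; [pos|]. apply Rleb_true.
  specialize (Hj u ltac:(lia)). apply andb_false_iff in Hj as [Hj|Hj].
  2: { apply Rleb_false in Hj. pos. }
  apply Rleb_false in Hj.
  destruct (Nat.le_gt_cases u (2 * r)) as [Hur|Hur].
  + replace (Nat.max (2 * r) u) with (2 * r)%nat in Hj by lia.
   assert (Hnear : near h4 (2 * n + 2) u 1).
   { apply (scale_good_joined r n wd D g L h4 u); [lia|assumption|].
    unfold h4. rewrite firstn_firstn. replace (Nat.min (m * (2 * r)) (m * (4 * r))) with (m * (2 * r))%nat by nia.
    pose proof md_pos. lra. }
   apply Hgood in Hnear. pos.
  + replace (Nat.max (2 * r) u) with u in Hj by lia.
   pose proof (degree_le (firstn (m * u) h) u (valid_firstn _ _ Hv) ltac:(lia)) as Hd.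
   rewrite length_firstn in Hd.
   assert (Hd' : (degree (firstn (m * u) h) u <= 2 * m)%nat) by nia.
   apply le_INR in Hd'. rewrite mult_INR in Hd'. simpl in Hd'. lra.
Qed.

Lemma dyadic s : (4 <= s)%nat -> exists i, (4 * 2 ^ i <= s < 8 * 2 ^ i)%nat.
Proof.
 exists (Nat.log2 s - 2)%nat.
 assert ((2 <= Nat.log2 s)%nat) by (change 2%nat with (Nat.log2 4); apply Nat.log2_le_mono; assumption).
 pose proof (Nat.log2_spec s ltac:(lia)) as [H3 H4].
 replace (Nat.log2 s) with (2 + (Nat.log2 s - 2))%nat in H3, H4 by lia.
 simpl in *. lia.
Qed.

Definition times_fail (t Q : nat) (rho eta L : R) (h : history) : bool :=
 existsb (fun s => Rleb (rho * ln (INR t)) (ln (INR s)) && negb (good_time t Q eta L h s)) (seq 1 t).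

(** Union bound: at most [3 * x] dyadic scales fail with probability [x^(-3)] each, and the degree
    jumps cost at most [t^2 * exp (- x^2)] per scale. *)
Theorem good_times_whp (e s0 rho : R) : 0 < e -> 0 < s0 <= 1/8 -> 0 < rho < 1 ->
 ev (fun x => forall t, (1 <= t)%nat -> ln (INR t) = x -> exists Q,
   INR Q <= (2 / (- ln kappa) + e) * ln x /\
   E (m * t) [] (fun h => b2R (times_fail t Q rho (exp (- (2 * s0 * ln x)) / 128)
                   (1024 * (x ^ 2 + INR m)) h)) <= / x).
Proof.
 intros He Hs0 Hrho.
 destruct group_weight_conc as (kap & Hkap & Hgrp).
 pose proof kappa_range as Hkp. pose proof gam_range as Hgam.
 assert (Hlk : 0 < - ln kappa).
 { assert (ln kappa < ln 1) by (apply ln_increasing; lra). rewrite ln_1 in H. lra. }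
 (* choose e1 so small that 1/|ln a'| is close to 1/|ln kappa| *)
 assert (Hch : exists e1 a', 0 < e1 < 1/2 /\ e1 < 2 * gam - 1 /\ a' = (1 + e1) * kappa / (1 - e1) /\ a' < 1 /\
        2 / (- ln a') <= 2 / (- ln kappa) + e / 2).
 { set (q := - ln kappa) in *.
  (* target: - ln a' >= q - d with d = q^2 e / (4 + q e) *)
  set (d := Rmin (q / 2) (q * q * e / (8 + 2 * q * e))).
  assert (Hd : 0 < d).
  { apply Rmin_glb_lt; [lra|]. apply Rdiv_lt_0_compat; [|nra].
   pos. }
  set (e1 := Rmin (Rmin (1/4) ((2 * gam - 1) / 2)) (d / 4)).
  assert (He1 : 0 < e1) by (unfold e1; repeat apply Rmin_glb_lt; lra).
  assert (He1b : e1 <= (2 * gam - 1) / 2) by (unfold e1; eapply Rle_trans; [apply Rmin_l|apply Rmin_r]).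
  assert (He1c : e1 <= d / 4) by (unfold e1; apply Rmin_r).
  assert (Hln : ln ((1 + e1) * kappa / (1 - e1)) <= - q + d).
  { rewrite ln_div, ln_mult by pos.
   pose proof (ln_le_sub1 (1 + e1) ltac:(lra)) as H1.
   pose proof (ln_le_sub1 (/ (1 - e1)) ltac:(apply Rinv_0_lt_compat; lra)) as H2.
   rewrite ln_Rinv in H2 by lra.
   assert (/ (1 - e1) <= 1 + 2 * e1).
   { apply Rmult_le_reg_r with (1 - e1); [lra|]. rewrite Rinv_l by lra. nra. }
   unfold q. lra. }
  assert (Hdq : d <= q / 2) by apply Rmin_l.
  exists e1, ((1 + e1) * kappa / (1 - e1)). split; [lra|]. split; [lra|]. split; [pos|].
  split.
  - destruct (Rlt_dec ((1 + e1) * kappa / (1 - e1)) 1) as [|Hn]; [assumption|].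
   assert (ln 1 <= ln ((1 + e1) * kappa / (1 - e1))) by pos. rewrite ln_1 in H. lra.
  - apply Rle_trans with (2 / (q - d)).
   + apply Rmult_le_compat_l; [lra|]. pos.
   + apply Rdiv_le_swap; [lra|].
    assert (d <= q * q * e / (8 + 2 * q * e)) by apply Rmin_r.
    assert (0 < q * e) by pos.
    assert (d * (8 + 2 * q * e) <= q * q * e).
    { apply Rle_trans with (q * q * e / (8 + 2 * q * e) * (8 + 2 * q * e)); [pos|].
     right. pos. }
    apply Rmult_le_reg_r with q; [lra|].
    replace ((2 / q + e / 2) * (q - d) * q) with ((2 + q * e / 2) * (q - d)) by pos.
    nra. }
 destruct Hch as (e1 & a' & He1 & He1g & Ha' & Ha1 & Hae).
 assert (Ha0 : 0 < a') by (rewrite Ha'; apply Rdiv_lt_0_compat; nra).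
 assert (Hlna : 0 < - ln a') by (assert (ln a' < ln 1) by (apply ln_increasing; lra); rewrite ln_1 in H; lra).
 pose proof (scale_event kap e1 a' s0 (rho / 2) Hkap Hgrp He1 He1g Ha' Ha1 Hs0 ltac:(lra)) as Hsc.
 pose proof INRm_ge2 as Hm2.
 generalize (ev_and _ _ Hsc (ev_and _ _ (ev_ge (m + 8))
  (ev_and _ _ (ev_ln_lin (4 * s0)) (ev_and _ _ (ev_ln_ge (/ (2 * s0) + 16 / e)) (ev_and _ _ (ev_ge (2 * ln 8 / rho)) (ev_ge 8)))))).
 apply ev_mono. clear Hsc. intros x (Hsc & Hxm & Hxl & Hl1 & Hx8 & Hx8') t Ht Htx.
 set (l := ln x) in *.
 assert (Hxpos : 0 < x) by lra.
 assert (His0 : 0 < / (2 * s0)) by pos.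
 assert (Hie : 0 < 16 / e) by pos.
 assert (Hs0l : 1 <= 2 * s0 * l).
 { assert (2 * s0 * (/ (2 * s0)) <= 2 * s0 * l) by pos. rewrite Rinv_r in H by lra. lra. }
 (* Real solution of [a'^yk * x / 2 = s0 * l]. Rounding it up to [k] loses at most a factor [a'],
    which is the lower bound in [Hk1]. *)
 set (yk := ln (x / (2 * s0 * l)) / (- ln a')).
 assert (Hyk0 : 0 <= yk).
 { apply Rmult_le_pos; [|pos].
  rewrite <- ln_1. pos. }
 assert (Hyk1 : yk <= l / (- ln a')).
 { apply Rmult_le_compat_r; [pos|].
  apply ln_mono; [pos|]. apply Rdiv_le_swap; [lra|]. nra. }
 set (k := nceil yk). pose proof (nceil_spec yk Hyk0) as Hk. fold k in Hk.
 assert (Hpow : a' ^ k = exp (k * ln a')) by (rewrite <- (exp_ln a') at 1 by assumption; apply exp_pow_nat).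
 assert (Hyx : exp (yk * ln a') = 2 * s0 * l / x).
 { unfold yk. replace (ln (x / (2 * s0 * l)) / - ln a' * ln a') with (- ln (x / (2 * s0 * l))) by pos.
  rewrite exp_Ropp, exp_ln by pos. pos. }
 assert (Hk1 : a' * s0 * l <= a' ^ k * x / 2 <= s0 * l).
 { split.
  - assert (exp (yk * ln a' + ln a') <= a' ^ k) by (rewrite Hpow; apply exp_mono; nra).
   rewrite exp_plus, exp_ln in H by assumption.
   apply Rle_trans with (2 * s0 * l / x * a' * x / 2); [right; field; lra|].
   pos.
  - assert (a' ^ k <= exp (yk * ln a')) by (rewrite Hpow; apply exp_mono; nra).
   apply Rle_trans with (2 * s0 * l / x * x / 2); [|right; field; lra].
   pos. }
 assert (Hk2 : k <= l / (- ln a') + 1) by lra.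
 (* Two edges for each of the [S k] levels and two for the final join. *)
 set (Q := (2 * S k + 2)%nat). exists Q. split.
 { unfold Q. rewrite plus_INR, mult_INR, (S_INR k). simpl (INR 2).
  assert (8 <= e / 2 * l).
  { apply Rle_trans with (e / 2 * (16 / e)); [right; field; lra|]. pos. }
  assert (2 / (- ln a') * l <= (2 / (- ln kappa) + e / 2) * l) by pos.
  lra. }
 set (N := S (Nat.log2 t)).
 set (sb := fun i => scale_bad (2 ^ i) (S k) (2 ^ i / S k) (thr a' (2 ^ i)) (gw e1 a' (2 ^ i)) (x ^ 2)).
 set (I := filter (fun i => Rleb (rho / 2 * x) (ln (INR (2 ^ i)))) (filter (fun i => Nat.leb (4 * 2 ^ i) t) (seq 0 N))).
 set (L2 := x ^ 2 + INR m).
 assert (HL2 : x * x <= L2) by (unfold L2; simpl; lra).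
 apply Rle_trans with (E (m * t) [] (fun h =>
   sumL (fun i => b2R (sb i (firstn (m * (4 * 2 ^ i)) h))) I
  + sumL (fun i => sumL (fun s => sumL (fun u =>
     b2R (Nat.leb (2 * 2 ^ i) s && Nat.leb s (8 * 2 ^ i) && Nat.leb u s && degree_jump (2 * 2 ^ i) s u L2 h)) (seq 1 t)) (seq 1 t)) (seq 0 N))).
 - apply E_le; [pos|]. intros h Hv Hl. simpl app in *.
  assert (Hn1 : 0 <= sumL (fun i => b2R (sb i (firstn (m * (4 * 2 ^ i)) h))) I)
   by pos.
  set (f3 := fun i s u => b2R (Nat.leb (2 * 2 ^ i) s && Nat.leb s (8 * 2 ^ i) && Nat.leb u s && degree_jump (2 * 2 ^ i) s u L2 h)).
  assert (Hn3 : forall i s u, 0 <= f3 i s u) by (intros; apply b2R_range).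
  assert (Hn2 : 0 <= sumL (fun i => sumL (fun s => sumL (fun u => f3 i s u) (seq 1 t)) (seq 1 t)) (seq 0 N)) by pos.
  destruct (times_fail t Q rho (exp (- (2 * s0 * l)) / 128) (1024 * L2) h) eqn:Hf.
  2: { apply Rle_trans with 0; [pos|]. pos. }
  change (1 <= sumL (fun i => b2R (sb i (firstn (m * (4 * 2 ^ i)) h))) I
    + sumL (fun i => sumL (fun s => sumL (fun u => f3 i s u) (seq 1 t)) (seq 1 t)) (seq 0 N)).
  apply existsb_exists in Hf as (s & Hs & Hs'). apply in_seq in Hs. apply andb_true_iff in Hs' as [Hs1 Hs2].
  apply Rleb_true in Hs1. apply negb_true_iff in Hs2. rewrite Htx in Hs1.
  assert (Hln8 : 2 * ln 8 <= rho * x).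
  { assert (rho * (2 * ln 8 / rho) <= rho * x) by pos.
   replace (rho * (2 * ln 8 / rho)) with (2 * ln 8) in H by pos. lra. }
  assert (Hs8 : (8 <= s)%nat).
  { apply INR_le. replace (INR 8) with 8 by (simpl; ring).
   assert (ln 8 <= ln s).
   { assert (0 < ln 8) by (rewrite <- ln_1; apply ln_increasing; lra). lra. }
   destruct (Rle_dec 8 s); [assumption|].
   assert (ln s < ln 8) by (apply ln_increasing; pos). lra. }
  destruct (dyadic s ltac:(lia)) as [i Hi].
  assert (Hp : (1 <= 2 ^ i)%nat) by pos.
  assert (In i (seq 0 N)).
  { apply in_seq. assert ((i <= Nat.log2 t)%nat); [|lia].
   apply Nat.log2_le_pow2; lia. }
  assert (HiI : In i I).
  { apply filter_In. split; [apply filter_In; split; [assumption|apply Nat.leb_le; lia]|].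
   apply Rleb_true.
   assert (ln s <= ln 8 + ln (INR (2 ^ i))).
   { rewrite <- ln_mult; [|lra|pos].
    replace 8 with (INR 8) by (simpl; ring). rewrite <- mult_INR. pos. }
   lra. }
  destruct (sb i (firstn (m * (4 * 2 ^ i)) h)) eqn:Hsb.
  { pose proof (sumL_In_le (fun i => b2R (sb i (firstn (m * (4 * 2 ^ i)) h))) I i ltac:(intros; apply b2R_range) HiI) as Hx.
   cbv beta in Hx. rewrite Hsb in Hx. change (b2R true) with 1 in Hx. lra. }
  destruct (existsb (fun u => degree_jump (2 * 2 ^ i) s u L2 h) (seq 1 s)) eqn:Hdj.
  { apply existsb_exists in Hdj as (u & Hu & Hju). apply in_seq in Hu.
   assert (f3 i s u = 1).
   { unfold f3. rewrite Hju. replace (Nat.leb (2 * 2 ^ i) s) with true by (symmetry; apply Nat.leb_le; lia).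
    replace (Nat.leb s (8 * 2 ^ i)) with true by (symmetry; apply Nat.leb_le; lia).
    replace (Nat.leb u s) with true by (symmetry; apply Nat.leb_le; lia). pos. }
   assert (H1 : f3 i s u <= sumL (fun u => f3 i s u) (seq 1 t))
    by (apply (sumL_In_le (fun u => f3 i s u)); pos).
   assert (H2 : sumL (fun u => f3 i s u) (seq 1 t) <= sumL (fun s => sumL (fun u => f3 i s u) (seq 1 t)) (seq 1 t)).
   { apply (sumL_In_le (fun s => sumL (fun u => f3 i s u) (seq 1 t))); pos. }
   assert (sumL (fun s => sumL (fun u => f3 i s u) (seq 1 t)) (seq 1 t) <=
     sumL (fun i => sumL (fun s => sumL (fun u => f3 i s u) (seq 1 t)) (seq 1 t)) (seq 0 N)).
   { apply (sumL_In_le (fun i => sumL (fun s => sumL (fun u => f3 i s u) (seq 1 t)) (seq 1 t)));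
     [pos|assumption]. }
   lra. }
  assert (good_time t Q (exp (- (2 * s0 * l)) / 128) (1024 * L2) h s = true); [|pos].
  apply (good_time_of_scale t h s (2 ^ i) (S k) (2 ^ i / S k) (thr a' (2 ^ i)) (gw e1 a' (2 ^ i)) (x ^ 2)); auto.
  + lia.
  + nra.
  + intros u Hu. destruct (degree_jump (2 * 2 ^ i) s u (x ^ 2 + m) h) eqn:Hx; [|pos].
   assert (existsb (fun u => degree_jump (2 * 2 ^ i) s u L2 h) (seq 1 s) = true); [|pos].
   apply existsb_exists. exists u. pos.
  + destruct (Hsc (2 ^ i)%nat k Hp) as [_ Hgn]; [|assumption|assumption|].
   * split.
    -- apply filter_In in HiI as [_ HiI]. apply Rleb_true in HiI. lra.
    -- rewrite <- Htx. pos.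
   *
    assert (s <= 8 * INR (2 ^ i)).
    { replace 8 with (INR 8) by (simpl; ring). rewrite <- mult_INR. pos. }
    apply Rle_trans with (exp (- (2 * s0 * l)) / 128 * (8 * INR (2 ^ i))); [|pos].
    pos.
 - rewrite E_plus, E_sumL, E_sumL.
  assert (N <= 3 * x).
  { unfold N. rewrite S_INR.
   pose proof (Nat.log2_spec t ltac:(lia)) as [Hlg _]. apply le_INR in Hlg. rewrite pow_INR in Hlg.
   assert (INR (Nat.log2 t) * ln 2 <= x).
   { rewrite <- Htx, <- ln_pow by lra.
    pos. }
   assert (/ 2 < ln 2). { pose proof (ln_lt_2). lra. }
   assert (INR (Nat.log2 t) * / 2 <= INR (Nat.log2 t) * ln 2) by pos. lra. }
  assert (Hbound1 : sumL (fun i => E (m * t) [] (fun h => b2R (sb i (firstn (m * (4 * 2 ^ i)) h)))) I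
       <= N * exp (- (3 * l))).
  { apply Rle_trans with (sumL (fun _ : nat => exp (- (3 * l))) I).
   - apply sumL_le. intros i Hi. apply filter_In in Hi as [Hi Hi2]. apply filter_In in Hi as [_ Hi1].
    apply Nat.leb_le in Hi1. apply Rleb_true in Hi2.
    assert (Hp : (1 <= 2 ^ i)%nat) by (pose proof (Nat.pow_nonzero 2 i); lia).
    eapply Rle_trans; [right; apply (E_firstn t (4 * 2 ^ i) (fun h => b2R (sb i h))); assumption|].
    apply (Hsc (2 ^ i)%nat k Hp); [|assumption|assumption].
    rewrite <- Htx. pos.
   - rewrite sumL_const, Rmult_comm. apply Rmult_le_compat_r; [pos|].
    apply le_INR. eapply Nat.le_trans; [apply filter_length_le|].
    eapply Nat.le_trans; [apply filter_length_le|]. rewrite length_seq. lia. }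
  assert (Hbound2 : sumL (fun a => E (m * t) [] (fun h => sumL (fun s => sumL (fun u =>
     b2R (Nat.leb (2 * 2 ^ a) s && Nat.leb s (8 * 2 ^ a) && Nat.leb u s && degree_jump (2 * 2 ^ a) s u L2 h)) (seq 1 t)) (seq 1 t))) (seq 0 N)
       <= N * (t * (t * exp (- L2)))).
  { apply Rle_trans with (sumL (fun _ : nat => t * (t * exp (- L2))) (seq 0 N)).
   2: { rewrite sumL_const, length_seq. lra. }
   apply sumL_le. intros i _. rewrite E_sumL.
   apply Rle_trans with (sumL (fun _ : nat => t * exp (- L2)) (seq 1 t)).
   2: { rewrite sumL_const, length_seq. lra. }
   apply sumL_le. intros s Hs. rewrite E_sumL.
   apply Rle_trans with (sumL (fun _ : nat => exp (- L2)) (seq 1 t)).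
   2: { rewrite sumL_const, length_seq. lra. }
   apply sumL_le. intros u Hu. apply in_seq in Hs, Hu.
   destruct (Nat.leb (2 * 2 ^ i) s && Nat.leb s (8 * 2 ^ i) && Nat.leb u s) eqn:Hc.
   - apply andb_true_iff in Hc as [Hc Hc3]. apply andb_true_iff in Hc as [Hc1 Hc2].
    apply Nat.leb_le in Hc1, Hc2, Hc3. apply degree_jump_prob; lia.
   - apply E_le_const; [pos|]. simpl. pos. }
  assert (Htexp : INR t = exp x) by (rewrite <- Htx, exp_ln; pos).
  assert (Hxl' : exp l = x) by (unfold l; apply exp_ln; assumption).
  assert (Hex3 : exp (- (3 * l)) = / x ^ 3).
  { rewrite exp_Ropp. f_equal. rewrite <- Hxl'. rewrite exp_pow_nat. f_equal. simpl. ring. }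
  assert (t * (t * exp (- L2)) <= exp (- (3 * l))).
  { rewrite Htexp, <- !exp_plus. apply exp_mono.
   assert (l <= x). { pose proof (exp_ge1 l). lra. }
   assert (8 * x <= x * x) by pos. lra. }
  apply Rle_trans with (3 * x * exp (- (3 * l)) + 3 * x * exp (- (3 * l))).
  + apply Rplus_le_compat.
   * eapply Rle_trans; [exact Hbound1|]. pos.
   * eapply Rle_trans; [exact Hbound2|]. apply Rle_trans with (N * exp (- (3 * l))).
    -- pos.
    -- pos.
  + rewrite Hex3. apply Rmult_le_reg_r with (x ^ 3); [pos|].
   replace ((3 * x * / x ^ 3 + 3 * x * / x ^ 3) * x ^ 3) with (6 * x) by pos.
   replace (/ x * x ^ 3) with (x * x) by pos. nra.
Qed.

End AllScales.

(** * Vertices whose older generations avoid good vertices *)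

Section Bad.
Context {P : PAmodel}.
Variables (t Q : nat).

(* [bad k h v]: following out-edges for at most [k] steps from [v] never meets a vertex that was
  already good when the edge was created; self-loops do not count as progress. *)
Fixpoint bad (k : nat) (h : history) (v : nat) : bool :=
 match k with
 | O => true
 | S k' => forallb (fun e => negb (Nat.eqb (fst e) v) || Nat.eqb (snd e) v ||
       (negb (good t Q (firstn (m * (v - 1)) h) (snd e)) && bad k' h (snd e))) h
 end.

Lemma forallb_ext_In {A} (p q : A -> bool) l : (forall x, In x l -> p x = q x) -> forallb p l = forallb q l.
Proof. induction l; simpl; intros H; [pos|]. rewrite H, IHl; auto. Qed.

Lemma forallb_false_ex {A} (p : A -> bool) l : forallb p l = false -> exists x, In x l /\ p x = false.
Proof.
 induction l; simpl; intros Hb; [pos|]. apply andb_false_iff in Hb as [Hb|Hb].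
 - pos.
 - destruct (IHl Hb) as (e & H1 & H2). pos.
Qed.

(** Goodness of a target is judged in the prefix preceding the edges of [v], so the verdict on a
    completed vertex never changes. *)
Lemma bad_stable k : forall h l v, valid (h ++ l) -> (1 <= v)%nat -> (m * v <= length h)%nat ->
 bad k (h ++ l) v = bad k h v.
Proof.
 induction k; intros h l v Hv Hv1 Hl; [pos|]. simpl. rewrite forallb_app.
 replace (forallb _ l) with true.
 - rewrite andb_true_r. apply forallb_ext_In. intros e He.
  destruct (Nat.eqb_spec (fst e) v); simpl; [|pos].
  pose proof (valid_In h e (valid_prefix _ _ Hv) He) as [Hb _].
  rewrite IHk by (assumption || nia). rewrite firstn_app_le by nia. pos.
 - symmetry. apply forallb_forall. intros e He. pose proof (valid_app_In h l e Hv He).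
  destruct (Nat.eqb_spec (fst e) v); pos.
Qed.

Lemma bad_near k : forall h v, valid h -> (length h <= m * t)%nat -> bad k h v = false -> near h (k + Q) v 1.
Proof.
 induction k; intros h v Hv Hl Hb; [discriminate|]. simpl in Hb.
 assert (Hex : exists e, In e h /\ fst e = v /\ snd e <> v /\
   (good t Q (firstn (m * (v - 1)) h) (snd e) = true \/ bad k h (snd e) = false)).
 { revert Hb. set (p := fun e => _). intros Hb.
  assert (Hx : exists e, In e h /\ p e = false).
  { apply forallb_false_ex. pos. }
  destruct Hx as (e & He & Hp). exists e.
  apply orb_false_iff in Hp as [Hp Hp3]. apply orb_false_iff in Hp as [Hp1 Hp2].
  apply negb_false_iff, Nat.eqb_eq in Hp1. apply Nat.eqb_neq in Hp2.
  apply andb_false_iff in Hp3. split; [assumption|]. split; [assumption|]. split; [assumption|].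
  destruct Hp3 as [H|H]; [left; apply negb_false_iff; assumption|pos]. }
 destruct Hex as ((a & b) & He & H1 & H2 & H3). simpl in *. subst a.
 replace (S (k + Q)) with (1 + (k + Q))%nat by lia. apply near_trans with b.
 - apply near_adj, adj_In. assumption.
 - destruct H3 as [H3|H3].
  + apply near_le with Q; [|lia]. apply reach_near in H3.
   rewrite <- (firstn_skipn (m * (v - 1)) h). apply near_app. assumption.
  + pos.
Qed.

(** The summand [4 * m] covers two errors inside a block: the weight of [U] grows by at most [m],
    and a self-loop has weight at most [2 * m]. *)
Lemma all_hits_prob h s U n : valid h -> length h = (m * s)%nat -> NoDup U ->
 (forall u, In u U -> (1 <= u <= s)%nat) ->
 forall l, valid (h ++ l) -> (length l + n <= m)%nat ->
 E n (h ++ l) (fun g => b2R (forallb (fun e => existsb (Nat.eqb (snd e)) (S s :: U)) (skipn (m * s) g)))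
  <= ((w h U + 4 * m) / cc (m * s)) ^ n.
Proof.
 intros Hv Hl HU HUb.
 assert (HUc : forall u, In u U -> (1 <= u)%nat /\ (m * u <= length h)%nat) by (intros u Hu; specialize (HUb u Hu); nia).
 assert (0 <= w h U) by pos.
 pose proof INRm_ge2.
 set (q := (w h U + 4 * INR m) / cc (m * s)).
 assert (0 <= q) by (apply Rmult_le_pos; pos).
 induction n; intros l Hvl Hn.
 - apply b2R_range.
 - rewrite E_S. set (g := h ++ l) in *.
  assert (Hlg : length g = (m * s + length l)%nat) by (unfold g; rewrite length_app; lia).
  assert (Hcur : cur (length g) = S s) by (rewrite Hlg; apply cur_mul; lia).
  apply Rle_trans with (E1 g (fun v => q ^ n * ((if Nat.eqb v (S s) then 1 else 0) +
    sumL (fun u => if Nat.eqb v u then 1 else 0) U))).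
  + apply E1_le; [assumption|]. intros v Hb.
   assert (valid (ext g v)) by pos.
   assert (Hee : ext g v = h ++ (l ++ [(S s, v)])) by (unfold ext; rewrite Hcur; unfold g; rewrite <- app_assoc; reflexivity).
   rewrite sumL_indic_range by assumption.
   destruct (existsb (Nat.eqb v) (S s :: U)) eqn:Hx.
   * apply Rle_trans with (q ^ n).
    -- rewrite Hee. apply IHn; [pos|rewrite length_app; simpl; lia].
    -- assert (0 <= q ^ n) by pos.
      rewrite <- (Rmult_1_r (q ^ n)) at 1. apply Rmult_le_compat_l; [assumption|].
      simpl in Hx. destruct (Nat.eqb v (S s)); simpl in *; [pose proof (b2R_range (existsb (Nat.eqb v) U)); lra|].
      rewrite Hx. simpl. lra.
   * apply Rle_trans with 0.
    -- apply E_le_const; [assumption|]. intros l' Hl' _.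
      replace (forallb _ _) with false; [pos|].
      rewrite Hee, <- app_assoc, <- Hl. rewrite skipn_app, Nat.sub_diag, skipn_all. simpl app.
      rewrite <- app_assoc, forallb_app. simpl forallb at 2. simpl in Hx. rewrite Hx.
      pos.
    -- apply Rmult_le_pos; [pos|]. apply Rplus_le_le_0_compat; [|pos].
      destruct (Nat.eqb v (S s)); lra.
  + rewrite E1_scal, E1_plus.
   rewrite (E1_eqb g (S s) (fun _ => 1)) by pos.
   assert (forall u, In u U -> (1 <= u)%nat /\ (m * u <= length g)%nat) by (intros u Hu; destruct (HUc u Hu); rewrite Hlg; lia).
   rewrite E1_hits by assumption.
   simpl pow. rewrite (Rmult_comm q). apply Rmult_le_compat_l; [pos|].
   pose proof (step_prob_self g Hvl) as Hself. rewrite Hcur in Hself.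
   pose proof (w_app_bounds h l U (length l) HU eq_refl Hvl HUc) as Hwb. fold g in Hwb.
   assert (INR (length l) <= m) by pos.
   assert (cc (m * s) <= cc (length g)) by (apply cc_mono; lia).
   assert (/ cc (length g) <= / cc (m * s)) by pos.
   apply Rle_trans with ((2 * m + w g U) * / cc (length g)); [lra|].
   apply Rle_trans with ((w h U + 4 * m) * / cc (length g)).
   * pos.
   * apply Rmult_le_compat_l; lra.
Qed.

Definition badset (k : nat) (h : history) (s : nat) : list nat :=
 filter (fun u => negb (good t Q h u) && bad k h u) (seq 1 s).

(** The recursion step: every edge of the new vertex is a self-loop or ends in [badset], which turns
    a weight fraction into its [m]-th power. *)
Lemma bad_prob k h s : valid h -> length h = (m * s)%nat ->
 E m h (fun g => b2R (bad (S k) g (S s))) <= ((w h (badset k h s) + 4 * m) / cc (m * s)) ^ m.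
Proof.
 intros Hv Hl.
 eapply Rle_trans; [|apply (all_hits_prob h s (badset k h s) m Hv Hl)].
 4: rewrite app_nil_r; assumption.
 - rewrite app_nil_r. apply E_le; [assumption|]. intros l Hvl Hn.
  destruct (bad (S k) (h ++ l) (S s)) eqn:Hb; [|apply b2R_range].
  replace (forallb _ (skipn _ _)) with true; [pos|]. symmetry.
  rewrite <- Hl, skipn_app, Nat.sub_diag, skipn_all.
  apply forallb_forall. intros e He. apply existsb_exists. exists (snd e). rewrite Nat.eqb_refl. split; [|pos].
  simpl in Hb. rewrite forallb_app in Hb. apply andb_true_iff in Hb as [_ Hb].
  rewrite forallb_forall in Hb. specialize (Hb e He).
  assert (Hfst : fst e = S s).
  { pose proof (valid_app_In h l e Hvl He).
   pose proof (valid_In (h ++ l) e Hvl (in_or_app _ _ _ (or_intror He))) as [_ H2].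
   rewrite length_app in H2. nia. }
  rewrite Hfst, Nat.eqb_refl in Hb.
  apply orb_true_iff in Hb as [Hb|Hb].
  + apply Nat.eqb_eq in Hb. pos.
  + destruct (Nat.eq_dec (snd e) (S s)) as [Heq|Hne]; [pos|].
   right. apply andb_true_iff in Hb as [Hb1 Hb2]. rewrite Nat.sub_0_r in Hb1.
   rewrite firstn_app_le, <- Hl, firstn_all in Hb1 by lia.
   pose proof (valid_In (h ++ l) e Hvl (in_or_app _ _ _ (or_intror He))) as [H2 _].
   apply filter_In.
   rewrite bad_stable in Hb2 by (assumption || nia). rewrite Hb1. pos.
 - apply NoDup_filter, seq_NoDup.
 - intros u Hu. apply filter_In in Hu as [Hu _]. apply in_seq in Hu. lia.
 - pos.
Qed.

(** Serves as the stopping rule of the supermartingales: level [k] has been under control at all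
    times from [s1] to the present. *)
Definition ok_weight (k : nat) (y : nat -> R) (s1 : nat) (g : history) : bool :=
 forallb (fun s => Rleb (w (firstn (m * s) g) (badset k (firstn (m * s) g) s)) (y s))
     (seq s1 (S (length g / m) - s1)).

Lemma ok_weight_app k y s1 g l : ok_weight k y s1 (g ++ l) = true -> ok_weight k y s1 g = true.
Proof.
 unfold ok_weight. rewrite !forallb_forall. intros H s Hs. apply in_seq in Hs.
 assert ((m * (length g / m) <= length g)%nat) by (apply Nat.Div0.mul_div_le).
 assert ((length g / m <= length (g ++ l) / m)%nat) by (apply Nat.Div0.div_le_mono; rewrite length_app; lia).
 assert ((m * s <= length g)%nat) by nia.
 specialize (H s). rewrite firstn_app_le in H by assumption. apply H. pos.
Qed.

Lemma ok_weight_cur k y s1 g s : length g = (m * s)%nat -> (s1 <= s)%nat -> ok_weight k y s1 g = true ->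
 w g (badset k g s) <= y s.
Proof.
 intros Hg Hs H. unfold ok_weight in H. rewrite forallb_forall in H. assert (HmP := Hm).
 specialize (H s). rewrite Hg, Nat.mul_comm, Nat.div_mul in H by lia.
 rewrite Nat.mul_comm, <- Hg, firstn_all in H. apply Rleb_true, H. pos.
Qed.

(** ** Counting bad vertices *)

Definition nbad (k : nat) (h : history) (s : nat) : R := INR (length (filter (bad k h) (seq 1 s))).

Lemma filter_bad_ext k h l s : valid (h ++ l) -> (m * s <= length h)%nat ->
 filter (bad k (h ++ l)) (seq 1 s) = filter (bad k h) (seq 1 s).
Proof.
 intros Hv Hl. apply filter_ext_in. intros u Hu. apply in_seq in Hu. apply bad_stable; [assumption|lia|nia].
Qed.

Lemma nbad_S k h s : nbad k h (S s) = nbad k h s + b2R (bad k h (S s)).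
Proof.
 unfold nbad. rewrite seq_S, filter_app, length_app, plus_INR. simpl.
 destruct (bad k h (S s)); reflexivity.
Qed.

(** An indicator of probability at most [p] has exponential moment at most
    [1 + 2 * p <= exp (2 * p)], as [exp 1 <= 3]; so the exponential of the compensated count is a
    supermartingale. All of the first [s1] vertices are counted as bad. *)
Lemma nbad_tail k (y p : nat -> R) s1 s2 x :
 (s1 <= s2)%nat ->
 (forall s g, (s1 <= s < s2)%nat -> valid g -> length g = (m * s)%nat -> w g (badset k g s) <= y s ->
   E m g (fun g' => b2R (bad (S k) g' (S s))) <= p s) ->
 (forall s, (s1 <= s < s2)%nat -> 0 <= p s) ->
 E (m * s2) [] (fun h => b2R (ok_weight k y s1 h &&
   Rleb (s1 + 2 * sumL p (seq s1 (s2 - s1)) + x) (nbad (S k) h s2))) <= exp (- x).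
Proof.
 intros Hs Hp Hp0. assert (HmP := Hm).
 replace (m * s2)%nat with (m * s1 + m * (s2 - s1))%nat by nia. rewrite E_add.
 apply E_le_const; [pos|]. intros h Hv Hl.
 set (V := fun s => INR s1 + 2 * sumL p (seq s1 (s - s1))).
 set (F := fun g => b2R (ok_weight k y s1 g) * exp (nbad (S k) g (length g / m) - V (length g / m)%nat)).
 assert (E (m * (s2 - s1)) h F <= F h).
 { apply (E_super_block (s2 - s1) h F s1 Hv Hl). intros l s' Hvl Hs' Hb. set (g := h ++ l) in *.
  assert (Hdiv : (length g / m = s')%nat) by (rewrite Hs', Nat.mul_comm, Nat.div_mul; lia).
  unfold F at 2. destruct (ok_weight k y s1 g) eqn:Hok.
  - rewrite Rmult_1_l, Hdiv.
   set (K := exp (nbad (S k) g s' - V (S s'))). assert (0 < K) by apply exp_pos.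
   apply Rle_trans with (E m g (fun g' => K * 1 + K * 2 * b2R (bad (S k) g' (S s')))).
   + apply E_le; [assumption|]. intros l' Hvl' Hn.
    assert (Hdiv' : (length (g ++ l') / m = S s')%nat).
    { rewrite length_app, Hs', Hn. replace (m * s' + m)%nat with (S s' * m)%nat by lia. apply Nat.div_mul. lia. }
    unfold F. rewrite Hdiv', nbad_S. unfold nbad at 1. rewrite filter_bad_ext by pos. fold (nbad (S k) g s').
    replace (nbad (S k) g s' + b2R (bad (S k) (g ++ l') (S s')) - V (S s')) with
     ((nbad (S k) g s' - V (S s')) + b2R (bad (S k) (g ++ l') (S s'))) by ring.
    rewrite exp_plus. fold K. pose proof (b2R_range (ok_weight k y s1 (g ++ l'))).
    destruct (bad (S k) (g ++ l') (S s')); [change (b2R true) with 1|change (b2R false) with 0].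
    * pose proof exp_le_3.
     apply Rle_trans with (1 * (K * 3)); [|lra].
     pos.
    * rewrite exp_0. nra.
   + rewrite E_plus, E_const, E_scal by assumption.
    pose proof (Hp s' g ltac:(lia) Hvl Hs' (ok_weight_cur k y s1 g s' Hs' ltac:(lia) Hok)).
    apply Rle_trans with (K * exp (2 * p s')).
    * apply Rle_trans with (K * (1 + 2 * p s')); [nra|]. apply Rmult_le_compat_l; [lra|apply exp_ge1].
    * unfold K. rewrite <- exp_plus. apply exp_mono. unfold V.
     replace (S s' - s1)%nat with (S (s' - s1)) by lia. rewrite seq_S, sumL_app. cbn [sumL].
     replace (s1 + (s' - s1))%nat with s' by lia. lra.
  - apply E_le_const; [assumption|]. intros l' Hvl' Hn. unfold F.
   destruct (ok_weight k y s1 (g ++ l')) eqn:Hx; [apply ok_weight_app in Hx; congruence|]. simpl. lra. }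
 assert (F h <= 1).
 { unfold F. rewrite Hl, Nat.mul_comm, Nat.div_mul by lia. unfold V. rewrite Nat.sub_diag. simpl sumL.
  assert (Hn : nbad (S k) h s1 <= s1).
  { apply le_INR. eapply Nat.le_trans; [apply filter_length_le|]. rewrite length_seq. lia. }
  assert (exp (nbad (S k) h s1 - (s1 + 2 * 0)) <= 1) by (rewrite <- exp_0; apply exp_mono; lra).
  pose proof (b2R_range (ok_weight k y s1 h)). nra. }
 apply Rle_trans with (E (m * (s2 - s1)) h (fun g => exp (- x) * F g)).
 - apply E_le; [assumption|]. intros l Hvl Hn.
  assert (Hdiv : (length (h ++ l) / m = s2)%nat).
  { rewrite length_app, Hl, Hn. replace (m * s1 + m * (s2 - s1))%nat with (s2 * m)%nat by nia. apply Nat.div_mul. lia. }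
  unfold F. rewrite Hdiv. destruct (ok_weight k y s1 (h ++ l)); [|simpl; lra].
  rewrite Rmult_1_l, <- exp_plus.
  destruct (Rleb _ _) eqn:Hb; [|left; apply exp_pos]. apply Rleb_true in Hb. unfold b2R.
  rewrite <- exp_0. apply exp_mono. unfold V. lra.
 - rewrite E_scal. pose proof (exp_pos (- x)). nra.
Qed.

End Bad.

Lemma pow_perturb A y n : 0 <= A <= 1 -> 0 <= y <= 1 -> (A + y) ^ n <= A ^ n + y * 3 ^ n.
Proof.
 intros HA Hy. induction n; [pos|]. simpl.
 assert (0 <= A ^ n <= 1) by (split; [pos|rewrite <- (pow1 n); apply pow_incr; lra]).
 apply Rle_trans with ((A + y) * (A ^ n + y * 3 ^ n)); [pos|].
 assert (A * (y * 3 ^ n) <= 1 * (y * 3 ^ n)) by pos.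
 assert (y * (y * 3 ^ n) <= 1 * (y * 3 ^ n)) by pos.
 assert (y * A ^ n <= y * 1) by pos.
 assert (y * 1 <= y * 3 ^ n) by pos. lra.
Qed.

(** * Phase A: weight fractions of bad vertices *)

Section PhaseA.
Context {P : PAmodel}.

Lemma sum_sq_decay Kb s1 n : (1 <= s1)%nat ->
 sumL (fun i => (Kb * Rpower (INR s1 / INR i) gam) ^ 2) (seq s1 n) <= Kb ^ 2 * (1 + / (2 * gam - 1)) * INR s1.
Proof.
 intros Hs. pose proof gam_range. set (a := 2 * gam - 1). assert (0 < a <= 1) by (unfold a; lra).
 assert (1 <= s1) by pos.
 rewrite (sumL_ext _ (fun i => Kb ^ 2 * Rpower s1 (1 + a) * Rpower (INR i) (- (1 + a)))).
 - rewrite sumL_scal.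
  apply Rle_trans with (Kb ^ 2 * Rpower s1 (1 + a) * ((1 + / a) * Rpower s1 (- a))).
  + apply Rmult_le_compat_l; [apply Rmult_le_pos; [apply pow2_ge_0|pos]|].
   apply sum_pow_tail'; pos.
  + right. transitivity (Kb ^ 2 * (1 + / a) * (Rpower s1 (1 + a) * Rpower s1 (- a))); [ring|].
   rewrite <- Rpower_plus. replace (1 + a + - a) with 1 by ring. rewrite Rpower_1 by lra. pos.
 - intros i Hi. apply in_seq in Hi. assert (0 < i) by pos.
  rewrite Rpower_div by lra. rewrite Rpower_Ropp.
  replace (1 + a) with (gam + gam) by (unfold a; ring). rewrite !Rpower_plus.
  pose proof (Rpower_pos i gam). pos.
Qed.

Lemma inv_PiV_upper s1 s : (1 <= s1 <= s)%nat -> / PiV s1 s <= 2 * Rpower (s1 / s) gam.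
Proof.
 intros Hs. pose proof (PiV_lower s1 s Hs). pose proof (PiV_ge1 s1 s).
 assert (0 < s1) by pos. assert (0 < s) by pos.
 assert (Rpower (s1 / s) gam * Rpower (s / s1) gam = 1).
 { rewrite Rpower_mult_distr by pos.
  replace (s1 / s * (s / s1)) with 1 by pos. apply Rpower_1_l. }
 pose proof (Rpower_pos (s1 / s) gam).
 apply Rmult_le_reg_r with (PiV s1 s); [lra|]. rewrite Rinv_l by lra.
 set (A := Rpower (INR s1 / INR s) gam) in *. set (A' := Rpower (INR s / INR s1) gam) in *.
 assert (2 * A * (A' / 2) <= 2 * A * PiV s1 s) by pos. lra.
Qed.

Lemma E_degree_block s n : forall h, valid h -> (m * s <= length h)%nat -> (length h + n <= m * s + m)%nat ->
 E n h (fun g => INR (degree g (S s))) <= INR (degree h (S s)) + n * (1 + 2 * m / cc (m * s)).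
Proof.
 induction n; intros h Hv H1 H2.
 - rewrite E_O. simpl. lra.
 - rewrite E_S. assert (Hcur : cur (length h) = S s).
  { replace (length h) with (m * s + (length h - m * s))%nat by lia. apply cur_mul. lia. }
  set (c := 1 + 2 * INR m / cc (m * s)).
  apply Rle_trans with (E1 h (fun v => (INR (degree h (S s)) + 1 + n * c) + (if Nat.eqb v (S s) then 1 else 0))).
  + apply E1_le; [assumption|]. intros v Hb. eapply Rle_trans; [apply IHn|].
   * pos.
   * rewrite ext_length. lia.
   * rewrite ext_length. lia.
   * fold c. rewrite degree_ext, Hcur, Nat.eqb_refl, !plus_INR.
    destruct (Nat.eqb v (S s)); simpl; lra.
  + rewrite E1_plus, E1_const by assumption. rewrite (E1_eqb h (S s) (fun _ => 1)) by pos.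
   pose proof (step_prob_self h Hv) as Hp. rewrite Hcur in Hp.
   assert (2 * m / cc (length h) <= 2 * m / cc (m * s)).
   { apply Rmult_le_compat_l; [pos|]. pos. }
   rewrite S_INR. unfold c. lra.
Qed.

Definition Wb (t Q k : nat) (h : history) (s : nat) : R := w h (filter (bad t Q k h) (seq 1 s)).

Lemma Wb_S t Q k g l s : valid (g ++ l) -> length g = (m * s)%nat ->
 Wb t Q k (g ++ l) (S s) = w (g ++ l) (filter (bad t Q k g) (seq 1 s))
   + b2R (bad t Q k (g ++ l) (S s)) * (INR (degree (g ++ l) (S s)) + delta).
Proof.
 intros Hv Hl. unfold Wb. rewrite seq_S, filter_app, (filter_bad_ext t Q k g l s Hv) by lia.
 unfold w. rewrite sumL_app. simpl. destruct (bad t Q k (g ++ l) (S s)); simpl; ring.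
Qed.

Lemma Wb_range t Q k g s : valid g -> length g = (m * s)%nat -> 0 <= Wb t Q k g s <= s * (2 * m + delta).
Proof.
 intros Hv Hl. rewrite <- (w_total g s Hv Hl). split.
 - apply w_nonneg; [assumption|]. intros u Hu. apply filter_In in Hu as [Hu _].
  eapply in_seq1_completed; pos.
 - apply sumL_incl; [pos|intros u Hu; apply filter_In in Hu as [Hu _]; assumption|].
  intros u Hu. destruct (in_seq1_completed s g s u Hl (le_n s) Hu) as [H1 H2].
  pose proof (degree_completed g u Hv H1 H2) as Hd. apply le_INR in Hd. pose proof md_pos. lra.
Qed.

(* One level of the weight recursion: the weight fraction of [bad (k+1)] vertices is at most
  [A^m] up to the contribution [(s1/s2)^(1-gam)] of the vertices born before [s1]. *)
Lemma weight_level : exists K S0, 0 < K /\ forall t Q k A s1 s2,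
 S0 <= INR s1 -> (2 <= s1 <= s2)%nat -> 0 <= A <= 1 -> ln (INR s2) <= INR s1 ->
 E (m * s2) [] (fun h => b2R (ok_weight t Q k (fun s => A * cc (m * s)) s1 h &&
   Rltb ((A ^ m + K * Rpower (INR s1 / INR s2) (1 - gam)) * cc (m * s2)) (Wb t Q (S k) h s2)))
  <= K * exp (- Rpower (INR s1) (/ 4)).
Proof.
 pose proof gam_range as Hgam. pose proof INRm_ge2 as Hm2. pose proof md_pos as Hmd. pose proof Hd2 as Hd2'. assert (HmP := Hm).
 set (M := 2 * INR m + delta). assert (HM : 2 <= M <= 2 * m) by (unfold M; lra).
 (* Collects the drift errors of order [1 / s]: second order growth of the weights, the perturbation
    [4 * m / c] of the fraction under the power [m], and self-loops of the new vertex. *)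
 set (K4 := 4 * INR m ^ 2 + INR m * (3 ^ m * (4 * INR m))).
 assert (HK4 : 0 < K4).
 { apply Rplus_lt_0_compat; [nra|]. pos. }
 set (Kb := 10 * INR m + K4). assert (HKb : 0 < Kb) by (unfold Kb; lra).
 set (B := Kb ^ 2 * (1 + / (2 * gam - 1))).
 set (K' := 2 * INR m + 1 + 2 * K4). assert (HK' : 0 < K') by (unfold K'; lra).
 set (K := Rmax (2 * K') (exp (2 * B))).
 assert (HKa : 2 * K' <= K) by apply Rmax_l. assert (HKe : exp (2 * B) <= K) by apply Rmax_r.
 exists K, (4 * Kb ^ 2 + 8 * m). split; [lra|].
 intros t Q k A s1 s2 HS0 Hs HA Hln.
 assert (Hs1R : 2 <= s1) by pos.
 assert (Hcc : forall s, INR s <= cc (m * s) /\ s * M <= cc (m * s)).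
 { intros s. rewrite cc_vertices. fold M. pose proof (pos_INR s). pose proof chi_range. nra. }
 set (ok := ok_weight t Q k (fun s => A * cc (m * s)) s1).
 replace (m * s2)%nat with (m * s1 + m * (s2 - s1))%nat at 1 by nia.
 rewrite E_add. apply E_le_const; [pos|]. intros h Hv Hl.
 set (T := fun s => INR s * M).
 assert (HAm : 0 <= A ^ m <= 1) by (split; [pos|rewrite <- (pow1 m); apply pow_incr; lra]).
 (* [X] measures the excess over the target fraction [A ^ m], division by [PiV] removes the growth,
    and [H] absorbs the drift errors. [H] grows logarithmically, which is why [ln s2 <= s1] is
    assumed. *)
 set (X := fun g s => Wb t Q (S k) g s - A ^ m * T s).
 set (H := fun s => K4 * sumL (fun i => / cc (m * i)) (seq s1 (s - s1))).
 set (Z := fun g : history => X g (length g / m)%nat / PiV s1 (length g / m) - H (length g / m)%nat).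
 assert (HZ : forall g s, length g = (m * s)%nat -> Z g = X g s / PiV s1 s - H s).
 { intros g s Hg. unfold Z. rewrite Hg, Nat.mul_comm, Nat.div_mul by lia. pos. }
 assert (HHS : forall s, (s1 <= s)%nat -> H (S s) = H s + K4 * / cc (m * s)).
 { intros s Hss. unfold H. replace (S s - s1)%nat with (S (s - s1)) by lia. rewrite seq_S, sumL_app. cbn [sumL].
  replace (s1 + (s - s1))%nat with s by lia. ring. }
 assert (Hrho : forall s, (s1 <= s)%nat -> 1 <= PiV s (S s) /\ T s * (PiV s (S s) - 1) <= m + 2 * m ^ 2 / cc (m * s)
       /\ cc (m * s) * (PiV s (S s) - 1) <= 2 * m).
 { intros s Hss. assert (s1 <= s) by pos.
  split; [apply PiV_ge1|]. destruct (Hcc s) as [Hc1 Hc2]. pose proof (cc_pos (m * s)) as Hc0.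
  pose proof (PiV_ge1 s (S s)). pose proof (PiV_step_upper s ltac:(lia)). split.
  2: { apply Rle_trans with (cc (m * s) * (2 * m / cc (m * s))); [pos|right; field; lra]. }
  set (y := / cc (m * s)). assert (Hy : 0 < y) by (apply inv_cc_pos).
  assert (m * y <= 1/2).
  { apply Rdiv_le_swap; [assumption|]. pose proof (pow2_ge_0 Kb). lra. }
  assert (PiV s (S s) <= 1 + m * y + 2 * (m * y) * (m * y)).
  { apply Rle_trans with ((1 + y) ^ m).
   - unfold PiV. replace (m * S s - m * s)%nat with m by lia.
    assert (forall n, Pi (m * s) n <= (1 + y) ^ n).
    { induction n; [pos|]. cbn [Pi]. simpl pow. rewrite Rmult_comm.
     pose proof (Pi_pos (m * s) n). pose proof (inv_cc_pos (m * s + n)).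
     apply Rmult_le_compat; try lra. apply Rplus_le_compat_l. apply Rinv_le_contravar; [assumption|apply cc_mono; lia]. }
    pos.
   - apply Rle_trans with (exp y ^ m).
    + apply pow_incr. pose proof (exp_ge1 y). lra.
    + rewrite exp_pow_nat. apply exp_le_quadratic. assumption. }
  apply Rle_trans with (cc (m * s) * (PiV s (S s) - 1)).
  - pos.
  - apply Rle_trans with (cc (m * s) * (m * y + 2 * (m * y) * (m * y))).
   + pos.
   + unfold y. right. pos. }
 assert (Hdrift : forall g s', valid g -> length g = (m * s')%nat -> (s1 <= s' < s1 + (s2 - s1))%nat -> ok g = true -> E m g Z <= Z g).
 { intros g s' Hg Hgl Hs' Hok. rewrite (HZ g s' Hgl).
  destruct (Hrho s' ltac:(lia)) as (Hr1 & Hr2 & _). set (rho := PiV s' (S s')) in *. set (Pn := PiV s1 s').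
  assert (HPn : 1 <= Pn) by apply PiV_ge1. destruct (Hcc s') as [Hc1 Hc2]. pose proof (cc_pos (m * s')) as Hc0.
  set (c := cc (m * s')) in *.
  pose proof (ok_weight_cur t Q k _ s1 g s' Hgl ltac:(lia) Hok) as Hw. cbv beta in Hw. fold c in Hw.
  set (U := filter (bad t Q (S k) g) (seq 1 s')).
  assert (HUc : forall u, In u U -> (1 <= u)%nat /\ (m * u <= length g)%nat).
  { intros u Hu. apply filter_In in Hu as [Hu _]. eapply in_seq1_completed; pos. }
  assert (E m g (fun g' => Wb t Q (S k) g' (S s')) <= w g U * rho + (m + delta) * (A ^ m + 4 * m / c * 3 ^ m) + m * (2 * m / c)).
  { apply Rle_trans with (E m g (fun g' => w g' U + ((m + delta) * b2R (bad t Q (S k) g' (S s'))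
      + (INR (degree g' (S s')) + - m)))).
   - apply E_le; [assumption|]. intros l Hvl Hn. rewrite Wb_S by assumption. fold U.
    assert (Hd : (m <= degree (g ++ l) (S s'))%nat) by (apply degree_completed; [assumption|lia|rewrite length_app; lia]).
    apply le_INR in Hd. destruct (bad t Q (S k) (g ++ l) (S s')); simpl; lra.
   - rewrite E_plus, E_w by (assumption || apply NoDup_filter, seq_NoDup).
    rewrite E_plus, E_scal, E_plus, E_const by assumption.
    replace (Pi (length g) m) with rho by (unfold rho, PiV; rewrite Hgl; f_equal; lia).
    assert (E m g (fun g' => b2R (bad t Q (S k) g' (S s'))) <= A ^ m + 4 * m / c * 3 ^ m).
    { eapply Rle_trans; [apply bad_prob; assumption|].
     assert (Hy : 0 <= 4 * m / c <= 1).
     { split; [pos|]. apply Rdiv_le_swap; [assumption|].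
      assert (s1 <= s') by pos. pose proof (pow2_ge_0 Kb). lra. }
     eapply Rle_trans; [|apply pow_perturb; assumption].
     apply pow_incr. split.
     - apply Rmult_le_pos; [|pos].
      assert (0 <= w g (badset t Q k g s')).
      { apply w_nonneg; [assumption|]. intros u Hu. apply filter_In in Hu as [Hu _].
       eapply in_seq1_completed; pos. }
      lra.
     - apply Rdiv_le_swap; [assumption|]. replace ((A + 4 * m / c) * c) with (A * c + 4 * m) by pos. lra. }
    assert (E m g (fun g' => INR (degree g' (S s'))) <= m * (1 + 2 * m / c)).
    { eapply Rle_trans; [apply E_degree_block; pos|]. fold c.
     assert (Hd0 : (degree g (S s') <= 0)%nat).
     { pose proof (degree_le g (S s') Hg ltac:(lia)) as Hd. lia. }
     apply le_INR in Hd0. simpl in Hd0. lra. }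
    assert ((m + delta) * E m g (fun g' => b2R (bad t Q (S k) g' (S s'))) <= (m + delta) * (A ^ m + 4 * m / c * 3 ^ m))
     by pos.
    lra. }
  rewrite (E_ext m g Z (fun g' => / (Pn * rho) * (Wb t Q (S k) g' (S s') + - (A ^ m * T (S s'))) + - H (S s'))).
  + rewrite E_plus, E_const, E_scal, E_plus, E_const by assumption.
   rewrite HHS by lia.
   assert (HPr : 1 <= Pn * rho) by nra.
   assert (Hnum : E m g (fun g' => Wb t Q (S k) g' (S s')) + - (A ^ m * T (S s')) <= X g s' * rho + K4 / c).
   { unfold X. change (Wb t Q (S k) g s') with (w g U).
    assert (HTS : T (S s') = T s' + M) by (unfold T; rewrite S_INR; ring). rewrite HTS.
    assert (A ^ m * (T s' * (rho - 1)) <= A ^ m * (m + 2 * m ^ 2 / c)) by pos.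
    assert (A ^ m * (2 * m ^ 2 / c) <= 2 * m ^ 2 / c).
    { rewrite <- (Rmult_1_l (2 * m ^ 2 / c)) at 2.
     pos. }
    assert ((m + delta) * (4 * m / c * 3 ^ m) <= m * (4 * m / c * 3 ^ m)) by pos.
    replace (K4 / c) with (2 * m ^ 2 / c + m * (4 * m / c * 3 ^ m) + m * (2 * m / c)) by (unfold K4; field; lra).
    unfold M. lra. }
   assert (0 < / (Pn * rho) <= 1) by (split; [pos|rewrite <- Rinv_1; apply Rinv_le_contravar; lra]).
   apply Rle_trans with (/ (Pn * rho) * (X g s' * rho + K4 / c) + - (H s' + K4 * / c)).
   * pos.
   * rewrite Rmult_plus_distr_l.
    assert (/ (Pn * rho) * (K4 / c) <= 1 * (K4 / c)) by pos.
    replace (/ (Pn * rho) * (X g s' * rho)) with (X g s' / Pn) by pos.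
    lra.
  + pos.
  + intros l Hvl Hn. rewrite (HZ _ (S s')) by (rewrite length_app; lia). rewrite PiV_S by lia. fold Pn rho.
   unfold X. pos. }
 set (b := fun i => Kb * Rpower (INR s1 / INR i) gam).
 assert (Hinc : forall g l s', valid (g ++ l) -> length g = (m * s')%nat -> (s1 <= s' < s1 + (s2 - s1))%nat -> length l = m ->
   ok g = true -> Rabs (Z (g ++ l) - Z g) <= b s').
 { intros g l s' Hvl Hgl Hs' Hn _. assert (Hg : valid g) by (eapply valid_prefix; eassumption).
  rewrite (HZ g s' Hgl), (HZ (g ++ l) (S s')) by (rewrite length_app; lia).
  destruct (Hrho s' ltac:(lia)) as (Hr1 & _ & Hr3). rewrite PiV_S by lia.
  pose proof (inv_PiV_upper s1 s' ltac:(lia)) as HiP.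
  set (rho := PiV s' (S s')) in *. set (Pn := PiV s1 s') in *.
  assert (HPn : 1 <= Pn) by apply PiV_ge1. destruct (Hcc s') as [Hc1 Hc2]. pose proof (cc_pos (m * s')) as Hc0.
  set (c := cc (m * s')) in *. rewrite HHS by lia. fold c.
  set (U := filter (bad t Q (S k) g) (seq 1 s')).
  assert (HUc : forall u, In u U -> (1 <= u)%nat /\ (m * u <= length g)%nat).
  { intros u Hu. apply filter_In in Hu as [Hu _]. eapply in_seq1_completed; pos. }
  pose proof (w_app_bounds g l U m ltac:(apply NoDup_filter, seq_NoDup) Hn Hvl HUc).
  pose proof (Wb_range t Q (S k) g s' Hg Hgl) as HWr. change (Wb t Q (S k) g s') with (w g U) in HWr. fold M in HWr.
  assert (w g U <= Wb t Q (S k) (g ++ l) (S s') <= w g U + 3 * m).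
  { rewrite Wb_S by assumption. fold U.
   assert (Hd : (m <= degree (g ++ l) (S s'))%nat) by (apply degree_completed; [assumption|lia|rewrite length_app; lia]).
   assert (Hd' : (degree (g ++ l) (S s') <= 2 * m)%nat).
   { pose proof (degree_le (g ++ l) (S s') Hvl ltac:(lia)) as Hx. rewrite length_app in Hx. lia. }
   apply le_INR in Hd, Hd'. rewrite mult_INR in Hd'. simpl (INR 2) in Hd'.
   destruct (bad t Q (S k) (g ++ l) (S s')); simpl; lra. }
  set (W' := Wb t Q (S k) (g ++ l) (S s')) in *. set (W0 := w g U) in *.
  assert (0 <= W0 * (rho - 1) <= 2 * m).
  { split; [pos|]. apply Rle_trans with (c * (rho - 1)); pos. }
  assert (0 <= T s' * (rho - 1) <= 2 * m).
  { unfold T. split; [pos|].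
   apply Rle_trans with (c * (rho - 1)); pos. }
  assert (HTS : T (S s') = T s' + M) by (unfold T; rewrite S_INR; ring).
  assert (Hnum : Rabs (X (g ++ l) (S s') - X g s' * rho) <= 5 * m).
  { unfold X. rewrite HTS.
   set (q := T s' * (rho - 1)) in *.
   replace (W' - A ^ m * (T s' + M) - (W0 - A ^ m * T s') * rho) with (W' - W0 - W0 * (rho - 1) - A ^ m * (M - q)) by (unfold q; ring).
   assert (- (2 * m) <= A ^ m * (M - q) <= 2 * m).
   { nra. }
   apply Rabs_le. lra. }
  assert (HPr : 1 <= Pn * rho) by nra.
  replace (X (g ++ l) (S s') / (Pn * rho) - (H s' + K4 * / c) - (X g s' / Pn - H s'))
   with ((X (g ++ l) (S s') - X g s' * rho) / (Pn * rho) + - (K4 * / c)) by pos.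
  eapply Rle_trans; [apply Rabs_triang|].
  rewrite Rabs_Ropp, (Rabs_right (K4 * / c)) by (left; apply Rmult_lt_0_compat; pos).
  assert (Hss : s1 <= s') by pos.
  assert (0 < s1 / s' <= 1) by pos.
  assert (Hpow : s1 / s' <= Rpower (s1 / s') gam).
  { rewrite <- (Rpower_1 (s1 / s')) at 1 by lra. apply exp_mono.
   assert (ln (s1 / s') <= 0) by (rewrite <- ln_1; apply ln_mono; lra). nra. }
  assert (/ c <= Rpower (s1 / s') gam).
  { apply Rle_trans with (/ s'); [pos|]. eapply Rle_trans; [|exact Hpow].
   rewrite <- (Rmult_1_l (/ s')) at 1. apply Rmult_le_compat_r; pos. }
  unfold b, Kb. rewrite Rmult_plus_distr_r. apply Rplus_le_compat; [|pos].
  unfold Rdiv at 1. rewrite Rabs_mult, (Rabs_right (/ (Pn * rho))) by (left; apply Rinv_0_lt_compat; lra).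
  apply Rle_trans with (5 * m * (2 * Rpower (s1 / s') gam)); [|lra].
  apply Rmult_le_compat; [pos|pos|pos|].
  eapply Rle_trans; [|exact HiP]. apply Rinv_le_contravar; nra. }
 (* The squares of the increments sum to order [s1], so this [lam] keeps the variance term bounded.
    The deviation [x = s1^(3/4)] is at most [s1] and yields the exponent [lam * x = s1^(1/4)]. *)
 set (lam := Rpower (INR s1) (- (/ 2))). set (x := Rpower (INR s1) (3 / 4)).
 assert (Hlam : 0 < lam) by apply Rpower_pos.
 assert (Hlam2 : lam * lam * s1 = 1).
 { unfold lam. rewrite <- Rpower_plus. rewrite <- (Rpower_1 s1) at 2 by lra. rewrite <- Rpower_plus.
  replace (- / 2 + - / 2 + 1) with 0 by field. apply Rpower_O. lra. }
 assert (Hlamx : lam * x = Rpower s1 (/ 4)).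
 { unfold lam, x. rewrite <- Rpower_plus. f_equal. field. }
 assert (Hlb : forall s', (s1 <= s' < s1 + (s2 - s1))%nat -> lam * b s' <= 1/2).
 { intros s' Hs'. assert (lam * Kb <= 1/2).
  {
   nra. }
  unfold b.
  assert (Hss : s1 <= s') by pos.
  assert (Rpower (s1 / s') gam <= 1).
  { rewrite <- (Rpower_1_l gam). apply Rpower_le_base; [pos| |lra]. pos. }
  rewrite <- Rmult_assoc. apply Rle_trans with (lam * Kb * 1); pos. }
 pose proof (azuma_tail Z ok b lam x (s2 - s1) h s1 Hv Hl Hdrift Hinc (ok_weight_app t Q k _ s1) Hlam Hlb) as Htail.
 eapply Rle_trans; [|eapply Rle_trans; [exact Htail|]].
 - apply E_le; [assumption|]. intros l Hvl Hn.
  destruct (ok (h ++ l)); [|pos].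
  destruct (Rltb _ _) eqn:Hb; [|apply b2R_range]. apply Rltb_true in Hb.
  destruct (Rle_dec x (Z (h ++ l) - Z h)) as [|Hc]; [pos|].
  assert (Hlen : length (h ++ l) = (m * s2)%nat) by (rewrite length_app; nia).
  rewrite (HZ _ s2 Hlen), (HZ h s1 Hl), PiV_refl in Hc.
  assert (H s1 = 0) by (unfold H; rewrite Nat.sub_diag; simpl; ring).
  pose proof (Wb_range t Q (S k) h s1 Hv Hl) as HW1. fold M in HW1.
  assert (X h s1 <= 2 * m * s1).
  { unfold X. assert (0 <= A ^ m * T s1) by (apply Rmult_le_pos; [lra|unfold T; apply Rmult_le_pos; lra]).
   assert (s1 * M <= s1 * (2 * m)) by pos. lra. }
  assert (Hx : x <= s1).
  { unfold x. rewrite <- (Rpower_1 s1) at 2 by lra. apply Rle_Rpower; lra. }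
  assert (H s2 <= 2 * K4 * s1).
  { unfold H. destruct (Nat.eq_dec s2 s1) as [->|Hne]; [rewrite Nat.sub_diag; simpl; nra|].
   assert (sumL (fun i => / cc (m * i)) (seq s1 (s2 - s1)) <= 1 + ln s2).
   { apply Rle_trans with (sumL (fun i => / INR i) (seq s1 (s2 - s1))).
    - apply sumL_le. intros i Hi. apply in_seq in Hi. apply Rinv_le_contravar; [pos|apply Hcc].
    - replace (s2 - s1)%nat with (S (s2 - s1 - 1)) by lia. eapply Rle_trans; [apply sum_harmonic; lia|].
     pos. }
   assert (K4 * sumL (fun i => / cc (m * i)) (seq s1 (s2 - s1)) <= K4 * (2 * s1)) by pos.
   lra. }
  pose proof (PiV_ge1 s1 s2). pose proof (PiV_upper s1 s2 ltac:(lia)).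
  set (Pn := PiV s1 s2) in *.
  assert (0 < s2) by pos.
  assert (X (h ++ l) s2 / Pn <= K' * s1) by (unfold K'; lra).
  assert (HX3 : X (h ++ l) s2 <= K' * s1 * Pn).
  { apply Rmult_le_reg_r with (/ Pn); [pos|]. rewrite Rmult_assoc, Rinv_r by lra.
   lra. }
  assert (s1 * Rpower (s2 / s1) gam = s2 * Rpower (s1 / s2) (1 - gam)).
  { rewrite !Rpower_div by lra. unfold Rminus. rewrite !Rpower_plus, !Rpower_Ropp, !Rpower_1 by lra.
   pose proof (Rpower_pos s1 gam). pose proof (Rpower_pos s2 gam). pos. }
  destruct (Hcc s2) as [Hc1 Hc2].
  assert (HX4 : X (h ++ l) s2 <= K * Rpower (s1 / s2) (1 - gam) * cc (m * s2)).
  { eapply Rle_trans; [exact HX3|].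
   apply Rle_trans with (K' * s1 * (2 * Rpower (s2 / s1) gam)).
   - pos.
   - replace (K' * s1 * (2 * Rpower (s2 / s1) gam)) with (2 * K' * (s1 * Rpower (s2 / s1) gam)) by ring.
    apply Rle_trans with (K * (s2 * Rpower (s1 / s2) (1 - gam))).
    + pos.
    + rewrite (Rmult_comm s2), <- Rmult_assoc. pos. }
  unfold X in HX4. assert (A ^ m * T s2 <= A ^ m * cc (m * s2)) by pos.
  lra.
 - pose proof (sum_sq_decay Kb s1 (s2 - s1) ltac:(lia)).
  unfold Rminus. rewrite exp_plus, Hlamx.
  apply Rmult_le_compat_r; [pos|]. eapply Rle_trans; [|exact HKe]. apply exp_mono.
  apply Rle_trans with (2 * lam ^ 2 * (B * s1)); [pos|].
  replace (2 * lam ^ 2 * (B * s1)) with (2 * B * (lam * lam * s1)) by ring. rewrite Hlam2. lra.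
Qed.

End PhaseA.

Lemma pow_sum_le u v n : 0 <= u -> 0 <= v -> (u + v) ^ n <= (2 * u) ^ n + (2 * v) ^ n.
Proof.
 intros Hu Hv. destruct (Rle_dec u v).
 - apply Rle_trans with ((2 * v) ^ n); [pos|]. assert (0 <= (2 * u) ^ n) by pos. lra.
 - apply Rle_trans with ((2 * u) ^ n); [pos|]. assert (0 <= (2 * v) ^ n) by pos. lra.
Qed.

(** * From rare bad vertices to the distance from vertex 1 *)

Section Upper.
Context {P : PAmodel}.

Definition hit_from (h : history) (s0 wd v : nat) : bool :=
 existsb (fun z => mem_edge h z v) (seq (S s0) wd).

Lemma hit_from_app h l s0 wd v : hit_from h s0 wd v = true -> hit_from (h ++ l) s0 wd v = true.
Proof. apply existsb_mono. intros z Hz. rewrite mem_edge_app, Hz. pos. Qed.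

(** A completed vertex has weight at least [m + delta], so it is hit at rate at least
    [q / (length + 1)]; the factor [(length + 1)^q] compensates exactly this. It serves the oldest
    vertices, which the recursion does not reach: they get a younger neighbour instead. *)
Lemma no_hit_prob s0 t v : (1 <= v <= s0)%nat -> (s0 <= t)%nat ->
 E (m * t) [] (fun h => b2R (negb (hit_from h s0 (t - s0) v)))
  <= Rpower ((INR (m * s0) + 1) / (INR (m * t) + 1)) (gam * (m + delta)).
Proof.
 intros Hv Hst. pose proof gam_range. pose proof md_pos.
 set (q := gam * (INR m + delta)). assert (0 < q) by (apply Rmult_lt_0_compat; lra).
 replace (m * t)%nat with (m * s0 + (m * t - m * s0))%nat at 1 by nia.
 rewrite E_add. apply E_le_const; [pos|]. intros h Hvh Hl. simpl app in *.
 set (nh := fun g => negb (hit_from g s0 (t - s0) v)).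
 set (F := fun g : history => b2R (nh g) * Rpower (INR (length g) + 1) q).
 assert (HF : E (m * t - m * s0) h F <= F h).
 { apply E_super; [assumption|]. intros l Hvl Hn. set (g := h ++ l) in *.
  assert ((m * s0 <= length g < m * t)%nat) by (unfold g; rewrite length_app; lia).
  unfold F at 2. destruct (nh g) eqn:Hng.
  - rewrite Rmult_1_l.
   pose proof (cur_bounds (length g)) as (Hc1 & Hc2).
   assert ((s0 < cur (length g) <= t)%nat) by nia.
   set (K := Rpower (INR (S (length g)) + 1) q). assert (0 < K) by apply Rpower_pos.
   apply Rle_trans with (E1 g (fun u => K * (1 + (if Nat.eqb u v then -1 else 0)))).
   + apply E1_le; [assumption|]. intros u Hu. unfold F. rewrite ext_length.
    rewrite Rmult_comm. apply Rmult_le_compat_l; [lra|].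
    destruct (Nat.eqb_spec u v).
    * subst u. replace (nh (ext g v)) with false; [simpl; lra|]. symmetry. apply negb_false_iff.
     apply existsb_exists. exists (cur (length g)). split; [pos|].
     apply mem_edge_In. apply in_or_app. right. pos.
    * pose proof (b2R_range (nh (ext g u))). lra.
   + rewrite E1_scal, E1_plus, E1_const by assumption.
    rewrite (E1_eqb g v (fun _ => -1)) by lia.
    rewrite step_prob_old by (assumption || nia).
    assert (m <= INR (degree g v)) by (apply le_INR, degree_completed; [assumption|lia|nia]).
    pose proof (cc_pos (length g)). pose proof (cc_upper (length g)).
    set (N := INR (length g) + 1). assert (1 <= N) by (unfold N; pose proof (pos_INR (length g)); lra).
    assert (q / N <= (INR (degree g v) + delta) / cc (length g)).
    { apply Rle_div_swap; [assumption|]. unfold q.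
     replace (gam * (m + delta) / N * cc (length g)) with ((m + delta) * (gam * cc (length g) / N)) by pos.
     assert (gam * cc (length g) / N <= 1) by (apply Rdiv_le_swap; unfold N in *; lra).
     apply Rle_trans with ((m + delta) * 1); pos. }
    apply Rle_trans with (K * exp (- (q / N))).
    * apply Rmult_le_compat_l; [lra|]. pose proof (exp_ge1 (- (q / N))). lra.
    * unfold K, Rpower. rewrite <- exp_plus. apply exp_mono. rewrite S_INR. fold N.
     assert (ln (N + 1) <= ln N + / N).
     { replace (N + 1) with (N * (1 + / N)) by pos.
      assert (0 < / N) by pos.
      rewrite ln_mult by lra. pose proof (ln_le_sub1 (1 + / N) ltac:(lra)). lra. }
     assert (q * ln (N + 1) <= q * (ln N + / N)) by pos.
     lra.
  - rewrite Rmult_0_l. rewrite <- (E1_const g 0 Hvl). apply E1_le; [assumption|]. intros u Hu. unfold F.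
   unfold nh in *. apply negb_false_iff in Hng. unfold ext. rewrite hit_from_app by assumption. simpl. lra. }
 set (Ce := Rpower (INR (m * t) + 1) q). assert (0 < Ce) by apply Rpower_pos.
 rewrite (E_ext _ _ _ (fun g => / Ce * F g)).
 - rewrite E_scal. pose proof (pos_INR (m * s0)). pose proof (pos_INR (m * t)).
  rewrite Rpower_div by lra.
  rewrite Rmult_comm. apply Rmult_le_compat_r; [pos|].
  eapply Rle_trans; [exact HF|]. unfold F. rewrite Hl.
  rewrite <- (Rmult_1_l (Rpower (INR (m * s0) + 1) q)) at 2. pos.
 - pos.
 - intros l Hvl Hn. unfold F. replace (length (h ++ l)) with (m * t)%nat by (rewrite length_app; nia). fold Ce.
  fold (nh (h ++ l)). pos.
Qed.

(** In phase A, [kA] levels long, [A k] bounds the weight fraction of bad vertices from time [sk k]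
    on. In phase B, [kB] levels long, at most [a j * s + M j] of the first [s] vertices are bad;
    [M j] pays for early vertices and fluctuations. The last level is used only after time [S3],
    where the share of [M kB] is small. *)
Variables (t Q S1 S3 kA kB : nat) (rho eta L1 x : R) (A : nat -> R) (sk : nat -> nat) (a M : nat -> R).

Definition far (Rad : nat) (h : history) : bool := existsb (fun v => negb (reach h t Rad v 1)) (seq 1 t).

Hypotheses (HS1 : (2 <= S1)%nat) (Hsk0 : sk 0 = S1) (Hskm : forall k, (sk k <= sk (S k))%nat)
 (HkA : (1 <= kA)%nat) (HS3 : (S1 <= S3 < t)%nat) (HL1 : 0 <= L1)
 (Hrho : forall s, (S1 <= s <= t)%nat -> rho * ln (INR t) <= ln (INR s))
 (HA0 : 1 - eta / (2 * INR m + 1) <= A 0%nat) (Heta : 0 <= eta)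
 (HB0 : forall s, (sk kA <= s)%nat -> A kA * cc (m * s) / (INR m + delta) <= a 0%nat * INR s)
 (HM0 : INR (sk kA) <= M 0%nat) (Ha : forall j, 0 <= a j) (HM : forall j, (j <= kB)%nat -> 4 * INR m <= L1 * M j /\ 0 <= M j)
 (HBstep : forall j s2, (j < kB)%nat -> (S1 <= s2 <= t)%nat ->
   INR S1 + 2 * sumL (fun s => (2 * L1 * a j) ^ m + 4 * L1 * M j / INR s) (seq S1 (s2 - S1)) + 3 * x
    <= a (S j) * INR s2 + M (S j))
 (HMS : forall j, (j <= kB)%nat -> INR S1 <= M j).

Lemma sk_ge k : (S1 <= sk k)%nat.
Proof. induction k; [lia|]. specialize (Hskm k). lia. Qed.

Lemma bad_prob_count k j g s : (j <= kB)%nat -> (1 <= s)%nat -> valid g -> length g = (m * s)%nat ->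
 w g (badset t Q k g s) <= L1 * (a j * s + M j) ->
 E m g (fun g' => b2R (bad t Q (S k) g' (S s))) <= (2 * L1 * a j) ^ m + (4 * L1 * M j / s) ^ m.
Proof.
 intros Hj Hs Hv Hl Hw. eapply Rle_trans; [apply bad_prob; assumption|].
 pose proof INRm_ge2. destruct (HM j Hj) as [HMj HM0'].
 assert (1 <= s) by (apply (le_INR 1); lia).
 assert (0 <= w g (badset t Q k g s)).
 { apply w_nonneg; [assumption|]. intros u Hu. apply filter_In in Hu as [Hu _].
  eapply in_seq1_completed; pos. }
 assert (s <= cc (m * s)).
 { rewrite cc_vertices. pose proof chi_range. pose proof md_pos. nra. }
 assert (0 <= L1 * a j) by pos.
 assert (0 <= 2 * L1 * M j / s) by pos.
 apply Rle_trans with ((L1 * a j + 2 * L1 * M j / s) ^ m).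
 - apply pow_incr. split; [pos|].
  apply Rle_trans with ((w g (badset t Q k g s) + 4 * m) / s).
  + apply Rmult_le_compat_l; [lra|]. pos.
  + apply Rdiv_le_swap; [lra|]. replace ((L1 * a j + 2 * L1 * M j / s) * s) with (L1 * a j * s + 2 * L1 * M j) by pos.
   lra.
 - eapply Rle_trans; [apply pow_sum_le; assumption|]. pos.
Qed.

Definition evA (k s2 : nat) (h : history) : bool :=
 let hs := firstn (m * s2) h in
 ok_weight t Q k (fun s => A k * cc (m * s)) (sk k) hs && Rltb (A (S k) * cc (m * s2)) (Wb t Q (S k) hs s2).

Definition yB (j s : nat) : R := L1 * (a j * INR s + M j).

Definition evB (j s2 : nat) (h : history) : bool :=
 let hs := firstn (m * s2) h in
 ok_weight t Q (kA + j) (yB j) S1 hs &&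
 Rleb (INR S1 + 2 * sumL (fun s => (2 * L1 * a j) ^ m + 4 * L1 * M j / INR s) (seq S1 (s2 - S1)) + 3 * x)
    (nbad t Q (S (kA + j)) hs s2).

Definition evC (s : nat) (h : history) : bool :=
 ok_weight t Q (kA + kB) (yB kB) S1 (firstn (m * s) h) && bad t Q (S (kA + kB)) (firstn (m * S s) h) (S s).

Lemma ok_weight_intro k y s1 h s2 : (m * s2 <= length h)%nat ->
 (forall s, (s1 <= s <= s2)%nat -> w (firstn (m * s) h) (badset t Q k (firstn (m * s) h) s) <= y s) ->
 ok_weight t Q k y s1 (firstn (m * s2) h) = true.
Proof.
 intros Hl H. assert (HmP := Hm). apply forallb_forall. intros s Hs. apply in_seq in Hs.
 rewrite length_firstn, Nat.min_l, Nat.mul_comm, Nat.div_mul in Hs by lia.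
 rewrite firstn_firstn. replace (Nat.min (m * s) (m * s2)) with (m * s)%nat by nia.
 apply Rleb_true, H. lia.
Qed.

Lemma badset_le_Wb k g s : valid g -> length g = (m * s)%nat -> w g (badset t Q k g s) <= Wb t Q k g s.
Proof.
 intros Hv Hl. apply sumL_incl.
 - apply NoDup_filter, seq_NoDup.
 - intros u Hu. apply filter_In in Hu as [Hu1 Hu2]. apply andb_true_iff in Hu2 as [_ Hu2]. apply filter_In. auto.
 - intros u Hu. apply filter_In in Hu as [Hu _]. destruct (in_seq1_completed s g s u Hl (le_n s) Hu) as [H1 H2].
  pose proof (degree_completed g u Hv H1 H2) as Hd. apply le_INR in Hd. pose proof md_pos. lra.
Qed.

(** The deterministic half of the argument, by induction on the levels. In the radius, [S (kA + kB)]
    steps lead from a vertex after [S3] to a good one, [Q] from there to vertex 1, and one more step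
    serves the vertices up to [S3]. *)
Lemma near_of_no_events h : valid h -> length h = (m * t)%nat ->
 times_fail t Q rho eta L1 h = false ->
 (forall k s2, (k < kA)%nat -> (sk (S k) <= s2 <= t)%nat -> evA k s2 h = false) ->
 (forall j s2, (j < kB)%nat -> (S1 <= s2 <= t)%nat -> evB j s2 h = false) ->
 (forall s, (S3 <= s < t)%nat -> evC s h = false) ->
 (forall v, (1 <= v <= S3)%nat -> hit_from h S3 (t - S3) v = true) ->
 far (kA + kB + Q + 2) h = false.
Proof.
 intros Hv Hl H0 HevA HevB HevC Hhit. pose proof md_pos as Hmd.
 assert (Hlen : forall s, (s <= t)%nat -> length (firstn (m * s) h) = (m * s)%nat) by (intros; rewrite length_firstn; nia).
 assert (Hvs : forall s, valid (firstn (m * s) h)) by pos.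
 assert (Hgt : forall s, (S1 <= s <= t)%nat -> good_time t Q eta L1 h s = true).
 { intros s Hs. destruct (good_time t Q eta L1 h s) eqn:Hg; [pos|].
  assert (times_fail t Q rho eta L1 h = true); [|pos].
  apply existsb_exists. exists s. split; [pos|]. rewrite Hg. rewrite andb_true_r.
  apply Rleb_true, Hrho. assumption. }
 (* Level 0 of [bad] is no restriction, so [badset] is the complement of the good vertices and [eta]
    bounds its weight. *)
 assert (HD0 : forall s, (S1 <= s <= t)%nat -> w (firstn (m * s) h) (badset t Q 0 (firstn (m * s) h) s) <= A 0%nat * cc (m * s)).
 { intros s Hs. specialize (Hgt s Hs). apply andb_true_iff in Hgt as [Hg1 _]. apply Rleb_true in Hg1.
  set (hs := firstn (m * s) h) in *.
  assert (Hsplit : w hs (seq 1 s) = w hs (filter (good t Q hs) (seq 1 s)) + w hs (badset t Q 0 hs s)).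
  { unfold w, badset. rewrite !sumL_filter, <- sumL_plus. apply sumL_ext. intros u _.
   destruct (good t Q hs u); simpl; ring. }
  rewrite (w_total hs s (Hvs s) (Hlen s ltac:(lia))) in Hsplit.
  pose proof (cc_vertices s) as Hcc. pose proof chi_range. pose proof Hd2.
  assert (1 <= s) by pos.
  assert (cc (m * s) <= (2 * m + 1) * s) by (rewrite Hcc; nra).
  assert (eta / (2 * m + 1) * cc (m * s) <= eta * s).
  { apply Rle_trans with (eta / (2 * m + 1) * ((2 * m + 1) * s)); [|right; field; lra].
   pos. }
  assert ((1 - eta / (2 * m + 1)) * cc (m * s) <= A 0%nat * cc (m * s)) by pos.
  lra. }
 assert (HDA : forall k, (k <= kA)%nat -> forall s, (sk k <= s <= t)%nat ->
   w (firstn (m * s) h) (badset t Q k (firstn (m * s) h) s) <= A k * cc (m * s) /\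
   ((1 <= k)%nat -> Wb t Q k (firstn (m * s) h) s <= A k * cc (m * s))).
 { induction k; intros Hk s Hs.
  - split; [apply HD0; lia|lia].
  - assert (HW : Wb t Q (S k) (firstn (m * s) h) s <= A (S k) * cc (m * s)).
   { specialize (HevA k s ltac:(lia) Hs). unfold evA in HevA.
    rewrite ok_weight_intro in HevA.
    - apply Rltb_false in HevA. pos.
    - nia.
    - intros s' Hs'. apply IHk; lia. }
   split; [|auto]. eapply Rle_trans; [apply badset_le_Wb; [pos|apply Hlen; lia]|pos]. }
 assert (HDB : forall j, (j <= kB)%nat -> forall s, (s <= t)%nat -> nbad t Q (kA + j) (firstn (m * s) h) s <= a j * s + M j).
 { assert (Htriv : forall k s, nbad t Q k (firstn (m * s) h) s <= s).
  { intros. apply le_INR. eapply Nat.le_trans; [apply filter_length_le|]. rewrite length_seq. lia. }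
  induction j; intros Hj s Hs.
  - rewrite Nat.add_0_r. pose proof (pos_INR s). destruct (Nat.le_gt_cases (sk kA) s) as [Hge|Hlt].
   + destruct (HDA kA (le_n _) s ltac:(lia)) as [_ HW]. specialize (HW HkA).
    assert (nbad t Q kA (firstn (m * s) h) s * (m + delta) <= Wb t Q kA (firstn (m * s) h) s).
    { unfold nbad, Wb, w. rewrite Rmult_comm, <- sumL_const. apply sumL_le. intros u Hu. apply filter_In in Hu as [Hu _].
     destruct (in_seq1_completed s _ s u (Hlen s Hs) (le_n s) Hu) as [H1 H2].
     pose proof (degree_completed _ u (Hvs s) H1 H2). pos. }
    specialize (HB0 s Hge). destruct (HM 0%nat ltac:(lia)) as [_ HM00].
    assert (nbad t Q kA (firstn (m * s) h) s <= A kA * cc (m * s) / (m + delta)) by pos.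
    lra.
   + apply Rle_trans with s; [pos|]. assert (s <= INR (sk kA)) by pos.
    specialize (Ha 0%nat). nra.
  - destruct (Nat.le_gt_cases S1 s) as [Hge|Hlt].
   + specialize (HevB j s ltac:(lia) ltac:(lia)). unfold evB in HevB.
    rewrite ok_weight_intro in HevB.
    * apply Rleb_false in HevB. specialize (HBstep j s ltac:(lia) ltac:(lia)).
     replace (kA + S j)%nat with (S (kA + j)) by lia. lra.
    * nia.
    * intros s' Hs'. specialize (IHj ltac:(lia) s' ltac:(lia)).
     eapply Rle_trans; [|apply Rmult_le_compat_l; [pos|exact IHj]].
     specialize (Hgt s' ltac:(lia)). apply andb_true_iff in Hgt as [_ Hg2]. rewrite forallb_forall in Hg2.
     set (hs := firstn (m * s') h) in *.
     apply Rle_trans with (sumL (fun _ : nat => L1) (badset t Q (kA + j) hs s')).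
     -- apply sumL_le. intros u Hu. apply filter_In in Hu as [Hu1 Hu2]. apply andb_true_iff in Hu2 as [Hu2 _].
       specialize (Hg2 u Hu1). apply negb_true_iff in Hu2. rewrite Hu2 in Hg2. apply Rleb_true in Hg2.
       pose proof Hd2. lra.
     -- rewrite sumL_const. apply Rmult_le_compat_l; [assumption|]. apply le_INR.
       apply NoDup_incl_length; [apply NoDup_filter, seq_NoDup|].
       intros u Hu. apply filter_In in Hu as [Hu1 Hu2]. apply andb_true_iff in Hu2 as [_ Hu2]. apply filter_In. auto.
   + apply Rle_trans with s; [pos|]. assert (s <= S1) by pos.
    specialize (Ha (S j)). pose proof (pos_INR s). specialize (HMS (S j) Hj). nra. }
 assert (HDC : forall v, (S3 < v <= t)%nat -> near h (kA + kB + Q + 1) v 1).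
 { intros v Hvt. destruct v as [|s]; [lia|]. specialize (HevC s ltac:(lia)). unfold evC in HevC.
  rewrite ok_weight_intro in HevC.
  -
   assert (bad t Q (S (kA + kB)) h (S s) = false).
   { rewrite <- HevC. rewrite <- (firstn_skipn (m * S s) h) at 1. apply bad_stable.
    - rewrite firstn_skipn. assumption.
    - lia.
    - rewrite Hlen by lia. lia. }
   replace (kA + kB + Q + 1)%nat with (S (kA + kB) + Q)%nat by lia. apply (bad_near t Q); pos.
  - nia.
  - intros s' Hs'. specialize (HDB kB (le_n _) s' ltac:(lia)).
   eapply Rle_trans; [|apply Rmult_le_compat_l; [pos|exact HDB]].
   specialize (Hgt s' ltac:(lia)). apply andb_true_iff in Hgt as [_ Hg2]. rewrite forallb_forall in Hg2.
   set (hs := firstn (m * s') h) in *.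
   apply Rle_trans with (sumL (fun _ : nat => L1) (badset t Q (kA + kB) hs s')).
   + apply sumL_le. intros u Hu. apply filter_In in Hu as [Hu1 Hu2]. apply andb_true_iff in Hu2 as [Hu2 _].
    specialize (Hg2 u Hu1). apply negb_true_iff in Hu2. rewrite Hu2 in Hg2. apply Rleb_true in Hg2.
    pose proof Hd2. lra.
   + rewrite sumL_const. apply Rmult_le_compat_l; [assumption|]. apply le_INR.
    apply NoDup_incl_length; [apply NoDup_filter, seq_NoDup|].
    intros u Hu. apply filter_In in Hu as [Hu1 Hu2]. apply andb_true_iff in Hu2 as [_ Hu2]. apply filter_In. auto. }
 destruct (far (kA + kB + Q + 2) h) eqn:Hfar; [|pos].
 apply existsb_exists in Hfar as (v & Hvin & Hvr). apply in_seq in Hvin.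
 assert (near h (kA + kB + Q + 2) v 1); [|rewrite near_reach in Hvr; pos].
 destruct (Nat.le_gt_cases v S3) as [Hle|Hgt'].
 - specialize (Hhit v ltac:(lia)). apply existsb_exists in Hhit as (z & Hz & Hme). apply in_seq in Hz.
  apply mem_edge_In in Hme. replace (kA + kB + Q + 2)%nat with (1 + (kA + kB + Q + 1))%nat by lia.
  apply near_trans with z; [apply near_sym, near_adj, adj_In; assumption|]. apply HDC. lia.
 - apply near_le with (kA + kB + Q + 1)%nat; [apply HDC; lia|lia].
Qed.

Lemma far_prob P0 pA pD :
 E (m * t) [] (fun h => b2R (times_fail t Q rho eta L1 h)) <= P0 ->
 (forall k s2, (k < kA)%nat -> (sk (S k) <= s2 <= t)%nat ->
  E (m * s2) [] (fun h => b2R (ok_weight t Q k (fun s => A k * cc (m * s)) (sk k) h &&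
    Rltb (A (S k) * cc (m * s2)) (Wb t Q (S k) h s2))) <= pA) -> 0 <= pA ->
 (forall v, (1 <= v <= S3)%nat -> E (m * t) [] (fun h => b2R (negb (hit_from h S3 (t - S3) v))) <= pD) ->
 E (m * t) [] (fun h => b2R (far (kA + kB + Q + 2) h)) <=
  P0 + INR kA * (INR t * pA) + INR kB * (INR t * exp (- (3 * x)))
  + sumL (fun s => (2 * L1 * a kB) ^ m + (4 * L1 * M kB / INR s) ^ m) (seq S3 (t - S3)) + INR S3 * pD.
Proof.
 intros H0 HpA HpA0 HpD. assert (HmP := Hm).
 set (fA := fun k h => sumL (fun s2 => b2R (Nat.leb (sk (S k)) s2 && evA k s2 h)) (seq 1 t)).
 set (fB := fun j h => sumL (fun s2 => b2R (Nat.leb S1 s2 && evB j s2 h)) (seq 1 t)).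
 apply Rle_trans with (E (m * t) [] (fun h => b2R (times_fail t Q rho eta L1 h) + (sumL (fun k => fA k h) (seq 0 kA) +
   (sumL (fun j => fB j h) (seq 0 kB) + (sumL (fun s => b2R (evC s h)) (seq S3 (t - S3))
    + sumL (fun v => b2R (negb (hit_from h S3 (t - S3) v))) (seq 1 S3)))))).
 - apply E_le; [pos|]. intros h Hv Hl. simpl app in *.
  assert (HnA : forall k, 0 <= fA k h) by (intros; apply sumL_nonneg; intros; apply b2R_range).
  assert (HnB : forall k, 0 <= fB k h) by (intros; apply sumL_nonneg; intros; apply b2R_range).
  assert (HsA : 0 <= sumL (fun k => fA k h) (seq 0 kA)) by pos.
  assert (HsB : 0 <= sumL (fun k => fB k h) (seq 0 kB)) by pos.
  assert (HsC : 0 <= sumL (fun s => b2R (evC s h)) (seq S3 (t - S3))) by pos.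
  assert (HsD : 0 <= sumL (fun v => b2R (negb (hit_from h S3 (t - S3) v))) (seq 1 S3)) by pos.
  pose proof (b2R_range (times_fail t Q rho eta L1 h)).
  destruct (far (kA + kB + Q + 2) h) eqn:Hfar; [|change (b2R false) with 0; lra]. change (b2R true) with 1.
  destruct (times_fail t Q rho eta L1 h) eqn:Htf; [change (b2R true) with 1 in *; lra|].
  destruct (existsb (fun k => existsb (fun s2 => Nat.leb (sk (S k)) s2 && evA k s2 h) (seq 1 t)) (seq 0 kA)) eqn:HxA.
  { apply existsb_exists in HxA as (k & Hk & HxA). pose proof (b2R_existsb_le (fun s2 => Nat.leb (sk (S k)) s2 && evA k s2 h) (seq 1 t)) as H1.
   rewrite HxA in H1. change (b2R true) with 1 in H1. fold (fA k h) in H1.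
   pose proof (sumL_In_le (fun k => fA k h) (seq 0 kA) k (fun y _ => HnA y) Hk). lra. }
  destruct (existsb (fun k => existsb (fun s2 => Nat.leb S1 s2 && evB k s2 h) (seq 1 t)) (seq 0 kB)) eqn:HxB.
  { apply existsb_exists in HxB as (k & Hk & HxB). pose proof (b2R_existsb_le (fun s2 => Nat.leb S1 s2 && evB k s2 h) (seq 1 t)) as H1.
   rewrite HxB in H1. change (b2R true) with 1 in H1. fold (fB k h) in H1.
   pose proof (sumL_In_le (fun k => fB k h) (seq 0 kB) k (fun y _ => HnB y) Hk). lra. }
  destruct (existsb (fun s => evC s h) (seq S3 (t - S3))) eqn:HxC.
  { pose proof (b2R_existsb_le (fun s => evC s h) (seq S3 (t - S3))) as H1. rewrite HxC in H1. change (b2R true) with 1 in H1. lra. }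
  destruct (existsb (fun v => negb (hit_from h S3 (t - S3) v)) (seq 1 S3)) eqn:HxD.
  { pose proof (b2R_existsb_le (fun v => negb (hit_from h S3 (t - S3) v)) (seq 1 S3)) as H1. rewrite HxD in H1. change (b2R true) with 1 in H1. lra. }
  assert (Hex : forall (T : Type) (p : T -> bool) l y, existsb p l = false -> In y l -> p y = false).
  { intros T p l y Hp Hy. destruct (p y) eqn:Hpy; [|pos]. rewrite <- Hp. symmetry. apply existsb_exists. eauto. }
  assert (far (kA + kB + Q + 2) h = false); [|pos].
  apply near_of_no_events; auto.
  + intros k s2 Hk Hs2. pose proof (Hex _ _ _ k HxA ltac:(apply in_seq; lia)) as Hy.
   assert ((1 <= s2)%nat) by (pose proof (sk_ge (S k)); lia).
   pose proof (Hex _ _ _ s2 Hy ltac:(apply in_seq; lia)) as Hz.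
   apply andb_false_iff in Hz as [Hz|Hz]; [apply Nat.leb_gt in Hz; lia|assumption].
  + intros j s2 Hj Hs2. pose proof (Hex _ _ _ j HxB ltac:(apply in_seq; lia)) as Hy.
   pose proof (Hex _ _ _ s2 Hy ltac:(apply in_seq; lia)) as Hz.
   apply andb_false_iff in Hz as [Hz|Hz]; [apply Nat.leb_gt in Hz; lia|assumption].
  + intros s Hs. apply (Hex _ _ _ s HxC). pos.
  + intros v Hv'. pose proof (Hex _ _ _ v HxD ltac:(apply in_seq; lia)) as Hy. apply negb_false_iff in Hy. assumption.
 - rewrite !E_plus, !E_sumL. rewrite !Rplus_assoc. repeat apply Rplus_le_compat.
  + pos.
  + apply Rle_trans with (sumL (fun _ : nat => t * pA) (seq 0 kA)); [|rewrite sumL_const, length_seq; lra].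
   apply sumL_le. intros k Hk. apply in_seq in Hk. unfold fA. rewrite E_sumL.
   apply Rle_trans with (sumL (fun _ : nat => pA) (seq 1 t)); [|rewrite sumL_const, length_seq; lra].
   apply sumL_le. intros s2 Hs2. apply in_seq in Hs2.
   destruct (Nat.leb_spec (sk (S k)) s2) as [Hle|Hgt].
   * eapply Rle_trans; [|apply (HpA k s2); lia]. right.
    apply (E_firstn t s2 (fun g => b2R (ok_weight t Q k (fun s => A k * cc (m * s)) (sk k) g && Rltb (A (S k) * cc (m * s2)) (Wb t Q (S k) g s2)))). lia.
   * apply E_le_const; [pos|]. pos.
  + apply Rle_trans with (sumL (fun _ : nat => t * exp (- (3 * x))) (seq 0 kB)); [|rewrite sumL_const, length_seq; lra].
   apply sumL_le. intros j Hj. apply in_seq in Hj. unfold fB. rewrite E_sumL.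
   apply Rle_trans with (sumL (fun _ : nat => exp (- (3 * x))) (seq 1 t)); [|rewrite sumL_const, length_seq; lra].
   apply sumL_le. intros s2 Hs2. apply in_seq in Hs2.
   destruct (Nat.leb_spec S1 s2) as [Hle|Hgt].
   *
    eapply Rle_trans; [|apply (nbad_tail t Q (kA + j) (yB j) (fun s => (2 * L1 * a j) ^ m + 4 * L1 * M j / s) S1 s2 (3 * x) Hle)].
    -- right. apply (E_firstn t s2 (fun g => b2R (ok_weight t Q (kA + j) (yB j) S1 g &&
       Rleb (S1 + 2 * sumL (fun s => (2 * L1 * a j) ^ m + 4 * L1 * M j / INR s) (seq S1 (s2 - S1)) + 3 * x) (nbad t Q (S (kA + j)) g s2)))). lia.
    -- intros s g Hs Hg Hgl Hw.
      destruct (HM j ltac:(lia)) as [_ HMj].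
      assert (0 <= 4 * L1 * M j / s) by pos.
      assert (0 <= (2 * L1 * a j) ^ m) by pos.
      (* The compensator is linear in this quotient [z]: [z^m <= z] for [z <= 1], and for [z > 1]
         the bound is trivial. *)
      destruct (Rle_dec (4 * L1 * M j / s) 1) as [Hz1|Hz1].
      ++ eapply Rle_trans; [apply (bad_prob_count (kA + j) j g s); try assumption; lia|].
       set (z := 4 * L1 * M j / INR s) in *.
       destruct m as [|mm]; [lia|]. simpl. rewrite <- (Rmult_1_r z) at 3.
       rewrite <- (pow1 mm). pos.
      ++ apply Rle_trans with 1; [|lra]. apply E_le_const; [assumption|]. pos.
    --
      destruct (HM j ltac:(lia)) as [_ HMj].
      pos.
   * apply E_le_const; [pos|]. intros; simpl. pos.
  + apply sumL_le. intros s Hs. apply in_seq in Hs.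
   apply Rle_trans with (E (m * S s) [] (fun g => b2R (ok_weight t Q (kA + kB) (yB kB) S1 (firstn (m * s) g) && bad t Q (S (kA + kB)) g (S s)))).
   * right. rewrite <- (E_firstn t (S s)) by lia. apply E_ext; [pos|]. intros l Hvl Hn.
    rewrite firstn_firstn. replace (Nat.min (m * s) (m * S s)) with (m * s)%nat by nia. pos.
   * replace (m * S s)%nat with (m * s + m)%nat by lia. rewrite E_add. apply E_le_const; [pos|].
    intros g Hg Hgl. simpl app in *.
    destruct (ok_weight t Q (kA + kB) (yB kB) S1 g) eqn:Hok.
    -- eapply Rle_trans; [|apply (bad_prob_count (kA + kB) kB g s); try assumption; try lia].
      ++ apply E_le; [assumption|]. intros l Hvl Hn. rewrite firstn_app_le by lia. rewrite <- Hgl, firstn_all, Hok. pos.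
      ++ apply (ok_weight_cur t Q (kA + kB) (yB kB) S1 g s Hgl); pos.
    -- apply Rle_trans with 0.
      ++ apply E_le_const; [assumption|]. intros l Hvl Hn. rewrite firstn_app_le by lia. rewrite <- Hgl, firstn_all, Hok. pos.
      ++ destruct (HM kB (le_n _)) as [_ HMj].
       pos.
  + apply Rle_trans with (sumL (fun _ : nat => pD) (seq 1 S3)); [|rewrite sumL_const, length_seq; lra].
   apply sumL_le. intros v Hv. apply in_seq in Hv. apply HpD. lia.
Qed.

End Upper.

Lemma ev_ln_sq C : ev (fun x => C * ln x ^ 2 <= x).
Proof.
 generalize (ev_and _ _ (ev_comp_ln _ (ev_pow_exp 2 1 C ltac:(lra))) (ev_ge 1)). apply ev_mono.
 intros x [H1 H2]. rewrite Rmult_1_l, exp_ln in H1 by lra. pos.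
Qed.

Lemma ev_exp_small a c : 0 < a -> 0 < c -> ev (fun x => exp (- (a * x)) <= c).
Proof.
 intros Ha Hc. generalize (ev_ge_exp a (/ c) Ha). apply ev_mono. intros x Hx.
 rewrite exp_Ropp. rewrite <- (Rinv_inv c). pos.
Qed.

Lemma ln_15 : 1/3 <= ln (3/2).
Proof.
 pose proof (ln_le_sub1 (/ (3/2)) ltac:(apply Rinv_0_lt_compat; lra)) as H.
 rewrite ln_Rinv in H by lra. lra.
Qed.

Lemma nceil_pos y : (1 <= nceil y)%nat.
Proof. unfold nceil. lia. Qed.

Lemma Rmul_ge1 a b : 1 <= a -> 0 <= b -> b <= a * b.
Proof. nra. Qed.

Lemma sq_ge l : 1 <= l -> l <= l ^ 2.
Proof. nra. Qed.

Lemma cubic_bounds x M : 4096 + M <= x -> 2 <= M ->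
 1024 * M <= 1024 * (x ^ 2 + M) /\ 1024 <= 1024 * (x ^ 2 + M) /\ 2 * (1024 * (x ^ 2 + M)) <= x ^ 3 /\ 5 * (1 + x) <= x ^ 2.
Proof.
 repeat split; nra.
Qed.

(** * Upper bound: choice of the constants *)

Section UpperAsymptotics.
Context {P : PAmodel}.

Lemma lnm_pos : 0 < ln m.
Proof. rewrite <- ln_1. apply ln_increasing; pose proof INRm_ge2; lra. Qed.

Theorem upper_whp (e epsp : R) : 0 < e -> 0 < epsp ->
 ev (fun x => forall t, (1 <= t)%nat -> ln (INR t) = x -> exists Rad,
   INR Rad <= (1 / ln (INR m) + 2 / (- ln kappa) + e) * ln x /\
   E (m * t) [] (fun h => b2R (far t Rad h)) <= epsp).
Proof.
 intros He Hep.
 pose proof gam_range as Hgam. pose proof INRm_ge2 as Hm2. pose proof md_pos as Hmd. pose proof Hd2 as Hd2'. assert (HmP := Hm).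
 pose proof lnm_pos as Hlm.
 destruct weight_level as (K & S0 & HK & Hwl).
 set (c5 := gam * (INR m + delta)). assert (Hc5 : 0 < c5) by (apply Rmult_lt_0_compat; lra).
 (* The recursion starts at [S1], about [t^rho], and its last level is applied after [S3], about
    [t^(10 * rho)]. A vertex up to [S3] is missed with probability about
    [t^(- c5 * (1 - 10 * rho))]; the second bound on [rho] makes the sum over these vertices tend to
    0. *)
 set (rho := Rmin (1/40) (c5 / (40 * (1 + c5)))).
 assert (Hrho : 0 < rho) by (apply Rmin_glb_lt; pos).
 assert (Hrho1 : rho <= 1/40) by apply Rmin_l.
 assert (Hrho2 : 40 * rho * (1 + c5) <= c5).
 { assert (rho <= c5 / (40 * (1 + c5))) by apply Rmin_r.
  apply Rle_trans with (40 * (c5 / (40 * (1 + c5))) * (1 + c5)); [|right; field; lra].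
  pos. }
 (* Phase A takes at most [9 * s0 * l + 1] levels, and [s0 <= e / 64] keeps them within the
    tolerance [e]. *)
 set (s0 := Rmin (1/8) (e / 64)).
 assert (Hs0 : 0 < s0) by (apply Rmin_glb_lt; lra).
 assert (Hs0a : s0 <= 1/8) by apply Rmin_l. assert (Hs0b : s0 <= e / 64) by apply Rmin_r.
 (* A ratio [F] of about [x^c3] between successive times reduces the influence [(s1 / s2)^(1 - gam)]
    of earlier vertices to [x^(-15)], which is below the slack of a level as long as
    [y k <= 9 * l]. *)
 set (c3 := 15 / (1 - gam)). assert (Hc3 : 0 < c3) by (apply Rdiv_lt_0_compat; lra).
 set (C9 := 4 + 5 * (/ ln (INR m) + 1)).
 assert (Hilm : 0 < / ln m) by pos.
 assert (Hev : ev (fun x =>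
   4096 + m <= x /\ 2 <= ln x /\ ln x <= x /\
   2 <= exp (rho * x) /\ S0 <= exp (rho * x) /\ 1 * x <= exp (rho * x) /\ 3 * x <= exp (rho / 4 * x) /\
   (2 * m + 1) / (m + delta) <= exp (1 * ln x) /\
   (2 / rho * (1 + 8 * (1 + c3))) * ln x ^ 2 <= x /\
   K * 512 * (2 * m + 1) <= exp (1 * ln x) /\
   ln (9 * 128 * (2 * m + 1)) + ln (ln x) <= s0 * ln x /\
   (2 / rho * C9) * ln x ^ 2 <= x /\
   16 / e <= ln x /\
   8 / epsp <= x /\
   (8 * K + / ln m + 1) * (8 / epsp) <= exp (1 * x) /\
   exp (- (1 * x)) <= epsp / 8 /\
   exp (- (2 * rho * x)) <= epsp / 16 /\
   exp (- (3 / 4 * c5 * x)) <= epsp / (16 * Rpower 4 c5))).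
 { repeat apply ev_and.
  - apply ev_ge.
  - apply ev_ln_ge.
  - generalize (ev_ln_lin 1). apply ev_mono. pos.
  - apply ev_ge_exp; assumption.
  - apply ev_ge_exp; assumption.
  - apply ev_lin_exp; assumption.
  - apply ev_lin_exp; lra.
  - apply (ev_comp_ln (fun y => (2 * m + 1) / (m + delta) <= exp (1 * y))). apply ev_ge_exp; lra.
  - apply ev_ln_sq.
  - apply (ev_comp_ln (fun y => K * 512 * (2 * m + 1) <= exp (1 * y))). apply ev_ge_exp; lra.
  - apply (ev_comp_ln (fun y => ln (9 * 128 * (2 * m + 1)) + ln y <= s0 * y)).
   generalize (ev_and _ _ (ev_ln_lin (2 / s0)) (ev_ge (2 * ln (9 * 128 * (2 * m + 1)) / s0))).
   apply ev_mono. intros y [H1 H2].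
   assert (s0 / 2 * (2 / s0 * ln y) <= s0 / 2 * y) by pos.
   assert (s0 / 2 * (2 * ln (9 * 128 * (2 * m + 1)) / s0) <= s0 / 2 * y) by pos.
   replace (s0 / 2 * (2 / s0 * ln y)) with (ln y) in H by pos.
   replace (s0 / 2 * (2 * ln (9 * 128 * (2 * m + 1)) / s0)) with (ln (9 * 128 * (2 * m + 1))) in H0 by pos.
   lra.
  - apply ev_ln_sq.
  - apply ev_ln_ge.
  - apply ev_ge.
  - apply ev_ge_exp; lra.
  - apply ev_exp_small; lra.
  - apply ev_exp_small; lra.
  - apply ev_exp_small; [lra|]. pos. }
 pose proof (good_times_whp (e / 4) s0 rho ltac:(lra) ltac:(lra) ltac:(lra)) as Hgt.
 generalize (ev_and _ _ Hgt Hev). apply ev_mono. clear Hgt Hev.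
 intros x (Hgt & H1 & H2 & H3 & H4 & H5 & H6 & H7 & H8 & H9 & H10 & H11 & H12 & H13 & H14 & H15 & H16 & H17 & H18) t Ht Htx.
 destruct (Hgt t Ht Htx) as (Q & HQ & HP0).
 set (l := ln x) in *. assert (Hx0 : 0 < x) by lra.
 assert (Hxl : exp l = x) by (unfold l; apply exp_ln; assumption).
 assert (Htexp : INR t = exp x) by (rewrite <- Htx, exp_ln; pos).
 set (L1 := 1024 * (x ^ 2 + INR m)) in *. set (eta := exp (- (2 * s0 * l)) / 128) in *.
 set (et := eta / (2 * INR m + 1)).
 assert (Hs0l : 0 <= s0 * l <= 1/8 * l) by pos.
 assert (Hrx0 : 0 <= rho * x <= 1/40 * x) by pos.
 assert (Hlsq : l <= l ^ 2) by (apply sq_ge; lra).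
 assert (Hexp1 : exp (- (2 * s0 * l)) <= 1) by (rewrite <- exp_0; apply exp_mono; lra).
 assert (Heta : 0 < eta <= 1/128) by (unfold eta; pose proof (exp_pos (- (2 * s0 * l))); lra).
 assert (Het : 0 < et <= 1/128).
 { split; [apply Rdiv_lt_0_compat; lra|]. apply Rdiv_le_swap; lra. }
 set (S1 := nceil (exp (rho * x))). set (S3 := nceil (exp (10 * rho * x))). set (F := nceil (exp (c3 * l))).
 pose proof (nceil_spec (exp (rho * x)) ltac:(left; apply exp_pos)) as HS1. fold S1 in HS1.
 pose proof (nceil_spec (exp (10 * rho * x)) ltac:(left; apply exp_pos)) as HS3. fold S3 in HS3.
 pose proof (nceil_spec (exp (c3 * l)) ltac:(left; apply exp_pos)) as HF. fold F in HF.
 assert (HF1 : (1 <= F)%nat) by apply nceil_pos.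
 clearbody S1 S3 F.
 set (sk := fun k => (S1 * F ^ k)%nat).
 set (y := fun k => Rmin ((3/2) ^ k * et) (9 * l)). set (A := fun k => exp (- y k)).
 set (a := fun j => exp (- (INR m ^ j * l + 7 * l))).
 set (G1 := 10 * L1 * (1 + x)). set (M := fun j => exp (2 * rho * x) * G1 ^ j).
 set (kA := nceil (ln (9 * l / et) / ln (3/2))). set (kB := nceil (l / ln (INR m))).
 pose proof ln_15 as Hl15.
 assert (H9et : 1 <= 9 * l / et) by pos.
 assert (HkA : ln (9 * l / et) / ln (3/2) <= kA <= ln (9 * l / et) / ln (3/2) + 1).
 { apply nceil_spec. apply Rmult_le_pos; [|pos]. rewrite <- ln_1. pos. }
 assert (HkB : l / ln m <= kB <= l / ln m + 1).
 { apply nceil_spec. pos. }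
 assert (HkA1 : (1 <= kA)%nat) by apply nceil_pos.
 clearbody kA kB.
 assert (HkA2 : kA <= 9 * s0 * l + 1).
 { assert (ln (9 * l / et) <= 3 * s0 * l).
  { unfold et, eta. replace (9 * l / (exp (- (2 * s0 * l)) / 128 / (2 * m + 1))) with
    (9 * 128 * (2 * m + 1) * l * exp (2 * s0 * l)).
   - rewrite ln_mult, ln_mult, ln_exp by pos. lra.
   - rewrite exp_Ropp. pose proof (exp_pos (2 * s0 * l)). pos. }
  destruct HkA as [_ HkA']. eapply Rle_trans; [exact HkA'|]. apply Rplus_le_compat_r.
  apply Rdiv_le_swap; [lra|]. apply Rle_trans with (9 * s0 * l * (1/3)); pos. }
 assert (HkA8 : kA <= 8 * l) by lra.
 destruct (cubic_bounds x m H1 Hm2) as (Hcb1 & Hcb2 & Hcb3 & Hcb4).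
 assert (HL1 : 1024 * m <= L1 /\ 1024 <= L1 /\ 2 * L1 <= exp (3 * l)).
 { replace (exp (3 * l)) with (x ^ 3) by (rewrite <- Hxl at 1; rewrite exp_pow_nat; f_equal; simpl; ring). auto. }
 assert (HG1 : 1 <= G1 /\ G1 <= exp (5 * l)).
 { unfold G1. split; [apply Rle_trans with (1 * 1); pos|].
  replace (5 * l) with (3 * l + 2 * l) by ring. rewrite exp_plus.
  replace (exp (2 * l)) with (x ^ 2) by (rewrite <- Hxl at 1; rewrite exp_pow_nat; f_equal; simpl; ring).
  apply Rle_trans with (2 * L1 * (5 * (1 + x))); [pos|]. pos. }
 assert (HM1 : forall j, exp (2 * rho * x) <= M j).
 { intros j. unfold M. pose proof (exp_pos (2 * rho * x)). assert (1 <= G1 ^ j) by pos.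
  rewrite (Rmult_comm (exp (2 * rho * x))). apply Rmul_ge1; lra. }
 assert (He2 : 2 * exp (rho * x) <= exp (2 * rho * x)).
 { replace (2 * rho * x) with (rho * x + rho * x) by ring. rewrite exp_plus. pos. }
 assert (HS1M : forall j, S1 <= M j) by (intros j; specialize (HM1 j); lra).
 assert (HS12 : (2 <= S1)%nat) by (apply INR_le; change (INR 2) with (1 + 1); lra).
 assert (He10 : 2 * exp (rho * x) <= exp (10 * rho * x)) by (eapply Rle_trans; [exact He2|]; apply exp_mono; lra).
 assert (HS13 : (S1 <= S3)%nat) by (apply INR_le; lra).
 assert (He10x : 2 * exp (10 * rho * x) < exp x).
 { apply Rle_lt_trans with (exp (rho * x) * exp (10 * rho * x)); [pos|].
  rewrite <- exp_plus. apply exp_increasing. lra. }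
 assert (HS3t : (S3 < t)%nat) by (apply INR_lt; lra).
 assert (Hskm : forall k, (sk k <= sk (S k))%nat).
 { unfold sk. simpl. nia. }
 assert (Hskge : forall k, (S1 <= sk k)%nat).
 { intros k. unfold sk. assert (1 <= F ^ k)%nat by (pose proof (Nat.pow_nonzero F k); lia). nia. }
 assert (Hy : forall k, et <= y k <= 9 * l).
 { split; [|apply Rmin_r]. apply Rmin_glb; [|lra].
  assert (1 <= (3/2) ^ k) by pos. apply Rmul_ge1; lra. }
 assert (HyS : forall k, y (S k) <= 3/2 * y k).
 { intros k. unfold y. simpl. destruct (Rle_dec ((3/2) ^ k * et) (9 * l)).
  - rewrite (Rmin_left ((3/2) ^ k * et)) by assumption. eapply Rle_trans; [apply Rmin_l|]. lra.
  - rewrite (Rmin_right ((3/2) ^ k * et)) by lra. eapply Rle_trans; [apply Rmin_r|]. lra. }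
 assert (HykA : y kA = 9 * l).
 { apply Rmin_right.
  replace ((3/2) ^ kA) with (exp (kA * ln (3/2))) by (rewrite <- exp_pow_nat, exp_ln; lra).
  assert (9 * l / et <= exp (kA * ln (3/2))).
  { rewrite <- (exp_ln (9 * l / et)) by lra. apply exp_mono.
   apply Rle_trans with (ln (9 * l / et) / ln (3/2) * ln (3/2)); [right; field; lra|].
   pos. }
  assert (9 * l / et * et <= exp (kA * ln (3/2)) * et) by pos.
  replace (9 * l / et * et) with (9 * l) in H0 by pos. lra. }
 assert (Hapos : forall j, 0 < a j) by (intros; apply exp_pos).
 assert (Hastep : forall j, 2 * (2 * L1 * a j) ^ m <= a (S j)).
 { intros j. apply Rle_trans with (exp l * (exp (3 * l) * a j) ^ m).
  -
   pos.
  - unfold a. rewrite <- exp_plus, exp_pow_nat, <- exp_plus. apply exp_mono. simpl pow.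
   assert (2 * l <= m * l) by pos. lra. }
 set (Rad := (kA + kB + Q + 2)%nat). exists Rad. split.
 { unfold Rad. rewrite !plus_INR. simpl (INR 2).
  assert (4 <= e / 4 * l).
  { apply Rle_trans with (e / 4 * (16 / e)); [right; field; lra|pos]. }
  assert (9 * s0 * l <= 9 * (e / 64) * l) by pos.
  lra. }
 eapply Rle_trans.
 { apply (far_prob t Q S1 S3 kA kB rho eta L1 x A sk a M HS12) with (P0 := / x) (pA := K * exp (- exp (rho / 4 * x)))
   (pD := Rpower 4 c5 * exp (c5 * (10 * rho * x - x))).
  - unfold sk. simpl. lia.
  - pos.
  - pos.
  - lia.
  - lra.
  - intros s Hs. rewrite Htx. rewrite <- (ln_exp (rho * x)). apply ln_mono; [pos|].
   assert (S1 <= s) by pos. lra.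
  - fold et. unfold A. pose proof (exp_ge1 (- y 0%nat)). assert (y 0%nat <= et) by (unfold y; eapply Rle_trans; [apply Rmin_l|]; simpl; lra). lra.
  - lra.
  - intros s Hs. unfold A, a.
   assert (1 <= s) by (apply (le_INR 1); pose proof (Hskge kA); lia).
   pose proof (cc_vertices s). pose proof chi_range.
   assert (s * delta <= s * 0) by pos.
   apply Rle_trans with (exp (- (9 * l)) * ((2 * m + 1) * s) / (m + delta)).
   + pos.
   + replace (exp (- (9 * l)) * ((2 * m + 1) * s) / (m + delta)) with
     (exp (- (9 * l)) * ((2 * m + 1) / (m + delta)) * s) by pos.
    apply Rmult_le_compat_r; [lra|].
    apply Rle_trans with (exp (- (9 * l)) * exp (1 * l)); [pos|].
    rewrite <- exp_plus. pos.
  - unfold sk. rewrite mult_INR, pow_INR. apply Rle_trans with (exp (2 * rho * x)); [|pos].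
   assert (S1 <= exp (l + rho * x)).
   { rewrite exp_plus, Hxl. assert (2 * exp (rho * x) <= x * exp (rho * x)) by pos. lra. }
   assert (F <= exp ((1 + c3) * l)).
   { replace ((1 + c3) * l) with (l + c3 * l) by ring. rewrite exp_plus, Hxl.
    assert (1 <= exp (c3 * l)) by (rewrite <- exp_0; apply exp_mono; apply Rmult_le_pos; lra).
    assert (2 * exp (c3 * l) <= x * exp (c3 * l)) by pos. lra. }
   apply Rle_trans with (exp (l + rho * x) * exp ((1 + c3) * l) ^ kA).
   + pos.
   + rewrite exp_pow_nat, <- exp_plus. apply exp_mono.
    assert (kA * ((1 + c3) * l) <= 8 * l * ((1 + c3) * l)) by pos.
    assert (Hrx : rho / 2 * (2 / rho * (1 + 8 * (1 + c3)) * l ^ 2) <= rho / 2 * x) by pos.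
    replace (rho / 2 * (2 / rho * (1 + 8 * (1 + c3)) * l ^ 2)) with ((1 + 8 * (1 + c3)) * l ^ 2) in Hrx by pos.
    lra.
  - pos.
  - intros j _. specialize (HM1 j).
   pos.
  - intros j s2 Hj Hs2. rewrite sumL_plus, sumL_const, length_seq.
   assert (1 <= M j) by (specialize (HM1 j); lra).
   assert ((2 * L1 * a j) ^ m * INR (s2 - S1) <= (2 * L1 * a j) ^ m * s2) by pos.
   assert (2 * (2 * L1 * a j) ^ m * s2 <= a (S j) * s2) by pos.
   assert (sumL (fun s => 4 * L1 * M j / INR s) (seq S1 (s2 - S1)) <= 4 * L1 * M j * (1 + x)).
   { unfold Rdiv. rewrite sumL_scal. apply Rmult_le_compat_l; [pos|].
    destruct (Nat.eq_dec s2 S1) as [->|Hne]; [rewrite Nat.sub_diag; simpl; lra|].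
    replace (s2 - S1)%nat with (S (s2 - S1 - 1)) by lia. eapply Rle_trans; [apply sum_harmonic; lia|].
    rewrite <- Htx. pos. }
   assert (M (S j) = 10 * (L1 * (1 + x) * M j)) by (unfold M, G1; simpl; ring).
   specialize (HS1M j).
   assert (1 <= L1 * (1 + x)) by (apply Rle_trans with (1 * 1); pos).
   assert (M j <= L1 * (1 + x) * M j) by (apply Rmul_ge1; lra).
   assert (3 * x <= L1 * (1 + x) * M j).
   { apply Rle_trans with (L1 * (1 + x) * 1); [|pos].
    rewrite Rmult_1_r. pos. }
   lra.
  - pos.
  - pos.
  - intros k s2 Hk Hs2.
   assert ((S1 <= sk k)%nat) by apply Hskge.
   assert (exp (rho * x) <= INR (sk k)) by (apply Rle_trans with S1; pos).
   assert ((sk k <= s2)%nat) by (specialize (Hskm k); lia).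
   assert (0 < s2) by pos.
   assert (0 <= A k <= 1).
   { split; [left; apply exp_pos|]. rewrite <- exp_0. apply exp_mono. destruct (Hy k). lra. }
   assert (Rpower (INR (sk k) / s2) (1 - gam) <= exp (- (15 * l))).
   { apply Rle_trans with (Rpower (exp (- (c3 * l))) (1 - gam)).
    - apply Rpower_le_base; [pos| |lra].
     apply Rdiv_le_swap; [assumption|].
     assert (HsF : INR (sk k) * F <= s2).
     { rewrite <- mult_INR. apply le_INR. unfold sk in *. simpl in Hs2.
      lia. }
     apply Rmult_le_reg_l with (exp (c3 * l)); [pos|].
     rewrite <- Rmult_assoc, <- exp_plus. replace (c3 * l + - (c3 * l)) with 0 by ring. rewrite exp_0, Rmult_1_l.
     eapply Rle_trans; [|exact HsF]. rewrite Rmult_comm. pos.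
    - unfold Rpower. rewrite ln_exp. apply exp_mono. right. unfold c3. pos. }
   assert (A k ^ m + K * Rpower (INR (sk k) / s2) (1 - gam) <= A (S k)).
   { destruct (Hy k) as [Hy1 Hy2].
    assert (A k ^ m <= exp (- (2 * y k))).
    { unfold A. rewrite exp_pow_nat. apply exp_mono.
     assert (2 * y k <= m * y k) by pos. lra. }
    assert (exp (- (3/2 * y k)) <= A (S k)) by (unfold A; apply exp_mono; specialize (HyS k); lra).
    assert (K * exp (- (15 * l)) <= exp (- (3/2 * y k)) - exp (- (2 * y k))).
    { replace (- (2 * y k)) with (- (3/2 * y k) + - (y k / 2)) by field. rewrite exp_plus.
     assert (exp (- (y k / 2)) <= 1 - et / 4).
     { apply Rle_trans with (exp (- (et / 2))); [pos|].
      eapply Rle_trans; [apply exp_le_quadratic; lra|].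
      assert (et * et <= 1/2 * et) by pos. lra. }
     apply Rle_trans with (exp (- (27/2 * l)) * (et / 4)).
     - unfold et, eta.
      apply Rle_trans with (exp (- (27/2 * l)) * (exp (- (1/2 * l)) / (512 * (2 * m + 1)))).
      + replace (exp (- (27/2 * l)) * (exp (- (1/2 * l)) / (512 * (2 * m + 1)))) with
        (exp (- (27/2 * l)) * exp (- (1/2 * l)) / (512 * (2 * m + 1))) by pos.
       rewrite <- exp_plus. apply Rle_div_swap; [lra|].
       apply Rle_trans with (exp (1 * l) * exp (- (15 * l))).
       * replace (K * exp (- (15 * l)) * (512 * (2 * m + 1))) with (K * 512 * (2 * m + 1) * exp (- (15 * l))) by ring.
        pos.
       * rewrite <- exp_plus. pos.
      +
       replace (exp (- (2 * s0 * l)) / 128 / (2 * m + 1) / 4) with (exp (- (2 * s0 * l)) / (512 * (2 * m + 1))) by pos.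
       pos.
     - apply Rle_trans with (exp (- (3/2 * y k)) * (et / 4)); [pos|].
      assert (exp (- (3/2 * y k)) * exp (- (y k / 2)) <= exp (- (3/2 * y k)) * (1 - et / 4)) by pos.
      lra. }
    assert (K * Rpower (INR (sk k) / s2) (1 - gam) <= K * exp (- (15 * l))) by pos.
    lra. }
   eapply Rle_trans; [|eapply Rle_trans; [apply (Hwl t Q k (A k) (sk k) s2)|]].
   + apply E_le; [pos|]. intros g Hg Hgl. simpl app.
    destruct (ok_weight t Q k (fun s => A k * cc (m * s)) (sk k) g); [|pos].
    destruct (Rltb (A (S k) * cc (m * s2)) (Wb t Q (S k) g s2)) eqn:Hb; [|apply b2R_range].
    apply Rltb_true in Hb. replace (Rltb _ _) with true; [lra|]. symmetry. apply Rltb_true.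
    eapply Rle_lt_trans; [|pos]. pos.
   + lra.
   + lia.
   + pos.
   + apply Rle_trans with x; [rewrite <- Htx; apply ln_mono; pos|lra].
   + apply Rmult_le_compat_l; [lra|]. apply exp_mono. apply Ropp_le_contravar.
    apply exp_mono.
    assert (rho * x <= ln (INR (sk k))) by (rewrite <- (ln_exp (rho * x)); apply ln_mono; pos). lra.
  - pos.
  - intros v Hv. eapply Rle_trans; [apply no_hit_prob; lia|].
   apply Rle_trans with (Rpower (4 * exp (10 * rho * x - x)) c5).
   + apply Rpower_le_base; [apply Rdiv_lt_0_compat; [pose proof (pos_INR (m * S3)); lra|pose proof (pos_INR (m * t)); lra]| |lra].
    apply Rdiv_le_swap; [pose proof (pos_INR (m * t)); lra|]. rewrite !mult_INR.
    apply Rle_trans with (2 * m * S3).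
    { assert (1 * 1 <= m * S3) by pos. lra. }
    apply Rle_trans with (4 * exp (10 * rho * x - x) * (m * exp x)).
    * replace (4 * exp (10 * rho * x - x) * (m * exp x)) with (4 * m * (exp (10 * rho * x - x) * exp x)) by ring.
     rewrite <- exp_plus. replace (10 * rho * x - x + x) with (10 * rho * x) by ring.
     assert (2 * m * S3 <= 2 * m * (2 * exp (10 * rho * x))) by pos. lra.
    * rewrite Htexp. pos.
   + rewrite <- Rpower_mult_distr by pos. apply Rmult_le_compat_l; [pos|].
    unfold Rpower at 1. rewrite ln_exp. lra. }
 assert (T1 : / x <= epsp / 8).
 { replace (epsp / 8) with (/ (8 / epsp)) by pos. pos. }
 assert (Hbase : l * exp (- (2 * x)) <= exp (- (1 * x))).
 { replace (- (1 * x)) with (x + - (2 * x)) by ring. rewrite exp_plus. pos. }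
 assert (Hsmall : (8 * K + / ln m + 1) * exp (- (1 * x)) <= epsp / 8).
 { rewrite exp_Ropp. apply Rdiv_le_swap; [pos|].
  assert (epsp / 8 * ((8 * K + / ln m + 1) * (8 / epsp)) <= epsp / 8 * exp (1 * x)) by pos.
  replace (epsp / 8 * ((8 * K + / ln m + 1) * (8 / epsp))) with (8 * K + / ln m + 1) in H by pos. lra. }
 assert (kA * (t * (K * exp (- exp (rho / 4 * x)))) <= epsp / 8).
 { eapply Rle_trans; [|exact Hsmall].
  apply Rle_trans with (8 * l * (exp x * (K * exp (- (3 * x))))).
  - apply Rmult_le_compat; [pos| |assumption|].
   + pos.
   + pos.
  - replace (8 * l * (exp x * (K * exp (- (3 * x))))) with (8 * K * (l * (exp x * exp (- (3 * x))))) by ring.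
   rewrite <- exp_plus. replace (x + - (3 * x)) with (- (2 * x)) by ring.
   pos. }
 assert (kB * (t * exp (- (3 * x))) <= epsp / 8).
 { eapply Rle_trans; [|exact Hsmall]. rewrite Htexp, <- exp_plus.
  apply Rle_trans with ((/ ln m + 1) * l * exp (- (2 * x))).
  - pos.
  - rewrite Rmult_assoc.
   pos. }
 (* This fixes [kB]: now [a kB <= exp (- x * l)], small enough to be summed over all vertices. *)
 assert (x <= m ^ kB).
 { rewrite <- Hxl. replace (m ^ kB) with (exp (kB * ln m)) by (rewrite <- exp_pow_nat, exp_ln; lra).
  apply exp_mono. apply Rle_trans with (l / ln m * ln m); [right; field; lra|].
  pos. }
 assert (sumL (fun s => (2 * L1 * a kB) ^ m + (4 * L1 * M kB / INR s) ^ m) (seq S3 (t - S3)) <= epsp / 8 + epsp / 8).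
 { rewrite sumL_plus. apply Rplus_le_compat.
  - rewrite sumL_const, length_seq. eapply Rle_trans; [|exact H16].
   apply Rle_trans with (exp (- (2 * x)) * exp x).
   + apply Rmult_le_compat; [pos|pos| |rewrite <- Htexp; apply le_INR; lia].
    apply Rle_trans with (a (S kB)); [specialize (Hastep kB); assert (0 <= (2 * L1 * a kB) ^ m) by pos; lra|].
    apply exp_mono. simpl pow.
    assert (2 * x <= m * m ^ kB) by pos.
    assert (m * m ^ kB * 1 <= m * m ^ kB * l) by pos. lra.
   + rewrite <- exp_plus. pos.
  (* [G] is at most [t^(4 * rho)] and [s] at least [t^(10 * rho)], so already the squares of [G / s]
     sum to order [t^(- 2 * rho)]. *)
  - set (G := 4 * L1 * M kB).
   assert (0 <= G <= exp (4 * rho * x)).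
   { split; [apply Rmult_le_pos; [lra|specialize (HM1 kB); pose proof (exp_pos (2 * rho * x)); lra]|].
    apply Rle_trans with (exp (4 * l) * (exp (2 * rho * x) * exp (5 * l) ^ kB)).
    - apply Rmult_le_compat; [lra|apply Rmult_le_pos; pos| |].
     + replace (4 * l) with (l + 3 * l) by ring. rewrite exp_plus.
      pos.
     + apply Rmult_le_compat_l; [pos|]. pos.
    - rewrite exp_pow_nat, <- !exp_plus. apply exp_mono.
     assert (kB * (5 * l) <= (/ ln m + 1) * l * (5 * l)) by pos.
     assert (Hrx : rho / 2 * (2 / rho * C9 * l ^ 2) <= rho / 2 * x) by pos.
     replace (rho / 2 * (2 / rho * C9 * l ^ 2)) with (C9 * l ^ 2) in Hrx by pos.
     unfold C9 in Hrx. lra. }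
   apply Rle_trans with (sumL (fun s => G ^ 2 * Rpower (INR s) (- (1 + 1))) (seq S3 (t - S3))).
   + apply sumL_le. intros s Hs. apply in_seq in Hs.
    assert (S3 <= s) by pos.
    assert (0 <= G / s <= 1).
    { split; [pos|]. apply Rdiv_le_swap; [lra|].
     assert (exp (4 * rho * x) <= exp (10 * rho * x)) by pos. lra. }
    replace (G ^ 2 * Rpower s (- (1 + 1))) with ((G / s) ^ 2).
    * replace m with (2 + (m - 2))%nat by lia. rewrite pow_add.
     rewrite <- (Rmult_1_r ((G / s) ^ 2)) at 2.
     rewrite <- (pow1 (m - 2)). pos.
    * rewrite Rpower_Ropp, Rpower_plus, Rpower_1 by lra. pos.
   + rewrite sumL_scal.
    apply Rle_trans with (exp (4 * rho * x) ^ 2 * (2 * exp (- (10 * rho * x)))).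
    * apply Rmult_le_compat; [pos|pos|pos|].
     eapply Rle_trans; [apply sum_pow_tail'; pos|]. rewrite Rpower_Ropp, Rpower_1 by lra.
     rewrite exp_Ropp.
     pos.
    * rewrite exp_pow_nat. simpl (INR 2).
     replace (exp ((1 + 1) * (4 * rho * x)) * (2 * exp (- (10 * rho * x)))) with (2 * (exp ((1 + 1) * (4 * rho * x)) * exp (- (10 * rho * x)))) by ring.
     rewrite <- exp_plus. replace ((1 + 1) * (4 * rho * x) + - (10 * rho * x)) with (- (2 * rho * x)) by ring. lra. }
 assert (S3 * (Rpower 4 c5 * exp (c5 * (10 * rho * x - x))) <= epsp / 8).
 { pose proof (Rpower_pos 4 c5).
  apply Rle_trans with (2 * exp (10 * rho * x) * (Rpower 4 c5 * exp (c5 * (10 * rho * x - x)))).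
  - pos.
  - replace (2 * exp (10 * rho * x) * (Rpower 4 c5 * exp (c5 * (10 * rho * x - x)))) with
    (2 * Rpower 4 c5 * (exp (10 * rho * x) * exp (c5 * (10 * rho * x - x)))) by ring.
   rewrite <- exp_plus.
   apply Rle_trans with (2 * Rpower 4 c5 * exp (- (3 / 4 * c5 * x))).
   + apply Rmult_le_compat_l; [lra|]. apply exp_mono.
    assert (40 * rho * (1 + c5) * x <= c5 * x) by pos. lra.
   + apply Rle_trans with (2 * Rpower 4 c5 * (epsp / (16 * Rpower 4 c5))); [pos|].
    right. pos. }
 lra.
Qed.

End UpperAsymptotics.

(** * Rising products *)

Definition bump (X : nat -> R) (v u : nat) : R := if Nat.eqb u v then X u + 1 else X u.

(** The product over all [u] of the rising factorials of [X u], with as many factors as [u] occurs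
    in [l]: the weight that a list of prescribed hits meets when each hit adds one to its vertex. *)
Fixpoint Phi (X : nat -> R) (l : list nat) : R :=
 match l with [] => 1 | v :: l' => X v * Phi (bump X v) l' end.

Lemma bump_mono X Y v : (forall u, 0 <= X u <= Y u) -> forall u, 0 <= bump X v u <= bump Y v u.
Proof. intros H u. unfold bump. specialize (H u). destruct (Nat.eqb u v); lra. Qed.

Lemma Phi_mono l : forall X Y, (forall u, 0 <= X u <= Y u) -> 0 <= Phi X l <= Phi Y l.
Proof.
 induction l as [|v l IH]; simpl; intros X Y H; [lra|].
 destruct (IH _ _ (bump_mono X Y v H)) as [H1 H2]. destruct (H v). split.
 - pos.
 - pos.
Qed.

Lemma Phi_ext l : forall X Y, (forall u, X u = Y u) -> Phi X l = Phi Y l.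
Proof.
 induction l as [|v l IH]; simpl; intros X Y H; [pos|]. rewrite H. f_equal.
 apply IH. intros u. unfold bump. rewrite H. pos.
Qed.

Lemma bump_comm X u v z : bump (bump X u) v z = bump (bump X v) u z.
Proof. unfold bump. destruct (Nat.eqb z v), (Nat.eqb z u); reflexivity. Qed.

Lemma Phi_perm l l' : Permutation l l' -> forall X, Phi X l = Phi X l'.
Proof.
 induction 1; intros X; simpl; [pos|congruence| |congruence].
 rewrite (Phi_ext _ (bump (bump X y) x) (bump (bump X x) y)) by (intros; apply bump_comm).
 change (bump X y x) with (if Nat.eqb x y then X x + 1 else X x).
 change (bump X x y) with (if Nat.eqb y x then X y + 1 else X y).
 rewrite (Nat.eqb_sym y x). destruct (Nat.eqb_spec x y); [subst|]; ring.
Qed.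

Definition cntIn (U l : list nat) : R := sumL (fun v => b2R (existsb (Nat.eqb v) U)) l.

(** Rising factorials are eigenfunctions of urn growth: with [x^(n)] for
    [x * (x+1) * ... * (x+n-1)], one has [x * ((x+1)^(n) - x^(n)) = n * x^(n)]. Hits of [U] at rates
    [X u] thus multiply [Phi] by a number depending on [l] alone. *)
Lemma Phi_growth U l : NoDup U -> forall X,
 sumL (fun u => X u * (Phi (bump X u) l - Phi X l)) U = cntIn U l * Phi X l.
Proof.
 intros HU. induction l as [|v l IH]; intros X.
 - unfold cntIn. simpl. rewrite (sumL_ext _ (fun _ => 0)) by pos. rewrite sumL_const. ring.
 - unfold cntIn. cbn [sumL Phi]. fold (cntIn U l). set (Y := bump X v).
  rewrite (sumL_ext _ (fun u => X v * (Y u * (Phi (bump Y u) l - Phi Y l)) +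
    X v * Phi Y l * (if Nat.eqb v u then 1 else 0))).
  + rewrite sumL_plus, !sumL_scal, IH, (sumL_indic_range v U HU). ring.
  + intros u _. rewrite (Phi_ext l (bump (bump X u) v) (bump Y u)) by (intros; apply bump_comm).
   change (bump X u v) with (if Nat.eqb v u then X v + 1 else X v).
   change (Y u) with (if Nat.eqb u v then X u + 1 else X u). rewrite (Nat.eqb_sym u v).
   destruct (Nat.eqb_spec v u); [subst|]; ring.
Qed.

Lemma Phi_bound M l : forall X, (forall u, 0 <= X u) ->
 (forall u, X u + INR (count_occ Nat.eq_dec l u) <= M) -> Phi X l <= M ^ length l.
Proof.
 induction l as [|v l IH]; intros X H0 HM; simpl; [lra|].
 assert (forall u, 0 <= bump X v u) by (intros u; unfold bump; specialize (H0 u); destruct (Nat.eqb u v); lra).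
 apply Rmult_le_compat; [pos| |..].
 - apply (Phi_mono l (bump X v) (bump X v)). pos.
 - specialize (HM v). pose proof (pos_INR (count_occ Nat.eq_dec (v :: l) v)). lra.
 - apply IH; [pos|]. intros u. specialize (HM u). unfold bump. cbn [count_occ] in HM.
  destruct (Nat.eqb_spec u v), (Nat.eq_dec v u); subst; try congruence; rewrite ?S_INR in HM; lra.
Qed.

Fixpoint prodL {A} (f : A -> R) (l : list A) : R :=
 match l with [] => 1 | a :: l' => f a * prodL f l' end.

Lemma prodL_nonneg {A} (f : A -> R) l : (forall x, In x l -> 0 <= f x) -> 0 <= prodL f l.
Proof. induction l; simpl; intros H; [lra|]. pos. Qed.

Lemma prodL_le {A} (f g : A -> R) l : (forall x, In x l -> 0 <= f x <= g x) -> prodL f l <= prodL g l.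
Proof.
 induction l; simpl; intros H; [lra|]. apply Rmult_le_compat; auto.
 - apply H; auto.
 - apply prodL_nonneg. intros; apply H; auto.
 - apply H; auto.
Qed.

Lemma prodL_mult {A} (f g : A -> R) l : prodL (fun x => f x * g x) l = prodL f l * prodL g l.
Proof. induction l; simpl; [ring|]. rewrite IHl. ring. Qed.

Lemma prodL_ext {A} (f g : A -> R) l : (forall x, In x l -> f x = g x) -> prodL f l = prodL g l.
Proof. induction l; simpl; intros H; [pos|]. rewrite H, IHl; auto. Qed.

Lemma prodL_perm {A} (f : A -> R) l l' : Permutation l l' -> prodL f l = prodL f l'.
Proof. induction 1; simpl; [pos|congruence|ring|pos]. Qed.

Lemma prodL_const {A} c (l : list A) : prodL (fun _ => c) l = c ^ length l.
Proof. induction l; simpl; congruence. Qed.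

Lemma prodL_bernoulli {A} (y : A -> R) l : (forall x, In x l -> 0 <= y x) -> 1 + sumL y l <= prodL (fun x => 1 + y x) l.
Proof.
 induction l as [|a l IH]; simpl; intros H; [lra|].
 specialize (IH (fun x Hx => H x (or_intror Hx))). pose proof (H a (or_introl eq_refl)).
 pose proof (sumL_nonneg y l (fun x Hx => H x (or_intror Hx))). nra.
Qed.

(** * Erasing the old targets *)

Section Erase.
Context {P : PAmodel}.
Variable ts : nat.
Hypothesis Hts : (1 <= ts)%nat.

(** [0] is not a vertex, so it can mark an edge into the old part without affecting any young
    degree. *)
Definition er (x : nat) : nat := if Nat.leb x ts then 0%nat else x.
Definition sg (h : history) : history := map (fun e => (fst e, er (snd e))) h.

Lemma er_old x : (x <= ts)%nat -> er x = 0%nat.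
Proof. clear Hts. unfold er. destruct (Nat.leb_spec x ts); pos. Qed.

Lemma er_new x : (ts < x)%nat -> er x = x.
Proof. clear Hts. unfold er. destruct (Nat.leb_spec x ts); pos. Qed.

Lemma sg_ext h v : sg (ext h v) = sg h ++ [(cur (length h), er v)].
Proof. unfold sg, ext. rewrite map_app. pos. Qed.

Lemma degree_sg h v : (ts < v)%nat -> degree (sg h) v = degree h v.
Proof.
 intros Hv. unfold degree, sg. induction h as [|[a b] h IH]; [pos|]. cbn [map fold_right fst snd].
 rewrite IH. unfold er. destruct (Nat.leb_spec b ts); [|pos].
 destruct (Nat.eqb_spec 0 v), (Nat.eqb_spec b v); lia.
Qed.

Lemma step_prob_sg h1 h2 v : (ts < v)%nat -> length h1 = length h2 -> sg h1 = sg h2 ->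
 step_prob m delta h1 v = step_prob m delta h2 v.
Proof.
 intros Hv Hl Hs. unfold step_prob. rewrite <- (degree_sg h1 v Hv), <- (degree_sg h2 v Hv), Hl, Hs. pos.
Qed.

Lemma E1_old_const h f c : valid h -> (forall v, (1 <= v <= cur (length h))%nat -> (v <= ts)%nat -> f v = c) ->
 E1 h f = c + sumL (fun v => if Nat.leb v ts then 0 else step_prob m delta h v * (f v - c)) (seq 1 (cur (length h))).
Proof.
 intros Hv H. rewrite <- (E1_const h c Hv) at 1. unfold E1. rewrite <- sumL_plus. apply sumL_ext.
 intros v Hin. apply in_seq in Hin. destruct (Nat.leb_spec v ts); [rewrite H by lia|]; ring.
Qed.

(* The conditional law of the erased history depends only on the erased past. *)
Lemma E_sg (F : history -> R) n : forall h1 h2, valid h1 -> valid h2 -> length h1 = length h2 -> sg h1 = sg h2 ->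
 E n h1 (fun g => F (sg g)) = E n h2 (fun g => F (sg g)).
Proof.
 induction n; intros h1 h2 Hv1 Hv2 Hl Hs; [rewrite !E_O, Hs; reflexivity|].
 rewrite !E_S. pose proof (cur_bounds (length h1)) as (Hc & _).
 assert (Hold : forall h h' v v', valid h -> valid h' -> length h = length h' -> sg h = sg h' ->
  (1 <= v <= cur (length h))%nat -> (1 <= v' <= cur (length h'))%nat -> er v = er v' ->
  E n (ext h v) (fun g => F (sg g)) = E n (ext h' v') (fun g => F (sg g))).
 { intros h h' v v' Hv Hv' Hl' Hs' Hb Hb' He. apply IHn; [pos|pos| |].
  - rewrite !ext_length. pos.
  - rewrite !sg_ext. pos. }
 set (c := E n (ext h1 1) (fun g => F (sg g))).
 rewrite (E1_old_const h1 _ c Hv1), (E1_old_const h2 _ c Hv2).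
 - rewrite <- Hl. f_equal. apply sumL_ext. intros v Hin. apply in_seq in Hin. destruct (Nat.leb_spec v ts); [pos|].
  rewrite (step_prob_sg h1 h2) by assumption. f_equal. f_equal. apply Hold; try assumption; try reflexivity; rewrite <- ?Hl; lia.
 - intros v Hb Ho. apply Hold; try assumption; try (symmetry; assumption); try lia; try reflexivity.
  rewrite !er_old by lia. pos.
 - intros v Hb Ho. apply Hold; try assumption; try reflexivity; try lia.
  rewrite !er_old by lia. pos.
Qed.

(** A lower bound for the total weight of the targets at most [ts] at decision [k]; after decision
    [m * ts] it stays at the value reached then. *)
Definition chat (k : nat) : R := INR (Nat.min k (m * ts)) * (2 + chi).

Lemma chat_pos k : (1 <= k)%nat -> 0 < chat k.
Proof.
 unfold chat. pose proof chi_range. pose proof Hm. pos.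
Qed.

(** The future of the erased process does not see which old target was taken ([E_sg]). Given an old
    target, the choice is therefore proportional to weights even in the presence of [F], and the
    total old weight is at least [chat]. *)
Lemma old_step F n h v : valid h -> (1 <= v <= ts)%nat -> (m * v <= length h)%nat -> (forall g, 0 <= F g) ->
 step_prob m delta h v * E n (ext h v) (fun g => F (sg g))
  <= (INR (degree h v) + delta) / chat (length h) * E (S n) h (fun g => F (sg g)).
Proof.
 intros Hv Hb Hmv HF. pose proof (cur_bounds (length h)) as (Hc1 & Hc2). pose proof chi_range.
 assert (Hk : (1 <= length h)%nat) by nia. pose proof (chat_pos _ Hk). pose proof (cc_pos (length h)).
 rewrite step_prob_old by pos.
 set (c := E n (ext h v) (fun g => F (sg g))).
 assert ((v <= cur (length h))%nat) by nia.
 assert (0 <= c) by (apply E_nonneg; [constructor; pos|pos]).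
 assert (0 <= INR (degree h v) + delta).
 { pose proof (degree_completed h v Hv ltac:(lia) Hmv) as Hd. apply le_INR in Hd. pose proof md_pos. lra. }
 assert (Hold : forall u, (1 <= u <= cur (length h))%nat -> (u <= ts)%nat -> E n (ext h u) (fun g => F (sg g)) = c).
 { intros u Hu Huo. apply E_sg; [pos|constructor; pos| |].
  - rewrite !ext_length. pos.
  - rewrite !sg_ext, !er_old by lia. pos. }
 assert (c * (chat (length h) / cc (length h)) <= E (S n) h (fun g => F (sg g))).
 { rewrite E_S. destruct (Nat.le_gt_cases (cur (length h)) ts) as [Hle|Hgt].
  - rewrite (E1_ext h _ (fun _ => c)) by (intros; apply Hold; lia). rewrite E1_const by assumption.
   rewrite <- (Rmult_1_r c) at 2. apply Rmult_le_compat_l; [assumption|]. apply Rdiv_le_swap; [assumption|].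
   unfold chat, cc. apply Rle_trans with (INR (length h) * (2 + chi)); [|lra].
   pos.
  - assert ((m * ts <= length h)%nat) by nia.
   apply Rle_trans with (E1 h (fun x => c * sumL (fun u => if Nat.eqb x u then 1 else 0) (seq 1 ts))).
   + rewrite E1_scal, E1_hits; [|assumption|intros u Hu; apply in_seq in Hu; nia].
    apply Rmult_le_compat_l; [assumption|]. apply Rmult_le_compat_r; [pos|].
    rewrite <- (firstn_skipn (m * ts) h). eapply Rle_trans; [|apply w_app_le].
    rewrite (w_total _ ts); [|pos|apply firstn_length_le; assumption].
    unfold chat. rewrite length_app, firstn_length_le, length_skipn by assumption.
    rewrite Nat.min_r, mult_INR, delta_chi by lia. lra.
   + apply E1_le; [assumption|]. intros x Hx.
    rewrite (sumL_indic_range x (seq 1 ts)) by apply seq_NoDup.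
    destruct (existsb (Nat.eqb x) (seq 1 ts)) eqn:Ex; unfold b2R.
    * apply existsb_exists in Ex as (y & Hy & Hxy). apply Nat.eqb_eq in Hxy. apply in_seq in Hy.
     rewrite Hold by lia. lra.
    * rewrite Rmult_0_r. pos. }
 apply Rle_trans with ((INR (degree h v) + delta) / chat (length h) * (c * (chat (length h) / cc (length h)))).
 - right. pos.
 - pos.
Qed.

Definition compl (h : history) (u : nat) : bool := Nat.leb 1 u && Nat.leb u ts && Nat.leb (m * u) (length h).

(** A vertex not yet completed is assigned [2 * m], which its weight on completion cannot exceed
    because [delta < 0]; with this convention [Xw] changes at most by a [bump]. *)
Definition Xw (h : history) (u : nat) : R := if compl h u then INR (degree h u) + delta else 2 * INR m.

Lemma compl_spec h u : compl h u = true <-> (1 <= u <= ts)%nat /\ (m * u <= length h)%nat.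
Proof. unfold compl. rewrite !andb_true_iff, !Nat.leb_le. lia. Qed.

Lemma Xw_nonneg h u : valid h -> 0 <= Xw h u.
Proof.
 intros Hv. unfold Xw. pose proof INRm_ge2. destruct (compl h u) eqn:Ec; [|lra].
 apply compl_spec in Ec as [H1 H2]. pose proof (degree_completed h u Hv ltac:(lia) H2) as Hd.
 apply le_INR in Hd. pose proof md_pos. lra.
Qed.

Lemma Xw_ext h v u : valid h -> (1 <= v <= cur (length h))%nat ->
 Xw (ext h v) u <= if compl h v then bump (Xw h) v u else Xw h u.
Proof.
 intros Hv Hb. pose proof (cur_bounds (length h)) as (Hc1 & Hc2). pose proof Hd2.
 assert (Hgoal : Xw (ext h v) u <= Xw h u + (if compl h v && Nat.eqb u v then 1 else 0)).
 2: { unfold bump. destruct (compl h v), (Nat.eqb u v); cbn [andb] in Hgoal; lra. }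
 unfold Xw. destruct (compl h u) eqn:Ec.
 - assert (Ec' := Ec). apply compl_spec in Ec' as [H1 H2].
  replace (compl (ext h v) u) with true by (symmetry; apply compl_spec; rewrite ext_length; lia).
  rewrite degree_ext. destruct (Nat.eqb_spec (cur (length h)) u); [nia|].
  rewrite (Nat.eqb_sym u v). destruct (Nat.eqb_spec v u).
  + subst. rewrite Ec. cbn [andb]. rewrite !plus_INR. simpl (INR 1). simpl (INR 0). lra.
  + rewrite andb_false_r, !Nat.add_0_r. lra.
 - assert (0 <= (if compl h v && Nat.eqb u v then 1 else 0)) by (destruct (compl h v && Nat.eqb u v); lra).
  destruct (compl (ext h v) u) eqn:Ec2; [|lra]. apply compl_spec in Ec2 as [H1 H2]. rewrite ext_length in H2.
  assert ((m * u = S (length h))%nat).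
  { destruct (Nat.le_gt_cases (m * u) (length h)) as [Hle|]; [|lia].
   assert (compl h u = true) by (apply compl_spec; lia). pos. }
  pose proof (degree_le (ext h v) u ltac:(constructor; assumption) ltac:(lia)) as Hd. rewrite ext_length in Hd.
  assert (Hd' : (degree (ext h v) u <= 2 * m)%nat) by nia. apply le_INR in Hd'. rewrite mult_INR in Hd'. pos.
Qed.

(** The factor of one requirement that decision [k] hits [v]: [/ chat k] for the hit, and the growth
    of the weight of [v] between [a] and [k], counted from the completion of [v]. *)
Definition kern (a : nat) (e : nat * nat) : R :=
 / chat (fst e) * prodL (fun j => 1 + (if Nat.leb (m * snd e) j then / chat j else 0)) (seq a (fst e - a)).

Definition hits (g : history) (e : nat * nat) : bool :=
 match nth_error g (fst e) with Some y => Nat.eqb (snd y) (snd e) | None => false end.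

Definition matches (g : history) (sp : list (nat * nat)) : bool := forallb (hits g) sp.

Definition spec_ok (a : nat) (sp : list (nat * nat)) : Prop :=
 NoDup (map fst sp) /\ forall e, In e sp -> (a <= fst e)%nat /\ (1 <= snd e <= ts)%nat /\ (m * snd e <= fst e)%nat.

Lemma chat_inv_nonneg (e : nat * nat) j : (1 <= snd e)%nat -> 0 <= (if Nat.leb (m * snd e) j then / chat j else 0).
Proof.
 destruct (Nat.leb_spec (m * snd e) j); [|lra]. left. apply Rinv_0_lt_compat, chat_pos. pose proof Hm. nia.
Qed.

Lemma kern_step a (e : nat * nat) : (1 <= snd e)%nat -> (a < fst e)%nat ->
 kern a e = (1 + (if Nat.leb (m * snd e) a then / chat a else 0)) * kern (S a) e.
Proof.
 intros He Ha. unfold kern. replace (fst e - a)%nat with (S (fst e - S a)) by lia. cbn [seq prodL]. ring.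
Qed.

Lemma kern_nonneg a (e : nat * nat) : (1 <= snd e)%nat -> (m * snd e <= fst e)%nat -> 0 <= kern a e.
Proof.
 intros He Hk. apply Rmult_le_pos.
 - left. apply Rinv_0_lt_compat, chat_pos. pose proof Hm. nia.
 - apply prodL_nonneg. intros j _. pose proof (chat_inv_nonneg e j He). lra.
Qed.

Lemma hits_now h v l x : hits (ext h v ++ l) (length h, x) = Nat.eqb v x.
Proof. unfold hits, ext. rewrite <- app_assoc. simpl fst. rewrite nth_error_app2, Nat.sub_diag by lia. pos. Qed.

Lemma matches_perm g sp sp' : Permutation sp sp' -> matches g sp = matches g sp'.
Proof.
 induction 1; simpl; [pos|pos| |pos].
 destruct (hits g x), (hits g y); reflexivity.
Qed.

(** The joint probability of prescribed hits factorises although hits of the same vertex reinforce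
    each other; [Phi] accounts for the reinforcement. A prescribed decision is handled by [old_step]
    and a [bump]. Any other decision multiplies [Phi] by at most [1 + n / chat], with [n]
    requirements on completed vertices, by [Phi_growth]; Bernoulli's inequality hides this in the
    kernels. *)
Lemma spec_bound_aux F (HF : forall g, 0 <= F g) n : forall h sp, valid h -> spec_ok (length h) sp ->
 E n h (fun g => F (sg g) * b2R (matches g sp))
  <= E n h (fun g => F (sg g)) * (Phi (Xw h) (map snd sp) * prodL (kern (length h)) sp).
Proof.
 induction n; intros h sp Hv [Hnd Hsp].
 - apply Rmult_le_compat_l; [pos|]. destruct sp as [|e sp]; [simpl; lra|].
  assert (Hf : hits h e = false).
  { unfold hits. destruct (Hsp e (or_introl eq_refl)) as [H1 _]. apply nth_error_None in H1. rewrite H1. pos. }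
  unfold matches. cbn [forallb]. rewrite Hf.
  apply Rmult_le_pos.
  + apply (Phi_mono _ (Xw h) (Xw h)). intros; split; [apply Xw_nonneg; assumption|lra].
  + apply prodL_nonneg. intros x Hx. destruct (Hsp x Hx) as (_ & H2 & H3). apply kern_nonneg; lia.
 - set (G := fun v => E n (ext h v) (fun g => F (sg g))).
  set (EG := E (S n) h (fun g => F (sg g))).
  assert (HG : forall v, (1 <= v <= cur (length h))%nat -> 0 <= G v)
   by (intros; apply E_nonneg; pos).
  assert (HEG : EG = E1 h G) by apply E_S.
  assert (HEG0 : 0 <= EG) by (apply E_nonneg; pos).
  assert (HX : forall u, 0 <= Xw h u) by (intros; apply Xw_nonneg; assumption).
  assert (HXv : forall v u, (1 <= v <= cur (length h))%nat -> 0 <= Xw (ext h v) u)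
   by (intros; apply Xw_nonneg; constructor; assumption).
  destruct (in_dec Nat.eq_dec (length h) (map fst sp)) as [Hin|Hnin].
  + apply in_map_iff in Hin as ((k & v0) & Hk & Hin). simpl in Hk. subst k.
   apply in_split in Hin as (p & q & Hsplit).
   set (rest := p ++ q).
   assert (Hperm : Permutation sp ((length h, v0) :: rest)) by (rewrite Hsplit; apply Permutation_sym, Permutation_middle).
   destruct (Hsp (length h, v0)) as (_ & Hv0 & Hk0); [rewrite Hsplit; apply in_or_app; right; left; reflexivity|].
   simpl in Hv0, Hk0.
   assert (Hnd' : NoDup (length h :: map fst rest)).
   { apply (Permutation_NoDup (Permutation_map fst Hperm)). assumption. }
   inversion Hnd' as [|? ? Hni Hnd2]; subst x l.
   assert (Hrest : forall e, In e rest -> (S (length h) <= fst e)%nat /\ (1 <= snd e <= ts)%nat /\ (m * snd e <= fst e)%nat).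
   { intros e He. destruct (Hsp e) as (H1 & H2 & H3).
    - apply (Permutation_in _ (Permutation_sym Hperm)). pos.
    - assert (fst e <> length h) by (intros Heq; apply Hni; rewrite <- Heq; apply in_map; assumption). lia. }
   assert (Hcur : (1 <= v0 <= cur (length h))%nat).
   { pose proof (cur_bounds (length h)). nia. }
   rewrite (Phi_perm _ _ (Permutation_map snd Hperm)), (prodL_perm _ _ _ Hperm). cbn [map snd Phi prodL].
   assert (0 <= prodL (kern (S (length h))) rest)
    by (apply prodL_nonneg; intros e He; destruct (Hrest e He) as (_ & H2 & H3); apply kern_nonneg; lia).
   apply Rle_trans with (step_prob m delta h v0 * (G v0 * (Phi (Xw (ext h v0)) (map snd rest) * prodL (kern (S (length h))) rest))).
   * rewrite E_S. rewrite <- (E1_eqb h v0 (fun v => G v * (Phi (Xw (ext h v)) (map snd rest) * prodL (kern (S (length h))) rest))) by assumption.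
    apply E1_le; [assumption|]. intros v Hb.
    rewrite (E_ext n (ext h v) _ (fun g => b2R (Nat.eqb v v0) * (F (sg g) * b2R (matches g rest)))).
    -- rewrite E_scal. destruct (Nat.eqb v v0); unfold b2R at 1; [|lra]. rewrite Rmult_1_l.
      rewrite <- (ext_length h v). apply IHn; [pos|]. rewrite ext_length. pos.
    -- pos.
    -- intros l Hl Hln. rewrite (matches_perm _ _ _ Hperm). unfold matches at 1. cbn [forallb]. rewrite hits_now.
      fold (matches (ext h v ++ l) rest). destruct (Nat.eqb v v0); cbn [andb]; unfold b2R; ring.
   * pose proof (old_step F n h v0 Hv Hv0 Hk0 HF) as Hos.
    assert (Hc : compl h v0 = true) by (apply compl_spec; lia).
    assert (0 <= Phi (Xw (ext h v0)) (map snd rest) <= Phi (bump (Xw h) v0) (map snd rest)).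
    { apply Phi_mono. intros u. pose proof (Xw_ext h v0 u Hv Hcur) as Hx. rewrite Hc in Hx. pos. }
    assert (prodL (kern (S (length h))) rest <= prodL (kern (length h)) rest).
    { apply prodL_le. intros e He. destruct (Hrest e He) as (H1 & H2 & H3). split; [apply kern_nonneg; lia|].
     rewrite (kern_step (length h)) by lia. apply Rmul_ge1; [|apply kern_nonneg; lia].
     pose proof (chat_inv_nonneg e (length h) ltac:(lia)). lra. }
    rewrite <- Rmult_assoc.
    apply Rle_trans with (((INR (degree h v0) + delta) / chat (length h) * EG) *
      (Phi (bump (Xw h) v0) (map snd rest) * prodL (kern (length h)) rest)).
    -- apply Rmult_le_compat; [|pos|pos|pos].
      apply Rmult_le_pos; [apply step_prob_nonneg; assumption|pos].
    -- unfold kern at 2. simpl fst. rewrite Nat.sub_diag. cbn [seq prodL].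
      replace (Xw h v0) with (INR (degree h v0) + delta) by (unfold Xw; rewrite Hc; reflexivity). pos.
  + assert (Hsp' : forall e, In e sp -> (S (length h) <= fst e)%nat /\ (1 <= snd e <= ts)%nat /\ (m * snd e <= fst e)%nat).
   { intros e He. destruct (Hsp e He) as (H1 & H2 & H3).
    assert (fst e <> length h) by (intros Heq; apply Hnin; rewrite <- Heq; apply in_map; assumption). lia. }
   set (l := map snd sp). set (K' := prodL (kern (S (length h))) sp).
   set (U := filter (compl h) (seq 1 ts)).
   assert (HU : NoDup U) by apply NoDup_filter, seq_NoDup.
   assert (HUin : forall v, In v U <-> compl h v = true).
   { intros v. unfold U. rewrite filter_In, in_seq. split; [tauto|]. intros Hc. split; [|assumption].
    apply compl_spec in Hc. lia. }
   assert (0 <= K') by (apply prodL_nonneg; intros e He; destruct (Hsp' e He) as (_ & H2 & H3); apply kern_nonneg; lia).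
   set (D := fun u => Phi (bump (Xw h) u) l - Phi (Xw h) l).
   assert (HD : forall u, 0 <= D u).
   { intros u. unfold D. destruct (Phi_mono l (Xw h) (bump (Xw h) u)); [|lra].
    intros z. specialize (HX z). unfold bump. destruct (Nat.eqb z u); lra. }
   apply Rle_trans with (K' * E1 h (fun v => Phi (Xw h) l * G v + sumL (fun u => if Nat.eqb v u then D v * G v else 0) U)).
   * rewrite E_S, <- E1_scal. apply E1_le; [assumption|]. intros v Hb.
    eapply Rle_trans; [apply IHn; [pos|split; [assumption|rewrite ext_length; exact Hsp']]|].
    rewrite ext_length.
    replace (G v * (Phi (Xw (ext h v)) l * K')) with (K' * (Phi (Xw (ext h v)) l * G v)) by ring.
    apply Rmult_le_compat_l; [assumption|].
    rewrite (sumL_ext _ (fun u => D v * G v * (if Nat.eqb v u then 1 else 0))) by (intros; destruct (Nat.eqb v x); ring).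
    rewrite sumL_scal, sumL_indic_range by assumption.
    assert (Hex : existsb (Nat.eqb v) U = compl h v).
    { apply eq_true_iff_eq. rewrite existsb_exists, <- HUin. split.
     - intros (x & Hx & Hvx). apply Nat.eqb_eq in Hvx. pos.
     - exists v. rewrite Nat.eqb_refl. auto. }
    rewrite Hex.
    assert (Phi (Xw (ext h v)) l <= Phi (if compl h v then bump (Xw h) v else Xw h) l).
    { apply Phi_mono. split; [pos|]. pose proof (Xw_ext h v u Hv Hb). destruct (compl h v); assumption. }
    apply Rle_trans with (Phi (if compl h v then bump (Xw h) v else Xw h) l * G v); [pos|].
    unfold D, b2R. destruct (compl h v); right; ring.
   * rewrite E1_plus, E1_scal, <- HEG, (E1_sumL h (fun u v => if Nat.eqb v u then D v * G v else 0)).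
    apply Rle_trans with (K' * (Phi (Xw h) l * EG + sumL (fun u => Xw h u * D u * (/ chat (length h) * EG)) U)).
    -- apply Rmult_le_compat_l; [assumption|]. apply Rplus_le_compat_l. apply sumL_le. intros u Hu.
      apply HUin in Hu. assert (Hc := Hu). apply compl_spec in Hu as [Hu1 Hu2].
      assert (Hcur : (1 <= u <= cur (length h))%nat).
      { pose proof (cur_bounds (length h)). nia. }
      rewrite (E1_eqb h u (fun v => D v * G v)) by assumption.
      pose proof (old_step F n h u Hv Hu1 Hu2 HF) as Hos. fold (G u) in Hos. fold EG in Hos.
      unfold Xw. rewrite Hc. pose proof (Rmult_le_compat_r _ _ _ (HD u) Hos).
      pos.
    -- rewrite sumL_scal_r. unfold D. rewrite (Phi_growth U l HU (Xw h)).
      replace (K' * (Phi (Xw h) l * EG + cntIn U l * Phi (Xw h) l * (/ chat (length h) * EG)))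
       with (EG * Phi (Xw h) l * ((1 + cntIn U l * / chat (length h)) * K')) by ring.
      rewrite <- (Rmult_assoc EG (Phi (Xw h) l) (prodL (kern (length h)) sp)). apply Rmult_le_compat_l.
      { apply Rmult_le_pos; [assumption|]. apply (Phi_mono _ (Xw h) (Xw h)). pos. }
      rewrite (prodL_ext (kern (length h)) (fun e => (1 + (if Nat.leb (m * snd e) (length h) then / chat (length h) else 0)) * kern (S (length h)) e))
       by (intros e He; destruct (Hsp' e He) as (H1 & H2 & _); apply kern_step; lia).
      rewrite prodL_mult. apply Rmult_le_compat_r; [assumption|].
      eapply Rle_trans; [|apply prodL_bernoulli; intros e He; apply chat_inv_nonneg; destruct (Hsp' e He); lia].
      apply Rplus_le_compat_l. unfold cntIn, l. rewrite sumL_map, <- sumL_scal_r. apply sumL_le. intros e He.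
      destruct (Hsp' e He) as (H1 & H2 & H3).
      destruct (existsb (Nat.eqb (snd e)) U) eqn:Ex; unfold b2R.
      ++ apply existsb_exists in Ex as (y & Hy & Hye). apply Nat.eqb_eq in Hye.
       apply HUin, compl_spec in Hy as [_ Hy]. destruct (Nat.leb_spec (m * snd e) (length h)); pos.
      ++ rewrite Rmult_0_l. apply chat_inv_nonneg. lia.
Qed.

(** The growth product is 1 before the completion of [v] and a [PG] up to decision [m * ts]. Since
    [t <= 2 * ts], at most [m * ts] decisions follow, each with a factor below [exp (/ (m * ts))],
    so together at most [exp 1]. *)
Lemma kern_bound t (e : nat * nat) : (t <= 2 * ts)%nat -> (fst e < m * t)%nat -> (1 <= snd e <= ts)%nat -> (m * snd e <= fst e)%nat ->
 kern 0 e <= 24 * (Rpower (INR (cur (fst e))) (gam - 1) * Rpower (INR (snd e)) (- gam)).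
Proof.
 destruct e as [k v]. simpl fst. simpl snd. intros Ht Hk Hv Hmv.
 pose proof gam_range. pose proof Hm. pose proof INRm_ge2.
 assert ((2 <= m * v)%nat) by nia.
 set (b := Nat.min k (m * ts)). assert (Hb : (m * v <= b)%nat) by (unfold b; nia).
 assert (Hchat : forall j, / chat j = gam / INR (Nat.min j (m * ts))).
 { intros j. unfold chat, gam. rewrite Rinv_mult. pos. }
 assert (Hprod : prodL (fun j => 1 + (if Nat.leb (m * v) j then / chat j else 0)) (seq 0 k) <= PG (m * v) (b - m * v) * exp 1).
 { replace k with (m * v + ((b - m * v) + (k - b)))%nat at 1 by pos.
  rewrite seq_app, seq_app.
  assert (Happ : forall (f : nat -> R) l1 l2, prodL f (l1 ++ l2) = prodL f l1 * prodL f l2).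
  { intros f l1 l2. induction l1; simpl; [ring|]. rewrite IHl1. ring. }
  rewrite !Happ. rewrite (prodL_ext _ (fun _ => 1) (seq 0 (m * v))), prodL_const, pow1, Rmult_1_l.
  2: { intros j Hj. apply in_seq in Hj. destruct (Nat.leb_spec (m * v) j); pos. }
  rewrite Nat.add_0_l. apply Rmult_le_compat.
  - apply prodL_nonneg. intros j _. pose proof (chat_inv_nonneg (k, v) j ltac:(simpl; lia)) as Hz. pos.
  - apply prodL_nonneg. intros j _. pose proof (chat_inv_nonneg (k, v) j ltac:(simpl; lia)) as Hz. pos.
  - assert (Hn : forall n, (m * v + n <= b)%nat -> prodL (fun j => 1 + (if Nat.leb (m * v) j then / chat j else 0)) (seq (m * v) n) = PG (m * v) n).
   { induction n; intros Hn; [pos|]. rewrite seq_S, Happ, IHn by lia. simpl.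
    destruct (Nat.leb_spec (m * v) (m * v + n)); [|lia]. rewrite Hchat, Nat.min_l by pos. ring. }
   right. apply Hn. lia.
  - replace (m * v + (b - m * v))%nat with b by lia.
   destruct (Nat.le_gt_cases k (m * ts)) as [Hle|Hgt].
   + replace (k - b)%nat with 0%nat by pos. simpl. pose proof (exp_ge1 1). lra.
   + assert (Hbe : b = (m * ts)%nat) by pos. rewrite Hbe.
    apply Rle_trans with (prodL (fun _ => exp (/ INR (m * ts))) (seq (m * ts) (k - m * ts))).
    * apply prodL_le. intros j Hj. apply in_seq in Hj. destruct (Nat.leb_spec (m * v) j); [|nia].
     rewrite Hchat, Nat.min_r by lia. assert (0 < / INR (m * ts)) by pos.
     pose proof (exp_ge1 (/ INR (m * ts))). nra.
    * rewrite prodL_const, length_seq, exp_pow_nat. apply exp_mono.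
     apply Rdiv_le_swap; [pos|].
     rewrite Rmult_1_l. apply le_INR. nia. }
 unfold kern. simpl fst. rewrite Nat.sub_0_r.
 pose proof (cur_bounds k) as (Hc1 & Hc2). set (s := cur k) in *.
 assert (1 <= s) by pos. assert (1 <= v) by pos.
 assert (s / 2 * m <= 2 * b).
 { assert (Hn : (s * m <= 4 * b)%nat) by (unfold b; nia). apply le_INR in Hn. rewrite !mult_INR in Hn. simpl (INR 4) in Hn. lra. }
 assert (b <= m * s) by (rewrite <- mult_INR; apply le_INR; unfold b; lia).
 assert (PG (m * v) (b - m * v) <= 2 * Rpower (s / v) gam).
 { eapply Rle_trans; [apply PG_upper; assumption|]. replace (m * v + (b - m * v))%nat with b by lia.
  rewrite mult_INR. apply Rle_trans with (Rpower (2 * (s / v)) gam).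
  - apply Rpower_le_base; [|apply Rdiv_le_swap; [nra|]|lra].
   + apply Rdiv_lt_0_compat; [|nra]. apply le_INR in Hb. rewrite mult_INR in Hb. nra.
   + replace (2 * (s / v) * (m * v - 1)) with (2 * s * m - 2 * s / v) by pos.
    assert (s / v <= s) by (apply Rdiv_le_swap; [lra|]; nra). nra.
  - rewrite <- Rpower_mult_distr; [|lra|pos].
   apply Rmult_le_compat_r; [pos|]. apply Rpower_2_le. lra. }
 assert (0 < b) by pos.
 rewrite (Hchat k).
 assert (gam / b <= 4 * / s).
 { apply Rdiv_le_swap; [assumption|]. replace (4 * / s * b) with (4 * b / s) by pos.
  apply Rle_div_swap; [lra|]. nra. }
 pose proof exp_le_3.
 (* The constant 24 is [4 * 2 * 3]: from [gam / b <= 4 / s], from [PG_upper], and from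
    [exp 1 <= 3]. *)
 apply Rle_trans with (4 * / s * (2 * Rpower (s / v) gam * 3)).
 - apply Rmult_le_compat; [pos| |pos|].
  + apply prodL_nonneg. intros j _. pose proof (chat_inv_nonneg (k, v) j ltac:(simpl; lia)) as Hz. pos.
  + eapply Rle_trans; [exact Hprod|]. pos.
 - rewrite Rpower_div by lra. unfold Rminus. rewrite Rpower_plus, !Rpower_Ropp, Rpower_1 by lra. pos.
Qed.

(** Each vertex is prescribed at most twice, so every factor of [Phi] is at most
    [2 * m + 2 <= 4 * m]; with the 24 of [kern_bound] this gives [96 * m]. *)
Lemma spec_bound F t sp : (forall g, 0 <= F g) -> (t <= 2 * ts)%nat -> spec_ok 0 sp ->
 (forall e, In e sp -> (fst e < m * t)%nat) -> (forall v, count_occ Nat.eq_dec (map snd sp) v <= 2)%nat ->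
 E (m * t) [] (fun g => F (sg g) * b2R (matches g sp)) <=
 E (m * t) [] (fun g => F (sg g)) *
  prodL (fun e => 96 * m * (Rpower (INR (cur (fst e))) (gam - 1) * Rpower (INR (snd e)) (- gam))) sp.
Proof.
 intros HF Ht Hok Hk Hcnt. eapply Rle_trans; [apply spec_bound_aux; pos|].
 destruct Hok as [_ Hsp]. pose proof INRm_ge2.
 apply Rmult_le_compat_l; [pos|].
 apply Rle_trans with ((4 * m) ^ length sp * prodL (fun e => 24 * (Rpower (INR (cur (fst e))) (gam - 1) * Rpower (INR (snd e)) (- gam))) sp).
 - apply Rmult_le_compat.
  + apply (Phi_mono _ (Xw []) (Xw [])). intros; split; [apply Xw_nonneg; constructor|lra].
  + apply prodL_nonneg. intros e He. destruct (Hsp e He) as (_ & H2 & H3). apply kern_nonneg; lia.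
  + rewrite <- (length_map snd sp). apply Phi_bound; [intros; apply Xw_nonneg; constructor|].
   intros u. specialize (Hcnt u). apply le_INR in Hcnt. simpl (INR 2) in Hcnt. unfold Xw, compl.
   simpl length. destruct (Nat.leb_spec 1 u), (Nat.leb u ts), (Nat.leb_spec (m * u) 0); cbn [andb]; pose proof Hm; try nia; lra.
  + apply prodL_le. intros e He. destruct (Hsp e He) as (_ & H2 & H3). split; [apply kern_nonneg; lia|].
   apply (kern_bound t); try assumption. pos.
 - right. rewrite <- prodL_const, <- prodL_mult. apply prodL_ext. pos.
Qed.

End Erase.

(** * Expected number of paths *)

Fixpoint walkb (h : history) (p : list nat) : bool :=
 match p with
 | x :: ((y :: _) as l) => adj h x y && walkb h l
 | _ => true
 end.

Lemma walkb_rev_append h l : forall x p, walkb h (rev_append l (x :: p)) = walkb h (x :: l) && walkb h (x :: p).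
Proof.
 induction l as [|y l IH]; intros x p; [pos|]. simpl rev_append. rewrite IH.
 change (walkb h (y :: x :: p)) with (adj h y x && walkb h (x :: p)).
 change (walkb h (x :: y :: l)) with (adj h x y && walkb h (y :: l)). rewrite (adj_sym h y x).
 destruct (adj h x y), (walkb h (y :: l)), (walkb h (x :: p)); reflexivity.
Qed.

Section Paths.
Context {P : PAmodel}.
Variables ts t : nat.
Hypothesis Hts : (1 <= ts <= t)%nat.
Hypothesis Ht2 : (t <= 2 * ts)%nat.

Lemma valid_nth h k e : valid h -> nth_error h k = Some e -> fst e = cur k.
Proof.
 clear ts t Hts Ht2. intros Hv. revert k. induction Hv as [|h v Hv IH Hb]; intros k Hk; [destruct k; discriminate|].
 unfold ext in Hk. destruct (Nat.lt_trichotomy k (length h)) as [Hl|[->|Hl]].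
 - rewrite nth_error_app1 in Hk by assumption. auto.
 - rewrite nth_error_app2, Nat.sub_diag in Hk by lia. injection Hk as <-. pos.
 - rewrite nth_error_app2 in Hk by lia. destruct (k - length h)%nat as [|[|]] eqn:Ek; [lia|discriminate|discriminate].
Qed.

Lemma adj_sg h x y : (ts < x)%nat -> (ts < y)%nat -> adj (sg ts h) x y = adj h x y.
Proof.
 intros Hx Hy. unfold adj, sg. induction h as [|[a b] h IH]; [pos|]. cbn [map existsb fst snd]. rewrite IH.
 unfold er. destruct (Nat.leb_spec b ts); [|pos].
 destruct (Nat.eqb_spec 0 y), (Nat.eqb_spec 0 x), (Nat.eqb_spec b y), (Nat.eqb_spec b x); try lia; reflexivity.
Qed.

Lemma adj_hits h x y : valid h -> adj h x y = true -> exists j, (j < m)%nat /\ hits h (m * (Nat.max x y - 1) + j, Nat.min x y)%nat = true.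
Proof.
 intros Hv Ha.
 assert (Hin : In (Nat.max x y, Nat.min x y) h).
 { apply adj_cases in Ha as [Ha|Ha]; pose proof (proj1 (valid_In h _ Hv Ha)) as Hb; simpl in Hb.
  - rewrite Nat.max_l, Nat.min_r by lia. assumption.
  - rewrite Nat.max_r, Nat.min_l by lia. assumption. }
 apply In_nth_error in Hin as (k & Hk). pose proof (valid_nth h k _ Hv Hk) as Hc. simpl in Hc.
 pose proof (cur_bounds k) as (H1 & H2).
 exists (k - m * (Nat.max x y - 1))%nat. split; [nia|].
 unfold hits. simpl fst. replace (m * (Nat.max x y - 1) + (k - m * (Nat.max x y - 1)))%nat with k by lia.
 rewrite Hk. apply Nat.eqb_refl.
Qed.

(** The second [m] counts the edges of the younger endpoint that may realise an adjacency. *)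
Definition C0 : R := 96 * INR m * INR m.

(** An edge between two young vertices is still visible after erasure and stays an indicator; any
    other edge is replaced by its kernel. *)
Definition kg (g : history) (x y : nat) : R :=
 if Nat.ltb ts (Nat.min x y) then b2R (adj g x y)
 else C0 * (Rpower (INR (Nat.max x y)) (gam - 1) * Rpower (INR (Nat.min x y)) (- gam)).

Lemma C0_pos : 0 < C0.
Proof. unfold C0. pose proof INRm_ge2. nra. Qed.

Lemma kg_nonneg g x y : 0 <= kg g x y.
Proof.
 unfold kg. destruct (Nat.ltb ts (Nat.min x y)); [pos|]. pose proof C0_pos.
 pos.
Qed.

Lemma kg_sym g x y : kg g x y = kg g y x.
Proof. unfold kg. rewrite Nat.min_comm, Nat.max_comm, adj_sym. pos. Qed.

Fixpoint Kp (g : history) (p : list nat) : R :=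
 match p with
 | x :: ((y :: _) as l) => kg g x y * Kp g l
 | _ => 1
 end.

Lemma Kp_nonneg g p : 0 <= Kp g p.
Proof.
 induction p as [|x [|y l] IH]; [simpl; lra|pos|].
 apply Rmult_le_pos; [apply kg_nonneg|pos].
Qed.

Lemma Kp_rev_append g l : forall x p, Kp g (rev_append l (x :: p)) = Kp g (x :: l) * Kp g (x :: p).
Proof.
 induction l as [|y l IH]; intros x p; [cbn [rev_append Kp]; ring|]. simpl rev_append. rewrite IH.
 change (Kp g (y :: x :: p)) with (kg g y x * Kp g (x :: p)).
 change (Kp g (x :: y :: l)) with (kg g x y * Kp g (y :: l)). rewrite (kg_sym g y x). ring.
Qed.

(** All ways to realise the non-young edges of the path, one decision index for each of them; young
    edges are left to [newok]. *)
Fixpoint specs (p : list nat) : list (list (nat * nat)) :=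
 match p with
 | x :: ((y :: _) as l) =>
   if Nat.ltb ts (Nat.min x y) then specs l
   else flat_map (fun sp => map (fun j => ((m * (Nat.max x y - 1) + j)%nat, Nat.min x y) :: sp) (seq 0 m)) (specs l)
 | _ => [[]]
 end.

Fixpoint newok (g : history) (p : list nat) : bool :=
 match p with
 | x :: ((y :: _) as l) => (negb (Nat.ltb ts (Nat.min x y)) || adj g x y) && newok g l
 | _ => true
 end.

Lemma walk_specs h p : valid h -> walkb h p = true ->
 newok (sg ts h) p = true /\ exists sp, In sp (specs p) /\ matches h sp = true.
Proof.
 intros Hv. induction p as [|x [|y l] IH]; [simpl; eauto|pos|].
 change (newok (sg ts h) (x :: y :: l)) with ((negb (Nat.ltb ts (Nat.min x y)) || adj (sg ts h) x y) && newok (sg ts h) (y :: l)).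
 intros Hw. apply andb_true_iff in Hw as [Ha Hw]. destruct (IH Hw) as (Hn & sp & Hin & Hmt).
 remember (y :: l) as l0 eqn:El. simpl specs. rewrite El. rewrite <- El.
 destruct (Nat.ltb_spec ts (Nat.min x y)) as [Hlt|Hge].
 - rewrite adj_sg, Ha by lia. pos.
 - split; [pos|]. destruct (adj_hits h x y Hv Ha) as (j & Hj & Hhit).
  exists (((m * (Nat.max x y - 1) + j)%nat, Nat.min x y) :: sp). split.
  + apply in_flat_map. exists sp. split; [assumption|]. apply in_map_iff. exists j. pos.
  + unfold matches. cbn [forallb]. rewrite Hhit. pos.
Qed.

(** Self-avoidance bounds the multiplicities: a vertex is the older endpoint of at most two edges of
    the path. The head is allowed only one, since a vertex put in front of it may add another. *)
Lemma specs_In p : (forall x, In x p -> (1 <= x <= t)%nat) -> NoDup p -> forall sp, In sp (specs p) ->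
 (forall e, In e sp -> exists x y, In x p /\ In y p /\ x <> y /\ (Nat.min x y <= ts)%nat /\ snd e = Nat.min x y /\ cur (fst e) = Nat.max x y) /\
 NoDup sp /\
 (forall v, (count_occ Nat.eq_dec (map snd sp) v <= (if in_dec Nat.eq_dec v p then if Nat.eqb v (hd 0%nat p) then 1 else 2 else 0))%nat).
Proof.
 induction p as [|x [|y l] IH]; intros Hb Hnd sp Hsp.
 - destruct Hsp as [<-|[]]. repeat split; [intros e []|pos|pos].
 - destruct Hsp as [<-|[]]. repeat split; [intros e []|pos|intros; apply Nat.le_0_l].
 - inversion Hnd as [|? ? Hx Hnd']; subst.
  assert (Hb' : forall z, In z (y :: l) -> (1 <= z <= t)%nat) by (intros; apply Hb; right; assumption).
  assert (x <> y) by (intros ->; apply Hx; left; reflexivity).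
  change (specs (x :: y :: l)) with (if Nat.ltb ts (Nat.min x y) then specs (y :: l)
   else flat_map (fun sp => map (fun j => ((m * (Nat.max x y - 1) + j)%nat, Nat.min x y) :: sp) (seq 0 m)) (specs (y :: l))) in Hsp.
  assert (Hcnt : forall sp' : list (nat * nat), (forall v, (count_occ Nat.eq_dec (map snd sp') v <= (if in_dec Nat.eq_dec v (y :: l) then if Nat.eqb v (hd 0%nat (y :: l)) then 1 else 2 else 0))%nat) ->
   forall v, (count_occ Nat.eq_dec (map snd sp') v + (if Nat.eq_dec (Nat.min x y) v then 1 else 0) <=
    (if in_dec Nat.eq_dec v (x :: y :: l) then if Nat.eqb v (hd 0%nat (x :: y :: l)) then 1 else 2 else 0))%nat).
  { intros sp' Hc v. specialize (Hc v). cbn [hd] in *.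
   destruct (in_dec Nat.eq_dec v (y :: l)) as [Hv|Hv], (in_dec Nat.eq_dec v (x :: y :: l)) as [Hv'|Hv'].
   - destruct (Nat.eqb_spec v x); [pos|]. destruct (Nat.eqb_spec v y), (Nat.eq_dec (Nat.min x y) v); lia.
   - exfalso. apply Hv'. pos.
   - destruct Hv' as [->|Hv']; [|tauto]. rewrite Nat.eqb_refl. destruct (Nat.eq_dec (Nat.min v y) v); lia.
   - destruct (Nat.eq_dec (Nat.min x y) v) as [He|]; [|lia]. exfalso. apply Hv'.
    destruct (Nat.min_spec x y) as [[_ Hm1]|[_ Hm1]]; rewrite Hm1 in He; subst; [left|right; left]; reflexivity. }
  destruct (Nat.ltb_spec ts (Nat.min x y)) as [Hlt|Hge].
  + destruct (IH Hb' Hnd' sp Hsp) as (H1 & H2 & H3). split; [|split; [assumption|]].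
   * intros e He. destruct (H1 e He) as (a & b & Ha & Hbb & Hr). exists a, b. pos.
   * intros v. specialize (Hcnt sp H3 v). lia.
  + apply in_flat_map in Hsp as (sp' & Hsp' & Hj). apply in_map_iff in Hj as (j & <- & Hj). apply in_seq in Hj.
   destruct (IH Hb' Hnd' sp' Hsp') as (H1 & H2 & H3).
   assert (cur (m * (Nat.max x y - 1) + j) = Nat.max x y) by (rewrite cur_mul by lia; lia).
   split; [|split].
   * intros e [<-|He].
    -- exists x, y. simpl. pos.
    -- destruct (H1 e He) as (a & b & Ha & Hbb & Hr). exists a, b. pos.
   * constructor; [|assumption]. intros Hin. destruct (H1 _ Hin) as (a & b & Ha & Hbb & Hab & _ & Hs & Hc).
    simpl in Hs, Hc. apply Hx. assert (x = a \/ x = b) as [->| ->] by lia; assumption.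
   * intros v. specialize (Hcnt sp' H3 v). cbn [map snd count_occ]. destruct (Nat.eq_dec (Nat.min x y) v); lia.
Qed.

(** Two distinct requirements on the same decision contradict each other, so lists with repeated
    indices have probability 0. *)
Lemma matches_keys h sp : NoDup sp -> matches h sp = true -> NoDup (map fst sp).
Proof.
 induction 1 as [|e sp Hni Hnd IH]; intros Hmt; simpl; [pos|].
 unfold matches in Hmt. cbn [forallb] in Hmt. apply andb_true_iff in Hmt as [He Hmt].
 constructor; [|pos]. intros Hin. apply in_map_iff in Hin as (e' & Hf & Hin).
 rewrite forallb_forall in Hmt. specialize (Hmt e' Hin). unfold hits in He, Hmt. rewrite Hf in Hmt.
 destruct (nth_error h (fst e)) as [z|]; [|pos]. apply Nat.eqb_eq in He, Hmt.
 destruct e, e'; simpl in *; congruence.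
Qed.

Lemma specs_sum g p : NoDup p ->
 b2R (newok g p) * sumL (prodL (fun e => 96 * m * (Rpower (INR (cur (fst e))) (gam - 1) * Rpower (INR (snd e)) (- gam)))) (specs p) = Kp g p
 \/ exists x, In x p /\ (x < 1)%nat.
Proof.
 set (f := fun e : nat * nat => 96 * INR m * (Rpower (INR (cur (fst e))) (gam - 1) * Rpower (INR (snd e)) (- gam))).
 induction p as [|x [|y l] IH]; intros Hnd; [left; simpl; unfold b2R; ring|left; simpl; unfold b2R; ring|].
 inversion Hnd as [|? ? Hx Hnd']; subst. destruct (IH Hnd') as [IH'|(z & Hz & Hz1)]; [|right; exists z; split; pos; assumption].
 destruct (Nat.le_gt_cases 1 x); [|right; exists x; split; pos].
 left. change (Kp g (x :: y :: l)) with (kg g x y * Kp g (y :: l)). rewrite <- IH'.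
 change (newok g (x :: y :: l)) with ((negb (Nat.ltb ts (Nat.min x y)) || adj g x y) && newok g (y :: l)).
 change (specs (x :: y :: l)) with (if Nat.ltb ts (Nat.min x y) then specs (y :: l)
   else flat_map (fun sp => map (fun j => ((m * (Nat.max x y - 1) + j)%nat, Nat.min x y) :: sp) (seq 0 m)) (specs (y :: l))).
 unfold kg. destruct (Nat.ltb ts (Nat.min x y)); cbn [negb orb].
 - destruct (adj g x y), (newok g (y :: l)); cbn [andb]; unfold b2R; ring.
 - cbn [andb]. rewrite sumL_flat_map.
  rewrite (sumL_ext _ (fun sp => C0 * (Rpower (INR (Nat.max x y)) (gam - 1) * Rpower (INR (Nat.min x y)) (- gam)) * prodL f sp)).
  + rewrite sumL_scal. ring.
  + intros sp _. rewrite sumL_map.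
   rewrite (sumL_ext _ (fun _ => f (m * (Nat.max x y - 1), Nat.min x y)%nat * prodL f sp)).
   * rewrite sumL_const, length_seq. unfold f at 1. simpl fst. simpl snd.
    rewrite <- (Nat.add_0_r (m * (Nat.max x y - 1))), cur_mul by (pose proof Hm; lia).
    replace (S (Nat.max x y - 1)) with (Nat.max x y) by lia. unfold C0. ring.
   * intros j Hj. apply in_seq in Hj. cbn [prodL]. unfold f. simpl fst.
    rewrite cur_mul by lia. rewrite <- (Nat.add_0_r (m * (Nat.max x y - 1))), cur_mul by pos. pos.
Qed.

(** The event [S] and the young edges depend on the erased history only and enter [spec_bound]
    through [F]; the remaining edges become kernels. *)
Lemma path_prob (S : history -> bool) p : NoDup p -> (forall x, In x p -> (1 <= x <= t)%nat) ->
 E (m * t) [] (fun h => b2R (S (sg ts h) && walkb h p)) <= E (m * t) [] (fun h => b2R (S (sg ts h)) * Kp (sg ts h) p).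
Proof.
 intros Hnd Hb. set (F := fun g => b2R (S g && newok g p)).
 set (f := fun e : nat * nat => 96 * INR m * (Rpower (INR (cur (fst e))) (gam - 1) * Rpower (INR (snd e)) (- gam))).
 apply Rle_trans with (sumL (fun sp => E (m * t) [] (fun h => F (sg ts h) * b2R (matches h sp))) (specs p)).
 - rewrite <- E_sumL. apply E_le; [pos|]. intros h Hv Hl. simpl app.
  rewrite sumL_scal. destruct (S (sg ts h) && walkb h p) eqn:Ew.
  + apply andb_true_iff in Ew as [HS Hw]. destruct (walk_specs h p Hv Hw) as (Hn & sp & Hin & Hmt).
   unfold F. rewrite HS, Hn. change (b2R true) with 1. rewrite Rmult_1_l.
   replace 1 with (b2R (matches h sp)) by (rewrite Hmt; reflexivity).
   apply (sumL_In_le (fun sp => b2R (matches h sp))); pos.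
  + apply Rmult_le_pos; [apply b2R_range|]. pos.
 - apply Rle_trans with (sumL (fun sp => E (m * t) [] (fun g => F (sg ts g)) * prodL f sp) (specs p)).
  + apply sumL_le. intros sp Hsp. destruct (specs_In p Hb Hnd sp Hsp) as (H1 & H2 & H3).
   assert (0 <= prodL f sp).
   { apply prodL_nonneg. unfold f.
    pos. }
   assert (0 <= E (m * t) [] (fun g => F (sg ts g))) by (apply E_nonneg; [pos|intros; apply b2R_range]).
   destruct (ListDec.NoDup_dec Nat.eq_dec (map fst sp)) as [Hk|Hk].
   * apply spec_bound; try assumption; try lia.
    -- intros g; apply b2R_range.
    -- split; [assumption|]. intros e He. destruct (H1 e He) as (x & y & Hx & Hy & Hxy & Hmin & Hs & Hc).
      pose proof (Hb x Hx). pose proof (Hb y Hy). pose proof (cur_bounds (fst e)) as (_ & Hcb).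
      repeat split; try lia. transitivity (m * (Nat.max x y - 1))%nat; [|lia]. pos.
    -- intros e He. destruct (H1 e He) as (x & y & Hx & Hy & Hxy & Hmin & Hs & Hc).
      pose proof (Hb x Hx). pose proof (Hb y Hy). pose proof (cur_bounds (fst e)) as (_ & Hcb).
      apply Nat.lt_le_trans with (m * Nat.max x y)%nat; [lia|]. pos.
    -- intros v. specialize (H3 v). destruct (in_dec Nat.eq_dec v p); [destruct (Nat.eqb v (hd 0%nat p))|]; lia.
   * rewrite (E_ext _ _ _ (fun _ => 0)).
    -- rewrite E_const by constructor. pos.
    -- pos.
    -- intros h _ _. simpl. destruct (matches h sp) eqn:Emt; [|unfold b2R at 1; ring].
      exfalso. apply Hk. eapply matches_keys; eassumption.
  + rewrite sumL_scal, Rmult_comm, <- E_scal. apply E_le; [pos|]. intros h _ _. simpl app. unfold F.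
   destruct (specs_sum (sg ts h) p Hnd) as [Hs|(x & Hx & Hx1)]; [|specialize (Hb x Hx); lia].
   rewrite <- Hs. fold f. destruct (S (sg ts h)), (newok (sg ts h) p); cbn [andb]; unfold b2R; right; ring.
Qed.

Lemma path_union {A} (pth : A -> list nat) (S : history -> A -> bool) (Om : list A) :
 (forall a, In a Om -> forall x, In x (pth a) -> (1 <= x <= t)%nat) ->
 E (m * t) [] (fun h => b2R (existsb (fun a => (if ListDec.NoDup_dec Nat.eq_dec (pth a) then true else false) && (S (sg ts h) a && walkb h (pth a))) Om))
  <= E (m * t) [] (fun h => sumL (fun a => b2R (S (sg ts h) a) * Kp (sg ts h) (pth a)) Om).
Proof.
 intros Hb. apply Rle_trans with (sumL (fun a => E (m * t) [] (fun h => b2R ((if ListDec.NoDup_dec Nat.eq_dec (pth a) then true else false) && (S (sg ts h) a && walkb h (pth a))))) Om).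
 - rewrite <- E_sumL. apply E_le; [pos|]. intros h _ _. apply b2R_existsb_le.
 - rewrite E_sumL. apply sumL_le. intros a Ha. destruct (ListDec.NoDup_dec Nat.eq_dec (pth a)) as [Hnd|Hnd].
  + apply (path_prob (fun g => S g a)); [assumption|]. apply Hb; assumption.
  + rewrite (E_ext _ _ _ (fun _ => 0)); [|pos|pos]. rewrite E_const by constructor.
   apply E_nonneg; [pos|]. intros h _ _. apply Rmult_le_pos; [pos|apply Kp_nonneg].
Qed.

End Paths.

#[export] Hint Resolve C0_pos kg_nonneg Kp_nonneg : pos.

Lemma Rpower_neg_le x y a : 0 < x -> x <= y -> 0 <= a -> Rpower y (- a) <= Rpower x (- a).
Proof.
 intros. rewrite !Rpower_Ropp. apply Rinv_le_contravar; [pos|apply Rpower_le_base; assumption].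
Qed.

Lemma sumL_tail (f : nat -> R) (y : R) t : 0 < y -> (forall v, 0 <= f v) ->
 exists n0, (1 <= n0)%nat /\ y <= INR n0 /\
 sumL (fun v => if Rleb y (INR v) then f v else 0) (seq 1 t) <= sumL f (seq n0 t).
Proof.
 intros Hy Hf. destruct (nceil_spec y ltac:(lra)) as [H1 H2]. set (nc := nceil y) in *.
 assert (Hex : exists n0, (1 <= n0)%nat /\ y <= n0 /\ forall v, y <= INR v -> (n0 <= v)%nat).
 (* [nceil] exceeds an integer by one; in that case its predecessor is the first index to be
    kept. *)
 { destruct (Rle_dec y (INR (nc - 1))) as [Hle|Hgt].
  - exists (nc - 1)%nat. destruct (Nat.eq_dec (nc - 1) 0) as [E0|E0]; [rewrite E0 in Hle; simpl in Hle; lra|].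
   repeat split; [lia|assumption|]. intros v Hv. apply INR_le. rewrite minus_INR by lia. simpl (INR 1). lra.
  - exists nc. split; [apply nceil_pos|]. split; [assumption|]. intros v Hv.
   destruct (Nat.le_gt_cases nc v); [assumption|]. exfalso. apply Hgt.
   apply Rle_trans with v; pos. }
 destruct Hex as (n0 & Hn0 & Hyn & Hmin). exists n0. repeat split; [assumption|assumption|].
 rewrite <- sumL_filter. apply sumL_incl; [pos| |pos].
 intros v Hv. apply filter_In in Hv as [Hv1 Hv2]. apply in_seq in Hv1. apply Rleb_true, Hmin in Hv2.
 pos.
Qed.

(** * Truncated path sums *)

Section PathSums.
Context {P : PAmodel}.
Variables ts t : nat.
Hypothesis Hts : (1 <= ts <= t)%nat.
Hypothesis Ht2 : (t <= 2 * ts)%nat.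
Variable th : nat -> R.

(* Paths are listed from their current end back to the start in [L]; the
  truncation [th] is imposed on all inner vertices. *)
Fixpoint okp (L : list nat) (p : list nat) : bool :=
 match p with
 | [] => false
 | w :: p' =>
   match p' with
   | [] => existsb (Nat.eqb w) L
   | v :: rest => (match rest with [] => Nat.leb w ts | _ => Rleb (th (length rest)) (INR v) end) && okp L p'
   end
 end.

Fixpoint Om (n : nat) : list (list nat) :=
 match n with
 | O => map (fun v => [v]) (seq 1 t)
 | S n' => flat_map (fun p => map (fun v => v :: p) (seq 1 t)) (Om n')
 end.

Lemma Om_In n p : In p (Om n) <-> length p = S n /\ forall x, In x p -> (1 <= x <= t)%nat.
Proof.
 clear Hts Ht2. revert p. induction n; intros p; cbn [Om].
 - rewrite in_map_iff. split.
  + intros (v & <- & Hv). apply in_seq in Hv. split; [pos|]. intros x [<-|[]]. lia.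
  + intros [Hl Hb]. destruct p as [|v [|? ?]]; try discriminate. exists v.
   specialize (Hb v (or_introl eq_refl)). pos.
 - rewrite in_flat_map. split.
  + intros (q & Hq & Hp). apply in_map_iff in Hp as (v & <- & Hv). apply in_seq in Hv. apply IHn in Hq as [Hl Hb].
   split; [simpl; lia|]. intros x [<-|Hx]; [lia|auto].
  + intros [Hl Hb]. destruct p as [|v q]; [discriminate|]. exists q. split.
   * apply IHn. split; [pos|]. intros; apply Hb; right; assumption.
   * apply in_map_iff. exists v. specialize (Hb v (or_introl eq_refl)). pos.
Qed.

Variable g : history.
Variable L : list nat.

Definition cond (n v w : nat) : bool := match n with O => Nat.leb w ts | _ => Rleb (th n) (INR v) end.

(** Total weight of the truncated paths of [n] edges from [L] to [w], arranged as the iteration of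
    an operator; [path_sum] identifies the two. *)
Fixpoint mu (n : nat) (w : nat) : R :=
 match n with
 | O => b2R (existsb (Nat.eqb w) L)
 | S n' => sumL (fun v => mu n' v * (b2R (cond n' v w) * kg ts g w v)) (seq 1 t)
 end.

Lemma mu_nonneg n : forall w, 0 <= mu n w.
Proof.
 induction n; intros w; cbn [mu]; [pos|].
 pos.
Qed.

Lemma path_sum n : forall F : nat -> R,
 sumL (fun p => F (hd 0%nat p) * (b2R (okp L p) * Kp ts g p)) (Om n) = sumL (fun v => F v * mu n v) (seq 1 t).
Proof.
 induction n; intros F; cbn [Om].
 - rewrite sumL_map. apply sumL_ext. intros v _. simpl. ring.
 - rewrite sumL_flat_map.
  rewrite (sumL_ext _ (fun p => (fun v => sumL (fun w => F w * (b2R (cond n v w) * kg ts g w v)) (seq 1 t)) (hd 0%nat p) * (b2R (okp L p) * Kp ts g p))).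
  + rewrite (IHn (fun v => sumL (fun w => F w * (b2R (cond n v w) * kg ts g w v)) (seq 1 t))).
   rewrite (sumL_ext (fun v => F v * _) (fun w => sumL (fun v => F w * (mu n v * (b2R (cond n v w) * kg ts g w v))) (seq 1 t)))
    by (intros; rewrite sumL_scal; reflexivity).
   rewrite sumL_exchange. apply sumL_ext. intros v _. rewrite <- sumL_scal_r. apply sumL_ext. pos.
  + intros p Hp. apply Om_In in Hp as [Hl _]. destruct p as [|v rest]; [discriminate|].
   rewrite sumL_map, <- sumL_scal_r. apply sumL_ext. intros w _. cbn [hd].
   change (Kp ts g (w :: v :: rest)) with (kg ts g w v * Kp ts g (v :: rest)).
   replace (okp L (w :: v :: rest)) with (cond n v w && okp L (v :: rest)).
   * destruct (cond n v w), (okp L (v :: rest)); cbn [andb]; unfold b2R; ring.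
   * injection Hl as Hl. rewrite <- Hl. destruct rest; reflexivity.
Qed.

Variables al be : nat -> R.
Variables La De : R.
Hypothesis HL1 : NoDup L.
Hypothesis HL2 : forall x, In x L -> (ts < x <= t)%nat.
Hypothesis Hdeg : forall w, (ts < w <= t)%nat -> sumL (fun v => if Nat.ltb ts v then b2R (adj g w v) else 0) (seq 1 t) <= De.
Hypothesis HDe : 0 <= De.
Hypothesis HLa1 : C0 * (1 + ln (INR t)) + 2 * De <= La.
Hypothesis HLa2 : C0 * (1 + / (2 * gam - 1)) <= La.
Hypothesis Hth : forall n, 0 < th n <= INR ts.
Hypothesis Hal1 : INR (length L) * C0 * Rpower (INR ts) (gam - 1) <= al 1%nat.
Hypothesis Hbe0 : forall n, 0 <= be n.
Hypothesis Hal : forall n, (1 <= n)%nat -> La * (al n + be n * Rpower (INR t) (2 * gam - 1)) <= al (S n).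
Hypothesis Hbe : forall n, (1 <= n)%nat -> La * (al n * Rpower (th n) (- (2 * gam - 1)) + be n) <= be (S n).

(** The kernel contributes [w^(-gam)] when [w] is the older endpoint of the last edge and
    [w^(gam-1)] when it is the younger one. In the second case [w] lies above the truncated previous
    vertex, hence the indicator. *)
Definition env (n w : nat) : R :=
 al n * Rpower (INR w) (- gam) + (if Rleb (th (n - 1)) (INR w) then be n * Rpower (INR w) (gam - 1) else 0).

Lemma kg_le w v : (1 <= w)%nat -> (1 <= v)%nat ->
 kg ts g w v <= (if Nat.leb v w then C0 * (Rpower v (- gam) * Rpower w (gam - 1))
         else C0 * (Rpower w (- gam) * Rpower v (gam - 1)))
  + (if Nat.ltb ts w && Nat.ltb ts v then b2R (adj g w v) else 0).
Proof.
 intros Hw Hv. unfold kg.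
 assert (Hpp : forall a b c d, 0 <= C0 * (Rpower a b * Rpower c d)) by pos.
 destruct (Nat.ltb_spec ts (Nat.min w v)).
 - destruct (Nat.ltb_spec ts w); [|lia]. destruct (Nat.ltb_spec ts v); [|lia]. cbn [andb].
  destruct (Nat.leb v w); (match goal with |- _ <= ?x + _ => assert (0 <= x) by apply Hpp end); lra.
 - replace (Nat.ltb ts w && Nat.ltb ts v) with false.
  2: { symmetry. apply andb_false_iff. rewrite !Nat.ltb_ge. lia. }
  destruct (Nat.leb_spec v w).
  + rewrite Nat.max_l, Nat.min_r by lia. pos.
  + rewrite Nat.max_r, Nat.min_l by lia. pos.
Qed.

Lemma al_nonneg n : (1 <= n)%nat -> 0 <= al n.
Proof.
 assert (0 <= La).
 { eapply Rle_trans; [|apply HLa2]. pose proof gam_range.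
  pos. }
 intros Hn. induction n as [|[|n] IH]; [lia| |].
 - eapply Rle_trans; [|apply Hal1].
  pos.
 - eapply Rle_trans; [|apply Hal; lia]. specialize (IH ltac:(lia)).
  pos.
Qed.

Lemma mu_bound n : (1 <= n)%nat -> forall w, (1 <= w <= t)%nat -> mu n w <= env n w.
Proof.
 pose proof gam_range as Hg. pose proof C0_pos as HC0.
 assert (Hg0 : 0 < gam) by lra. assert (Hg3 : 0 < 1 - gam) by lra. assert (Hg4 : 1 - gam <= 1) by lra.
 set (a := 2 * gam - 1). assert (Ha : 0 < a <= 1) by (unfold a; lra).
 assert (HA2 : 0 < / a) by pos.
 induction n as [|[|n] IH]; intros Hn w Hw; [lia| |].
 - unfold env.
  apply Rle_trans with (sumL (fun v => b2R (existsb (Nat.eqb v) L) * (C0 * Rpower ts (gam - 1) * Rpower w (- gam))) (seq 1 t)).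
  + apply sumL_le. intros v Hv. destruct (existsb (Nat.eqb v) L) eqn:Ev; [|unfold b2R at 1 3; lra].
   apply existsb_exists in Ev as (x & Hx & Hvx). apply Nat.eqb_eq in Hvx. subst x. specialize (HL2 v Hx).
   rewrite !Rmult_1_l. unfold cond.
   assert (H0 : 0 <= C0 * Rpower ts (gam - 1) * Rpower w (- gam)) by pos.
   destruct (Nat.leb_spec w ts); [|change (b2R false) with 0; lra]. rewrite Rmult_1_l.
   unfold kg. destruct (Nat.ltb_spec ts (Nat.min w v)); [lia|]. rewrite Nat.min_l by lia.
   rewrite Rmult_assoc. apply Rmult_le_compat_l; [lra|]. apply Rmult_le_compat_r; [pos|].
   replace (gam - 1) with (- (1 - gam)) by ring. apply Rpower_neg_le; pos.
  + rewrite sumL_scal_r.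
   assert (Hcard : sumL (fun v => b2R (existsb (Nat.eqb v) L)) (seq 1 t) <= INR (length L)).
   { rewrite <- INR_sum_filter. apply le_INR. apply NoDup_incl_length; [pos|].
    intros v Hv. apply filter_In in Hv as [_ Hv]. apply existsb_exists in Hv as (x & Hx & Hvx). apply Nat.eqb_eq in Hvx. pos. }
   assert (H0 : 0 <= C0 * Rpower ts (gam - 1)) by pos.
   pose proof (Rpower_pos w (- gam)).
   assert (H1 : sumL (fun v => b2R (existsb (Nat.eqb v) L)) (seq 1 t) * (C0 * Rpower ts (gam - 1)) <= al 1%nat)
    by (eapply Rle_trans; [apply Rmult_le_compat_r; [assumption|exact Hcard]|]; rewrite <- Rmult_assoc; exact Hal1).
   apply (Rmult_le_compat_r (Rpower w (- gam))) in H1; [|lra].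
   assert (0 <= (if Rleb (th (1 - 1)) w then be 1 * Rpower w (gam - 1) else 0)).
   { destruct (Rleb (th (1 - 1)) w); [|lra]. pos. }
   lra.
 - set (n' := S n) in *.
  assert (Hcond : forall v, cond n' v w = Rleb (th n') v) by reflexivity.
  pose proof (al_nonneg n' ltac:(unfold n'; lia)) as Hal0. pose proof (Hbe0 n') as Hb0.
  destruct (Hth n') as [Hth0 Hthts].
  assert (0 < w) by pos.
  set (W1 := Rpower (INR w) (- gam)). set (W2 := Rpower (INR w) (gam - 1)).
  assert (HW1 : 0 < W1) by apply Rpower_pos. assert (HW2 : 0 < W2) by apply Rpower_pos.
  set (I := if Rleb (th n') (INR w) then 1 else 0).
  set (f1 := fun v => if Rleb (th n') (INR v) then Rpower (INR v) (- (1 + a)) else 0).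
  set (f3 := fun v => if Nat.ltb ts v then b2R (adj g w v) else 0).
  (* The three groups are steps from an older vertex, from a younger one, and along young edges.
     Summed over [v], the products of powers give [th^(-(2 * gam - 1))], a logarithm, and
     [t^(2 * gam - 1)], exactly the terms of [Hal] and [Hbe]. *)
  assert (Hterm : forall v, In v (seq 1 t) -> mu n' v * (b2R (cond n' v w) * kg ts g w v) <=
   I * C0 * W2 * (al n' * f1 v + be n' * / v) + C0 * W1 * (al n' * / v + be n' * Rpower v (a - 1))
   + (if Nat.ltb ts w then 2 * (al n' * W1 + be n' * W2) else 0) * f3 v).
  { intros v Hv. apply in_seq in Hv. rewrite Hcond. assert (0 < v) by pos.
   pose proof (Rpower_pos v (- (1 + a))).
   assert (0 <= f1 v) by (unfold f1; destruct (Rleb (th n') v); lra).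
   assert (0 <= f3 v) by (unfold f3; destruct (Nat.ltb ts v); pos).
   assert (HI : 0 <= I) by (unfold I; destruct (Rleb (th n') w); lra).
   assert (0 <= I * C0 * W2 * (al n' * f1 v + be n' * / v)) by pos.
   assert (0 <= C0 * W1 * (al n' * / v + be n' * Rpower v (a - 1))) by pos.
   assert (0 <= (if Nat.ltb ts w then 2 * (al n' * W1 + be n' * W2) else 0) * f3 v).
   { destruct (Nat.ltb ts w); [|lra].
    pos. }
   destruct (Rleb (th n') v) eqn:Ev; [|unfold b2R; rewrite Rmult_0_l, Rmult_0_r; lra].
   rewrite Rmult_1_l.
   set (e := al n' * Rpower (INR v) (- gam) + be n' * Rpower (INR v) (gam - 1)).
   pose proof (Rpower_pos v (- gam)). pose proof (Rpower_pos v (gam - 1)).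
   assert (0 <= e) by (apply Rplus_le_le_0_compat; apply Rmult_le_pos; lra).
   assert (mu n' v <= e).
   { eapply Rle_trans; [apply IH; lia|]. apply Rplus_le_compat_l.
    destruct (Rleb (th (n' - 1)) v); [lra|]. pos. }
   apply Rle_trans with (e * kg ts g w v); [pos|].
   eapply Rle_trans; [apply Rmult_le_compat_l; [assumption|apply kg_le; lia]|].
   rewrite Rmult_plus_distr_l. apply Rplus_le_compat.
   - assert (Hm1 : Rpower v (- gam) * Rpower v (gam - 1) = / v).
    { rewrite <- Rpower_plus. replace (- gam + (gam - 1)) with (- (1)) by ring. rewrite Rpower_Ropp, Rpower_1 by assumption. pos. }
    destruct (Nat.leb_spec v w) as [Hle|Hgt].
    + assert (HI1 : I = 1).
     { unfold I. replace (Rleb (th n') w) with true; [pos|]. symmetry. apply Rleb_true. apply Rleb_true in Ev.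
      apply Rle_trans with v; pos. }
     assert (Hm2 : Rpower v (- gam) * Rpower v (- gam) = f1 v).
     { unfold f1. rewrite Ev, <- Rpower_plus. f_equal. unfold a. ring. }
     apply Rle_trans with (I * C0 * W2 * (al n' * f1 v + be n' * / v)); [|lra].
     right. rewrite HI1, <- Hm1, <- Hm2. fold W2. unfold e. ring.
    + assert (Hm2 : Rpower v (gam - 1) * Rpower v (gam - 1) = Rpower v (a - 1)).
     { rewrite <- Rpower_plus. f_equal. unfold a. ring. }
     apply Rle_trans with (C0 * W1 * (al n' * / v + be n' * Rpower v (a - 1))); [|lra].
     right. rewrite <- Hm1, <- Hm2. fold W1. unfold e. ring.
   - unfold f3 at 1. destruct (Nat.ltb_spec ts w); cbn [andb]; [|pos].
    destruct (Nat.ltb_spec ts v); [|lra].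
    apply Rmult_le_compat_r; [pos|].
    assert (w / 2 <= v).
    { assert (Hx : (w <= 2 * v)%nat) by lia. apply le_INR in Hx. rewrite mult_INR in Hx. simpl (INR 2) in Hx. lra. }
    assert (Hpow : forall c, 0 <= c <= 1 -> Rpower v (- c) <= 2 * Rpower w (- c)).
    { intros c Hc. eapply Rle_trans; [apply (Rpower_neg_le (w / 2)); lra|]. rewrite !Rpower_Ropp, Rpower_div by lra.
     unfold Rdiv. rewrite Rinv_mult, Rinv_inv.
     rewrite Rmult_comm. apply Rmult_le_compat_r; [pos|apply Rpower_2_le; assumption]. }
    assert (Hx1 := Hpow gam). assert (Hx2 := Hpow (1 - gam)).
    destruct Hg as [Hg1 Hg2]. specialize (Hx1 (conj (Rlt_le _ _ Hg0) (Rlt_le _ _ Hg2))). specialize (Hx2 (conj (Rlt_le _ _ Hg3) Hg4)).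
    replace (- (1 - gam)) with (gam - 1) in Hx2 by ring. fold W1 in Hx1. fold W2 in Hx2.
    apply (Rmult_le_compat_l (al n')) in Hx1; [|assumption]. apply (Rmult_le_compat_l (be n')) in Hx2; [|assumption]. unfold e. lra. }
  eapply Rle_trans; [apply sumL_le; exact Hterm|].
  rewrite !sumL_plus, !sumL_scal, !sumL_plus, !sumL_scal.
  assert (sumL f1 (seq 1 t) <= (1 + / a) * Rpower (th n') (- a)).
  { destruct (sumL_tail (fun v => Rpower v (- (1 + a))) (th n') t Hth0 ltac:(intros; left; apply Rpower_pos)) as (n0 & Hn0 & Hyn & Hs).
   eapply Rle_trans; [exact Hs|]. eapply Rle_trans; [apply sum_pow_tail'; assumption|].
   apply Rmult_le_compat_l; [lra|]. apply Rpower_neg_le; lra. }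
  assert (Hs2 : sumL (fun v => / INR v) (seq 1 t) <= 1 + ln t).
  { replace t with (S (t - 1)) at 1 by lia. eapply Rle_trans; [apply sum_harmonic; lia|].
   pos. }
  assert (Hs3 : sumL (fun v => Rpower (INR v) (a - 1)) (seq 1 t) <= / a * Rpower t a) by (apply sum_pow_head; assumption).
  assert ((if Nat.ltb ts w then 2 * (al n' * W1 + be n' * W2) else 0) * sumL f3 (seq 1 t) <= 2 * De * (al n' * W1 + I * (be n' * W2))).
  { pose proof (Rmult_le_pos _ _ Hal0 (Rlt_le _ _ HW1)) as Hx1. pose proof (Rmult_le_pos _ _ Hb0 (Rlt_le _ _ HW2)) as Hx2.
   destruct (Nat.ltb_spec ts w).
   - assert (HI1 : I = 1).
    { unfold I. replace (Rleb (th n') w) with true; [pos|]. symmetry. apply Rleb_true.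
     apply Rle_trans with ts; pos. }
    rewrite HI1, Rmult_1_l. replace (2 * De * (al n' * W1 + be n' * W2)) with (2 * (al n' * W1 + be n' * W2) * De) by ring.
    apply Rmult_le_compat_l; [lra|]. apply Hdeg. lia.
   - rewrite Rmult_0_l.
    assert (0 <= I) by (unfold I; destruct (Rleb (th n') w); lra).
    pos. }
  unfold env. replace (S n' - 1)%nat with n' by lia. fold W1 W2.
  replace (if Rleb (th n') w then be (S n') * W2 else 0) with (I * (be (S n') * W2))
   by (unfold I; destruct (Rleb (th n') w); ring).
  assert (HI : 0 <= I) by (unfold I; destruct (Rleb (th n') w); lra).
  pose proof (Rpower_pos (th n') (- a)) as Hpt. pose proof (Rpower_pos t a) as HpT.
  specialize (Hal n' ltac:(unfold n'; lia)). specialize (Hbe n' ltac:(unfold n'; lia)).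
  fold a in Hal, Hbe. fold a in HLa2.
  assert (Hs2b := Hs2).
  apply (Rmult_le_compat_l (al n')) in Hs2b; [|assumption].
  apply (Rmult_le_compat_l (be n')) in Hs3; [|assumption].
  assert (I * C0 * W2 * (al n' * sumL f1 (seq 1 t) + be n' * sumL (fun v => / INR v) (seq 1 t)) <=
    I * C0 * W2 * (al n' * ((1 + / a) * Rpower (th n') (- a)) + be n' * (1 + ln t))) by pos.
  assert (C0 * W1 * (al n' * sumL (fun v => / INR v) (seq 1 t) + be n' * sumL (fun v => Rpower (INR v) (a - 1)) (seq 1 t)) <=
    C0 * W1 * (al n' * (1 + ln t) + be n' * ((1 + / a) * Rpower t a))).
  { apply Rmult_le_compat_l; [pos|]. pose proof (Rmult_le_pos _ _ Hb0 (Rlt_le _ _ HpT)). lra. }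
  assert (HA : C0 * (al n' * (1 + ln t) + be n' * ((1 + / a) * Rpower t a)) + 2 * De * al n' <= al (S n')).
  { pose proof (Rmult_le_compat_r _ _ _ Hal0 HLa1).
   pose proof (Rmult_le_compat_r _ _ _ (Rmult_le_pos _ _ Hb0 (Rlt_le _ _ HpT)) HLa2). lra. }
  assert (HB : C0 * (al n' * ((1 + / a) * Rpower (th n') (- a)) + be n' * (1 + ln t)) + 2 * De * be n' <= be (S n')).
  { pose proof (Rmult_le_compat_r _ _ _ Hb0 HLa1).
   pose proof (Rmult_le_compat_r _ _ _ (Rmult_le_pos _ _ Hal0 (Rlt_le _ _ Hpt)) HLa2). lra. }
  apply (Rmult_le_compat_r W1) in HA; [|lra]. apply (Rmult_le_compat_r (I * W2)) in HB; [|pos].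
  lra.
Qed.

End PathSums.

Lemma walkb_app h l p : walkb h (l ++ p) = true -> walkb h p = true.
Proof.
 induction l as [|x l IH]; intros Hw; [assumption|]. apply IH. simpl app in Hw.
 destruct (l ++ p); [pos|]. apply andb_true_iff in Hw. apply Hw.
Qed.

Lemma app_prefix2 (A B r : list nat) z x0 x1 : A <> [] -> A ++ z :: B = x0 :: x1 :: r ->
 exists r1, A ++ [z] = x0 :: x1 :: r1.
Proof.
 intros HA Heq. destruct A as [|a [|b A]]; [pos| |]; simpl in Heq; injection Heq as -> -> Heq.
 - exists []. pos.
 - exists (A ++ [z]). pos.
Qed.

(** * First moment bound for paths between two sets of leaves *)

Section ShortPaths.
Context {P : PAmodel}.
Variables ts t : nat.
Hypothesis Hts : (1 <= ts <= t)%nat.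
Hypothesis Ht2 : (t <= 2 * ts)%nat.
Variable lam : nat -> R.
Variables theta eta s La De N : R.
Variable K : nat.
Variable okg : history -> bool.
Hypothesis Htheta : theta = 1 - gam - eta.
Hypothesis Hth0 : 0 < theta.
Hypothesis Heta : 0 < eta.
Hypothesis Hs0 : 0 <= s.
Hypothesis HDe : 0 <= De.
Hypothesis HLa1 : C0 * (1 + ln (INR t)) + 2 * De <= La.
Hypothesis HLa2 : C0 * (1 + / (2 * gam - 1)) <= La.
Hypothesis HsLa : 2 * La <= exp s.
Hypothesis Hlam0 : forall n, ln 2 <= lam n.
Hypothesis Hlam1 : forall n, s <= theta * (lam (S n) - lam n).
Hypothesis Hlam2 : forall n, (theta + (2 * gam - 1)) * lam n + 2 * s <= theta * lam (S (S n)).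
Hypothesis HN : 2 * N * C0 <= exp (theta * lam 1%nat).
Hypothesis Hdeg : forall g, okg g = true -> forall w, (ts < w <= t)%nat ->
 sumL (fun v => if Nat.ltb ts v then b2R (adj g w v) else 0) (seq 1 t) <= De.

Definition leafy (L : history -> list nat) : Prop := forall g, okg g = true ->
 NoDup (L g) /\ (forall x, In x (L g) -> (ts < x <= t)%nat) /\ INR (length (L g)) <= N.

Definition th (n : nat) : R := INR t * exp (- lam n).
(** Since [theta + eta = 1 - gam], the paths that end below [th n] at step [n] have mean number of
    order [al n * (th n)^(1 - gam) = exp (- eta * lam n)]. Closing the recursion with [be] requires
    [Hlam2]: over two steps [lam] gains a factor above [(theta + 2 * gam - 1) / theta], which tends
    to [/ kappa] as [eta] tends to 0. *)
Definition al (n : nat) : R := Rpower (INR t) (gam - 1) * exp (theta * lam n).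
Definition be (n : nat) : R := Rpower (INR t) (- gam) * exp (theta * lam (S n) - s).

Lemma lam_mono a b : (a <= b)%nat -> lam a <= lam b.
Proof.
 induction 1 as [|b _ IH]; [lra|]. specialize (Hlam1 b).
 assert (0 <= lam (S b) - lam b); [|lra]. apply Rmult_le_reg_l with theta; lra.
Qed.

Lemma tR : 0 < t.
Proof. pos. Qed.

Lemma ln_th n : ln (th n) = ln t - lam n.
Proof. unfold th. rewrite ln_mult, ln_exp by pos. ring. Qed.

Lemma th_bounds n : 0 < th n <= ts.
Proof.
 pose proof tR. split; [apply Rmult_lt_0_compat; pos|].
 apply Rle_trans with (t * / 2).
 - apply Rmult_le_compat_l; [lra|]. rewrite exp_Ropp.
  rewrite <- (exp_ln 2) by lra. pos.
 - apply le_INR in Ht2. rewrite mult_INR in Ht2. simpl (INR 2) in Ht2. lra.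
Qed.

Lemma mu_env L g n w : leafy L -> okg g = true -> (1 <= n)%nat -> (1 <= w <= t)%nat ->
 mu ts t th g (L g) n w <= env th al be n w.
Proof.
 intros HL Hg Hn Hw. destruct (HL g Hg) as (H1 & H2 & H3). pose proof gam_range. pose proof tR.
 (* Each inequality of the recursion has two terms on the left; [2 * La <= exp s] makes each of them
    at most half of the right side. *)
 assert (Hmax : forall x y z, x + s <= z -> y + s <= z -> La * (exp x + exp y) <= exp z).
 { intros x y z Hx Hy. apply exp_mono in Hx, Hy. rewrite exp_plus in Hx, Hy.
  assert (exp x * (2 * La) <= exp x * exp s) by pos.
  assert (exp y * (2 * La) <= exp y * exp s) by pos. lra. }
 apply mu_bound with (La := La) (De := De); try assumption.
 - pos.
 - apply th_bounds.
 -
  assert (Rpower ts (gam - 1) <= 2 * Rpower t (gam - 1)).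
  { replace (gam - 1) with (- (1 - gam)) by ring.
   assert (t / 2 <= ts) by (apply le_INR in Ht2; rewrite mult_INR in Ht2; simpl (INR 2) in Ht2; lra).
   eapply Rle_trans; [apply (Rpower_neg_le (t / 2)); lra|].
   rewrite !Rpower_Ropp, Rpower_div by lra.
   unfold Rdiv. rewrite Rinv_mult, Rinv_inv, Rmult_comm.
   apply Rmult_le_compat_r; [pos|apply Rpower_2_le; lra]. }
  pose proof (Rpower_pos t (gam - 1)).
  apply Rle_trans with (N * C0 * (2 * Rpower t (gam - 1))).
  + pos.
  + replace (N * C0 * (2 * Rpower t (gam - 1))) with (Rpower t (gam - 1) * (2 * N * C0)) by ring.
   apply Rmult_le_compat_l; lra.
 - unfold be. pos.
 - intros k Hk. unfold al, be.
  replace (Rpower t (- gam) * exp (theta * lam (S k) - s) * Rpower t (2 * gam - 1))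
   with (Rpower t (gam - 1) * exp (theta * lam (S k) - s)).
  + rewrite <- Rmult_plus_distr_l. rewrite <- Rmult_assoc, (Rmult_comm La), Rmult_assoc.
   apply Rmult_le_compat_l; [pos|]. apply Hmax; [|lra]. specialize (Hlam1 k). lra.
  + replace (gam - 1) with (- gam + (2 * gam - 1)) by ring. rewrite Rpower_plus. ring.
 - intros k Hk. unfold al, be.
  replace (Rpower t (gam - 1) * exp (theta * lam k) * Rpower (th k) (- (2 * gam - 1)))
   with (Rpower t (- gam) * exp ((theta + (2 * gam - 1)) * lam k)).
  + rewrite <- Rmult_plus_distr_l. rewrite <- Rmult_assoc, (Rmult_comm La), Rmult_assoc.
   apply Rmult_le_compat_l; [pos|]. apply Hmax.
   * specialize (Hlam2 k). lra.
   * specialize (Hlam1 (S k)). lra.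
  + unfold Rpower. rewrite ln_th, <- !exp_plus. f_equal. ring.
Qed.

Lemma bad_sum L g j : leafy L -> okg g = true -> (1 <= j)%nat ->
 sumL (fun v => b2R (Rltb (INR v) (th j)) * mu ts t th g (L g) j v) (seq 1 t) <= / (1 - gam) * exp (- (eta * lam j)).
Proof.
 intros HL Hg Hj. pose proof gam_range. pose proof tR. destruct (th_bounds j) as [Hthj _].
 assert (Hi : 0 < / (1 - gam)) by pos.
 apply Rle_trans with (al j * sumL (fun v => if Rltb (INR v) (th j) then Rpower v (- gam) else 0) (seq 1 t)).
 - rewrite <- sumL_scal. apply sumL_le. intros v Hv. apply in_seq in Hv.
  destruct (Rltb v (th j)) eqn:Ev; [|unfold b2R; lra]. rewrite Rmult_1_l.
  eapply Rle_trans; [apply mu_env; assumption || lia|]. unfold env.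
  replace (Rleb (th (j - 1)) v) with false; [lra|]. symmetry. apply Rleb_false. apply Rltb_true in Ev.
  eapply Rlt_le_trans; [pos|]. apply Rmult_le_compat_l; [lra|]. apply exp_mono.
  pose proof (lam_mono (j - 1) j ltac:(lia)). lra.
 - rewrite <- sumL_filter.
  destruct (nfloor_spec (th j) ltac:(lra)) as [Hf1 Hf2]. set (nf := nfloor (th j)) in *.
  assert (Hs : sumL (fun v => Rpower (INR v) (- gam)) (filter (fun v => Rltb (INR v) (th j)) (seq 1 t)) <= / (1 - gam) * Rpower (th j) (1 - gam)).
  { apply Rle_trans with (sumL (fun v => Rpower (INR v) (- gam)) (seq 1 nf)).
   - apply sumL_incl; [pos| |pos].
    intros v Hv. apply filter_In in Hv as [Hv1 Hv2]. apply in_seq in Hv1. apply Rltb_true in Hv2. apply in_seq.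
    assert (v < INR (S nf)) by (rewrite S_INR; lra). apply INR_lt in H1. lia.
   - destruct nf as [|k]; [simpl; left; apply Rmult_lt_0_compat; pos|].
    assert (Hg1 : 0 < 1 - gam <= 1) by lra. pose proof (sum_pow_head (1 - gam) (S k) Hg1) as Hh. replace (1 - gam - 1) with (- gam) in Hh by ring.
    eapply Rle_trans; [exact Hh|]. apply Rmult_le_compat_l; [lra|]. apply Rpower_le_base; pos. }
  eapply Rle_trans; [apply Rmult_le_compat_l; [|exact Hs]|].
  + unfold al. pos.
  + right. unfold al, Rpower. rewrite ln_th, Htheta.
   replace (exp ((gam - 1) * ln t) * exp ((1 - gam - eta) * lam j) * (/ (1 - gam) * exp ((1 - gam) * (ln t - lam j))))
    with (/ (1 - gam) * (exp ((gam - 1) * ln t) * exp ((1 - gam - eta) * lam j) * exp ((1 - gam) * (ln t - lam j)))) by ring.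
   rewrite <- !exp_plus. f_equal. f_equal. ring.
Qed.

(** Two such bounds, one for each half of a path, multiplied and summed over [t] midpoints leave
    [4 * exp (4 * lam (S K)) / t]. *)
Lemma good_pointwise L g a z : leafy L -> okg g = true -> (1 <= a <= K)%nat -> (1 <= z <= t)%nat -> th K <= z ->
 mu ts t th g (L g) a z <= 2 * exp (2 * lam (S K) - ln t).
Proof.
 intros HL Hg Ha Hz Hthz. pose proof gam_range.
 assert (0 < ln 2) by (rewrite <- ln_1; apply ln_increasing; lra).
 pose proof (Hlam0 a). pose proof (Hlam0 (S a)). pose proof (lam_mono a K ltac:(lia)). pose proof (lam_mono K (S K) ltac:(lia)).
 pose proof (lam_mono (S a) (S K) ltac:(lia)).
 assert (ln t - lam K <= ln z).
 { rewrite <- ln_th. apply ln_mono; [apply th_bounds|assumption]. }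
 assert (Hmul : forall x y, 0 <= x <= 1 -> 0 <= y -> x * y <= y).
 { intros x y Hx Hy. rewrite <- (Rmult_1_l y) at 2. pos. }
 eapply Rle_trans; [apply mu_env; assumption || lia|]. unfold env.
 assert (al a * Rpower z (- gam) <= exp (2 * lam (S K) - ln t)).
 { unfold al, Rpower. rewrite <- !exp_plus. apply exp_mono.
  pose proof (Hmul theta (lam a) ltac:(lra) ltac:(lra)). assert (gam * lam K <= lam K) by (apply Hmul; lra).
  assert (gam * (ln t - lam K) <= gam * ln z) by pos. lra. }
 assert (be a * Rpower z (gam - 1) <= exp (2 * lam (S K) - ln t)).
 { unfold be, Rpower. rewrite <- !exp_plus. apply exp_mono.
  pose proof (Hmul theta (lam (S a)) ltac:(lra) ltac:(lra)). assert ((1 - gam) * lam K <= lam K) by (apply Hmul; lra).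
  assert ((1 - gam) * (ln t - lam K) <= (1 - gam) * ln z) by pos. lra. }
 pose proof (exp_pos (2 * lam (S K) - ln t)).
 destruct (Rleb (th (a - 1)) z); lra.
Qed.

Definition NoDupb (p : list nat) : bool := if ListDec.NoDup_dec Nat.eq_dec p then true else false.

Lemma NoDupb_true p : NoDup p -> NoDupb p = true.
Proof. unfold NoDupb. destruct (ListDec.NoDup_dec Nat.eq_dec p); pos. Qed.

Definition Sbad (L : history -> list nat) (j : nat) (g : history) (p : list nat) : bool :=
 okg g && (Rltb (INR (hd 0%nat p)) (th j) && okp ts th (L g) p).

Definition bad_path (L : history -> list nat) (h : history) : bool :=
 existsb (fun j => existsb (fun p => NoDupb p && (Sbad L j (sg ts h) p && walkb h p)) (Om t j)) (seq 1 K).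

(** Both halves are listed from the common midpoint outwards; the first is reversed without its
    head, so that the midpoint occurs once. *)
Definition join (q : list nat * list nat) : list nat := rev_append (tl (fst q)) (snd q).

Definition Sgood (L1 L2 : history -> list nat) (g : history) (q : list nat * list nat) : bool :=
 okg g && (Nat.eqb (hd 0%nat (snd q)) (hd 0%nat (fst q)) && Rleb (th K) (INR (hd 0%nat (fst q)))
   && okp ts th (L1 g) (fst q) && okp ts th (L2 g) (snd q)).

Definition good_path (L1 L2 : history -> list nat) (h : history) : bool :=
 existsb (fun a => existsb (fun b =>
  existsb (fun q => NoDupb (join q) && (Sgood L1 L2 (sg ts h) q && walkb h (join q))) (list_prod (Om t a) (Om t b)))
  (seq 1 K)) (seq 1 K).

Lemma bad_path_prob L : leafy L ->
 E (m * t) [] (fun h => b2R (bad_path L h)) <= sumL (fun j => / (1 - gam) * exp (- (eta * lam j))) (seq 1 K).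
Proof.
 intros HL. apply Rle_trans with (sumL (fun j => E (m * t) [] (fun h => b2R (existsb (fun p => NoDupb p && (Sbad L j (sg ts h) p && walkb h p)) (Om t j)))) (seq 1 K)).
 - rewrite <- E_sumL. apply E_le; [pos|]. intros h _ _. apply b2R_existsb_le.
 - apply sumL_le. intros j Hj. apply in_seq in Hj.
  eapply Rle_trans; [apply (path_union ts t Hts Ht2 (fun p => p) (Sbad L j) (Om t j))|].
  + intros p Hp. apply Om_In in Hp. apply Hp.
  + apply E_le_const; [pos|]. intros h _ _. simpl app. set (g := sg ts h).
   assert (0 <= / (1 - gam) * exp (- (eta * lam j))).
   { pose proof gam_range. pos. }
   unfold Sbad. destruct (okg g) eqn:Eg.
   * rewrite (sumL_ext _ (fun p => (fun v => b2R (Rltb v (th j))) (hd 0%nat p) * (b2R (okp ts th (L g) p) * Kp ts g p))).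
    -- rewrite (path_sum ts t th g (L g) j (fun v => b2R (Rltb v (th j)))). apply bad_sum; assumption || lia.
    -- intros p _. destruct (Rltb (INR (hd 0%nat p)) (th j)), (okp ts th (L g) p); cbn [andb]; unfold b2R; ring.
   * cbn [andb]. rewrite (sumL_ext _ (fun _ => 0)) by (intros; unfold b2R; ring). rewrite sumL_const. lra.
Qed.

Lemma good_path_prob L1 L2 : leafy L1 -> leafy L2 ->
 E (m * t) [] (fun h => b2R (good_path L1 L2 h)) <= K * K * (4 * exp (4 * lam (S K) - ln t)).
Proof.
 intros HL1 HL2. set (B := 4 * exp (4 * lam (S K) - ln (INR t))).
 assert (0 <= B) by (unfold B; pose proof (exp_pos (4 * lam (S K) - ln t)); lra).
 set (f := fun a b h => b2R (existsb (fun q => NoDupb (join q) && (Sgood L1 L2 (sg ts h) q && walkb h (join q))) (list_prod (Om t a) (Om t b)))).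
 apply Rle_trans with (sumL (fun a => sumL (fun b => E (m * t) [] (f a b)) (seq 1 K)) (seq 1 K)).
 - rewrite (sumL_ext _ (fun a => E (m * t) [] (fun h => sumL (fun b => f a b h) (seq 1 K)))) by (intros; rewrite E_sumL; reflexivity).
  rewrite <- E_sumL. apply E_le; [pos|]. intros h _ _. eapply Rle_trans; [apply b2R_existsb_le|].
  apply sumL_le. intros a _. apply b2R_existsb_le.
 - apply Rle_trans with (sumL (fun a : nat => sumL (fun b : nat => B) (seq 1 K)) (seq 1 K)).
  2: { rewrite !sumL_const, length_seq. pos. }
  apply sumL_le. intros a Ha. apply sumL_le. intros b Hb. apply in_seq in Ha, Hb.
  eapply Rle_trans; [apply (path_union ts t Hts Ht2 join (Sgood L1 L2) (list_prod (Om t a) (Om t b)))|].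
  + intros [p q] Hpq. apply in_prod_iff in Hpq as [Hp Hq]. apply Om_In in Hp, Hq. intros x Hx.
   unfold join in Hx. rewrite rev_append_rev in Hx. apply in_app_or in Hx as [Hx|Hx]; [|apply Hq; assumption].
   apply in_rev in Hx. apply Hp. destruct p; pos.
  + apply E_le_const; [pos|]. intros h _ _. simpl app. set (g := sg ts h).
   unfold Sgood. destruct (okg g) eqn:Eg.
   2: { cbn [andb]. rewrite (sumL_ext _ (fun _ => 0)) by (intros; unfold b2R; ring). rewrite sumL_const. lra. }
   apply Rle_trans with (sumL (fun p => (fun v => b2R (Rleb (th K) (INR v)) * mu ts t th g (L2 g) b v) (hd 0%nat p) * (b2R (okp ts th (L1 g) p) * Kp ts g p)) (Om t a)).
   * right.
    assert (Hprod : forall (F : list nat * list nat -> R) l1 l2, sumL F (list_prod l1 l2) = sumL (fun x => sumL (fun y => F (x, y)) l2) l1).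
    { intros F l1 l2. induction l1; simpl; [pos|]. rewrite sumL_app, sumL_map. pos. }
    rewrite Hprod. apply sumL_ext. intros p Hp. apply Om_In in Hp as [Hlp Hbp]. destruct p as [|v pr]; [discriminate|].
    specialize (Hbp v (or_introl eq_refl)). cbn [hd fst snd andb].
    rewrite (sumL_ext _ (fun q => b2R (Rleb (th K) v) * (b2R (okp ts th (L1 g) (v :: pr)) * Kp ts g (v :: pr)) *
      ((fun u => if Nat.eqb u v then 1 else 0) (hd 0%nat q) * (b2R (okp ts th (L2 g) q) * Kp ts g q)))).
    -- rewrite sumL_scal, (path_sum ts t th g (L2 g) b (fun u => if Nat.eqb u v then 1 else 0)).
      rewrite (sumL_ext (fun u => (if Nat.eqb u v then 1 else 0) * _) (fun u => if Nat.eqb u v then mu ts t th g (L2 g) b u else 0))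
       by (intros u _; destruct (Nat.eqb u v); ring).
      rewrite sumL_eqb; pos.
    -- intros q Hq. apply Om_In in Hq as [Hlq _]. destruct q as [|u qr]; [discriminate|]. cbn [hd]. unfold join. cbn [fst snd tl].
      destruct (Nat.eqb_spec u v) as [->|]; cbn [andb]; [|unfold b2R at 1; ring].
      rewrite Kp_rev_append. destruct (Rleb (th K) v), (okp ts th (L1 g) (v :: pr)), (okp ts th (L2 g) (v :: qr)); cbn [andb]; unfold b2R; ring.
   * rewrite (path_sum ts t th g (L1 g) a (fun v => b2R (Rleb (th K) v) * mu ts t th g (L2 g) b v)).
    apply Rle_trans with (sumL (fun _ : nat => 2 * exp (2 * lam (S K) - ln t) * (2 * exp (2 * lam (S K) - ln t))) (seq 1 t)).
    -- apply sumL_le. intros v Hv. apply in_seq in Hv.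
      destruct (Rleb (th K) v) eqn:Ev; unfold b2R.
      ++ apply Rleb_true in Ev. rewrite Rmult_1_l. apply Rmult_le_compat; try apply mu_nonneg; apply good_pointwise; assumption || lia.
      ++ rewrite !Rmult_0_l. pos.
    -- rewrite sumL_const, length_seq. right. unfold B. rewrite <- (exp_ln t) at 3 by apply tR.
      replace (2 * exp (2 * lam (S K) - ln t) * (2 * exp (2 * lam (S K) - ln t)) * exp (ln t))
       with (4 * (exp (2 * lam (S K) - ln t) * exp (2 * lam (S K) - ln t) * exp (ln t))) by ring.
      rewrite <- !exp_plus. f_equal. f_equal. ring.
Qed.

(** The path is followed from its start, the end of the list, up to the first vertex below the
    truncation; until there it is truncated correctly, so it is one of the paths counted in
    [bad_path]. *)
Lemma okp_or_bad L q' : forall w v, In v L -> (w <= ts)%nat ->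
 okp ts th L (q' ++ [w; v]) = true \/
 exists l p, q' ++ [w; v] = l ++ p /\ (2 <= length p)%nat /\ okp ts th L p = true /\ INR (hd 0%nat p) < th (length p - 1).
Proof.
 induction q' as [|x q' IH]; intros w v Hv Hw.
 - left. apply andb_true_iff. split; [apply Nat.leb_le; assumption|]. apply existsb_exists. exists v. split; [assumption|apply Nat.eqb_refl].
 - destruct (IH w v Hv Hw) as [Hok|(l & p & Heq & Hr)].
  + simpl app. assert (Hlen : (2 <= length (q' ++ [w; v]))%nat) by (rewrite length_app; simpl; lia).
   remember (q' ++ [w; v]) as q eqn:Eq. destruct q as [|y [|y2 rest]]; [simpl in Hlen; lia|simpl in Hlen; lia|].
   destruct (Rle_lt_dec (th (length (y2 :: rest))) y) as [Hle|Hlt].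
   * change (okp ts th L (x :: y :: y2 :: rest)) with (Rleb (th (length (y2 :: rest))) y && okp ts th L (y :: y2 :: rest)).
    apply Rleb_true in Hle. rewrite Hle. pos.
   * right. exists [x], (y :: y2 :: rest). pos.
  + right. exists (x :: l), p. split; [simpl; rewrite Heq; reflexivity|pos].
Qed.

Lemma half_path L h p' w v : okg (sg ts h) = true -> In v (L (sg ts h)) -> (w <= ts)%nat ->
 let p := p' ++ [w; v] in
 (length p <= S K)%nat -> NoDup p -> (forall x, In x p -> (1 <= x <= t)%nat) -> walkb h p = true ->
 bad_path L h = true \/ (okp ts th (L (sg ts h)) p = true /\ th K <= INR (hd 0%nat p)).
Proof.
 intros Hok Hv Hw p Hlen Hnd Hb Hwalk.
 assert (Hbad : forall l q, p = l ++ q -> (2 <= length q)%nat -> okp ts th (L (sg ts h)) q = true -> INR (hd 0%nat q) < th (length q - 1) -> bad_path L h = true).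
 { intros l q Heq Hlq Hokq Hlt. assert ((length q <= length p)%nat) by (rewrite Heq, length_app; lia).
  apply existsb_exists. exists (length q - 1)%nat. split; [pos|].
  apply existsb_exists. exists q. split.
  - apply Om_In. split; [lia|]. intros x Hx. apply Hb. rewrite Heq. apply in_or_app. pos.
  - unfold Sbad. rewrite NoDupb_true by (rewrite Heq in Hnd; eapply NoDup_app_remove_l; exact Hnd).
   apply Rltb_true in Hlt. rewrite Hok, Hlt, Hokq. rewrite Heq in Hwalk. apply walkb_app in Hwalk. pos. }
 destruct (okp_or_bad (L (sg ts h)) p' w v Hv Hw) as [Hokp|(l & q & Heq & H1 & H2 & H3)]; [|pos].
 assert ((2 <= length p)%nat) by (unfold p; rewrite length_app; simpl; lia).
 destruct (Rle_lt_dec (th (length p - 1)) (INR (hd 0%nat p))) as [Hle|Hlt].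
 - right. split; [assumption|]. eapply Rle_trans; [|exact Hle]. apply Rmult_le_compat_l; [pos|].
  apply exp_mono. pose proof (lam_mono (length p - 1) K ltac:(lia)). lra.
 - left. apply (Hbad [] p); assumption || reflexivity.
Qed.

Lemma short_path_event L1 L2 h q r r' x0 x1 y0 y1 : okg (sg ts h) = true ->
 q = x0 :: x1 :: r -> q = r' ++ [y1; y0] -> In x0 (L1 (sg ts h)) -> In y0 (L2 (sg ts h)) -> (x1 <= ts)%nat -> (y1 <= ts)%nat ->
 NoDup q -> (forall x, In x q -> (1 <= x <= t)%nat) -> walkb h q = true -> (3 <= length q <= 2 * K + 1)%nat ->
 bad_path L1 h || bad_path L2 h || good_path L1 L2 h = true.
Proof.
 intros Hok Hq1 Hq2 Hx0 Hy0 Hx1 Hy1 Hnd Hb Hw Hlen.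
 (* Cut at the middle vertex: of at most [2 * K] edges, each half receives at most [K], so each
    truncation is needed only up to index [K]. *)
 set (a := ((length q - 1) / 2)%nat).
 assert ((1 <= a <= K /\ 2 * a <= length q - 1 /\ length q - 1 <= 2 * a + 1)%nat).
 { pose proof (Nat.div_mod (length q - 1) 2 ltac:(lia)). pose proof (Nat.mod_upper_bound (length q - 1) 2 ltac:(lia)). lia. }
 set (A := firstn a q). destruct (skipn a q) as [|z B] eqn:EB.
 { apply (f_equal (@length nat)) in EB. rewrite length_skipn in EB. simpl in EB. lia. }
 assert (Hq : q = A ++ z :: B) by (rewrite <- EB; unfold A; symmetry; apply firstn_skipn).
 assert (HlA : length A = a) by (unfold A; rewrite firstn_length_le; lia).
 assert ((length B = length q - 1 - a)%nat) by (apply (f_equal (@length nat)) in EB; rewrite length_skipn in EB; simpl in EB; lia).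
 assert (Hp1 : exists p', z :: rev A = p' ++ [x1; x0]).
 { destruct (app_prefix2 A B r z x0 x1) as (r1 & Hr1).
  - intros ->. simpl in HlA. lia.
  - pos.
  - apply (f_equal (@rev nat)) in Hr1. rewrite rev_app_distr in Hr1. simpl in Hr1. rewrite Hr1, <- app_assoc. pos. }
 assert (Hp2 : exists p', z :: B = p' ++ [y1; y0]).
 { assert (rev B ++ z :: rev A = y0 :: y1 :: rev r').
  { assert (Hr : rev q = rev q) by reflexivity. rewrite Hq in Hr at 1. rewrite Hq2 in Hr.
   rewrite !rev_app_distr in Hr. simpl in Hr. rewrite <- app_assoc in Hr. pos. }
  destruct (app_prefix2 (rev B) (rev A) (rev r') z y0 y1) as (r1 & Hr1).
  - intros HB0. apply (f_equal (@length nat)) in HB0. rewrite length_rev in HB0. simpl in HB0. lia.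
  - pos.
  - apply (f_equal (@rev nat)) in Hr1. rewrite rev_app_distr, rev_involutive in Hr1. simpl in Hr1. rewrite Hr1, <- app_assoc. pos. }
 assert (Hjoin : q = rev_append (rev A) (z :: B)) by (rewrite rev_append_rev, rev_involutive; exact Hq).
 assert (Hw' : walkb h (z :: rev A) = true /\ walkb h (z :: B) = true).
 { rewrite Hjoin, walkb_rev_append in Hw. apply andb_true_iff in Hw. pos. }
 destruct Hw' as [Hw1 Hw2]. destruct Hp1 as (p1 & Hp1). destruct Hp2 as (p2 & Hp2).
 assert (NoDup (z :: rev A)).
 { rewrite Hq in Hnd. apply NoDup_rev in Hnd. rewrite rev_app_distr in Hnd. simpl in Hnd. rewrite <- app_assoc in Hnd.
  apply NoDup_app_remove_l in Hnd. pos. }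
 assert (NoDup (z :: B)) by (rewrite Hq in Hnd; apply NoDup_app_remove_l in Hnd; exact Hnd).
 assert (forall x, In x (z :: rev A) -> (1 <= x <= t)%nat).
 { intros x Hx. apply Hb. rewrite Hq. apply in_or_app. destruct Hx as [->|Hx]; [right; left; reflexivity|left; apply in_rev; assumption]. }
 assert (forall x, In x (z :: B) -> (1 <= x <= t)%nat) by (intros x Hx; apply Hb; rewrite Hq; apply in_or_app; right; assumption).
 destruct (half_path L1 h p1 x1 x0 Hok Hx0 Hx1) as [->|[Ho1 Hz]]; try (rewrite <- Hp1; assumption);
  [rewrite <- Hp1; simpl; rewrite length_rev; lia|pos|].
 destruct (half_path L2 h p2 y1 y0 Hok Hy0 Hy1) as [->|[Ho2 _]]; try (rewrite <- Hp2; assumption);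
  [rewrite <- Hp2; simpl; lia|pos|].
 rewrite <- Hp1 in Ho1, Hz. rewrite <- Hp2 in Ho2. simpl hd in Hz.
 replace (good_path L1 L2 h) with true; [pos|]. symmetry.
 apply existsb_exists. exists a. split; [pos|]. apply existsb_exists. exists (length B). split; [pos|].
 apply existsb_exists. exists (z :: rev A, z :: B). split.
 - apply in_prod_iff. split; apply Om_In; split; try assumption; [simpl; rewrite length_rev; lia|pos].
 - unfold join, Sgood. cbn [fst snd tl hd]. rewrite <- Hjoin, NoDupb_true, Hok, Nat.eqb_refl, Ho1, Ho2, Hw by assumption.
  apply Rleb_true in Hz. rewrite Hz. pos.
Qed.

End ShortPaths.

(** * Isolated clusters of young vertices *)

Definition memb (u : nat) (C : list nat) : bool := existsb (Nat.eqb u) C.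

Lemma memb_In u C : memb u C = true <-> In u C.
Proof.
 unfold memb. rewrite existsb_exists. split.
 - intros (x & Hx & Hu). apply Nat.eqb_eq in Hu. pos.
 - exists u. split; [assumption|apply Nat.eqb_refl].
Qed.

Lemma memb_false u C : memb u C = false <-> ~ In u C.
Proof. rewrite <- memb_In. destruct (memb u C); split; congruence. Qed.

Lemma concat_filter_perm (p : list nat -> bool) A :
 Permutation (concat (filter p A) ++ concat (filter (fun C => negb (p C)) A)) (concat A).
Proof.
 induction A as [|C A IH]; simpl; [pos|]. destruct (p C); simpl.
 - rewrite <- app_assoc. apply Permutation_app_head. pos.
 - rewrite app_assoc. rewrite (Permutation_app_comm (concat (filter p A)) C), <- app_assoc. apply Permutation_app_head. pos.
Qed.

Lemma NoDup_concat_heads (A : list (list nat)) : NoDup (concat A) -> (forall C, In C A -> C <> []) -> NoDup (map (hd 0%nat) A).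
Proof.
 induction A as [|C A IH]; simpl; intros Hnd Hne; [pos|]. constructor.
 - intros Hin. apply in_map_iff in Hin as (D & Hd & HD). destruct C as [|c C]; [exact (Hne [] (or_introl eq_refl) eq_refl)|].
  inversion Hnd as [|? ? Hni _]; subst. apply Hni. apply in_or_app. right.
  apply in_concat. exists D. destruct D; [exfalso; apply (Hne []); pos|pos].
 - apply IH; [eapply NoDup_app_remove_l; exact Hnd|auto].
Qed.

Lemma NoDup_concat_uniq (A : list (list nat)) : NoDup (concat A) -> forall C D x, In C A -> In D A -> In x C -> In x D -> C = D.
Proof.
 induction A as [|B A IH]; simpl; intros Hnd C D x HC HD Hx Hx'; [pos|].
 assert (Hdis : forall y, In y B -> ~ In y (concat A)).
 { intros y Hy Hy'. destruct (in_split _ _ Hy) as (p & q & ->). rewrite <- app_assoc in Hnd.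
  apply NoDup_remove_2 in Hnd. apply Hnd. apply in_or_app. right. apply in_or_app. pos. }
 destruct HC as [<-|HC], HD as [<-|HD]; [pos| | |].
 - exfalso. apply (Hdis x Hx). apply in_concat. eauto.
 - exfalso. apply (Hdis x Hx'). apply in_concat. eauto.
 - apply (IH (NoDup_app_remove_l _ _ Hnd) C D x); assumption.
Qed.

Lemma length_concat_le (A : list (list nat)) M : (forall C, In C A -> (length C <= M)%nat) -> (length (concat A) <= length A * M)%nat.
Proof.
 induction A as [|C A IH]; simpl; intros H; [lia|]. rewrite length_app. specialize (IH (fun D HD => H D (or_intror HD))).
 specialize (H C (or_introl eq_refl)). lia.
Qed.

Section Clusters.
Context {P : PAmodel}.
Variables ts om : nat.

Definition lvl (z : nat) : nat := ((z - ts - 1) / om)%nat.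

Lemma lvl_eq z i : (1 <= om)%nat -> (ts + i * om < z <= ts + S i * om)%nat -> lvl z = i.
Proof.
 symmetry. apply (Nat.div_unique _ om i (z - ts - 1 - i * om)%nat); nia.
Qed.

Definition touched (xs C : list nat) : bool := existsb (fun x => memb x C) xs.

Definition layer (i : nat) (A : list (list nat)) : list (list nat) := filter (fun C => Nat.eqb (lvl (hd 0%nat C)) i) A.

Definition roots (i : nat) (A : list (list nat)) : list nat := map (hd 0%nat) (layer i A).

(* After erasure the targets at most [ts] have become [0]. *)
Definition succeeds (A : list (list nat)) (z : nat) (xs : list nat) : bool :=
 forallb (fun x => if Nat.eqb (lvl z) 0 then Nat.eqb x 0 else memb x (roots (lvl z - 1) A)) xs.

(** An edge from [z] destroys the isolation of the cluster it enters. The cluster is dropped, or, if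
    all edges of [z] are admissible, absorbed into a new cluster with root [z]; the root is always
    listed first. *)
Definition grow (A : list (list nat)) (z : nat) (xs : list nat) : list (list nat) :=
 filter (fun C => negb (touched xs C)) A ++ (if succeeds A z xs then [z :: concat (filter (touched xs) A)] else []).

Definition targets (g : history) (z : nat) : list nat := map snd (firstn m (skipn (m * (z - 1)) g)).

Fixpoint alive (n : nat) (g : history) : list (list nat) :=
 match n with
 | O => []
 | S n' => grow (alive n' g) (ts + n' + 1) (targets g (ts + n' + 1))
 end.

Definition hgt (C : list nat) (u : nat) : nat := if memb u C then S (lvl u) else 0%nat.

(** Isolation: no edge enters [C] from outside, every edge descends one level, and level 0 leads to
    erased targets only. The value 0 of [hgt] outside [C] covers the exits in the same equation. *)
Definition clean (C : list nat) (G : history) : Prop := forall e, In e G -> In (fst e) C \/ In (snd e) C ->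
 In (fst e) C /\ hgt C (fst e) = S (hgt C (snd e)) /\ (lvl (fst e) = 0%nat -> snd e = 0%nat).

(** [2 * m^i - 1] bounds the size of an [m]-ary tree of depth [i] and is stable under the recursion
    for [m >= 2]. *)
Definition cl_ok (z : nat) (G : history) (C : list nat) : Prop :=
 C <> [] /\ (forall u, In u C -> (ts < u < z)%nat) /\ (S (length C) <= 2 * m ^ lvl (hd 0%nat C))%nat /\ clean C G.

Definition Inv (A : list (list nat)) (z : nat) (G : history) : Prop := NoDup (concat A) /\ forall C, In C A -> cl_ok z G C.

Lemma touched_spec xs C : touched xs C = true <-> exists x, In x xs /\ In x C.
Proof. unfold touched. rewrite existsb_exists. split; intros (x & H1 & H2); exists x; apply memb_In in H2 || rewrite memb_In; auto. Qed.

Lemma hd_In (C : list nat) : C <> [] -> In (hd 0%nat C) C.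
Proof. destruct C; pos. Qed.

Lemma roots_In i A x : (forall C, In C A -> C <> []) -> In x (roots i A) -> exists C, In C A /\ In x C /\ hd 0%nat C = x /\ lvl x = i.
Proof.
 intros Hne Hx. apply in_map_iff in Hx as (C & Hh & HC). apply filter_In in HC as [HC Hl].
 apply Nat.eqb_eq in Hl. exists C. repeat split; try assumption; [rewrite <- Hh; apply hd_In; auto|pos].
Qed.

(** Clusters are disjoint, so a target identifies its cluster: a successful vertex touches clusters
    of the previous level only, and at their roots. *)
Lemma touched_root A z xs C : NoDup (concat A) -> (forall D, In D A -> D <> []) -> (forall u, In u (concat A) -> (ts < u)%nat) ->
 succeeds A z xs = true -> In C A -> touched xs C = true -> exists i, lvl z = S i /\ lvl (hd 0%nat C) = i /\ In (hd 0%nat C) xs.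
Proof.
 intros Hnd Hne Hts' Hs HC Ht. apply touched_spec in Ht as (x & Hx & HxC). unfold succeeds in Hs. rewrite forallb_forall in Hs.
 specialize (Hs x Hx). destruct (lvl z) as [|i]; simpl in Hs.
 - apply Nat.eqb_eq in Hs. subst x. assert (ts < 0)%nat; [|lia]. apply Hts'. apply in_concat. eauto.
 - rewrite Nat.sub_0_r in Hs. apply memb_In in Hs. apply roots_In in Hs as (D & HD & HxD & Hh & Hl); [|assumption].
  assert (C = D) by (eapply NoDup_concat_uniq; eassumption). exists i. pos.
Qed.

Lemma Inv_grow A z G B xs : Inv A z G -> (ts < z)%nat -> (length xs <= m)%nat ->
 (forall e, In e G -> (fst e < z)%nat /\ (snd e < z)%nat) -> (forall e, In e B -> fst e = z /\ In (snd e) xs) ->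
 Inv (grow A z xs) (S z) (G ++ B).
Proof.
 intros [Hnd HC] Hz Hxs HG HB.
 assert (Hne : forall C, In C A -> C <> []) by (intros C H; apply HC; assumption).
 assert (Hts' : forall u, In u (concat A) -> (ts < u < z)%nat).
 { intros u Hu. apply in_concat in Hu as (C & HC1 & Hu). apply (HC C HC1). assumption. }
 set (pos := filter (touched xs) A). set (neg := filter (fun C => negb (touched xs C)) A).
 assert (Hperm : Permutation (concat pos ++ concat neg) (concat A)) by apply concat_filter_perm.
 assert (Hndp : NoDup (concat pos ++ concat neg)) by (apply (Permutation_NoDup (Permutation_sym Hperm)); assumption).
 assert (forall C, In C neg -> cl_ok (S z) (G ++ B) C).
 { intros C HCn. apply filter_In in HCn as [HCA Ht]. destruct (HC C HCA) as (H1 & H2 & H3 & H4).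
  repeat split; try assumption; try (apply H2 in H; lia).
  - apply in_app_or in H as [H|H]; [apply (H4 e H H0)|]. destruct (HB e H) as [Hf Hs]. destruct H0 as [H0|H0].
   + pos.
   + assert (touched xs C = true) by (apply touched_spec; eauto). rewrite H5 in Ht. pos.
  - apply in_app_or in H as [H|H]; [apply (H4 e H H0)|]. destruct (HB e H) as [Hf Hs]. destruct H0 as [H0|H0].
   + apply H2 in H0. lia.
   + assert (touched xs C = true) by (apply touched_spec; eauto). rewrite H5 in Ht. pos.
  - apply in_app_or in H as [H|H]; [apply (H4 e H H0)|]. destruct (HB e H) as [Hf Hs]. destruct H0 as [H0|H0].
   + apply H2 in H0. lia.
   + assert (touched xs C = true) by (apply touched_spec; eauto). rewrite H5 in Ht. pos. }
 unfold grow. fold pos. destruct (succeeds A z xs) eqn:Es.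
 2: { rewrite app_nil_r. split; [eapply NoDup_app_remove_l; exact Hndp|pos]. }
 split.
 - rewrite concat_app. simpl. rewrite app_nil_r. apply (Permutation_NoDup (l := z :: concat A)).
  + apply Permutation_trans with (z :: concat neg ++ concat pos); [|apply Permutation_middle].
   apply perm_skip. rewrite <- Hperm. apply Permutation_app_comm.
  + constructor; [|assumption]. intros Hin. apply Hts' in Hin. lia.
 - intros C HCin. apply in_app_or in HCin as [HCin|[<-|[]]]; [pos|].
  assert (Hpos : forall D, In D pos -> In D A /\ exists i, lvl z = S i /\ lvl (hd 0%nat D) = i /\ In (hd 0%nat D) xs).
  { intros D HD. apply filter_In in HD as [HD Ht]. split; [assumption|]. apply (touched_root A z xs D); try assumption.
   intros u Hu. apply Hts' in Hu. lia. }
  set (D := z :: concat pos).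
  assert (HDA : forall u, In u (concat pos) -> In u (concat A)).
  { intros u Hu. apply (Permutation_in _ Hperm). apply in_or_app. pos. }
  split; [discriminate|]. split; [intros u [<-|Hu]; [lia|apply HDA, Hts' in Hu; lia]|]. split.
  + simpl hd. pose proof Hm. destruct (lvl z) as [|i] eqn:El.
   * destruct pos as [|D0 ps]; [pos|].
    destruct (Hpos D0 (or_introl eq_refl)) as (_ & i & Hi & _). pos.
   * assert ((length pos <= m)%nat).
    { transitivity (length xs); [|assumption]. rewrite <- (length_map (hd 0%nat) pos). apply NoDup_incl_length.
     - apply NoDup_concat_heads; [eapply NoDup_app_remove_r; exact Hndp|]. intros C HCp. apply Hpos in HCp as [HCp _]. auto.
     - intros x Hx. apply in_map_iff in Hx as (C & <- & HCp). apply Hpos in HCp as (_ & j & _ & _ & Hj). assumption. }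
    assert ((length (concat pos) <= length pos * (2 * m ^ i - 1))%nat).
    { apply length_concat_le. intros C HCp. destruct (Hpos C HCp) as (HCA & j & Hj & Hl & _).
     destruct (HC C HCA) as (_ & _ & H3 & _). injection Hj as <-. rewrite Hl in H3. lia. }
    assert ((1 <= m ^ i)%nat) by (pose proof (Nat.pow_nonzero m i ltac:(lia)); lia).
    simpl length. rewrite Nat.pow_succ_r'. nia.
  + assert (HzD : hgt D z = S (lvl z)).
   { unfold hgt. replace (memb z D) with true; [pos|]. symmetry. apply memb_In. pos. }
   intros e He Hor. apply in_app_or in He as [He|He].
   * destruct (HG e He) as [Hfz Hsz].
    assert (Hex : exists C, In C pos /\ (In (fst e) C \/ In (snd e) C)).
    { destruct Hor as [[Hor|Hor]|[Hor|Hor]]; try lia; apply in_concat in Hor as (C & HCp & Hor); exists C; auto. }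
    destruct Hex as (C & HCp & Hor'). destruct (Hpos C HCp) as [HCA _]. destruct (HC C HCA) as (_ & H2 & _ & H4).
    destruct (H4 e He Hor') as (Hf & Hh & Hl0).
    assert (Hin : forall u, In u C -> In u D) by (intros u Hu; right; apply in_concat; eauto).
    split; [pos|]. split; [|assumption].
    unfold hgt in Hh |- *. rewrite (proj2 (memb_In _ _) Hf) in Hh. rewrite (proj2 (memb_In _ _) (Hin _ Hf)).
    destruct (memb (snd e) C) eqn:Em.
    -- apply memb_In in Em. rewrite (proj2 (memb_In _ _) (Hin _ Em)). assumption.
    -- injection Hh as Hh. rewrite (Hl0 Hh). replace (memb 0 D) with false; [pos|]. symmetry. apply memb_false.
      intros [H0|H0]; [lia|]. apply HDA, Hts' in H0. lia.
   * destruct (HB e He) as [Hf Hs]. rewrite Hf. rewrite HzD.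
    assert (Hse := Es). unfold succeeds in Hse. rewrite forallb_forall in Hse. specialize (Hse _ Hs).
    destruct (lvl z) as [|i] eqn:El; simpl in Hse.
    -- apply Nat.eqb_eq in Hse. rewrite Hse. unfold hgt. replace (memb 0 D) with false; [pos|].
      symmetry. apply memb_false. intros [H0|H0]; [lia|]. apply HDA, Hts' in H0. lia.
    -- apply memb_In in Hse. apply roots_In in Hse as (C & HCA & HxC & _ & Hl); [|assumption].
      unfold hgt. replace (memb (snd e) D) with true; [pos|]. symmetry. apply memb_In. right.
      apply in_concat. exists C. split; [|assumption]. apply filter_In. split; [assumption|]. apply touched_spec. eauto.
Qed.

Lemma sg_In h e : In e (sg ts h) <-> exists e', In e' h /\ e = (fst e', er ts (snd e')).
Proof.
 unfold sg. rewrite in_map_iff. split; intros (e' & H1 & H2); exists e'; auto.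
Qed.

Lemma block_In h z e : valid h -> (1 <= z)%nat -> In e (firstn m (skipn (m * (z - 1)) (sg ts h))) -> fst e = z /\ In (snd e) (targets (sg ts h) z).
Proof.
 intros Hv Hz He. split; [|apply in_map; exact He].
 apply In_nth_error in He as (k & Hk). assert ((k < m)%nat).
 { assert (Hl : (k < length (firstn m (skipn (m * (z - 1)) (sg ts h))))%nat) by (apply nth_error_Some; congruence).
  rewrite length_firstn in Hl. lia. }
 rewrite nth_error_firstn in Hk. destruct (Nat.ltb_spec k m); [|lia]. rewrite nth_error_skipn in Hk.
 unfold sg in Hk. rewrite nth_error_map in Hk. destruct (nth_error h (m * (z - 1) + k)) as [e'|] eqn:En; [|discriminate].
 injection Hk as <-. simpl. rewrite (valid_nth h _ _ Hv En), cur_mul by assumption. lia.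
Qed.

Lemma Inv_alive h n : valid h -> Inv (alive n (sg ts h)) (ts + n + 1) (firstn (m * (ts + n)) (sg ts h)).
Proof.
 intros Hv. induction n.
 - split; [pos|intros C []].
 - replace (ts + S n + 1)%nat with (S (ts + n + 1)) by lia.
  replace (firstn (m * (ts + S n)) (sg ts h)) with
   (firstn (m * (ts + n)) (sg ts h) ++ firstn m (skipn (m * (ts + n + 1 - 1)) (sg ts h))).
  + apply Inv_grow; [pos|lia| | |].
   * unfold targets. rewrite length_map, length_firstn. lia.
   * intros e He. assert (Hin : exists k, (k < m * (ts + n))%nat /\ nth_error (sg ts h) k = Some e).
    { apply In_nth_error in He as (k & Hk). exists k. rewrite nth_error_firstn in Hk. destruct (Nat.ltb_spec k (m * (ts + n))); pos. }
    destruct Hin as (k & Hk & Hn). unfold sg in Hn. rewrite nth_error_map in Hn.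
    destruct (nth_error h k) as [e'|] eqn:En; [|discriminate]. injection Hn as <-. simpl.
    pose proof (valid_nth h k e' Hv En). pose proof (cur_bounds k) as (H1 & H2).
    assert (fst e' <= ts + n)%nat by nia.
    pose proof (valid_In h e' Hv (nth_error_In _ _ En)). unfold er. destruct (Nat.leb (snd e') ts); lia.
   * intros e He. apply block_In; pos.
  + replace (ts + n + 1 - 1)%nat with (ts + n)%nat by lia. replace (m * (ts + S n))%nat with (m * (ts + n) + m)%nat by lia.
   rewrite <- (firstn_skipn (m * (ts + n)) (sg ts h)) at 3.
   destruct (Nat.le_gt_cases (m * (ts + n)) (length (sg ts h))) as [Hle|Hgt].
   * rewrite firstn_app, firstn_firstn, firstn_length_le by assumption.
    replace (Nat.min (m * (ts + n) + m) (m * (ts + n))) with (m * (ts + n))%nat by lia. f_equal. f_equal. lia.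
   * rewrite (skipn_all2 (sg ts h)) by lia. rewrite firstn_nil, app_nil_r.
    rewrite (firstn_all2 (n := (m * (ts + n) + m)%nat)); [pos|]. rewrite length_firstn. lia.
Qed.

Lemma targets_app g l z : (m * z <= length g)%nat -> (1 <= z)%nat -> targets (g ++ l) z = targets g z.
Proof.
 intros Hl Hz. unfold targets. f_equal. rewrite skipn_app.
 rewrite firstn_app, length_skipn.
 replace (m - (length g - m * (z - 1)))%nat with 0%nat by nia. apply app_nil_r.
Qed.

Lemma alive_app g l n : (m * (ts + n) <= length g)%nat -> alive n (g ++ l) = alive n g.
Proof.
 induction n; intros Hl; [pos|]. cbn [alive]. rewrite IHn by nia. rewrite targets_app by nia. pos.
Qed.

Lemma count_fst h u : valid h -> (1 <= u)%nat -> (length (filter (fun e => Nat.eqb (fst e) u) h) <= Nat.min m (length h - m * (u - 1)))%nat.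
Proof.
 intros Hv Hu. induction Hv; [simpl; lia|]. rewrite ext_length. unfold ext. rewrite filter_app, length_app. cbn [filter fst].
 pose proof (cur_bounds (length h)) as (Hc1 & Hc2).
 destruct (Nat.eqb_spec (cur (length h)) u); cbn [length].
 - assert (length h - m * (cur (length h) - 1) < m)%nat by nia. lia.
 - lia.
Qed.

(* Every edge meeting a union of clean sets starts in it. *)
Lemma clean_weight h l : valid h -> NoDup l -> (forall u, In u l -> (1 <= u)%nat) ->
 (forall e, In e h -> In (snd e) l -> In (fst e) l) -> w h l <= 2 * m * INR (length l).
Proof.
 intros Hv Hnd H1 Hcl.
 assert (Hdeg : forall h', (forall e, In e h' -> In (snd e) l -> In (fst e) l) ->
  sumL (fun u => INR (degree h' u)) l <= 2 * sumL (fun u => INR (length (filter (fun e => Nat.eqb (fst e) u) h'))) l).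
 { induction h' as [|e h' IH]; intros Hc; [simpl; rewrite sumL_const; lra|].
  specialize (IH (fun e' He' => Hc e' (or_intror He'))).
  rewrite (sumL_ext (fun u => INR (degree (e :: h') u)) (fun u => INR (degree h' u) + ((if Nat.eqb (snd e) u then 1 else 0) + (if Nat.eqb (fst e) u then 1 else 0)))).
  2: { intros u _. unfold degree. cbn [map fold_right]. rewrite !plus_INR. destruct (Nat.eqb (snd e) u), (Nat.eqb (fst e) u); simpl (INR 1); simpl (INR 0); ring. }
  rewrite (sumL_ext (fun u => INR (length (filter (fun e => Nat.eqb (fst e) u) (e :: h')))) (fun u => INR (length (filter (fun e => Nat.eqb (fst e) u) h')) + (if Nat.eqb (fst e) u then 1 else 0))).
  2: { intros u _. cbn [filter]. destruct (Nat.eqb (fst e) u); cbn [length]; rewrite ?S_INR; ring. }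
  rewrite !sumL_plus, !sumL_indic_range by assumption.
  assert (b2R (existsb (Nat.eqb (snd e)) l) <= b2R (existsb (Nat.eqb (fst e)) l)); [|lra].
  fold (memb (snd e) l) (memb (fst e) l). destruct (memb (snd e) l) eqn:Es; [|apply b2R_range].
  apply memb_In in Es. rewrite (proj2 (memb_In _ _) (Hc e (or_introl eq_refl) Es)). lra. }
 unfold w. rewrite sumL_plus, sumL_const. pose proof Hd2. specialize (Hdeg h Hcl).
 assert (Hc : sumL (fun u => INR (length (filter (fun e => Nat.eqb (fst e) u) h))) l <= m * INR (length l)).
 { rewrite <- sumL_const. apply sumL_le. intros u Hu. apply le_INR. pose proof (count_fst h u Hv (H1 u Hu)). lia. }
 pose proof (pos_INR (length l)). assert (delta * INR (length l) <= 0) by nra. lra.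
Qed.

End Clusters.

Lemma sumL_concat (f : nat -> R) A : sumL f (concat A) = sumL (fun C => sumL f C) A.
Proof. induction A; simpl; [pos|]. rewrite sumL_app. pos. Qed.

Lemma filter_comm {A} (p q : A -> bool) l : filter p (filter q l) = filter q (filter p l).
Proof. induction l as [|C l IH]; simpl; [pos|]. destruct (p C) eqn:Ep, (q C) eqn:Eq; simpl; rewrite ?Ep, ?Eq, ?IH; reflexivity. Qed.

(** * Growth of the number of clusters within one window *)

Section Windows.
Context {P : PAmodel}.

Lemma Pi_small a n : INR n / cc a <= 1/2 -> Pi a n <= 1 + 2 * (INR n / cc a).
Proof.
 intros Hx. pose proof (cc_pos a). set (x := INR n / cc a) in *.
 assert (H0 : 0 <= x) by (apply Rmult_le_pos; pos).
 assert (Pi a n <= exp x).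
 { replace x with (n * / cc a) by reflexivity. rewrite <- exp_pow_nat. clear Hx H0 x. induction n; simpl; [lra|].
  rewrite Rmult_comm. apply Rmult_le_compat; [pos|pos| |pos].
  eapply Rle_trans; [|apply exp_ge1]. apply Rplus_le_compat_l. apply Rinv_le_contravar; [assumption|apply cc_mono; lia]. }
 pose proof (exp_le_quadratic x Hx). assert (2 * x * x <= x) by nra. lra.
Qed.

Lemma E_block_rec (F : history -> R) a b wd : forall h s, 0 <= a <= 1 -> 0 <= b -> valid h -> length h = (m * s)%nat ->
 (forall l s', valid (h ++ l) -> length (h ++ l) = (m * s')%nat -> (s <= s' < s + wd)%nat -> E m (h ++ l) F <= a * F (h ++ l) + b) ->
 E (m * wd) h F <= a ^ wd * F h + wd * b.
Proof.
 induction wd; intros h s Ha Hb Hv Hl H.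
 - rewrite Nat.mul_0_r, E_O. simpl. lra.
 - replace (m * S wd)%nat with (m + m * wd)%nat by lia. rewrite E_add.
  apply Rle_trans with (E m h (fun g => a ^ wd * F g + wd * b)).
  + apply E_le; [assumption|]. intros l Hvl Hll. apply (IHwd _ (S s)); try assumption.
   * rewrite length_app. lia.
   * intros l' s' Hv' Hs' Hb'. rewrite <- app_assoc in *. apply (H _ s'); assumption || lia.
  + rewrite E_plus, E_scal, E_const by assumption. specialize (H [] s). rewrite app_nil_r in H. specialize (H Hv Hl ltac:(lia)).
   assert (0 <= a ^ wd <= 1) by (split; [pos|rewrite <- (pow1 wd); apply pow_incr; lra]).
   apply (Rmult_le_compat_l (a ^ wd)) in H; [|lra]. rewrite S_INR. simpl pow.
   assert (a ^ wd * b <= b) by (rewrite <- (Rmult_1_l b) at 2; apply Rmult_le_compat_r; lra). lra.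
Qed.

Lemma all_targets_in U k : forall g q, valid g -> NoDup U -> (forall u, In u U -> (1 <= u)%nat /\ (m * u <= length g)%nat) -> 0 <= q ->
 q * cc (length g + k) <= w g U ->
 q ^ k <= E k g (fun h => b2R (forallb (fun e => memb (snd e) U) (skipn (length g) h))).
Proof.
 induction k; intros g q Hv HU Hc Hq Hw.
 - rewrite E_O, skipn_all. pos.
 - rewrite E_S.
  apply Rle_trans with (E1 g (fun v => q ^ k * sumL (fun u => if Nat.eqb v u then 1 else 0) U)).
  + rewrite E1_scal, E1_hits by assumption. simpl pow. rewrite Rmult_comm. apply Rmult_le_compat_l; [pos|].
   apply Rle_div_swap; [pos|]. eapply Rle_trans; [|exact Hw]. apply Rmult_le_compat_l; [assumption|apply cc_mono; lia].
  + apply E1_le; [assumption|]. intros v Hb. rewrite sumL_indic_range by assumption. fold (memb v U).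
   destruct (memb v U) eqn:Em; unfold b2R at 1.
   * rewrite Rmult_1_r. eapply Rle_trans; [apply (IHk (ext g v) q); try assumption|].
    -- pos.
    -- intros u Hu. destruct (Hc u Hu). rewrite ext_length. lia.
    -- rewrite ext_length. replace (S (length g) + k)%nat with (length g + S k)%nat by lia.
      eapply Rle_trans; [exact Hw|apply w_app_le].
    -- right. apply E_ext; [pos|]. intros l _ _.
      assert (H1 : skipn (length g) (ext g v ++ l) = (cur (length g), v) :: l)
       by (unfold ext; rewrite <- app_assoc, skipn_app, skipn_all, Nat.sub_diag; reflexivity).
      assert (H2 : skipn (length (ext g v)) (ext g v ++ l) = l) by (rewrite skipn_app, skipn_all, Nat.sub_diag; reflexivity).
      rewrite H1, H2. cbn [forallb snd]. rewrite Em. pos.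
   * rewrite Rmult_0_r. pos.
Qed.

Variables ts om : nat.
Hypothesis Hom : (1 <= om)%nat.
Hypothesis Hts : (1 <= ts)%nat.

Notation Al n h := (alive ts om n (sg ts h)).
Notation layer' i A := (layer ts om i A).

Definition cn (i n : nat) (h : history) : R := INR (length (layer ts om i (alive ts om n (sg ts h)))).

Lemma layer_incl i A : forall C, In C (layer' i A) -> In C A.
Proof. intros C H. apply filter_In in H. apply H. Qed.

Lemma NoDup_concat_filter (p : list nat -> bool) A : NoDup (concat A) -> NoDup (concat (filter p A)).
Proof.
 intros H. eapply NoDup_app_remove_r. eapply Permutation_NoDup; [|exact H]. apply Permutation_sym, concat_filter_perm.
Qed.

Lemma length_layer_touched xs (A : list (list nat)) :
 (length A = length (filter (fun C => negb (touched xs C)) A) + length (filter (touched xs) A))%nat.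
Proof. clear ts om Hom Hts. induction A as [|C A IH]; simpl; [pos|]. destruct (touched xs C); simpl; lia. Qed.

Lemma sg_app h l : sg ts (h ++ l) = sg ts h ++ sg ts l.
Proof. apply map_app. Qed.

Lemma alive_block g b n : length g = (m * (ts + n))%nat -> length b = m ->
 Al (S n) (g ++ b) = grow ts om (Al n g) (ts + n + 1) (map (fun e => er ts (snd e)) b).
Proof.
 intros Hg Hb. cbn [alive]. rewrite sg_app, alive_app by (unfold sg; rewrite length_map; lia). f_equal.
 unfold targets. replace (ts + n + 1 - 1)%nat with (ts + n)%nat by lia. rewrite skipn_app.
 rewrite skipn_all2 by (unfold sg; rewrite length_map; lia). unfold sg at 1. rewrite length_map, Hg, Nat.sub_diag. simpl app.
 rewrite firstn_all2 by (unfold sg; rewrite length_map; lia). unfold sg. rewrite map_map. pos.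
Qed.

Lemma layer_grow_other i A z xs : lvl ts om z <> i -> layer' i (grow ts om A z xs) = filter (fun C => negb (touched xs C)) (layer' i A).
Proof.
 intros Hz. unfold grow, layer. rewrite filter_app.
 rewrite filter_comm. destruct (succeeds ts om A z xs); simpl; [|apply app_nil_r].
 destruct (Nat.eqb_spec (lvl ts om z) i); [congruence|apply app_nil_r].
Qed.

Lemma layer_grow_same A z xs : exists N, layer' (lvl ts om z) (grow ts om A z xs) =
  filter (fun C => negb (touched xs C)) (layer' (lvl ts om z) A) ++ N /\ length N = (if succeeds ts om A z xs then 1 else 0)%nat.
Proof.
 unfold grow, layer. rewrite filter_app.
 rewrite filter_comm. eexists. split; [pos|]. destruct (succeeds ts om A z xs); simpl; [|pos].
 rewrite Nat.eqb_refl. pos.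
Qed.

Lemma w_app_diff g b U : w (g ++ b) U - w g U = sumL (fun u => INR (degree b u)) U.
Proof.
 unfold w. rewrite (sumL_ext _ (fun u => (INR (degree g u) + delta) + INR (degree b u))), sumL_plus; [ring|].
 intros u _. rewrite degree_app, plus_INR. ring.
Qed.

(** Each touched cluster contains a vertex whose degree the block increases. Losses are thus charged
    to the growth of the total weight, whose mean is known exactly. *)
Lemma touched_le_weight (A : list (list nat)) g b : (forall u, In u (concat A) -> (ts < u)%nat) ->
 INR (length (filter (touched (map (fun e => er ts (snd e)) b)) A)) <= w (g ++ b) (concat A) - w g (concat A).
Proof.
 intros Hts'. rewrite w_app_diff, sumL_concat, INR_sum_filter. apply sumL_le. intros C HC.
 assert (0 <= sumL (fun u => INR (degree b u)) C) by pos.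
 destruct (touched (map (fun e => er ts (snd e)) b) C) eqn:Et; unfold b2R; [|assumption].
 apply touched_spec in Et as (x & Hx & HxC). apply in_map_iff in Hx as (e & He & Heb).
 assert (Hx : (ts < x)%nat) by (apply Hts', in_concat; eauto).
 assert (Hse : snd e = x).
 { unfold er in He. destruct (Nat.leb (snd e) ts); lia. }
 apply Rle_trans with (INR (degree b x)); [|apply (sumL_In_le (fun u => INR (degree b u))); pos].
 apply (le_INR 1). clear - Heb Hse. induction b as [|e' b IH]; [destruct Heb|]. unfold degree. cbn [map fold_right].
 destruct Heb as [->|Heb]; [rewrite Hse, Nat.eqb_refl; lia|]. specialize (IH Heb). unfold degree in IH. lia.
Qed.

Lemma alive_facts g n : valid g -> length g = (m * (ts + n))%nat ->
 NoDup (concat (Al n g)) /\ (forall C, In C (Al n g) -> C <> []) /\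
 (forall u, In u (concat (Al n g)) -> (ts < u <= ts + n)%nat) /\
 forall i, (INR (length (concat (layer' i (Al n g)))) <= cn i n g * (2 * m ^ i)) /\
   w g (concat (layer' i (Al n g))) <= 2 * m * INR (length (concat (layer' i (Al n g)))).
Proof.
 intros Hv Hl. destruct (Inv_alive ts om g n Hv) as [Hnd HC].
 rewrite firstn_all2 in HC by (unfold sg; rewrite length_map; lia).
 assert (Hb : forall u, In u (concat (Al n g)) -> (ts < u <= ts + n)%nat).
 { intros u Hu. apply in_concat in Hu as (C & HC1 & Hu). destruct (HC C HC1) as (_ & H2 & _). specialize (H2 u Hu). lia. }
 assert (Hsub : forall i u, In u (concat (layer' i (Al n g))) -> In u (concat (Al n g))).
 { intros i u Hu. apply in_concat in Hu as (C & HC1 & Hu). apply layer_incl in HC1. apply in_concat. eauto. }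
 repeat split; try assumption.
 - intros C H. apply (HC C H).
 - apply Hb in H. lia.
 - apply Hb in H. lia.
 - apply Rle_trans with (INR (length (layer' i (Al n g)) * (2 * m ^ i))).
  + apply le_INR, length_concat_le. intros C H. apply filter_In in H as [H Hi]. apply Nat.eqb_eq in Hi.
   destruct (HC C H) as (_ & _ & H3 & _). rewrite Hi in H3. lia.
  + rewrite !mult_INR, pow_INR. pos.
 - apply clean_weight; [assumption|apply NoDup_concat_filter; assumption| |].
  + intros u Hu. apply Hsub, Hb in Hu. lia.
  + intros e He Hs. apply in_concat in Hs as (C & HC1 & Hs). apply in_concat. exists C. split; [assumption|].
   apply layer_incl in HC1. destruct (HC C HC1) as (_ & H2 & _ & H4). specialize (H2 _ Hs).
   destruct (H4 (fst e, er ts (snd e))) as (Hf & _); [apply sg_In; eauto| |pos].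
   right. rewrite er_new by lia. assumption.
Qed.

Definition time (g : history) : nat := (length g / m - ts)%nat.

Lemma time_eq g n : length g = (m * (ts + n))%nat -> time g = n.
Proof. intros H. unfold time. pose proof Hm. rewrite H, Nat.mul_comm, Nat.div_mul by lia. lia. Qed.

Definition succ_at (g : history) (h : history) : bool :=
 succeeds ts om (Al (time g) g) (ts + time g + 1) (map (fun e => er ts (snd e)) (skipn (length g) h)).

(** Contraction for [exp (- count)]: a success, of probability at least [p], multiplies it by
    [exp (-1) <= 1/2]. The last hypothesis makes losses negligible as long as there are at most [r']
    clusters. *)
Lemma window_block i n g V0 w0 rr p r' : valid g -> length g = (m * (ts + n))%nat -> (i * om <= n < S i * om)%nat ->
 0 < p <= 1 ->
 (w g V0 - w0 <= rr -> p <= E m g (fun h => b2R (succ_at g h))) ->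
 m / cc (m * ts) <= 1/2 -> 0 <= r' ->
 exp m * (2 * m * (r' * (2 * m ^ i)) * (2 * (m / cc (m * ts)))) <= p / 4 ->
 let F := fun h => exp (- cn i (time h) h) * b2R (Rleb (w h V0 - w0) rr) in
 E m g F <= (1 - p / 4) * F g + exp (m - r').
Proof.
 intros Hv Hl Hn Hp Hsucc Hcc Hr Hsmall F. pose proof INRm_ge2 as Hm2.
 destruct (alive_facts g n Hv Hl) as (Hnd & Hne & Hbd & Hw). destruct (Hw i) as [Hw1 Hw2].
 assert (Htg : time g = n) by (apply time_eq; assumption).
 assert (forall h, 0 <= F h) by (intros; unfold F; apply Rmult_le_pos; pos).
 pose proof (exp_pos (m - r')).
 set (U := concat (layer' i (Al n g))) in *.
 assert (HUnd : NoDup U) by (apply NoDup_concat_filter; assumption).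
 assert (HUb : forall u, In u U -> (1 <= u)%nat /\ (m * u <= length g)%nat).
 { intros u Hu. apply in_concat in Hu as (C & HC1 & Hu). apply layer_incl in HC1.
  assert (Hb := Hbd u ltac:(apply in_concat; eauto)). rewrite Hl. pos. }
 destruct (Rle_dec (w g V0 - w0) rr) as [Hok|Hno].
 2: { rewrite (E_ext m g F (fun _ => 0)).
    - rewrite E_const by assumption. pos.
    - pos.
    - intros b _ _. unfold F. replace (Rleb (w (g ++ b) V0 - w0) rr) with false; [unfold b2R; ring|].
     symmetry. apply Rleb_false. pose proof (w_app_le g b V0). lra. }
 assert (HFg : F g = exp (- cn i n g)).
 { unfold F. rewrite Htg. replace (Rleb (w g V0 - w0) rr) with true by (symmetry; apply Rleb_true; assumption). unfold b2R. ring. }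
 set (c := cn i n g) in *.
 assert (Hblock : forall b, valid (g ++ b) -> length b = m ->
   F (g ++ b) <= exp (- cn i (S n) (g ++ b)) /\
   0 <= w (g ++ b) U - w g U <= m /\
   c - (w (g ++ b) U - w g U) <= cn i (S n) (g ++ b) /\
   (succ_at g (g ++ b) = true -> c + 1 <= cn i (S n) (g ++ b))).
 { intros b Hvb Hb. split; [|split; [|split]].
  - unfold F. rewrite (time_eq (g ++ b) (S n)) by (rewrite length_app; lia). pose proof (exp_pos (- cn i (S n) (g ++ b))).
   destruct (Rleb (w (g ++ b) V0 - w0) rr); unfold b2R; lra.
  - pose proof (w_app_bounds g b U m HUnd Hb Hvb HUb). lra.
  - pose proof (touched_le_weight (layer' i (Al n g)) g b) as Ht. fold U in Ht.
   unfold c, cn. rewrite (alive_block g b n Hl Hb). set (xs := map (fun e => er ts (snd e)) b) in *.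
   assert (Hz : lvl ts om (ts + n + 1) = i) by (apply lvl_eq; pos).
   destruct (layer_grow_same (Al n g) (ts + n + 1) xs) as (N & HN & _). rewrite Hz in HN. rewrite HN, length_app, plus_INR.
   rewrite (length_layer_touched xs (layer' i (Al n g))), plus_INR. pose proof (pos_INR (length N)).
   assert (Hts' : forall u, In u U -> (ts < u)%nat).
   { intros u Hu. apply in_concat in Hu as (C & HC1 & Hu). apply layer_incl in HC1.
    assert (Hb' := Hbd u ltac:(apply in_concat; eauto)). lia. }
   specialize (Ht Hts'). lra.
  - unfold succ_at. rewrite Htg, skipn_app, skipn_all, Nat.sub_diag. simpl app. intros Hs.
   unfold c, cn. rewrite (alive_block g b n Hl Hb). set (xs := map (fun e => er ts (snd e)) b) in *.
   assert (Hz : lvl ts om (ts + n + 1) = i) by (apply lvl_eq; pos).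
   destruct (layer_grow_same (Al n g) (ts + n + 1) xs) as (N & HN & HlN). rewrite Hz in HN. rewrite HN, length_app, plus_INR.
   rewrite Hs in HlN. rewrite HlN. apply Rplus_le_compat_r.
   apply le_INR. rewrite (length_layer_touched xs (layer' i (Al n g))).
   replace (filter (touched xs) (layer' i (Al n g))) with (@nil (list nat)); [simpl; lia|].
   destruct (filter (touched xs) (layer' i (Al n g))) as [|C l] eqn:Ef; [pos|].
   assert (HCin : In C (filter (touched xs) (layer' i (Al n g)))) by (rewrite Ef; left; reflexivity).
   apply filter_In in HCin as [HCl Ht]. apply filter_In in HCl as [HCA HCi]. apply Nat.eqb_eq in HCi.
   destruct (touched_root ts om (Al n g) (ts + n + 1) xs C) as (j & Hj1 & Hj2 & _); try assumption.
   + intros u Hu. apply Hbd in Hu. lia.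
   + lia. }
 (* Below [r'] successes outweigh losses; above [r'] a block loses at most [m] clusters, so the
    potential remains at most [exp (m - r')]. *)
 destruct (Rle_dec c r') as [Hcr|Hcr].
 - apply Rle_trans with (E m g (fun h => exp (- c) * ((1 - b2R (succ_at g h) * / 2) + exp m * (w h U - w g U)))).
  + apply E_le; [assumption|]. intros b Hvb Hb. destruct (Hblock b Hvb Hb) as (H1 & H2 & H3 & H4).
   eapply Rle_trans; [exact H1|]. set (y := w (g ++ b) U - w g U) in *.
   pose proof (exp_pos (- c)).
   assert (0 <= exp m * y) by pos.
   destruct (succ_at g (g ++ b)) eqn:Es; unfold b2R.
   * apply Rle_trans with (exp (- c) * exp (- (1))).
    -- rewrite <- exp_plus. pos.
    -- apply Rmult_le_compat_l; [lra|]. rewrite exp_Ropp. pose proof (exp_ge1 1).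
      assert (/ exp 1 <= / 2) by pos. lra.
   * destruct (Rle_lt_dec (cn i (S n) (g ++ b)) (c - 1)) as [Hle|Hgt].
    -- apply Rle_trans with (exp (- c) * exp m).
      ++ rewrite <- exp_plus. pos.
      ++ apply Rmult_le_compat_l; [lra|].
       assert (exp m * 1 <= exp m * y) by pos. lra.
    -- assert (c <= cn i (S n) (g ++ b)).
      { unfold c, cn in Hgt |- *. apply le_INR. set (x := length (layer' i (Al (S n) (g ++ b)))) in *.
       assert (Hx : INR (length (layer' i (Al n g))) < INR (S x)) by (rewrite S_INR; lra). apply INR_lt in Hx. lia. }
      apply Rle_trans with (exp (- c)); [pos|]. rewrite <- (Rmult_1_r (exp (- c))) at 1.
      pos.
  + rewrite E_scal, E_plus, E_scal.
   rewrite (E_ext m g (fun x => 1 - b2R (succ_at g x) * / 2) (fun x => 1 + - / 2 * b2R (succ_at g x))) by pos.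
   rewrite E_plus, E_scal, E_const by assumption.
   rewrite (E_ext m g (fun x => w x U - w g U) (fun x => w x U + - w g U)) by pos.
   rewrite E_plus, E_const, E_w by assumption.
   assert (Pi (length g) m <= 1 + 2 * (m / cc (m * ts))).
   { assert (m / cc (length g) <= m / cc (m * ts)).
    { apply Rmult_le_compat_l; [lra|]. apply Rinv_le_contravar; [pos|]. apply cc_mono. lia. }
    eapply Rle_trans; [apply Pi_small; lra|lra]. }
   assert (w g U <= 2 * m * (r' * (2 * m ^ i))).
   { eapply Rle_trans; [exact Hw2|]. apply Rmult_le_compat_l; [lra|]. eapply Rle_trans; [exact Hw1|].
    pos. }
   assert (exp m * (w g U * Pi (length g) m + - w g U) <= p / 4).
   { eapply Rle_trans; [|exact Hsmall].
    replace (w g U * Pi (length g) m + - w g U) with (w g U * (Pi (length g) m - 1)) by ring.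
    pose proof (Pi_ge1 (length g) m). pos. }
   rewrite HFg.
   assert (exp (- c) * (1 + - / 2 * E m g (fun h => b2R (succ_at g h)) + exp m * (w g U * Pi (length g) m + - w g U)) <= exp (- c) * (1 - p / 4)) by pos.
   lra.
 - apply Rle_trans with (exp (m - r')).
  + apply E_le_const; [assumption|]. intros b Hvb Hb. destruct (Hblock b Hvb Hb) as (H1 & H2 & H3 & _).
   eapply Rle_trans; [exact H1|]. pos.
  + assert (0 <= (1 - p / 4) * F g) by pos. lra.
Qed.

(** [V0] is the vertex set of the previous level. Success has probability [p] only while its weight
    has grown by at most [rr]; the first error term is Markov's inequality for that growth. *)
Lemma window_prob i h0 V0 rr p : valid h0 -> length h0 = (m * (ts + i * om))%nat -> NoDup V0 ->
 (forall u, In u V0 -> (1 <= u)%nat /\ (m * u <= length h0)%nat) -> 0 < rr -> 0 < p <= 1 ->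
 (forall l n, valid (h0 ++ l) -> length (h0 ++ l) = (m * (ts + n))%nat -> (i * om <= n < S i * om)%nat ->
   w (h0 ++ l) V0 - w h0 V0 <= rr -> p <= E m (h0 ++ l) (fun h => b2R (succ_at (h0 ++ l) h))) ->
 INR (m * om) / cc (m * ts) <= 1/2 ->
 exp m * om * m ^ (i + 2) <= cc (m * ts) / 4 ->
 E (m * om) h0 (fun h => b2R (Rltb (cn i (S i * om) h) (p * om / 16)))
  <= w h0 V0 * (2 * (INR (m * om) / cc (m * ts))) / rr + (1 + om * exp m) * exp (- (p * om / 16)).
Proof.
 intros Hv Hl HVnd HVb Hrr Hp Hsucc Hcc Hsm. pose proof (cc_pos (m * ts)).
 (* The contraction [(1 - p / 4)^om] is then at most [exp (- 2 * r')], and the threshold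
    [p * om / 16] of the statement is [r' / 2]. *)
 set (r' := p * INR om / 8).
 assert (0 <= r') by (unfold r'; assert (0 <= p * om) by pos; lra).
 assert (m / cc (m * ts) <= 1/2).
 { eapply Rle_trans; [|exact Hcc]. rewrite mult_INR.
  rewrite <- (Rmult_1_r m) at 1. pos. }
 set (F := fun h => exp (- cn i (time h) h) * b2R (Rleb (w h V0 - w h0 V0) rr)).
 assert (HE : E (m * om) h0 F <= (1 - p / 4) ^ om * F h0 + om * exp (m - r')).
 { apply (E_block_rec F (1 - p / 4) (exp (m - r')) om h0 (ts + i * om)); try assumption; try lra; [pos|].
  intros l s' Hvl Hs' Hb. set (n := (s' - ts)%nat). assert (s' = (ts + n)%nat) by pos.
  apply (window_block i n (h0 ++ l) V0 (w h0 V0) rr p r'); try assumption; try lia.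
  - apply (Hsucc l n); pos.
  - replace (exp m * (2 * m * (r' * (2 * m ^ i)) * (2 * (m / cc (m * ts)))))
    with (p * ((exp m * om * m ^ (i + 2)) / cc (m * ts))) by (unfold r'; rewrite pow_add; simpl; field; lra).
   apply Rmult_le_compat_l; [lra|]. pos. }
 assert (F h0 <= 1).
 { unfold F. assert (0 <= cn i (time h0) h0) by (unfold cn; apply pos_INR).
  assert (exp (- cn i (time h0) h0) <= 1) by (rewrite <- exp_0; apply exp_mono; lra).
  destruct (Rleb (w h0 V0 - w h0 V0) rr); unfold b2R; lra. }
 assert (Hpw : (1 - p / 4) ^ om <= exp (- (2 * r'))).
 { apply Rle_trans with (exp (- (p / 4)) ^ om); [apply pow_incr; split; [lra|]; pose proof (exp_ge1 (- (p / 4))); lra|].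
  rewrite exp_pow_nat. apply exp_mono. unfold r'. lra. }
 assert (E (m * om) h0 F <= exp (- (2 * r')) + om * exp (m - r')).
 { eapply Rle_trans; [exact HE|]. apply Rplus_le_compat_r. eapply Rle_trans; [|exact Hpw].
  rewrite <- (Rmult_1_r ((1 - p / 4) ^ om)) at 2. pos. }
 replace (p * om / 16) with (r' / 2) by (unfold r'; field).
 apply Rle_trans with (E (m * om) h0 (fun h => (w h V0 + - w h0 V0) * / rr + exp (r' / 2) * F h)).
 - apply E_le; [assumption|]. intros l Hvl Hll. set (h := h0 ++ l).
  assert (0 <= w h V0 + - w h0 V0) by (pose proof (w_app_le h0 l V0); unfold h; lra).
  assert (0 <= (w h V0 + - w h0 V0) * / rr) by pos.
  assert (0 <= exp (r' / 2) * F h) by (apply Rmult_le_pos; [pos|apply Rmult_le_pos; pos]).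
  destruct (Rltb (cn i (S i * om) h) (r' / 2)) eqn:Ec; unfold b2R; [|lra]. apply Rltb_true in Ec.
  destruct (Rle_lt_dec (w h V0 - w h0 V0) rr) as [Hle|Hgt].
  + assert (1 <= exp (r' / 2) * F h); [|lra]. unfold F.
   rewrite (time_eq h (S i * om)) by (unfold h; rewrite length_app; nia).
   apply Rleb_true in Hle. rewrite Hle. rewrite Rmult_1_r, <- exp_plus.
   rewrite <- exp_0. pos.
  + assert (1 <= (w h V0 + - w h0 V0) * / rr); [|lra]. apply Rle_div_swap; lra.
 - rewrite E_plus, E_scal.
  rewrite (E_ext (m * om) h0 (fun x => (w x V0 + - w h0 V0) * / rr) (fun x => / rr * (w x V0 + - w h0 V0))) by pos.
  rewrite E_scal, E_plus, E_const, E_w by assumption.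
  apply Rplus_le_compat.
  + rewrite Rmult_comm. apply Rmult_le_compat_r; [pos|].
   replace (w h0 V0 * Pi (length h0) (m * om) + - w h0 V0) with (w h0 V0 * (Pi (length h0) (m * om) - 1)) by ring.
   apply Rmult_le_compat_l; [pos|].
   assert (INR (m * om) / cc (length h0) <= INR (m * om) / cc (m * ts)).
   { apply Rmult_le_compat_l; [pos|]. apply Rinv_le_contravar; [pos|]. apply cc_mono. lia. }
   assert (Pi (length h0) (m * om) <= 1 + 2 * (INR (m * om) / cc (length h0))) by (apply Pi_small; lra). lra.
  + apply Rle_trans with (exp (r' / 2) * (exp (- (2 * r')) + om * exp (m - r'))).
   * pos.
   * rewrite Rmult_plus_distr_l, <- exp_plus.
    replace (exp (r' / 2) * (om * exp (m - r'))) with (om * (exp (r' / 2) * exp (m - r'))) by ring.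
    rewrite <- exp_plus. replace (r' / 2 + (m - r')) with (m + - (r' / 2)) by field. rewrite (exp_plus m).
    assert (exp (r' / 2 + - (2 * r')) <= exp (- (r' / 2))) by pos. lra.
Qed.

End Windows.

(** * Clusters of every depth *)

Section Levels.
Context {P : PAmodel}.
Variables ts om k : nat.
Hypothesis Hom : (1 <= om)%nat.
Hypothesis Hts : (1 <= ts)%nat.

Notation Al n h := (alive ts om n (sg ts h)).
Notation layer' i A := (layer ts om i A).
Notation t := (ts + S k * om)%nat.

Definition Cmax : R := cc (m * (ts + S k * om)).

(** Guaranteed number of clusters of level [i] when its window closes: half of the previous level
    survives, each root has weight at least [m + delta], and all [m] edges have to find such
    roots. *)
Fixpoint Rv (i : nat) : R :=
 match i with
 | O => (INR ts * (2 * INR m + delta) / Cmax) ^ m * INR om / 16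
 | S i' => (Rv i' / 2 * (INR m + delta) / Cmax) ^ m * INR om / 16
 end.

Lemma Cmax_ge : INR (ts + S k * om) * m <= Cmax.
Proof.
 unfold Cmax, cc. rewrite (mult_INR m). pose proof chi_range.
 assert (m * INR (ts + S k * om) * 1 <= m * INR (ts + S k * om) * (2 + chi)) by pos. lra.
Qed.

Lemma p0_range : 0 < (ts * (2 * m + delta) / Cmax) ^ m <= 1.
Proof.
 assert (0 < Cmax) by apply cc_pos. pose proof md_pos. pose proof INRm_ge2.
 assert (0 < ts * (2 * m + delta) / Cmax <= 1).
 { split; [pos|]. apply Rdiv_le_swap; [assumption|].
  rewrite Rmult_1_l. apply Rle_trans with (cc (m * ts)); [|apply cc_mono; nia].
  rewrite cc_vertices. pose proof chi_range. lra. }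
 rewrite <- (pow1 m). pos.
Qed.

Lemma pp_range r : 0 < r <= om -> 0 < (r / 2 * (m + delta) / Cmax) ^ m <= 1.
Proof.
 intros Hr. assert (0 < Cmax) by apply cc_pos. pose proof md_pos. pose proof Hd2.
 assert (0 < r / 2 * (m + delta) / Cmax <= 1).
 { split; [pos|]. apply Rdiv_le_swap; [assumption|].
  rewrite Rmult_1_l. eapply Rle_trans; [|apply Cmax_ge].
  assert (om <= INR (ts + S k * om)) by pos. pos. }
 rewrite <- (pow1 m). pos.
Qed.

Lemma Rv_range i : 0 < Rv i <= om.
Proof.
 assert (Hx : forall p, 0 < p <= 1 -> 0 < p * om / 16 <= om).
 { intros p Hp. assert (0 < p * om) by pos.
  assert (p * om <= 1 * om) by pos. lra. }
 induction i; cbn [Rv]; apply Hx; [apply p0_range|apply pp_range; assumption].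
Qed.

(** During the next window no cluster of level [i] is born, and the losses are charged to the growth
    of the vertex set [V0] fixed at its start. *)
Lemma layer_survive i h0 d : forall l, valid (h0 ++ l) -> length h0 = (m * (ts + S i * om))%nat -> length l = (m * d)%nat -> (d <= om)%nat ->
 let V0 := concat (layer' i (Al (S i * om) h0)) in
 let n := (S i * om + d)%nat in
 incl (layer' i (Al n (h0 ++ l))) (layer' i (Al (S i * om) h0)) /\
 cn ts om i (S i * om) h0 - (w (h0 ++ l) V0 - w h0 V0) <= cn ts om i n (h0 ++ l).
Proof.
 induction d; intros l Hv Hl Hll Hd V0 n.
 - destruct l as [|? ?]; [|simpl in Hll; lia]. unfold n. rewrite Nat.add_0_r, app_nil_r. pos.
 - set (l1 := firstn (m * d) l). set (b := skipn (m * d) l).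
  assert (Hl12 : l = l1 ++ b) by (symmetry; apply firstn_skipn).
  assert (Hll1 : length l1 = (m * d)%nat) by (unfold l1; rewrite firstn_length_le; lia).
  assert (Hlb : length b = m) by (unfold b; rewrite length_skipn; lia).
  rewrite Hl12, app_assoc in *.
  assert (Hv1 := valid_prefix _ _ Hv).
  destruct (IHd l1 Hv1 Hl Hll1 ltac:(lia)) as [Hin Hcn]. fold V0 in Hcn. set (g := h0 ++ l1) in *.
  set (n1 := (S i * om + d)%nat) in *. replace n with (S n1) by pos.
  assert (Hlg : length g = (m * (ts + n1))%nat) by (unfold g, n1; rewrite length_app; lia).
  unfold cn at 2. rewrite (alive_block ts om Hom Hts g b n1 Hlg Hlb).
  assert (lvl ts om (ts + n1 + 1) = S i) by (apply lvl_eq; pos).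
  rewrite layer_grow_other by pos.
  set (xs := map (fun e => er ts (snd e)) b).
  destruct (alive_facts ts om Hom Hts g n1 Hv1 Hlg) as (Hnd & Hne & Hbd & _).
  split.
  + intros C HC. apply filter_In in HC as [HC _]. pos.
  + pose proof (touched_le_weight ts om Hom Hts (layer' i (Al n1 g)) g b) as Ht. fold xs in Ht.
   assert (Hts' : forall u, In u (concat (layer' i (Al n1 g))) -> (ts < u)%nat).
   { intros u Hu. apply in_concat in Hu as (C & HC & Hu). apply layer_incl in HC.
    assert (Hb := Hbd u ltac:(apply in_concat; eauto)). lia. }
   specialize (Ht Hts').
   assert (w (g ++ b) (concat (layer' i (Al n1 g))) - w g (concat (layer' i (Al n1 g))) <= w (g ++ b) V0 - w g V0).
   { rewrite !w_app_diff. apply sumL_incl; [apply NoDup_concat_filter; assumption| |pos].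
    intros u Hu. apply in_concat in Hu as (C & HC & Hu). apply in_concat. pos. }
   unfold cn in Hcn. unfold cn. rewrite (length_layer_touched xs (layer' i (Al n1 g))), plus_INR in Hcn. lra.
Qed.

Definition errA : R := 16 * INR m ^ k * (INR (m * om) / cc (m * ts)).
Definition errB (r : R) : R := (1 + INR om * exp (INR m)) * exp (- r).

Hypothesis Hcc : INR (m * om) / cc (m * ts) <= 1/2.
Hypothesis Hsm : exp (INR m) * INR om * INR m ^ (k + 2) <= cc (m * ts) / 4.

Lemma Hsm_le i : (i <= k)%nat -> exp m * om * m ^ (i + 2) <= cc (m * ts) / 4.
Proof.
 intros Hi. eapply Rle_trans; [|exact Hsm]. pose proof INRm_ge2. apply Rmult_le_compat_l.
 - pos.
 - apply Rle_pow; pos.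
Qed.

Lemma errA_nonneg : 0 <= errA.
Proof.
 unfold errA.
 pos.
Qed.

Lemma errB_nonneg r : 0 <= errB r.
Proof.
 unfold errB.
 pos.
Qed.

Lemma succ_lower i g n q U : valid g -> length g = (m * (ts + n))%nat -> (i * om <= n < S i * om)%nat -> (i <= k)%nat ->
 NoDup U -> (forall u, In u U -> (1 <= u)%nat /\ (m * u <= length g)%nat) -> 0 <= q -> q * Cmax <= w g U ->
 (forall u, In u U -> if Nat.eqb i 0 then er ts u = 0%nat else In (er ts u) (roots ts om (i - 1) (Al n g))) ->
 q ^ m <= E m g (fun h => b2R (succ_at ts om g h)).
Proof.
 intros Hv Hl Hn Hi HU HUb Hq Hw Hs. eapply Rle_trans; [apply (all_targets_in U m g q); try assumption|].
 - eapply Rle_trans; [|exact Hw]. apply Rmult_le_compat_l; [assumption|]. apply cc_mono.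
  nia.
 - apply E_le; [assumption|]. intros b Hvb Hb.
  destruct (forallb (fun e => memb (snd e) U) (skipn (length g) (g ++ b))) eqn:Ef; [|apply b2R_range].
  replace (succ_at ts om g (g ++ b)) with true; [lra|]. symmetry. unfold succ_at, succeeds. rewrite (time_eq ts om Hom Hts g n Hl).
  rewrite (lvl_eq ts om (ts + n + 1) i) by pos.
  apply forallb_forall. intros x Hx. apply in_map_iff in Hx as (e & <- & He). rewrite forallb_forall in Ef.
  specialize (Ef e He). apply memb_In in Ef. specialize (Hs _ Ef). destruct (Nat.eqb i 0); [pos|apply memb_In]; exact Hs.
Qed.

Lemma levels_prob (Rl : R) : (forall i, (i <= k)%nat -> Rl <= Rv i) -> forall i, (i <= k)%nat ->
 E (m * (ts + S i * om)) [] (fun h => b2R (Rltb (cn ts om i (S i * om) h) (Rv i))) <= INR (S i) * (errA + errB Rl).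
Proof.
 intros HRl. pose proof errA_nonneg. pose proof INRm_ge2. pose proof md_pos.
 assert (0 < Cmax) by apply cc_pos.
 assert (HB : forall i, (i <= k)%nat -> errB (Rv i) <= errB Rl).
 { intros i Hi. apply Rmult_le_compat_l.
  - pos.
  - apply exp_mono. specialize (HRl i Hi). lra. }
 pose proof (errB_nonneg Rl).
 induction i; intros Hi.
 - replace (m * (ts + 1 * om))%nat with (m * ts + m * om)%nat by lia. rewrite E_add.
  simpl (INR 1). apply E_le_const; [pos|]. intros h0 Hv Hl.
  eapply Rle_trans; [apply (window_prob ts om Hom Hts 0 h0 [] 1 ((ts * (2 * m + delta) / Cmax) ^ m))|]; try assumption.
  + lia.
  + pos.
  + intros u [].
  + lra.
  + apply p0_range.
  + intros l n Hvl Hll Hn _. apply (succ_lower 0 (h0 ++ l) n _ (seq 1 ts)); try assumption; try lia.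
   * pos.
   * intros u Hu. apply in_seq in Hu. rewrite Hll. pos.
   * pos.
   * eapply Rle_trans; [|apply w_app_le]. rewrite (w_total h0 ts) by pos. right. pos.
   * intros u Hu. apply in_seq in Hu. apply er_old; lia.
  + apply Hsm_le. lia.
  + assert (Hw0 : w h0 [] = 0) by reflexivity.
   apply Rle_trans with (errB (Rv 0)); [right; rewrite Hw0; unfold errB; cbn [Rv]; unfold Rdiv; ring|]. specialize (HB 0%nat ltac:(lia)). lra.
 - specialize (IHi ltac:(lia)). replace (m * (ts + S (S i) * om))%nat with (m * (ts + S i * om) + m * om)%nat by lia. rewrite E_add.
  apply Rle_trans with (E (m * (ts + S i * om)) [] (fun h => b2R (Rltb (cn ts om i (S i * om) h) (Rv i)) + (errA + errB Rl))).
  2: { rewrite E_plus, E_const by constructor. rewrite (S_INR (S i)). lra. }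
  apply E_le; [pos|]. intros h0 Hv Hl. simpl app.
  destruct (Rltb (cn ts om i (S i * om) h0) (Rv i)) eqn:Ec.
  { change (b2R true) with 1. apply Rle_trans with 1; [|lra]. apply E_le_const; [assumption|]. pos. }
  rewrite Rplus_0_l. apply Rltb_false in Ec.
  destruct (Rv_range i) as [HRv0 HRv1]. set (c0 := cn ts om i (S i * om) h0) in *.
  destruct (alive_facts ts om Hom Hts h0 (S i * om) Hv Hl) as (Hnd & Hne & Hbd & Hw). destruct (Hw i) as [Hw1 Hw2].
  set (V0 := concat (layer' i (Al (S i * om) h0))) in *.
  assert (forall u, In u V0 -> (1 <= u)%nat /\ (m * u <= length h0)%nat).
  { intros u Hu. apply in_concat in Hu as (C & HC1 & Hu). apply layer_incl in HC1.
   assert (Hb := Hbd u ltac:(apply in_concat; eauto)). rewrite Hl. pos. }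
  eapply Rle_trans; [apply (window_prob ts om Hom Hts (S i) h0 V0 (c0 / 2) ((Rv i / 2 * (m + delta) / Cmax) ^ m))|]; try assumption.
  + apply NoDup_concat_filter; assumption.
  + lra.
  + apply pp_range. lra.
  + intros l n Hvl Hll Hn Hwl. set (g := h0 ++ l) in *.
   assert (Hd : length l = (m * (n - S i * om))%nat) by (unfold g in Hll; rewrite length_app in Hll; nia).
   destruct (layer_survive i h0 (n - S i * om) l Hvl Hl Hd ltac:(lia)) as [Hin Hcn]. fold V0 g in Hcn. fold c0 in Hcn.
   replace (S i * om + (n - S i * om))%nat with n in Hin, Hcn by lia.
   destruct (alive_facts ts om Hom Hts g n Hvl Hll) as (Hndg & Hneg & Hbdg & _).
   assert (HUin : forall u, In u (roots ts om i (Al n g)) -> (ts < u <= ts + n)%nat).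
   { intros u Hu. apply roots_In in Hu as (C & HC1 & Hu & _); [|assumption]. apply Hbdg, in_concat. eauto. }
   assert (HUb : forall u, In u (roots ts om i (Al n g)) -> (1 <= u)%nat /\ (m * u <= length g)%nat).
   { intros u Hu. apply HUin in Hu. rewrite Hll. pos. }
   apply (succ_lower (S i) g n _ (roots ts om i (Al n g))); try assumption.
   * apply NoDup_concat_heads; [apply NoDup_concat_filter; assumption|]. intros C HC1. apply layer_incl in HC1. auto.
   * pos.
   * replace (Rv i / 2 * (m + delta) / Cmax * Cmax) with (Rv i / 2 * (m + delta)) by pos.
    apply Rle_trans with (cn ts om i n g * (m + delta)); [pos|].
    unfold cn. rewrite <- (length_map (hd 0%nat)). rewrite Rmult_comm, <- sumL_const.
    apply sumL_le. intros u Hu. destruct (HUb u Hu) as [Hu1 Hu2]. pose proof (degree_completed g u Hvl Hu1 Hu2).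
    pos.
   * intros u Hu. simpl. rewrite Nat.sub_0_r, er_new by (apply HUin in Hu; lia). assumption.
  + apply Hsm_le. assumption.
  + apply Rplus_le_compat; [|apply (HB (S i)); assumption].
   assert (0 <= INR (m * om) / cc (m * ts)) by pos.
   apply Rdiv_le_swap; [lra|].
   apply Rle_trans with (2 * m * (c0 * (2 * m ^ i)) * (2 * (INR (m * om) / cc (m * ts)))).
   * apply Rmult_le_compat_r; [lra|]. eapply Rle_trans; [exact Hw2|]. pos.
   * replace (2 * m * (c0 * (2 * m ^ i)) * (2 * (INR (m * om) / cc (m * ts))))
     with (16 * m ^ S i * (INR (m * om) / cc (m * ts)) * (c0 / 2)) by (simpl; field; apply Rgt_not_eq, cc_pos).
    apply Rmult_le_compat_r; [lra|]. apply Rmult_le_compat_r; [assumption|]. apply Rmult_le_compat_l; [lra|].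
    apply Rle_pow; pos.
Qed.

End Levels.

(** * Distances between clusters *)

Lemma near_walk h n u v : near h n u v -> exists q, walkb h (v :: q) = true /\ last (v :: q) 0%nat = u /\ (length q <= n)%nat.
Proof.
 induction 1 as [n u|n u x v Hn IH Ha].
 - exists []. simpl. lia.
 - destruct IH as (q & Hw & Hl & Hlen). exists (x :: q). repeat split.
  + change (adj h v x && walkb h (x :: q) = true). rewrite adj_sym, Ha. pos.
  + pos.
  + simpl. lia.
Qed.

Lemma last_app_cons (l : list nat) x r d : last (l ++ x :: r) d = last (x :: r) d.
Proof. induction l as [|y l IH]; [pos|]. simpl app. destruct (l ++ x :: r) eqn:E; [destruct l; discriminate|pos]. Qed.

Lemma loop_erase h q : forall x, walkb h (x :: q) = true ->
 exists q', walkb h (x :: q') = true /\ NoDup (x :: q') /\ last (x :: q') 0%nat = last (x :: q) 0%nat /\ incl (x :: q') (x :: q) /\ (length q' <= length q)%nat.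
Proof.
 induction q as [|y q IH]; intros x Hw.
 - exists []. repeat split; try assumption; [constructor; pos|pos|lia].
 - apply andb_true_iff in Hw as [Ha Hw].
  destruct (IH y Hw) as (q' & H1 & H2 & H3 & H4 & H5).
  destruct (in_dec Nat.eq_dec x (y :: q')) as [Hin|Hni].
  + apply in_split in Hin as (a & b & Hab). exists b. rewrite Hab in *.
   repeat split.
   * eapply walkb_app. pos.
   * eapply NoDup_app_remove_l. pos.
   * rewrite <- (last_app_cons a x b), H3. pos.
   * right. apply H4. apply in_or_app. pos.
   * apply (f_equal (@length nat)) in Hab. rewrite length_app in Hab. simpl in Hab. simpl. lia.
  + exists (y :: q'). repeat split.
   * change (adj h x y && walkb h (y :: q') = true). rewrite Ha. pos.
   * pos.
   * pos.
   * intros z [<-|Hz]; pos.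
   * simpl. lia.
Qed.

Section Distance.
Context {P : PAmodel}.
Variables ts om : nat.

Lemma clean_adj h C u v : (forall x, In x C -> (ts < x)%nat) -> clean ts om C (sg ts h) -> adj h u v = true -> In u C ->
 (In v C /\ (lvl ts om u = S (lvl ts om v) \/ lvl ts om v = S (lvl ts om u))) \/ (~ In v C /\ lvl ts om u = 0%nat /\ (v <= ts)%nat).
Proof.
 intros Hb Hc Ha Hu. apply adj_cases in Ha as [Ha|Ha].
 - destruct (Hc (u, er ts v)) as (_ & Hh & H0); [apply sg_In; exists (u, v); auto|pos|]. simpl in Hh, H0.
  unfold hgt in Hh. rewrite (proj2 (memb_In _ _) Hu) in Hh. injection Hh as Hh.
  destruct (memb (er ts v) C) eqn:Em.
  + apply memb_In in Em. assert (He : er ts v = v) by (pose proof (Hb _ Em); unfold er in *; destruct (Nat.leb v ts); lia).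
   rewrite He in *. auto.
  + assert (Hv : (v <= ts)%nat) by (unfold er in H0; destruct (Nat.leb_spec v ts); lia).
   right. repeat split; try assumption. intros Hin. apply Hb in Hin. lia.
 - pose proof (Hb u Hu). destruct (Hc (v, er ts u)) as (Hv & Hh & _); [apply sg_In; exists (v, u); auto| |].
  + rewrite er_new by assumption. pos.
  + simpl in Hv, Hh. rewrite er_new in Hh by assumption. unfold hgt in Hh.
   rewrite (proj2 (memb_In _ _) Hu), (proj2 (memb_In _ _) Hv) in Hh. pos.
Qed.

(** A path can leave a clean set only from level 0, and inside it the level changes by one per step;
    so getting from height [h] to the last exit takes at least [h - 1] steps. *)
Lemma last_exit h C p : (forall x, In x C -> (ts < x)%nat) -> clean ts om C (sg ts h) -> walkb h p = true ->
 (exists u, In u p /\ In u C) -> ~ In (last p 0%nat) C ->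
 exists l x r, p = l ++ x :: r /\ r <> [] /\ In x C /\ lvl ts om x = 0%nat /\ (forall y, In y r -> ~ In y C) /\
  (hgt ts om C (hd 0%nat p) <= S (length l))%nat.
Proof.
 intros Hb Hc. induction p as [|x p IH]; intros Hw (u & Hu & HuC) Hlast; [destruct Hu|].
 destruct p as [|y p].
 { destruct Hu as [->|[]]. contradiction. }
 apply andb_true_iff in Hw as [Ha Hw].
 destruct (existsb (fun v => memb v C) (y :: p)) eqn:Ex.
 - apply existsb_exists in Ex as (v & Hv & HvC). apply memb_In in HvC.
  destruct (IH Hw (ex_intro _ v (conj Hv HvC)) Hlast) as (l & x0 & r & H1 & H2 & H3 & H4 & H5 & H6).
  exists (x :: l), x0, r. repeat split; try assumption; [simpl; rewrite H1; reflexivity|].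
  simpl hd in *. simpl length. unfold hgt at 1. destruct (memb x C) eqn:Em; [|lia]. apply memb_In in Em.
  destruct (clean_adj h C x y Hb Hc Ha Em) as [(Hy & Hl)|(_ & Hl & _)]; [|lia].
  unfold hgt in H6. rewrite (proj2 (memb_In _ _) Hy) in H6. lia.
 - assert (Hno : forall v, In v (y :: p) -> ~ In v C).
  { intros v Hv HvC. apply memb_In in HvC. assert (existsb (fun v => memb v C) (y :: p) = true) by (apply existsb_exists; eauto). pos. }
  assert (HxC : In x C) by (destruct Hu as [->|Hu]; [assumption|exfalso; apply (Hno u Hu); assumption]).
  destruct (clean_adj h C x y Hb Hc Ha HxC) as [(Hy & _)|(_ & Hl & _)]; [exfalso; apply (Hno y); pos|].
  exists [], x, (y :: p). repeat split; try assumption; [pos|].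
  simpl hd. unfold hgt. rewrite (proj2 (memb_In _ _) HxC), Hl. lia.
Qed.

Definition leaves (C : list nat) : list nat := filter (fun u => Nat.eqb (lvl ts om u) 0) C.

Lemma leaves_In C u : In u (leaves C) <-> In u C /\ lvl ts om u = 0%nat.
Proof. unfold leaves. rewrite filter_In, Nat.eqb_eq. pos. Qed.

(** The path is cut at its last exit from [C], reversed, and cut at its last exit from [D]. This
    removes [k] edges at either end, and loop erasure makes the middle part self-avoiding without
    changing its ends. *)
Lemma cluster_path h n k C D : (forall x, In x C \/ In x D -> (ts < x)%nat) -> clean ts om C (sg ts h) -> clean ts om D (sg ts h) ->
 (forall x, In x C -> ~ In x D) -> C <> [] -> D <> [] -> lvl ts om (hd 0%nat C) = k -> lvl ts om (hd 0%nat D) = k ->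
 near h n (hd 0%nat D) (hd 0%nat C) ->
 exists q r r' x0 x1 y0 y1, q = x0 :: x1 :: r /\ q = r' ++ [y1; y0] /\ In x0 (leaves D) /\ In y0 (leaves C) /\ (x1 <= ts)%nat /\ (y1 <= ts)%nat /\
  NoDup q /\ walkb h q = true /\ (3 <= length q)%nat /\ (length q + 2 * k <= S n)%nat.
Proof.
 intros Hb HcC HcD Hdis HC HD HkC HkD Hn.
 assert (HbC : forall x, In x C -> (ts < x)%nat) by auto. assert (HbD : forall x, In x D -> (ts < x)%nat) by auto.
 pose proof (hd_In C HC) as HhC. pose proof (hd_In D HD) as HhD.
 apply near_walk in Hn as (p & Hw & Hl & Hlen).
 destruct (last_exit h C (hd 0%nat C :: p) HbC HcC Hw) as (l & y0 & r & H1 & H2 & H3 & H4 & H5 & H6).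
 { exists (hd 0%nat C). pos. }
 { rewrite Hl. intros Hin. apply (Hdis _ Hin HhD). }
 simpl hd in H6. unfold hgt in H6. rewrite (proj2 (memb_In _ _) HhC), HkC in H6.
 assert (Hw2 : walkb h (rev (y0 :: r)) = true).
 { rewrite H1 in Hw. apply walkb_app in Hw. simpl rev. rewrite rev_alt in *.
  pose proof (walkb_rev_append h r y0 []) as Hrev. rewrite rev_append_rev in Hrev. rewrite rev_append_rev, app_nil_r. rewrite Hrev, Hw. pos. }
 assert (Hlast : last (y0 :: r) 0%nat = hd 0%nat D) by (rewrite <- Hl, H1, last_app_cons; reflexivity).
 assert (Hhd : hd 0%nat (rev (y0 :: r)) = hd 0%nat D).
 { rewrite <- Hlast. destruct (exists_last (l := y0 :: r)) as (r0 & z & Hz); [pos|]. rewrite Hz, rev_app_distr, last_app_cons. pos. }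
 assert (In (hd 0%nat D) (rev (y0 :: r))).
 { destruct (rev (y0 :: r)) eqn:Er; [|pos]. apply (f_equal (@length nat)) in Er. rewrite length_rev in Er. discriminate. }
 destruct (last_exit h D (rev (y0 :: r)) HbD HcD Hw2) as (l' & x0 & r2 & G1 & G2 & G3 & G4 & G5 & G6).
 { pos. }
 { simpl rev. rewrite last_app_cons. pos. }
 rewrite Hhd in G6. unfold hgt in G6. rewrite (proj2 (memb_In _ _) HhD), HkD in G6.
 assert (Hw3 : walkb h (x0 :: r2) = true) by (rewrite G1 in Hw2; apply walkb_app in Hw2; exact Hw2).
 assert (Hlast2 : last (x0 :: r2) 0%nat = y0).
 { rewrite <- (last_app_cons l' x0 r2), <- G1. simpl rev. rewrite last_app_cons. pos. }
 destruct (loop_erase h r2 x0 Hw3) as (q' & E1 & E2 & E3 & E4 & E5). rewrite Hlast2 in E3.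
 assert (x0 <> y0) by (intros ->; apply (Hdis y0); assumption).
 assert (Hmem : forall z, In z (x0 :: q') -> z <> y0 -> ~ In z C).
 { intros z Hz Hne. apply H5. apply E4 in Hz. assert (Hz' : In z (rev (y0 :: r))) by (rewrite G1; apply in_or_app; right; assumption).
  apply in_rev in Hz'. destruct Hz' as [->|Hz']; pos. }
 assert (HmemD : forall z, In z q' -> ~ In z D).
 { intros z Hz. apply G5. destruct (E4 z (or_intror Hz)) as [<-|Hz']; [|assumption]. inversion E2; contradiction. }
 destruct q' as [|x1 q2]; [simpl in E3; congruence|].
 apply andb_true_iff in E1 as [Ea E1].
 assert ((x1 <= ts)%nat).
 { destruct (clean_adj h D x0 x1 HbD HcD Ea G3) as [(Hin & _)|(_ & _ & Hle)]; [|assumption]. exfalso. apply (HmemD x1); pos. }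
 destruct (exists_last (l := x1 :: q2)) as (q3 & y0' & Hq3); [pos|].
 assert (y0' = y0) by (rewrite <- E3; rewrite Hq3; change (x0 :: q3 ++ [y0']) with ((x0 :: q3) ++ [y0']); rewrite last_app_cons; reflexivity).
 subst y0'. destruct q3 as [|z q3].
 { injection Hq3 as Hx1y _. apply HbC in H3. lia. }
 destruct (exists_last (l := z :: q3)) as (q4 & y1 & Hq4); [pos|].
 assert (Hq : x0 :: x1 :: q2 = (x0 :: q4) ++ [y1; y0]) by (rewrite Hq3, Hq4; simpl; rewrite <- app_assoc; reflexivity).
 exists (x0 :: x1 :: q2), q2, (x0 :: q4), x0, x1, y0, y1.
 assert (Hw4 : walkb h (x0 :: x1 :: q2) = true) by (change (adj h x0 x1 && walkb h (x1 :: q2) = true); rewrite Ea; exact E1).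
 assert ((y1 <= ts)%nat).
 { rewrite Hq in Hw4. apply walkb_app in Hw4. change (adj h y1 y0 && true = true) in Hw4. rewrite andb_true_r, adj_sym in Hw4.
  destruct (clean_adj h C y0 y1 HbC HcC Hw4 H3) as [(Hin & _)|(_ & _ & Hle)]; [|assumption]. exfalso.
  apply (Hmem y1); [rewrite Hq; apply in_or_app; right; left; reflexivity| |assumption].
  intros ->. rewrite Hq in E2. apply NoDup_app_remove_l in E2. inversion E2 as [|? ? Hni _]; subst. apply Hni. pos. }
 repeat split; try assumption; try (apply leaves_In; auto).
 - apply (f_equal (@length nat)) in Hq. rewrite length_app in Hq. simpl in *. lia.
 - apply (f_equal (@length nat)) in H1, G1. rewrite length_app in H1, G1. rewrite length_rev in G1. simpl length in *. lia.
Qed.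

End Distance.

Lemma adj_degree g u : forall l, NoDup l -> sumL (fun v => b2R (adj g u v)) l <= INR (degree g u).
Proof.
 induction g as [|[a b] g IH]; intros l Hl.
 - change (sumL (fun _ : nat => 0) l <= 0). rewrite sumL_const. lra.
 - apply Rle_trans with (sumL (fun v => (if Nat.eqb a u then 1 else 0) * (if Nat.eqb b v then 1 else 0) + (if Nat.eqb b u then 1 else 0) * (if Nat.eqb a v then 1 else 0) + b2R (adj g u v)) l).
  + apply sumL_le. intros v _. unfold adj at 1. cbn [existsb fst snd].
   eapply Rle_trans; [apply b2R_orb_le|]. apply Rplus_le_compat_r. eapply Rle_trans; [apply b2R_orb_le|].
   destruct (Nat.eqb a u), (Nat.eqb b v), (Nat.eqb a v), (Nat.eqb b u); cbn [andb]; unfold b2R; lra.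
  + rewrite !sumL_plus, !sumL_scal, !sumL_indic_range by assumption. specialize (IH l Hl).
   unfold degree. cbn [map fold_right fst snd]. fold (degree g u). rewrite !plus_INR.
   pose proof (b2R_range (existsb (Nat.eqb a) l)). pose proof (b2R_range (existsb (Nat.eqb b) l)).
   destruct (Nat.eqb a u), (Nat.eqb b u); simpl (INR 1); simpl (INR 0); lra.
Qed.

Definition all_close (t D : nat) (h : history) : bool :=
 forallb (fun u => forallb (fun v => reach h t D u v) (seq 1 t)) (seq 1 t).

(** * Two deep clusters are far apart *)

Section Core.
Context {P : PAmodel}.
Variables ts om k K : nat.
Hypothesis Hom : (1 <= om)%nat.
Hypothesis Hts : (1 <= ts)%nat.
Hypothesis Ht2 : (ts + S k * om <= 2 * ts)%nat.
Variable Ld : R.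
Hypothesis HLd : 2 * INR m <= Ld.

Notation t := (ts + S k * om)%nat.
Notation De := (1024 * Ld).

Definition deep (g : history) : list (list nat) := layer ts om k (alive ts om (S k * om) g).
Definition lv (j : nat) (g : history) : list nat := leaves ts om (nth j (deep g) []).

Definition lv_ok (j : nat) (g : history) : bool :=
 NoDupb (lv j g) && forallb (fun x => Nat.ltb ts x && Nat.leb x t) (lv j g) && Rleb (INR (length (lv j g))) (2 * INR m ^ k).

(** All conditions are stated on the erased history, as the path bounds require. Two clusters at
    least are demanded, so the default of [nth] in [lv] is never met. *)
Definition okg (g : history) : bool :=
 Nat.leb 2 (length (deep g)) && lv_ok 0 g && lv_ok 1 g &&
 forallb (fun x => Rleb (sumL (fun v => if Nat.ltb ts v then b2R (adj g x v) else 0) (seq 1 t)) De) (seq (ts + 1) (S k * om)).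

Lemma lv_leafy j : (j < 2)%nat -> leafy ts t (2 * m ^ k) okg (lv j).
Proof.
 intros Hj g Hg. unfold okg in Hg. rewrite !andb_true_iff in Hg. destruct Hg as [[[_ H0] H1] _].
 assert (Hok : lv_ok j g = true) by (destruct j as [|[|j]]; pos).
 unfold lv_ok in Hok. rewrite !andb_true_iff in Hok. destruct Hok as [[Ha Hb] Hc]. repeat split.
 - unfold NoDupb in Ha. destruct (ListDec.NoDup_dec Nat.eq_dec (lv j g)); pos.
 - rewrite forallb_forall in Hb. apply Hb in H. apply andb_true_iff in H as [H _]. apply Nat.ltb_lt in H. lia.
 - rewrite forallb_forall in Hb. apply Hb in H. apply andb_true_iff in H as [_ H]. apply Nat.leb_le in H. lia.
 - apply Rleb_true. assumption.
Qed.

Lemma deep_facts h : valid h -> length h = (m * t)%nat -> forall C, In C (deep (sg ts h)) ->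
 C <> [] /\ (forall u, In u C -> (ts < u <= t)%nat) /\ INR (length C) <= 2 * m ^ k /\ clean ts om C (sg ts h) /\
 lvl ts om (hd 0%nat C) = k /\ NoDup C.
Proof.
 intros Hv Hl C HC. apply filter_In in HC as [HC Hk]. apply Nat.eqb_eq in Hk.
 destruct (Inv_alive ts om h (S k * om) Hv) as [Hnd Hok].
 rewrite firstn_all2 in Hok by (unfold sg; rewrite length_map; lia). destruct (Hok C HC) as (H1 & H2 & H3 & H4).
 split; [assumption|]. split; [intros u Hu; apply H2 in Hu; lia|]. split; [|split; [assumption|split; [assumption|]]].
 - rewrite Hk in H3. assert (Hx : (length C <= 2 * m ^ k)%nat) by lia. apply le_INR in Hx. rewrite mult_INR, pow_INR in Hx. pos.
 - apply in_split in HC as (a & b & HC). rewrite HC, concat_app in Hnd. apply NoDup_app_remove_l in Hnd.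
  eapply NoDup_app_remove_r. pos.
Qed.

Definition big_degree (h : history) : bool := existsb (fun u => Rltb De (INR (degree h u))) (seq (ts + 1) (S k * om)).

Lemma okg_fail h : valid h -> length h = (m * t)%nat ->
 b2R (negb (okg (sg ts h))) <= b2R (Rltb (cn ts om k (S k * om) h) 2) + b2R (big_degree h).
Proof.
 intros Hv Hl. pose proof (b2R_range (Rltb (cn ts om k (S k * om) h) 2)). pose proof (b2R_range (big_degree h)).
 destruct (okg (sg ts h)) eqn:Eo; [change (b2R (negb true)) with 0; lra|]. change (b2R (negb false)) with 1.
 destruct (Rltb (cn ts om k (S k * om) h) 2) eqn:Ec; [change (b2R true) with 1; lra|].
 destruct (big_degree h) eqn:Eb; [change (b2R true) with 1; lra|]. exfalso.
 apply Rltb_false in Ec.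
 assert (H2 : (2 <= length (deep (sg ts h)))%nat) by (apply INR_le; exact Ec).
 assert (Hlv : forall j, (j < 2)%nat -> lv_ok j (sg ts h) = true).
 { intros j Hj. destruct (deep_facts h Hv Hl (nth j (deep (sg ts h)) [])) as (F1 & F2 & F3 & _ & _ & F6); [apply nth_In; lia|].
  unfold lv_ok, lv. rewrite !andb_true_iff. repeat split.
  - apply NoDupb_true, NoDup_filter. assumption.
  - apply forallb_forall. intros x Hx. apply leaves_In in Hx as [Hx _]. apply F2 in Hx. apply andb_true_iff. rewrite Nat.ltb_lt, Nat.leb_le. lia.
  - apply Rleb_true. eapply Rle_trans; [|exact F3]. apply le_INR. apply filter_length_le. }
 unfold okg in Eo. rewrite (proj2 (Nat.leb_le _ _) H2), !Hlv in Eo by lia.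
 apply not_true_iff_false in Eo. apply Eo. apply forallb_forall. intros x Hx. apply Rleb_true.
 assert (Hxb := Hx). apply in_seq in Hxb.
 apply Rle_trans with (INR (degree (sg ts h) x)).
 - rewrite <- sumL_filter. apply adj_degree. pos.
 - rewrite degree_sg by lia. apply Rnot_lt_le. intros Hlt. apply Rltb_true in Hlt.
  assert (big_degree h = true) by (apply existsb_exists; eauto). pos.
Qed.

(** A young vertex is completed with degree at most [2 * m <= Ld], and from then on time does not
    even double. *)
Lemma big_degree_prob : E (m * t) [] (fun h => b2R (big_degree h)) <= t * exp (- Ld).
Proof.
 apply Rle_trans with (sumL (fun u => E (m * t) [] (fun h => b2R (degree_jump ts t u Ld h))) (seq (ts + 1) (S k * om))).
 - rewrite <- E_sumL. apply E_le; [pos|]. intros h Hv Hl. simpl app.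
  eapply Rle_trans; [apply b2R_existsb_le|]. apply sumL_le. intros u Hu. apply in_seq in Hu.
  destruct (Rltb De (INR (degree h u))) eqn:Ed; [|apply b2R_range]. apply Rltb_true in Ed.
  replace (degree_jump ts t u Ld h) with true; [lra|]. symmetry. apply andb_true_iff. split; apply Rleb_true.
  + rewrite Nat.max_r by lia.
   assert ((m * u <= length h)%nat) by (rewrite Hl; apply Nat.mul_le_mono_l; lia).
   pose proof (degree_le (firstn (m * u) h) u (valid_firstn _ _ Hv) ltac:(lia)) as Hd. rewrite firstn_length_le in Hd by assumption.
   assert (Hd' : (degree (firstn (m * u) h) u <= 2 * m)%nat) by nia. apply le_INR in Hd'. rewrite mult_INR in Hd'. simpl (INR 2) in Hd'. lra.
  + rewrite <- Hl, firstn_all. lra.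
 - apply Rle_trans with (sumL (fun _ : nat => exp (- Ld)) (seq (ts + 1) (S k * om))).
  + apply sumL_le. intros u Hu. apply in_seq in Hu. apply degree_jump_prob; lia.
  + rewrite sumL_const, length_seq, Rmult_comm. pos.
Qed.

Variable lam : nat -> R.
Variables theta eta s La : R.
Hypothesis Htheta : theta = 1 - gam - eta.
Hypothesis Hth0 : 0 < theta.
Hypothesis Heta : 0 < eta.
Hypothesis Hs0 : 0 <= s.
Hypothesis HLa1 : C0 * (1 + ln (INR t)) + 2 * De <= La.
Hypothesis HLa2 : C0 * (1 + / (2 * gam - 1)) <= La.
Hypothesis HsLa : 2 * La <= exp s.
Hypothesis Hlam0 : forall n, ln 2 <= lam n.
Hypothesis Hlam1 : forall n, s <= theta * (lam (S n) - lam n).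
Hypothesis Hlam2 : forall n, (theta + (2 * gam - 1)) * lam n + 2 * s <= theta * lam (S (S n)).
Hypothesis HN : 2 * (2 * INR m ^ k) * C0 <= exp (theta * lam 1%nat).

(** If the roots of two deep clusters were within [2 * k + 2 * K] steps, [cluster_path] would leave
    at most [2 * K] edges between their leaves, and one of the three path events would occur. *)
Theorem all_close_prob :
 E (m * t) [] (fun h => b2R (all_close t (2 * k + 2 * K) h)) <=
  E (m * t) [] (fun h => b2R (Rltb (cn ts om k (S k * om) h) 2)) + t * exp (- Ld)
  + 2 * sumL (fun j => / (1 - gam) * exp (- (eta * lam j))) (seq 1 K)
  + K * K * (4 * exp (4 * lam (S K) - ln t)).
Proof.
 assert (Hts' : (1 <= ts <= t)%nat) by lia. pose proof INRm_ge2.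
 assert (0 <= De) by lra.
 assert (forall g, okg g = true -> forall x, (ts < x <= t)%nat ->
  sumL (fun v => if Nat.ltb ts v then b2R (adj g x v) else 0) (seq 1 t) <= De).
 { intros g Hg x Hx. unfold okg in Hg. rewrite !andb_true_iff in Hg. rewrite forallb_forall in Hg.
  apply Rleb_true, Hg. pos. }
 set (b1 := bad_path ts t lam K okg (lv 0)). set (b2 := bad_path ts t lam K okg (lv 1)). set (gd := good_path ts t lam K okg (lv 0) (lv 1)).
 assert (HB : forall j, (j < 2)%nat -> E (m * t) [] (fun h => b2R (bad_path ts t lam K okg (lv j) h)) <= sumL (fun j => / (1 - gam) * exp (- (eta * lam j))) (seq 1 K)).
 { intros j Hj. apply (bad_path_prob ts t Hts' Ht2 lam theta eta s La De (2 * m ^ k) K okg); try assumption. apply lv_leafy; assumption. }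
 assert (E (m * t) [] (fun h => b2R (gd h)) <= K * K * (4 * exp (4 * lam (S K) - ln t))).
 { apply (good_path_prob ts t Hts' Ht2 lam theta eta s La De (2 * m ^ k) K okg); try assumption; apply lv_leafy; lia. }
 pose proof (HB 0%nat ltac:(lia)) as HB1. pose proof (HB 1%nat ltac:(lia)) as HB2. fold b1 in HB1. fold b2 in HB2.
 pose proof big_degree_prob.
 apply Rle_trans with (E (m * t) [] (fun h => b2R (Rltb (cn ts om k (S k * om) h) 2) + b2R (big_degree h) + (b2R (b1 h) + b2R (b2 h) + b2R (gd h)))).
 2: { rewrite !E_plus. lra. }
 apply E_le; [pos|]. intros h Hv Hl. simpl app.
 pose proof (okg_fail h Hv Hl) as Hf.
 pose proof (b2R_range (Rltb (cn ts om k (S k * om) h) 2)). pose proof (b2R_range (big_degree h)).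
 pose proof (b2R_range (b1 h)). pose proof (b2R_range (b2 h)). pose proof (b2R_range (gd h)).
 destruct (all_close t (2 * k + 2 * K) h) eqn:Ea; [|change (b2R false) with 0; lra]. change (b2R true) with 1.
 destruct (okg (sg ts h)) eqn:Eo; [|change (b2R (negb false)) with 1 in Hf; lra].
 assert (Hev : b1 h || b2 h || gd h = true).
 2: { apply orb_true_iff in Hev as [Hev|Hev]; [apply orb_true_iff in Hev as [Hev|Hev]|];
    (assert (Hone : 1 = b2R true) by reflexivity; rewrite <- Hev in Hone; lra). }
 assert (Hd2 : (2 <= length (deep (sg ts h)))%nat).
 { unfold okg in Eo. rewrite !andb_true_iff in Eo. destruct Eo as [[[Eo _] _] _]. apply Nat.leb_le. assumption. }
 destruct (deep (sg ts h)) as [|D [|C rest]] eqn:Ed; [simpl in Hd2; lia|simpl in Hd2; lia|].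
 destruct (deep_facts h Hv Hl C) as (C1 & C2 & _ & C4 & C5 & _); [rewrite Ed; right; left; reflexivity|].
 destruct (deep_facts h Hv Hl D) as (D1 & D2 & _ & D4 & D5 & _); [rewrite Ed; left; reflexivity|].
 assert (forall x, In x C -> ~ In x D).
 { intros x HxC HxD. destruct (Inv_alive ts om h (S k * om) Hv) as [Hnd _].
  apply (NoDup_concat_filter (fun C => Nat.eqb (lvl ts om (hd 0%nat C)) k)) in Hnd. fold (layer ts om k (alive ts om (S k * om) (sg ts h))) in Hnd.
  fold (deep (sg ts h)) in Hnd. rewrite Ed in Hnd. simpl in Hnd.
  destruct (in_split _ _ HxD) as (p & q & ->). rewrite <- app_assoc in Hnd.
  apply NoDup_remove_2 in Hnd. apply Hnd. apply in_or_app. right. apply in_or_app. right. apply in_or_app. pos. }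
 assert (near h (2 * k + 2 * K) (hd 0%nat D) (hd 0%nat C)).
 { apply (reach_near h t). unfold all_close in Ea. rewrite forallb_forall in Ea.
  pose proof (C2 _ (hd_In C C1)). pose proof (D2 _ (hd_In D D1)).
  specialize (Ea (hd 0%nat D) ltac:(apply in_seq; lia)). rewrite forallb_forall in Ea. apply Ea. pos. }
 destruct (cluster_path ts om h (2 * k + 2 * K) k C D) as (q & r & r' & x0 & x1 & y0 & y1 & Q1 & Q2 & Q3 & Q4 & Q5 & Q6 & Q7 & Q8 & Q9 & Q10); try assumption.
 { intros x [Hx|Hx]; [apply C2 in Hx|apply D2 in Hx]; lia. }
 apply (short_path_event ts t Hts' Ht2 lam theta s K okg Hth0 Hs0 Hlam1 (lv 0) (lv 1) h q r r' x0 x1 y0 y1); try assumption.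
 - unfold lv. rewrite Ed. pos.
 - unfold lv. rewrite Ed. pos.
 - intros x Hx.
  (* A vertex of the path has an incident edge, which confines it to [1..t]. *)
  assert (Hadj : exists y, adj h x y = true).
  { apply in_split in Hx as (a & b & Hab). rewrite Hab in Q8. destruct b as [|y b].
   - destruct (exists_last (l := a)) as (a' & y & Ha').
    { intros ->. rewrite Hab in Q9. simpl in Q9. lia. }
    rewrite Ha', <- app_assoc in Q8. apply walkb_app in Q8. change (adj h y x && true = true) in Q8.
    rewrite andb_true_r, adj_sym in Q8. eauto.
   - apply walkb_app in Q8. apply andb_true_iff in Q8 as [Q8 _]. eauto. }
  destruct Hadj as (y & Hadj). apply adj_cases in Hadj as [Hadj|Hadj];
   pose proof (valid_In_vertex h t _ Hv ltac:(lia) Hadj) as Hb; simpl in Hb; lia.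
 - lia.
Qed.

End Core.

(** * Lower bound: existence of deep clusters *)

Section LowerAsymptotics.
Context {P : PAmodel}.

Lemma Rv_lower ts om k x T : (1 <= om)%nat -> (1 <= ts)%nat -> INR (ts + S k * om) = T -> 0 < x -> T / (2 * x ^ 3) <= om -> T / 2 <= ts ->
 32 <= ((m + delta) / (6 * m)) ^ m * x ->
 forall i, T * exp (- (4 * ln x * (2 * m ^ i - 1))) <= Rv ts om k i.
Proof.
 intros Hom Hts HT Hx Hom2 Hts2 H32. pose proof INRm_ge2. pose proof md_pos. pose proof Hd2. pose proof chi_range.
 set (c1 := (INR m + delta) / (6 * INR m)) in *.
 assert (0 < c1) by (apply Rdiv_lt_0_compat; lra).
 assert (1 <= T) by (rewrite <- HT; apply (le_INR 1); lia).
 assert (0 < Cmax ts om k <= 3 * m * T).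
 { split; [apply cc_pos|]. unfold Cmax, cc. rewrite mult_INR, HT.
  assert (m * T * (2 + chi) <= m * T * 2) by pos. assert (1 <= m * T) by nra. lra. }
 assert (Hstep : forall q a, 0 <= a -> c1 * a <= q -> a ^ m * (T * exp (- (4 * ln x))) <= q ^ m * om / 16).
 { intros q a Ha Hq. assert (Hqm : (c1 * a) ^ m <= q ^ m) by pos.
  rewrite Rpow_mult_distr in Hqm.
  apply Rle_trans with (c1 ^ m * a ^ m * (T / (2 * x ^ 3)) / 16).
  - replace (exp (- (4 * ln x))) with (/ x ^ 4).
   + apply Rmult_le_reg_r with (32 * x ^ 4); [pos|].
    replace (a ^ m * (T * / x ^ 4) * (32 * x ^ 4)) with (a ^ m * T * 32) by pos.
    replace (c1 ^ m * a ^ m * (T / (2 * x ^ 3)) / 16 * (32 * x ^ 4)) with (a ^ m * T * (c1 ^ m * x)) by pos.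
    pos.
   + rewrite exp_Ropp. f_equal. rewrite <- (exp_ln x) at 1 by assumption. rewrite exp_pow_nat. simpl (INR 4). f_equal. ring.
  - pos. }
 induction i; cbn [Rv].
 - eapply Rle_trans; [|apply (Hstep _ 1); [lra|]].
  + rewrite pow1, Rmult_1_l. pos.
  + rewrite Rmult_1_r. apply Rle_trans with (1 / 6).
   * apply Rdiv_le_swap; lra.
   * apply Rle_div_swap; [lra|]. apply Rle_trans with (T / 2 * m); [lra|]. pos.
 - set (a := exp (- (4 * ln x * (2 * INR m ^ i - 1)))) in *.
  assert (Ha : 0 < a) by apply exp_pos.
  apply Rle_trans with (a ^ m * (T * exp (- (4 * ln x)))).
  + unfold a. rewrite exp_pow_nat. rewrite (Rmult_comm T (exp (- (4 * ln x)))), <- Rmult_assoc, <- exp_plus, (Rmult_comm T).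
   apply Rmult_le_compat_r; [lra|]. apply exp_mono. simpl pow.
   assert (0 <= ln x).
   { rewrite <- ln_1. apply ln_mono; [lra|]. assert (c1 <= 1) by (unfold c1; apply Rdiv_le_swap; lra).
    assert (c1 ^ m <= 1) by (rewrite <- (pow1 m); apply pow_incr; lra).
    assert (c1 ^ m * x <= 1 * x) by pos. lra. }
   assert (0 <= 4 * ln x * (m - 2)) by pos. lra.
  + apply Hstep; [lra|]. apply Rle_div_swap; [lra|].
   apply Rle_trans with (T * a / 2 * (m + delta)); [|pos].
   apply Rle_trans with (c1 * a * (3 * m * T)); [pos|].
   right. unfold c1. pos.
Qed.

(** The density at depth [k] is [exp (- O(ln x * m^k))]. The bound [m^k <= x^(1 - e1)] keeps this
    above [exp (- x / 2)], so many clusters remain among [t = exp x] vertices. *)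
Lemma clusters_whp (e1 epsp : R) : 0 < e1 -> 0 < epsp ->
 ev (fun x => forall t k, (1 <= t)%nat -> ln t = x -> INR (S k) <= x -> m ^ k <= exp ((1 - e1) * ln x) ->
  exists om ts, (1 <= om)%nat /\ (1 <= ts)%nat /\ t = (ts + S k * om)%nat /\ (t <= 2 * ts)%nat /\
   E (m * t) [] (fun h => b2R (Rltb (cn ts om k (S k * om) h) 2)) <= epsp).
Proof.
 intros He1 Hep. pose proof INRm_ge2 as Hm2. pose proof md_pos as Hmd. pose proof chi_range as Hchi.
 set (c1 := (INR m + delta) / (6 * INR m)). assert (Hc1 : 0 < c1 ^ m) by (apply pow_lt, Rdiv_lt_0_compat; lra).
 pose proof (exp_pos m) as Hem.
 generalize (ev_and _ _ (ev_comp_ln _ (ev_lin_exp e1 16 He1)) (ev_and _ _ (ev_pow_exp 3 1 2 ltac:(lra))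
  (ev_and _ _ (ev_lin_exp (1/2) 3 ltac:(lra)) (ev_and _ _ (ev_exp_small 1 (epsp / (4 * exp m)) ltac:(lra) ltac:(apply Rdiv_lt_0_compat; lra))
  (ev_ge (2 + 2 * m + 4 * exp m * m ^ 2 + 32 / c1 ^ m + 32 * m / epsp)))))).
 apply ev_mono. intros x (H1 & H2 & H3 & H4 & H5) t k Ht Hlt Hk Hmk.
 assert (P1 : 0 < 4 * exp m * m ^ 2) by pos.
 assert (P2 : 0 < 32 / c1 ^ m) by pos.
 assert (P3 : 0 < 32 * m / epsp) by pos.
 rewrite Rmult_1_l in H2, H4.
 assert (HT0 : 0 < t) by pos. assert (HT : INR t = exp x) by (rewrite <- Hlt, exp_ln; pos).
 set (T := INR t) in *. assert (Hx3 : 0 < x ^ 3) by pos.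
 assert (Hq2 : 2 <= T / x ^ 3) by pos.
 (* Windows of width [t / x^3] are so narrow that at most [x] of them occupy [t / x^2] vertices and
    existing clusters are rarely touched, yet cost only a power of [x] in the number of clusters. *)
 destruct (nfloor_spec (T / x ^ 3) ltac:(lra)) as [Ho1 Ho2]. set (om := nfloor (T / x ^ 3)) in *.
 assert (Hom : (1 <= om)%nat) by (apply INR_le; simpl (INR 1); lra).
 assert (Hko : INR (S k) * om <= T / x ^ 2).
 { apply Rle_trans with (x * (T / x ^ 3)); [pos|]. right. pos. }
 assert (Hx2 : T / x ^ 2 <= T / 2).
 { apply Rmult_le_compat_l; [lra|]. apply Rinv_le_contravar; [lra|]. nra. }
 assert (Hkt : (S k * om <= t)%nat) by (apply INR_le; rewrite mult_INR; fold T; lra).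
 set (ts := (t - S k * om)%nat). assert (Htt : t = (ts + S k * om)%nat) by pos.
 assert (HtsR : INR ts = T - INR (S k) * om) by (unfold ts; rewrite minus_INR, mult_INR by assumption; reflexivity).
 assert (Hts1 : (1 <= ts)%nat) by (apply INR_lt; simpl (INR 0); lra).
 exists om, ts. split; [assumption|]. split; [assumption|]. split; [assumption|]. split.
 { apply INR_le. rewrite mult_INR. simpl (INR 2). fold T. lra. }
 assert (Hcc : T <= cc (m * ts)).
 { unfold cc. rewrite mult_INR.
  assert (2 * ts <= m * ts) by pos.
  assert (m * ts * 1 <= m * ts * (2 + chi)) by pos. lra. }
 assert (Hmx : m ^ k <= x).
 { eapply Rle_trans; [exact Hmk|]. rewrite <- (exp_ln x) at 2 by lra. apply exp_mono.
  assert (0 <= ln x) by (rewrite <- ln_1; apply ln_mono; lra). assert (0 <= e1 * ln x) by pos. lra. }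
 assert (HmoT : INR (m * om) / cc (m * ts) <= m / x ^ 3).
 { apply Rle_trans with (INR (m * om) / T).
  - apply Rmult_le_compat_l; [pos|]. pos.
  - rewrite mult_INR. apply Rdiv_le_swap; [assumption|]. replace (m / x ^ 3 * T) with (m * (T / x ^ 3)) by pos.
   pos. }
 assert (Hx3x : x * 4 <= x ^ 3) by (simpl; nra).
 assert (HRl : forall i, (i <= k)%nat -> exp (x / 2) <= Rv ts om k i).
 { intros i Hi. eapply Rle_trans; [|apply (Rv_lower ts om k x T); try assumption; try lra].
  - rewrite HT, <- exp_plus. apply exp_mono.
   assert (m ^ i <= m ^ k) by (apply Rle_pow; pos).
   assert (0 <= ln x) by (rewrite <- ln_1; apply ln_mono; lra).
   assert (16 * ln x * m ^ k <= x).
   { apply Rle_trans with (exp (e1 * ln x) * exp ((1 - e1) * ln x)).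
    - pos.
    - rewrite <- exp_plus. replace (e1 * ln x + (1 - e1) * ln x) with (ln x) by ring. rewrite exp_ln; lra. }
   assert (ln x * m ^ i <= ln x * m ^ k) by pos. lra.
  - rewrite <- Htt. pos.
  - replace (T / (2 * x ^ 3)) with (T / x ^ 3 / 2) by pos. lra.
  - assert (32 / c1 ^ m <= x) by lra. apply (Rmult_le_compat_l (c1 ^ m)) in H; [|lra].
   replace (c1 ^ m * (32 / c1 ^ m)) with 32 in H by pos. pos. }
 rewrite Htt.
 apply Rle_trans with (E (m * (ts + S k * om)) [] (fun h => b2R (Rltb (cn ts om k (S k * om) h) (Rv ts om k k)))).
 { apply E_le; [pos|]. intros h _ _. simpl app. destruct (Rltb (cn ts om k (S k * om) h) 2) eqn:Ec; [|apply b2R_range].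
  apply Rltb_true in Ec. replace (Rltb (cn ts om k (S k * om) h) (Rv ts om k k)) with true; [lra|]. symmetry. apply Rltb_true.
  specialize (HRl k (le_n _)). pose proof (exp_ge1 (x / 2)). lra. }
 eapply Rle_trans; [apply (levels_prob ts om k Hom Hts1) with (Rl := exp (x / 2)); try assumption; try lia|].
 - eapply Rle_trans; [exact HmoT|]. pos.
 - rewrite pow_add. apply Rle_trans with (exp m * (T / x ^ 3) * (x * m ^ 2)).
  +
   pos.
  + apply Rle_trans with (T / 4); [|lra]. replace (exp m * (T / x ^ 3) * (x * m ^ 2)) with (T * (exp m * m ^ 2 / x ^ 2)) by pos.
   apply Rmult_le_compat_l; [lra|]. apply Rdiv_le_swap; [pos|]. nra.
 -
  assert (INR (S k) * errA ts om k <= epsp / 2).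
  { assert (0 <= INR (m * om) / cc (m * ts)) by pos.
   apply Rle_trans with (x * (16 * x * (m / x ^ 3))).
   - apply Rmult_le_compat; [pos|apply errA_nonneg|assumption|].
    apply Rmult_le_compat; pos.
   - replace (x * (16 * x * (m / x ^ 3))) with (16 * m / x) by pos. apply Rdiv_le_swap; [lra|].
    assert (Hz : 32 * m / epsp <= x) by lra. apply (Rmult_le_compat_l epsp) in Hz; [|lra].
    replace (epsp * (32 * m / epsp)) with (32 * m) in Hz by pos. lra. }
  assert (INR (S k) * errB om (exp (x / 2)) <= epsp / 2).
  { assert (om <= T).
   { apply Rle_trans with (T / x ^ 3); [assumption|].
    rewrite <- (Rmult_1_r T) at 1. pos. }
   pose proof (exp_ge1 m).
   assert (1 + om * exp m <= 2 * exp m * T).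
   { assert (1 * 1 <= om * exp m) by pos.
    assert (om * exp m <= T * exp m) by pos. lra. }
   apply Rle_trans with (exp x * (2 * exp m * exp x * exp (- (3 * x)))).
   - apply Rmult_le_compat; [pos|apply errB_nonneg|pos|]. rewrite <- HT.
    assert (0 <= om * exp m) by pos.
    apply Rmult_le_compat; [lra|pos|assumption|]. apply exp_mono. replace (1 / 2 * x) with (x / 2) in H3 by field. lra.
   - replace (exp x * (2 * exp m * exp x * exp (- (3 * x)))) with (2 * exp m * (exp x * exp x * exp (- (3 * x)))) by ring.
    rewrite <- !exp_plus. replace (x + x + - (3 * x)) with (- x) by ring.
    apply (Rmult_le_compat_l (2 * exp m)) in H4; [|lra].
    replace (2 * exp m * (epsp / (4 * exp m))) with (epsp / 2) in H4 by pos. pos. }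
  lra.
Qed.

End LowerAsymptotics.

(** * Lower bound: choice of the constants *)

Section LowerBound.
Context {P : PAmodel}.

(* [e^sg] is the excess of the growth rate [A] of the truncation exponents over [kappa^(-1/2)]. *)
Lemma growth_rate (ll sg A : R) : ll = - ln kappa / 2 -> 0 < sg -> A = exp (ll + sg) -> exists eta s1,
 0 < eta /\ 0 < s1 /\ 0 < 1 - gam - eta /\ (1 - gam - eta) + (2 * gam - 1) + s1 <= (1 - gam - eta) * (A * A).
Proof.
 intros Hll Hsg HA. pose proof gam_range. pose proof kappa_range. pose proof kappa_gam as Hkg.
 assert (HAA : A * A = exp (2 * sg) / kappa).
 { rewrite HA, <- exp_plus, Hll. replace (- ln kappa / 2 + sg + (- ln kappa / 2 + sg)) with (2 * sg + - ln kappa) by field.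
  rewrite exp_plus, exp_Ropp, exp_ln by lra. pos. }
 assert (1 < exp (2 * sg)) by (rewrite <- exp_0; apply exp_increasing; lra).
 set (q := exp (2 * sg)) in *. set (s1 := gam * (q - 1) / 2).
 assert (0 < s1) by (unfold s1; assert (0 < gam * (q - 1)) by pos; lra).
 set (eta := Rmin ((1 - gam) / 2) (s1 * kappa / q)).
 assert (0 < s1 * kappa / q) by pos.
 assert (0 < eta) by (unfold eta; apply Rmin_glb_lt; lra).
 assert (eta <= (1 - gam) / 2) by apply Rmin_l. assert (eta <= s1 * kappa / q) by apply Rmin_r.
 exists eta, s1. rewrite HAA.
 assert (eta * (q / kappa) <= s1).
 { apply Rle_trans with (s1 * kappa / q * (q / kappa)).
  - pos.
  - right. pos. }
 assert ((1 - gam) * (q / kappa) = gam * q) by (rewrite <- Hkg; field; lra).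
 unfold s1 in *. lra.
Qed.

Theorem lower_whp (e epsp : R) : 0 < e -> 0 < epsp ->
 ev (fun x => forall t, (1 <= t)%nat -> ln (INR t) = x -> exists D,
   (2 / ln (INR m) + 4 / (- ln kappa) - e) * ln x <= INR D /\
   E (m * t) [] (fun h => b2R (all_close t D h)) <= epsp).
Proof.
 intros He Hep. pose proof INRm_ge2 as Hm2. pose proof gam_range as Hgam. pose proof kappa_range as Hkap. pose proof lnm_pos as Hlnm.
 pose proof C0_pos as HC0.
 set (ll := - ln kappa / 2).
 assert (Hll : 0 < ll).
 { unfold ll. assert (ln kappa < ln 1) by (apply ln_increasing; lra). rewrite ln_1 in H. lra. }
 assert (Hlld : ll = - ln kappa / 2) by reflexivity.
 (* Small enough that [2 / (ll + sg) >= 2 / ll - e / 8]. *)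
 set (sg := e * ll * ll / 16). assert (Hsg : 0 < sg) by (unfold sg; assert (0 < e * ll * ll) by pos; lra).
 set (A := exp (ll + sg)). destruct (growth_rate ll sg A Hlld Hsg eq_refl) as (eta & s1 & Heta & Hs1 & Hth & HAA).
 set (theta := 1 - gam - eta) in *.
 assert (HA1 : 1 < A) by (unfold A; rewrite <- exp_0; apply exp_increasing; lra).
 set (e1 := Rmin (1/2) (e * ln (INR m) / 16)). set (e2 := Rmin (1/4) (e * ll / 32)).
 assert (Hq1 : 0 < e * ln m) by pos. assert (Hq2 : 0 < e * ll) by pos.
 assert (He1 : 0 < e1) by (unfold e1; apply Rmin_glb_lt; lra). assert (He2 : 0 < e2) by (unfold e2; apply Rmin_glb_lt; lra).
 assert (He1a : e1 <= 1/2) by apply Rmin_l. assert (He1b : e1 <= e * ln m / 16) by apply Rmin_r.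
 assert (He2a : e2 <= 1/4) by apply Rmin_l. assert (He2b : e2 <= e * ll / 32) by apply Rmin_r.
 set (a2 := / (2 * gam - 1)). assert (Ha2 : 0 < a2) by (unfold a2; apply Rinv_0_lt_compat; lra).
 set (CL := C0 * (2 + a2) + 2048 * (2 + 2 * INR m)).
 set (M1 := 4 / s1 + 2 / (theta * (A - 1)) + (2 + Rabs (ln (4 * C0))) / theta + 1 + 3 / eta + 8 * A).
 assert (Hg1 : 0 < theta * (A - 1)) by pos.
 assert (Hd1 : 0 < 4 / s1) by pos. assert (Hd2' : 0 < 2 / (theta * (A - 1))) by pos.
 assert (Hd3 : 0 < (2 + Rabs (ln (4 * C0))) / theta) by (apply Rdiv_lt_0_compat; [pose proof (Rabs_pos (ln (4 * C0)))|]; lra).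
 assert (Hd4 : 0 < 3 / eta) by pos.
 set (lA := ll + sg) in *. assert (HlA : 0 < lA) by (unfold lA; lra).
 set (cK := epsp * (1 - gam) * lA / 8). assert (HcK : 0 < cK) by (unfold cK; assert (0 < epsp * (1 - gam) * lA) by pos; lra).
 generalize (ev_and _ _ (clusters_whp e1 (epsp / 4) He1 ltac:(lra))
  (ev_and _ _ (ev_comp_ln _ (ev_and _ _ (ev_lin_exp e2 M1 He2) (ev_and _ _ (ev_ge_exp 1 (2 * CL + 1 / ln m + 2 + 1 / lA) ltac:(lra))
    (ev_and _ _ (ev_exp_small 1 cK ltac:(lra) HcK) (ev_and _ _ (ev_ge (8 / e + 1)) (ev_lin_exp 1 (1 / ln m + 2 + 1 / lA) ltac:(lra)))))))
  (ev_and _ _ (ev_exp_small 1 (epsp / 8) ltac:(lra) ltac:(lra)) (ev_and _ _ (ev_pow_exp 2 (1/2) (32 / epsp) ltac:(lra)) (ev_ge 3))))).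
 apply ev_mono. intros x (Hcl & (V1 & V2 & V3 & V4 & V5) & W1 & W2 & W3) t Ht Hlt. rewrite Rmult_1_l in *.
 set (y := ln x) in *. assert (Hxy : exp y = x) by (unfold y; apply exp_ln; lra).
 assert (H8e : 0 < 8 / e) by pos. assert (Hy1 : 1 <= y) by lra.
 assert (Hil : 0 < 1 / ln m) by pos. assert (HilA : 0 < 1 / lA) by pos.
 assert (HT0 : 0 < t) by pos. assert (HT : INR t = exp x) by (rewrite <- Hlt, exp_ln; pos).
 assert (Hyl : 0 <= (1 - e1) * y / ln m) by pos.
 destruct (nfloor_spec _ Hyl) as [Hk1 Hk2]. set (k := nfloor ((1 - e1) * y / ln (INR m))) in *.
 assert (HyK : 0 <= (1 - 2 * e2) * y / lA) by pos.
 destruct (nfloor_spec _ HyK) as [HK1 HK2]. set (K := nfloor ((1 - 2 * e2) * y / lA)) in *.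
 assert (Hkl : k * ln m <= (1 - e1) * y).
 { apply (Rmult_le_compat_r (ln m)) in Hk1; [|lra]. replace ((1 - e1) * y / ln m * ln m) with ((1 - e1) * y) in Hk1 by pos. assumption. }
 assert (HKl : K * lA <= (1 - 2 * e2) * y).
 { apply (Rmult_le_compat_r lA) in HK1; [|lra]. replace ((1 - 2 * e2) * y / lA * lA) with ((1 - 2 * e2) * y) in HK1 by pos. assumption. }
 assert (HKy : K <= y / lA).
 { apply Rle_div_swap; [lra|]. assert (0 <= e2 * y) by pos. lra. }
 assert (Hmk : m ^ k <= exp ((1 - e1) * y)).
 { rewrite <- (exp_ln m) at 1 by lra. rewrite exp_pow_nat. pos. }
 assert (Hmkx : m ^ k <= exp y).
 { eapply Rle_trans; [exact Hmk|]. apply exp_mono. assert (0 <= e1 * y) by pos. lra. }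
 assert (HSk : INR (S k) <= x).
 { rewrite S_INR. assert (k <= y / ln m).
  { apply Rle_div_swap; [lra|]. assert (0 <= e1 * y) by pos. lra. }
  lra. }
 destruct (Hcl t k Ht Hlt HSk Hmk) as (om & ts & Hom & Hts & Htt & Ht2 & HE).
 exists (2 * k + 2 * K)%nat. split.
 - rewrite plus_INR, !mult_INR. simpl (INR 2).
  assert (2 / ln m * y - e / 8 * y - 2 <= 2 * k).
  { assert (e1 * (y / ln m) <= e / 16 * y).
   { apply Rle_trans with (e * ln m / 16 * (y / ln m)).
    - pos.
    - right. pos. }
   lra. }
  assert (2 / ll * y - e / 4 * y - 2 <= 2 * K).
  { assert (Ha : 2 / ll - e / 8 <= 2 / lA).
   { apply Rle_div_swap; [assumption|]. unfold lA.
    replace ((2 / ll - e / 8) * (ll + sg)) with (2 + (2 / ll * sg - e / 8 * ll) - e / 8 * sg) by pos.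
    replace (2 / ll * sg) with (e * ll / 8) by (unfold sg; field; lra).
    assert (0 <= e / 8 * sg) by pos. lra. }
   apply (Rmult_le_compat_r y) in Ha; [|lra].
   assert (e2 * (y / lA) <= e / 32 * y).
   { apply Rle_trans with (e * ll / 32 * (y / lA)).
    - pos.
    - replace (e * ll / 32 * (y / lA)) with (e / 32 * y * (ll / lA)) by pos.
     rewrite <- (Rmult_1_r (e / 32 * y)) at 2. apply Rmult_le_compat_l; [pos|].
     apply Rdiv_le_swap; unfold lA; lra. }
   lra. }
  replace (4 / - ln kappa) with (2 / ll) by (rewrite Hlld; field; lra).
  assert (8 <= e * y).
  { apply Rle_trans with (e * (8 / e)); [right; field; lra|]. pos. }
  lra.
 - set (B := exp (e2 * y)) in *. set (lam := fun n => B * A ^ n).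
  assert (HB : M1 * y <= B) by exact V1. assert (HM1 : M1 <= B).
  { eapply Rle_trans; [|exact HB]. rewrite <- (Rmult_1_r M1) at 1. apply Rmult_le_compat_l; [unfold M1; lra|assumption]. }
  assert (HB0 : 0 < B) by apply exp_pos.
  assert (HlamB : forall n, B <= lam n) by (intros n; unfold lam; rewrite <- (Rmult_1_r B) at 1; apply Rmult_le_compat_l; pos).
  (* [Ld] beats the union bound over [t = exp x] vertices, and [exp s = x^2] beats [La], which is
     linear in [x]. *)
  set (Ld := 2 * x + 2 * INR m). set (s := 2 * y).
  assert (Hscale : forall c d, 0 < d -> c / d <= M1 -> c * y <= d * B).
  { intros c d Hd Hcd. apply Rle_trans with (d * (M1 * y)); [|pos].
   apply (Rmult_le_compat_l d) in Hcd; [|lra]. replace (d * (c / d)) with c in Hcd by pos.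
   apply (Rmult_le_compat_r y) in Hcd; [|lra]. lra. }
  assert (L1 : 4 * y <= s1 * B) by (apply Hscale; [assumption|unfold M1; lra]).
  assert (L2 : 2 * y <= theta * (A - 1) * B) by (apply Hscale; [assumption|unfold M1; lra]).
  assert (L3 : (2 + Rabs (ln (4 * C0))) * y <= theta * B) by (apply Hscale; [assumption|unfold M1; lra]).
  assert (L4 : 3 * y <= eta * B) by (apply Hscale; [assumption|unfold M1; lra]).
  assert (H8A : 8 * A <= B) by (eapply Rle_trans; [|exact HM1]; unfold M1; lra).
  subst t. set (t := (ts + S k * om)%nat) in *.
  eapply Rle_trans; [apply (all_close_prob ts om k K Hom Hts Ht2 Ld) with (lam := lam) (theta := theta) (eta := eta) (s := s) (La := CL * x)|].
  + unfold Ld. lra.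
  + pos.
  + pos.
  + pos.
  + unfold s. lra.
  + fold t. rewrite Hlt. unfold Ld, CL. assert (m <= m * x) by (rewrite <- (Rmult_1_r m) at 1; apply Rmult_le_compat_l; lra).
   assert (C0 <= C0 * x) by (rewrite <- (Rmult_1_r C0) at 1; apply Rmult_le_compat_l; lra).
   assert (0 <= C0 * a2 * x) by pos. lra.
  + fold a2. unfold CL. assert (C0 * (1 + a2) <= C0 * (1 + a2) * x) by (rewrite <- (Rmult_1_r (C0 * (1 + a2))) at 1; apply Rmult_le_compat_l; pos; lra).
   assert (0 <= C0 * x) by pos. assert (0 <= 2048 * (2 + 2 * m) * x) by pos. lra.
  + unfold s. replace (2 * y) with (y + y) by ring. rewrite exp_plus, Hxy.
   assert (2 * CL * x <= x * x) by pos. lra.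
  + intros n. apply Rle_trans with B; [|pos]. pose proof (ln_le_sub1 2 ltac:(lra)). lra.
  + intros n. unfold s, lam. simpl pow. apply Rle_trans with (theta * (A - 1) * B * 1); [lra|].
   replace (theta * (B * (A * A ^ n) - B * A ^ n)) with (theta * (A - 1) * B * A ^ n) by ring.
   pos.
  + intros n. assert (0 <= lam n) by (pose proof (HlamB n); lra).
   replace (theta * lam (S (S n))) with (theta * (A * A) * lam n) by (unfold lam; simpl; ring).
   apply (Rmult_le_compat_r (lam n)) in HAA; [|assumption].
   assert (s1 * B <= s1 * lam n) by pos. unfold s. lra.
  + apply Rle_trans with (exp (y + ln (4 * C0))).
   * rewrite exp_plus, (exp_ln (4 * C0)) by lra. replace (2 * (2 * m ^ k) * C0) with (m ^ k * (4 * C0)) by ring.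
    pos.
   * apply exp_mono. apply Rle_trans with (theta * B); [|pos].
    pose proof (Rle_abs (ln (4 * C0))).
    assert (Rabs (ln (4 * C0)) * 1 <= Rabs (ln (4 * C0)) * y) by pos. lra.
  + fold t. rewrite Hlt.
   assert (T1 : t * exp (- Ld) <= epsp / 8).
   { rewrite HT, <- exp_plus. eapply Rle_trans; [|exact W1]. apply exp_mono. unfold Ld. lra. }
   assert (T2 : sumL (fun j => / (1 - gam) * exp (- (eta * lam j))) (seq 1 K) <= epsp / 8).
   { apply Rle_trans with (sumL (fun _ : nat => / (1 - gam) * exp (- (3 * y))) (seq 1 K)).
    - apply sumL_le. intros j _. apply Rmult_le_compat_l; [pos|]. apply exp_mono.
     assert (eta * B <= eta * lam j) by pos. lra.
    - rewrite sumL_const, length_seq.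
     apply Rle_trans with (/ (1 - gam) * exp (- (3 * y)) * (exp y / lA)).
     + apply Rmult_le_compat_l; [pos|].
      eapply Rle_trans; [exact HKy|]. apply Rmult_le_compat_r; [pos|]. pose proof (exp_ge1 y). lra.
     + replace (/ (1 - gam) * exp (- (3 * y)) * (exp y / lA)) with (exp (- (3 * y)) * exp y * / ((1 - gam) * lA)) by pos.
      rewrite <- exp_plus. apply Rdiv_le_swap; [pos|].
      apply Rle_trans with cK; [|unfold cK; right; field]. eapply Rle_trans; [|exact V3]. pos. }
   assert (K * K * (4 * exp (4 * lam (S K) - x)) <= epsp / 8).
   { assert (4 * lam (S K) <= x / 2).
    { assert (HAK : A ^ K <= exp ((1 - 2 * e2) * y)).
     { unfold A. rewrite exp_pow_nat. pos. }
     unfold lam. simpl pow. apply Rle_trans with (4 * (B * (A * exp ((1 - 2 * e2) * y)))).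
     - pos.
     - apply Rle_trans with (B * B * exp ((1 - 2 * e2) * y) / 2).
      + assert (0 <= B * exp ((1 - 2 * e2) * y)) by pos.
       pose proof (Rmult_le_compat_r _ _ _ H H8A). lra.
      + unfold B. rewrite <- !exp_plus. replace (e2 * y + e2 * y + (1 - 2 * e2) * y) with y by ring. lra. }
    assert (K <= x).
    { assert (0 <= 1 / ln m * y) by pos. lra. }
    apply Rle_trans with (x * x * (4 * exp (- (1 / 2 * x)))).
    -
     pos.
    - rewrite exp_Ropp. apply Rmult_le_reg_r with (exp (1 / 2 * x) * (8 / epsp)); [pos|].
     replace (epsp / 8 * (exp (1 / 2 * x) * (8 / epsp))) with (exp (1 / 2 * x)) by pos.
     eapply Rle_trans; [|exact W2]. right. field. split; [lra|apply Rgt_not_eq, exp_pos]. }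
   lra.
Qed.

End LowerBound.

(** * The diameter *)

Lemma find_seq (f : nat -> bool) n : forall a j, (a <= j < a + n)%nat -> f j = true ->
 exists k, find f (seq a n) = Some k /\ (k <= j)%nat /\ f k = true.
Proof.
 induction n; intros a j Hj Hf; [lia|]. simpl. destruct (f a) eqn:Ea; [exists a; repeat split; pos|].
 apply IHn; [|assumption]. destruct (Nat.eq_dec a j); pos.
Qed.

Section Diameter.
Context {P : PAmodel}.

Lemma reach_mono h t n n' u v : valid h -> length h = (m * t)%nat -> (n <= n')%nat -> reach h t n u v = true -> reach h t n' u v = true.
Proof. intros Hv Hl Hn Hr. apply near_reach; [assumption|lia|]. eapply near_le; [eapply reach_near; exact Hr|assumption]. Qed.

(** [dist] searches only distances below [t] and gives 0 when the search fails; [2 * Rad < t] and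
    the route through vertex 1 ensure that it succeeds for every pair. *)
Lemma diam_bounds h t D Rad : valid h -> length h = (m * t)%nat -> (2 * Rad < t)%nat -> far t Rad h = false -> all_close t D h = false ->
 (D <= diam h t <= 2 * Rad)%nat.
Proof.
 intros Hv Hl Hrt Hfar Hac.
 assert (forall u, In u (seq 1 t) -> near h Rad u 1).
 { intros u Hu. destruct (reach h t Rad u 1) eqn:Er; [apply (reach_near h t); assumption|].
  assert (far t Rad h = true); [|pos]. apply existsb_exists. exists u. rewrite Er. auto. }
 assert (forall u v, In u (seq 1 t) -> In v (seq 1 t) -> reach h t (2 * Rad) u v = true).
 { intros u v Hu Hw. apply near_reach; [assumption|lia|]. replace (2 * Rad)%nat with (Rad + Rad)%nat by lia.
  apply near_trans with 1%nat; [auto|apply near_sym; auto]. }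
 assert (Hdist : forall u v, In u (seq 1 t) -> In v (seq 1 t) -> (Defs.dist h t u v <= 2 * Rad)%nat /\ reach h t (Defs.dist h t u v) u v = true).
 { intros u v Hu Hw. destruct (find_seq (fun k => reach h t k u v) t 0 (2 * Rad)) as (k & Hf & Hk & Hr); [lia|auto|].
  unfold Defs.dist. rewrite Hf. auto. }
 unfold diam. set (l := flat_map _ _).
 assert (Hin : forall n, In n l <-> exists u v, In u (seq 1 t) /\ In v (seq 1 t) /\ n = Defs.dist h t u v).
 { intros n. unfold l. rewrite in_flat_map. split.
  - intros (u & Hu & Hn). apply in_map_iff in Hn as (v & <- & Hw). eauto.
  - intros (u & v & Hu & Hw & ->). exists u. split; [assumption|]. apply in_map. assumption. }
 assert (Hmax : forall l' : list nat, (forall n, In n l' -> (n <= fold_right Nat.max 0 l')%nat) /\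
   (forall M, (forall n, In n l' -> (n <= M)%nat) -> (fold_right Nat.max 0 l' <= M)%nat)).
 { induction l' as [|a l' [IH1 IH2]]; simpl; [pos|]. split.
  - intros n [->|Hn]; [lia|specialize (IH1 n Hn); lia].
  - intros M HM. specialize (IH2 M (fun n Hn => HM n (or_intror Hn))). specialize (HM a (or_introl eq_refl)). lia. }
 destruct (Hmax l) as [M1 M2]. split.
 - assert (Hex : exists u v, In u (seq 1 t) /\ In v (seq 1 t) /\ reach h t D u v = false).
  { apply forallb_false_ex in Hac as (u & Hu & Hac). apply forallb_false_ex in Hac as (v & Hw & Hac). eauto. }
  destruct Hex as (u & v & Hu & Hw & Hr). destruct (Hdist u v Hu Hw) as [_ Hd].
  apply Nat.le_trans with (Defs.dist h t u v); [|apply M1, Hin; eauto].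
  destruct (Nat.le_gt_cases D (Defs.dist h t u v)); [assumption|].
  rewrite (reach_mono h t (Defs.dist h t u v) D) in Hr; pos.
 - apply M2. intros n Hn. apply Hin in Hn as (u & v & Hu & Hw & ->). apply Hdist; assumption.
Qed.

Theorem diam_whp (eps eta : R) : 0 < eps -> 0 < eta ->
 ev (fun x => forall t, (1 <= t)%nat -> ln t = x ->
  E (m * t) [] (fun h => if (if Rlt_dec eps (Rabs (INR (diam h t) / ln x - (2 / ln m + 4 / - ln kappa))) then true else false) then 1 else 0) < eta).
Proof.
 intros Heps Heta. set (c := 2 / ln (INR m) + 4 / - ln kappa).
 generalize (ev_and _ _ (upper_whp (eps / 4) (eta / 4) ltac:(lra) ltac:(lra)) (ev_and _ _ (lower_whp (eps / 4) (eta / 4) ltac:(lra) ltac:(lra))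
  (ev_and _ _ (ev_ln_lin (c + eps)) (ev_and _ _ (ev_ln_ge 1) (ev_ge 1))))).
 apply ev_mono. intros x (Hup & Hlo & H1 & H2 & H3) t Ht Hlt.
 destruct (Hup t Ht Hlt) as (Rad & HR & HE1). destruct (Hlo t Ht Hlt) as (D & HD & HE2). fold c in HD.
 assert (ln kappa < 0) by (pose proof kappa_range; rewrite <- ln_1; apply ln_increasing; lra).
 pose proof lnm_pos.
 assert (Hcc : 2 * (1 / ln m + 2 / - ln kappa) = c) by (unfold c; field; lra).
 assert (2 * Rad <= (c + eps / 2) * ln x) by (rewrite <- Hcc; lra).
 assert (Hrt : (2 * Rad < t)%nat).
 (* The radius is of order [ln x], far below [t]; this is the side condition of [diam_bounds]. *)
 { apply INR_lt. rewrite mult_INR. simpl (INR 2). assert (Ht0 : 0 < t) by pos.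
  pose proof (ln_le_sub1 t Ht0). assert (0 < eps * ln x) by pos. lra. }
 apply Rle_lt_trans with (E (m * t) [] (fun h => b2R (far t Rad h)) + E (m * t) [] (fun h => b2R (all_close t D h))); [|lra].
 rewrite <- E_plus. apply E_le; [pos|]. intros h Hv Hl. simpl app.
 pose proof (b2R_range (far t Rad h)). pose proof (b2R_range (all_close t D h)).
 destruct (Rlt_dec eps (Rabs (INR (diam h t) / ln x - c))) as [Hbad|_]; [|lra].
 destruct (far t Rad h) eqn:Ef; [change (b2R true) with 1; lra|]. destruct (all_close t D h) eqn:Ea; [change (b2R true) with 1; lra|].
 exfalso. destruct (diam_bounds h t D Rad Hv Hl Hrt Ef Ea) as [Hd1 Hd2]. apply le_INR in Hd1, Hd2. rewrite mult_INR in Hd2. simpl (INR 2) in Hd2.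
 assert (INR (diam h t) / ln x <= c + eps / 2) by pos.
 assert (c - eps / 4 <= INR (diam h t) / ln x) by pos.
 apply Rlt_not_le in Hbad. apply Hbad. apply Rabs_le. lra.
Qed.

End Diameter.

Theorem theorem1p5 (m : nat) (delta : R) :
  (2 <= m)%nat -> - INR m < delta -> delta < 0 ->
  let tau := 3 + delta / INR m in
  let c := 2 / ln (INR m) + 4 / Rabs (ln (tau - 2)) in
  forall eps eta : R, 0 < eps -> 0 < eta ->
  exists T : nat, forall t : nat, (T <= t)%nat ->
    PA_prob m delta t
      (fun h => if Rlt_dec eps (Rabs (INR (diam h t) / ln (ln (INR t)) - c))
                then true else false) < eta.
Proof.
  intros Hm0 Hl Hu tau c eps eta Heps Heta.
  set (P := Build_PAmodel m delta Hm0 Hl Hu).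
  destruct (@diam_whp P eps eta Heps Heta) as (x0 & Hx0).
  assert (Hc : c = 2 / ln (INR m) + 4 / - ln (@kappa P)).
  { unfold c, tau. replace (3 + delta / INR m - 2) with (@kappa P) by (unfold kappa, chi; simpl; ring).
    pose proof (@kappa_range P). rewrite Rabs_left; [reflexivity|]. rewrite <- ln_1. apply ln_increasing; lra. }
  rewrite Hc. exists (nceil (exp x0)). intros t Ht.
  assert (HT : exp x0 <= INR t).
  { pose proof (exp_pos x0). destruct (nceil_spec (exp x0) ltac:(lra)) as [H1 _]. apply le_INR in Ht. lra. }
  pose proof (nceil_pos (exp x0)).
  apply (Hx0 (ln (INR t))); [|lia|reflexivity].
  rewrite <- (ln_exp x0). apply ln_mono; [apply exp_pos|assumption].
Qed.
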